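(* Consider the infinite-dimensional HIK iteration for the two-dimensional thin obstacle problem: minimize $\int_\Omega\frac12|\nabla u|^2-fu\,\mathrm{d}x$ over $K=\{v\in H^1_0(\Omega): v|_\Gamma\le\varphi\}$, with $\Omega=(0,1)^2$, $f\equiv 20$, $\Gamma=\{(x_1,x_2)\in\Omega:x_1=1/2\}$ and $\varphi\equiv 1$ on $\Gamma$. Let $(u^*,\lambda^* )$ be the solution and its Lagrange multiplier. Consider an HIK iterate $k\ge1$ such that $\mathcal{A}^*\subseteq\mathcal{A}^k$ and, consequently, $\mathcal{I}^k\subseteq\mathcal{I}^*$. Moreover, suppose that $(u^k,\lambda^k)\ne(u^*,\lambda^* )$ and $u^k\le\varphi$ a.e. on $\Gamma$. Then $$\|\nabla(u^{k+1}-u^* )\|^2_{L^2(\Omega)}-\|\nabla(u^k-u^* )\|^2_{L^2(\Omega)}+\|\lambda^k\|^2_{H^{-1}(\mathcal{I}^k)}=0.$$ Therefore HIK converges at the following guaranteed sublinear rate: $$\frac{\|\nabla(u^{k+1}-u^* )\|_{L^2(\Omega)}}{\|\nabla(u^{k}-u^* )\|_{L^2(\Omega)}}=\frac{\|\lambda^{k+1}-\lambda^*\|_{H^{-1}(\Omega)}}{\|\lambda^{k}-\lambda^*\|_{H^{-1}(\Omega)}}=\left(1-\frac{\|\lambda^k\|^2_{H^{-1}(\mathcal{I}^k)}}{\|\lambda^k-\lambda^*\|^2_{H^{-1}(\Omega)}}\right)^{1/2},$$ where the right-hand side is strictly less than $1$.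
   Context: The pair $(u^*,\lambda^* )\in K\times H^{-1}(\Omega)$ satisfies $(\nabla u^*,\nabla v)+\langle\lambda^*,v\rangle=(f,v)$ for all $v\in H^1_0(\Omega)$, $u^*\le\varphi$ on $\Gamma$, $\lambda^*\ge0$ on $\Gamma$, and complementarity $\lambda^*(u^*-\varphi)=0$ on $\Gamma$, where the multiplier is supported on $\Gamma$ and identified with a function on $\Gamma$ through $\langle\lambda^*,v\rangle=\int_\Gamma\lambda^*v\,\mathrm{d}s$. Here $(\cdot,\cdot)$ is the $L^2(\Omega)$ inner product. Infinite-dimensional HIK iteration: $u^0=\lambda^0=0$. For $k\ge0$, with $\mathcal{A}^k=\{x\in\Gamma:\lambda^k+u^k-\varphi>0\}$ (defined up to null sets of $\Gamma$) and $\mathcal{I}^k=\operatorname{int}(\Omega\setminus\mathcal{A}^k)$, find $(u^{k+1},\lambda^{k+1})\in H^1_0(\Omega)\times H^{-1}(\Omega)$ with $(-\Delta)u^{k+1}+\lambda^{k+1}=f$ in $H^{-1}(\Omega)$, $u^{k+1}=\varphi$ on $\mathcal{A}^k$, $\lambda^{k+1}=0$ on $\mathcal{I}^k$; equivalently, $u^{k+1}|_{\partial\Omega}=0$, $u^{k+1}|_{\mathcal{A}^k}=\varphi$, $(\nabla u^{k+1},\nabla v)=(f,v)$ for all $v\in H^1_0(\mathcal{I}^k)$, and $\langle\lambda^{k+1},w\rangle=(f,w)-(\nabla u^{k+1},\nabla w)$ for all $w\in H^1_0(\Omega)$. The iterates are taken to be well-posed: for $p\in[1,4/3)$ and $q\in[1,8/5)$,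 $u^k$ is in $W^{2,p}$ on each of $\Omega_-=\Omega\cap\{x_1<1/2\}$ and $\Omega_+=\Omega\cap\{x_1>1/2\}$, and $\lambda^k$ is identified with the function $-[\![\nabla u^k]\!]\in L^q(\Gamma)$ via $\langle\lambda^k,v\rangle=\int_\Gamma\lambda^kv\,\mathrm{d}s$, where $[\![\nabla v]\!]=\nabla v^-\cdot n^-+\nabla v^+\cdot n^+$ with $n^\pm$ the outward normals of $\Omega_\pm$ on $\Gamma$. $\mathcal{A}^*=\{x\in\Gamma:\lambda^*+u^*-\varphi>0\}$ and $\mathcal{I}^*=\operatorname{int}(\Omega\setminus\mathcal{A}^* )$. Norms: for an open set $\mathcal{I}\subseteq\Omega$, $\|\mu\|_{H^{-1}(\mathcal{I})}=\sup_{0\ne v\in H^1_0(\mathcal{I})}|\langle\mu,v\rangle|/\|\nabla v\|_{L^2(\Omega)}$, functions in $H^1_0(\mathcal{I})$ being extended by zero to $\Omega$. *)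

(* Defs.v *)
From HB Require Import structures.
From mathcomp Require Import all_boot all_order all_algebra.
From mathcomp Require Import all_classical all_reals all_analysis.

Set Implicit Arguments.
Unset Strict Implicit.
Unset Printing Implicit Defensive.

Import Order.TTheory GRing.Theory Num.Theory.
Import numFieldNormedType.Exports.

Local Open Scope classical_set_scope.
Local Open Scope ring_scope.

(* Functions on a subset D of the plane (or of the line) are represented by
   total functions of which only the restriction to D matters, up to null
   sets. *)

Section Sobolev.
Context {R : realType}.
Local Notation plane := (R * R)%type.
Local Notation leb1 := (@lebesgue_measure R).
Implicit Types (O : set plane) (u v w : plane -> R).

Definition leb2 :
    {measure set (measurableTypeR R * measurableTypeR R)%type -> \bar R} :=
  (leb1 \x leb1)%E.

Definition inLp d (T : measurableType d) (mu : {measure set T -> \bar R})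
    (p : R) (D : set T) (f : T -> R) : Prop :=
  measurable_fun D f /\ finite_norm mu p%:E (f \_ D).

Definition cvgLp d (T : measurableType d) (mu : {measure set T -> \bar R})
    (p : R) (D : set T) (f_ : nat -> T -> R) (f : T -> R) : Prop :=
  'N[mu]_(p%:E)[EFin \o ((f_ n \- f)%R \_ D)]%E @[n --> \oo] --> 0%E.

Definition basis_vec (i : 'I_2) : plane :=
  if i == ord0 then (1, 0) else (0, 1).

Definition partial (i : 'I_2) v : plane -> R := 'D_(basis_vec i) v.

Fixpoint class_C (n : nat) v : Prop :=
  continuous v /\
  if n is m.+1 then
    forall i, (forall x, derivable v x (basis_vec i)) /\ class_C m (partial i v)
  else True.

Definition smooth v : Prop := forall n, class_C n v.

Definition test_function O v : Prop :=
  [/\ smooth v, compact (closure [set x | v x != 0])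
    & closure [set x | v x != 0] `<=` O].

Definition loc_integrable O v : Prop :=
  forall K, K `<=` O -> compact K -> leb2.-integrable K (EFin \o v).

Definition weak_partial O (i : 'I_2) v w : Prop :=
  [/\ loc_integrable O v, loc_integrable O w
    & forall phi, test_function O phi ->
        \int[leb2]_(x in O) (v x * partial i phi x) =
        - \int[leb2]_(x in O) (w x * phi x)].

Definition has_weak_partial O (i : 'I_2) v : Prop :=
  exists w, weak_partial O i v w.

(* Unique up to a null set when it exists. *)
Definition wD O (i : 'I_2) v : plane -> R := get (weak_partial O i v).

Fixpoint inWkp (k : nat) (p : R) O v : Prop :=
  inLp leb2 p O v /\
  if k is m.+1 then
    forall i, has_weak_partial O i v /\ inWkp m p O (wD O i v)
  else True.

(* Convergence in W^{1,p}(O) of smooth functions. *)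
Definition smooth_cvgW1p (p : R) O (psi : nat -> plane -> R) v : Prop :=
  cvgLp leb2 p O psi v /\
  forall i, cvgLp leb2 p O (fun n => partial i (psi n)) (wD O i v).

Definition grad_dot O u v : R :=
  \int[leb2]_(x in O) \sum_(i < 2) (wD O i u x * wD O i v x).

End Sobolev.

(* The thin obstacle problem on the unit square. A point (1/2, y) of Gamma is
   identified with y in ]0, 1[, so functions on Gamma are functions of y and
   subsets of Gamma are sets of reals; ds is the Lebesgue measure. *)
Section ThinObstacle.
Context {R : realType}.
Local Notation plane := (R * R)%type.
Local Notation leb1 := (@lebesgue_measure R).
Local Notation G := (`]0, 1[%classic : set R).
Implicit Types (O : set plane) (u v w : plane -> R) (A : set R).

Definition Omega : set plane := [set x | 0 < x.1 < 1 /\ 0 < x.2 < 1].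
Definition OmegaL : set plane := Omega `&` [set x | x.1 < 2^-1].
Definition OmegaR : set plane := Omega `&` [set x | 2^-1 < x.1].
Definition on_Gamma A : set plane := [set x | x.1 = 2^-1 /\ A x.2].

Definition load : plane -> R := fun=> 20.
Definition obstacle : R -> R := fun=> 1.

(* H^1_0(O) for O open in Omega, as functions on Omega: the closure in
   H^1(Omega) of the test functions on O, hence extended by zero. *)
Definition H10 O v : Prop :=
  inWkp 1 2 Omega v /\
  exists2 phi : nat -> plane -> R,
    forall n, test_function O (phi n) & smooth_cvgW1p 2 Omega phi v.

Definition grad_norm v : R := Num.sqrt (grad_dot Omega v v).

(* t is the trace on Gamma of v in W^{1,p}(O), where O is one of Omega,
   OmegaL and OmegaR (Gamma lies in O or in its boundary). *)
Definition is_trace (p : R) O v (t : R -> R) : Prop :=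
  inLp leb1 p G t /\
  exists psi : nat -> plane -> R,
    [/\ forall n, smooth (psi n), smooth_cvgW1p p O psi v
      & cvgLp leb1 p G (fun n y => psi n (2^-1, y)) t].

(* Unique up to a null set when it exists. *)
Definition trace (p : R) O v : R -> R := get (is_trace p O v).

Definition trG v : R -> R := trace 2 Omega v.

(* The outward normals on Gamma are (1, 0) for OmegaL and (-1, 0) for OmegaR.
   The traces are those of W^{1,1}, which contains every W^{1,p}, p >= 1, here
   since the domains are bounded. *)
Definition jump_grad v : R -> R := fun y =>
  trace 1 OmegaL (wD OmegaL ord0 v) y - trace 1 OmegaR (wD OmegaR ord0 v) y.

(* Elements of H^{-1}(Omega) are functionals on H^1_0(Omega); their values
   elsewhere are irrelevant. *)
Definition Hm1 (L : (plane -> R) -> R) : Prop :=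
  (forall a v w, H10 Omega v -> H10 Omega w ->
     L (fun x => a * v x + w x) = a * L v + L w) /\
  exists C, forall v, H10 Omega v -> `|L v| <= C * grad_norm v.

Definition Hm1_norm O (L : (plane -> R) -> R) : R :=
  sup [set `|L v| / grad_norm v
      | v in [set v | H10 O v /\ ~ (v = cst 0 %[ae leb2 in Omega])]].

(* <L, v> is the integral over Gamma of l v. *)
Definition represented_by (L : (plane -> R) -> R) (l : R -> R) : Prop :=
  measurable_fun G l /\
  forall v, H10 Omega v ->
    leb1.-integrable G (EFin \o (l \* trG v)) /\
    L v = \int[leb1]_(y in G) (l y * trG v y).

Definition load_pair v : R := \int[leb2]_(x in Omega) (load x * v x).

Definition energy v : R :=
  \int[leb2]_(x in Omega)
    (2^-1 * (\sum_(i < 2) wD Omega i v x ^+ 2) - load x * v x).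

Definition below_obstacle v : Prop :=
  \forall y \ae leb1, G y -> trG v y <= obstacle y.

Definition admissible v : Prop := H10 Omega v /\ below_obstacle v.

(* u is the solution and L, represented by the function l on Gamma, its
   Lagrange multiplier. *)
Record solution_multiplier u (L : (plane -> R) -> R) (l : R -> R) : Prop := {
  solution_admissible : admissible u;
  solution_min : forall v, admissible v -> energy u <= energy v;
  multiplier_Hm1 : Hm1 L;
  multiplier_repr : represented_by L l;
  multiplier_eq : forall v, H10 Omega v ->
    grad_dot Omega u v + L v = load_pair v;
  multiplier_ge0 : \forall y \ae leb1, G y -> 0 <= l y;
  multiplier_compl : \forall y \ae leb1, G y -> l y * (trG u y - obstacle y) = 0
}.

Definition active u (l : R -> R) : set R :=
  [set y | G y /\ 0 < l y + trG u y - obstacle y].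

Definition ae_subset A B : Prop := \forall y \ae leb1, G y -> A y -> B y.

(* int(Omega \ A) for a set A known up to null sets: literally the interior
   would depend on the representative (removing a dense null set removes all
   of Gamma), so take the largest one, the union over all representatives;
   it is itself attained by a representative. *)
Definition inactive A : set plane :=
  [set x | exists A', [/\ ae_subset A A', ae_subset A' A
    & (Omega `\` on_Gamma A')° x]].

Section Iteration.
Variables (u : nat -> plane -> R) (lam : nat -> (plane -> R) -> R).

Definition lam_fun (k : nat) : R -> R := fun y => - jump_grad (u k) y.
Definition active_it (k : nat) : set R := active (u k) (lam_fun k).
Definition inactive_it (k : nat) : set plane := inactive (active_it k).

Record HIK : Prop := {
  HIK_u0 : u 0 = cst 0;
  HIK_lam0 : lam 0 = cst 0;
  HIK_H10 : forall k, H10 Omega (u k.+1);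
  HIK_Hm1 : forall k, Hm1 (lam k.+1);
  HIK_eq : forall k v, H10 Omega v ->
    grad_dot Omega (u k.+1) v + lam k.+1 v = load_pair v;
  HIK_active : forall k,
    \forall y \ae leb1, active_it k y -> trG (u k.+1) y = obstacle y;
  HIK_inactive : forall k v, H10 (inactive_it k) v -> lam k.+1 v = 0;
  HIK_W2p : forall k p, 1 <= p < 4 / 3 ->
    inWkp 2 p OmegaL (u k) /\ inWkp 2 p OmegaR (u k);
  HIK_Lq : forall k q, 1 <= q < 8 / 5 -> inLp leb1 q G (lam_fun k);
  HIK_repr : forall k, represented_by (lam k) (lam_fun k)
}.

End Iteration.

End ThinObstacle.

(* Main.v *)
From HB Require Import structures.
Require Import Defs.
From mathcomp Require Import all_boot all_order all_algebra.
From mathcomp Require Import all_classical all_reals all_analysis.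
From mathcomp Require Import measurable_realfun ring lra.
Import Order.TTheory GRing.Theory Num.Theory.
Import numFieldNormedType.Exports.
Local Open Scope classical_set_scope.
Local Open Scope ring_scope.

(** The identity is a Pythagorean theorem. Let U be the solution, u and u' the
    k-th and the next iterate, a the Dirichlet form, d = u - u' the correction
    and e = u' - U. The correction lies in H^1_0 of the inactive set
    ([correction_inactive]), so the next multiplier vanishes on it; and the
    multiplier of the solution is carried by A*, a part of the active set,
    where the traces of u and u' both equal the obstacle. Subtracting the
    equations gives a(e, d) = 0 ([orthogonality]), hence
    |e + d|^2 = |e|^2 + |d|^2. On the inactive set d represents the functional
    - lambda^k, so its norm is that of the residual, and the error of each
    multiplier is represented by the error of the function; dual norms are
    norms of representatives ([Hm1_norm_riesz]). The rate formula is then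
    algebra, and what remains is that d is not zero.

    That d lies in H^1_0 of the inactive set is a statement of spectral
    synthesis: a function of H^1_0 that vanishes on a set is a limit of test
    functions supported off that set. It is easy for functions with a
    continuous version ([truncation]): truncate the values near 0 and multiply
    by a cutoff. Iterates are continuous because they are W^{2,1} on both
    halves of the square: their mixed derivative g is integrable, and the
    integral of g over the rectangle between the origin and x is a continuous
    version of the function, whose restriction to the line is the trace
    ([repr_ae], [trace_repr_ae]).

    The active set is known up to null sets; what matters is its essential
    support, the complement of its gaps. In the gaps of the previous active
    set the multiplier vanishes ([multiplier_zero]); as u does not exceed the
    obstacle, active points lie in the previous essential support, where u
    equals the obstacle. So both u and u' equal the obstacle on the new
    essential support F ([contact_persists]).

    Strictness is the delicate point. If d = 0, then the multiplier l of u
    vanishes in the gaps of the new active set, and on F, where u equals the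
    obstacle, the active points are those where l is positive. Nothing in the
    iteration gives a sign to the rest of F, and F could have many points
    where l is at most 0, so the minimality of F has to be used: every
    neighbourhood of a point of F contains active points. The key fact
    ([negative_open]) is that on F the set where l is negative is open up to
    null sets; then it is null, l is nonnegative, u and l satisfy the
    conditions that characterise the solution, and the iterate is the
    solution, which was excluded ([correction_neq0]).

    To prove the key fact, subtract from u an explicit parabola, so that the
    rest w is harmonic on both halves, is nonpositive on the line and zero on
    F. Formally l is the sum of the derivatives of w on both sides, in the
    directions away from the line, and at a zero y of w these are integrals of
    w against the kernel 1 / (y' - y)^2 up to continuous terms: infima over
    truncations of the kernel, since w has a sign. Infima of continuous
    functions are upper semicontinuous. This is made rigorous with the Poisson
    kernel at distance eps from the line: Green's formula expresses the
    Poisson average of l through w ([kernel_identity]), and the average is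
    monotone in eps, up to a continuous part and a window around y of
    half-width eps ([average_mono]). In the window w is o(eps), because at
    almost every point of F the trace is differentiable and has a maximum
    ([contact_window]); and at Lebesgue points the averages converge to the
    value of l up to a factor ([poisson_limit]). *)

Set Implicit Arguments.
Unset Strict Implicit.
Unset Printing Implicit Defensive.

(** * Almost everywhere statements and real-valued integrals *)
Section AlmostEverywhere.
Context d (T : measurableType d) (R : realType) (mu : {measure set T -> \bar R}).
Implicit Types P Q : T -> Prop.

Lemma aeS P Q : (forall x, P x -> Q x) ->
  (\forall x \ae mu, P x) -> \forall x \ae mu, Q x.
Proof. by move=> PQ; apply: filterS. Qed.

Lemma aeI P Q : (\forall x \ae mu, P x) -> (\forall x \ae mu, Q x) ->
  \forall x \ae mu, P x /\ Q x.
Proof. exact: filterI. Qed.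

Lemma aeT P : (forall x, P x) -> \forall x \ae mu, P x.
Proof. by move=> h; apply: aeW. Qed.

Lemma ae_all (I : countType) (P : I -> T -> Prop) :
  (forall i, \forall x \ae mu, P i x) -> \forall x \ae mu, forall i, P i x.
Proof.
move=> h; pose Q (n : nat) x := if unpickle n is Some i then P i x else True.
have hQ n : \forall x \ae mu, Q n x.
  by rewrite /Q; case: (unpickle n) => [i|]; [exact: h|exact: aeT].
have : mu.-negligible (\bigcup_n ~` [set x | Q n x]) by exact: negligible_bigcup.
apply: negligibleS => x /= /existsNP[i nP].
by exists (pickle i) => //=; rewrite /Q pickleK.
Qed.

End AlmostEverywhere.

Section Pairing.
Context d (T : measurableType d) (R : realType).

(** The pairing is sealed: unification would otherwise unfold it down to
    suprema of integrals of simple functions. *)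
Fact ip_seal : {F : {measure set T -> \bar R} -> set T -> (T -> R) -> (T -> R) -> R |
  F = fun mu D f g => \int[mu]_(x in D) (f x * g x)}.
Proof. by eexists. Qed.

Definition ip := sval ip_seal.

Lemma ipE mu D f g : ip mu D f g = \int[mu]_(x in D) (f x * g x).
Proof. by rewrite /ip; case: ip_seal => F /= ->. Qed.

Definition sqdist mu D (f g : T -> R) : R :=
  ip mu D (fun x => f x - g x) (fun x => f x - g x).

Lemma sqdistE mu D f g : sqdist mu D f g = \int[mu]_(x in D) ((f x - g x) ^+ 2).
Proof. by rewrite /sqdist ipE. Qed.

End Pairing.

Section RealIntegral.
Context d (T : measurableType d) (R : realType) (mu : {measure set T -> \bar R}).
Context (D : set T) (mD : measurable D).
Implicit Types (f g h : T -> R).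

Definition L1 f : Prop := mu.-integrable D (EFin \o f).
Definition L2 f : Prop := measurable_fun D f /\ L1 (fun x => f x ^+ 2).
Local Notation ip := (ip mu D).
Local Notation sqdist := (sqdist mu D).

Lemma L1_meas f : L1 f -> measurable_fun D f.
Proof. by move=> /measurable_int /measurable_EFinP. Qed.

Lemma L1_le f g : measurable_fun D f -> L1 g ->
  (forall x, D x -> `|f x| <= g x) -> L1 f.
Proof.
move=> mf ig fg; apply: (le_integrable mD _ _ ig); first exact/measurable_EFinP.
by move=> x Dx /=; rewrite lee_fin (le_trans (fg _ Dx)) ?ler_norm.
Qed.

Lemma L1D f g : L1 f -> L1 g -> L1 (fun x => f x + g x).
Proof. by move=> If Ig; exact: (integrableD mD If Ig). Qed.

Lemma L1B f g : L1 f -> L1 g -> L1 (fun x => f x - g x).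
Proof. by move=> If Ig; exact: (integrableB mD If Ig). Qed.

Lemma L1Zl (a : R) f : L1 f -> L1 (fun x => a * f x).
Proof. by move=> If; exact: (integrableZl mD a If). Qed.

Lemma L1Zr (a : R) f : L1 f -> L1 (fun x => f x * a).
Proof. by move=> If; under eq_fun do rewrite mulrC; exact: L1Zl. Qed.

Lemma L1N f : L1 f -> L1 (fun x => - f x).
Proof. by move=> /(L1Zl (-1)); under eq_fun do rewrite mulN1r. Qed.

Lemma L1_abs f : L1 f -> L1 (fun x => `|f x|).
Proof.
move=> If; apply/(integrableP) => /=; split.
  by apply/measurable_EFinP; apply: measurableT_comp => //; exact: L1_meas.
by case/integrableP: If => _; under eq_integral do rewrite /= -normr_id.
Qed.

Lemma L1_eq f g : (forall x, D x -> f x = g x) -> L1 f -> L1 g.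
Proof.
by move=> fg; apply: eq_integrable => // x; rewrite inE => Dx /=; rewrite fg.
Qed.

Lemma L1_ae_eq f g : measurable_fun D g -> f = g %[ae mu in D] -> L1 f -> L1 g.
Proof.
move=> mg fg If; have mf := L1_meas If.
apply/integrableP; split; first exact/measurable_EFinP.
case/integrableP: If => _; apply: le_lt_trans.
rewrite le_eqVlt; apply/orP; left; apply/eqP.
apply: ae_eq_integral => //; try by apply: measurableT_comp => //; exact/measurable_EFinP.
by apply: filterS fg => x fg Dx /=; rewrite fg.
Qed.

Lemma Rint_ae_eq f g : measurable_fun D f -> measurable_fun D g ->
  f = g %[ae mu in D] -> \int[mu]_(x in D) f x = \int[mu]_(x in D) g x.
Proof.
move=> mf mg fg; congr fine; apply: ae_eq_integral => //; try exact/measurable_EFinP.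
by apply: filterS fg => x fg Dx /=; rewrite fg.
Qed.

Lemma Rint_ae0 f : measurable_fun D f -> (\forall x \ae mu, D x -> f x = 0) ->
  \int[mu]_(x in D) f x = 0.
Proof.
move=> mf f0; rewrite (@Rint_ae_eq f (cst 0))//.
by rewrite Rintegral_cst ?mul0r.
Qed.

Lemma Rint_ext f g : (forall x, D x -> f x = g x) ->
  \int[mu]_(x in D) f x = \int[mu]_(x in D) g x.
Proof. by move=> fg; apply: eq_Rintegral => x; rewrite inE; exact: fg. Qed.

Lemma RintN f : L1 f -> \int[mu]_(x in D) (- f x) = - \int[mu]_(x in D) f x.
Proof.
move=> If; under Rint_ext do rewrite -mulN1r.
by rewrite RintegralZl// mulN1r.
Qed.

Lemma EFin_Rint f : L1 f ->
  (\int[mu]_(x in D) f x)%:E = (\int[mu]_(x in D) (f x)%:E)%E.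
Proof. by move=> If; rewrite fineK//; exact: integrable_fin_num. Qed.

Lemma Rint_eq0_ae f : L1 f -> (forall x, D x -> 0 <= f x) ->
  \int[mu]_(x in D) f x = 0 -> \forall x \ae mu, D x -> f x = 0.
Proof.
move=> If f0 I0.
have /ae_eq_integral_abs : measurable_fun D (EFin \o f) by exact/measurable_EFinP/L1_meas.
move=> /(_ mu mD) [+ _] => h.
have : ae_eq mu D (EFin \o f) (cst 0%E).
  apply: h; rewrite -[RHS]/(0%:E) -[in RHS]I0 EFin_Rint//.
  by apply: eq_integral => x; rewrite inE => Dx; rewrite /= ger0_norm// f0.
by apply: filterS => x h0 Dx; have [] := h0 Dx.
Qed.

Lemma Rdominated (f_ : nat -> T -> R) f g :
  (forall n, measurable_fun D (f_ n)) -> measurable_fun D f -> L1 g ->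
  (\forall x \ae mu, D x -> f_ n x @[n --> \oo] --> f x) ->
  (\forall x \ae mu, forall n, D x -> `|f_ n x| <= g x) ->
  L1 f /\ \int[mu]_(x in D) f_ n x @[n --> \oo] --> \int[mu]_(x in D) f x.
Proof.
move=> mf_ mf Ig fcv fle.
have [] := @dominated_convergence _ _ _ mu D mD (fun n => EFin \o f_ n) (EFin \o f) (EFin \o g).
- by move=> n; exact/measurable_EFinP.
- exact/measurable_EFinP.
- apply: filterS fcv => x h Dx; apply: cvg_EFin; first exact: nearW.
  exact: h.
- exact: Ig.
- by apply: filterS fle => x h n Dx /=; rewrite lee_fin; exact: h.
move=> If _ cv; split => //.
have E : (\int[mu]_(x in D) (EFin \o f) x)%E = (\int[mu]_(x in D) f x)%:E.
  by rewrite EFin_Rint.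
rewrite E in cv; exact: (fine_cvg cv).
Qed.

Lemma L1_bounded_mul f g M : measurable_fun D f ->
  (forall x, D x -> `|f x| <= M) -> L1 g -> L1 (fun x => f x * g x).
Proof.
move=> mf fM Ig; apply: (@L1_le _ (fun x => M * `|g x|)).
- by apply: measurable_funM => //; exact: L1_meas.
- by apply: L1Zl; exact: L1_abs.
- by move=> x Dx; rewrite normrM ler_wpM2r// fM.
Qed.

Lemma L2_meas f : L2 f -> measurable_fun D f. Proof. by case. Qed.

Lemma L2_mul f g : L2 f -> L2 g -> L1 (fun x => f x * g x).
Proof.
move=> [mf If] [mg Ig]; apply: (@L1_le _ (fun x => f x ^+ 2 + g x ^+ 2)).
- exact: measurable_funM.
- exact: L1D.
- move=> x Dx; rewrite normrM -(real_normK (num_real (f x))) -(real_normK (num_real (g x))).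
  by have := sqr_ge0 (`|f x| - `|g x|); nra.
Qed.

Lemma L2D f g : L2 f -> L2 g -> L2 (fun x => f x + g x).
Proof.
move=> Lf Lg; split; first by apply: measurable_funD; exact: L2_meas.
apply: (@L1_eq (fun x => f x ^+ 2 + (2 * (f x * g x) + g x ^+ 2))).
  by move=> x _; ring.
by apply: L1D; [case: Lf|apply: L1D; [apply: L1Zl; exact: L2_mul|case: Lg]].
Qed.

Lemma L2Z a f : L2 f -> L2 (fun x => a * f x).
Proof.
move=> [mf If]; split; first exact: measurable_funM.
by apply: (L1_eq _ (L1Zl (a ^+ 2) If)) => x _; ring.
Qed.

Lemma L2N f : L2 f -> L2 (fun x => - f x).
Proof. by move=> /(L2Z (-1)); under eq_fun do rewrite mulN1r. Qed.

Lemma L2B f g : L2 f -> L2 g -> L2 (fun x => f x - g x).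
Proof. by move=> Lf /L2N; exact: L2D. Qed.

Lemma L2_eq f g : (forall x, D x -> f x = g x) -> L2 f -> L2 g.
Proof.
move=> fg [mf If]; split; last by apply: (L1_eq _ If) => x Dx; rewrite fg.
by apply: eq_measurable_fun mf => x; rewrite inE; exact: fg.
Qed.

Lemma L2_bounded_mul f g M : measurable_fun D f ->
  (forall x, D x -> `|f x| <= M) -> L2 g -> L2 (fun x => f x * g x).
Proof.
move=> mf fM [mg Ig]; split; first exact: measurable_funM.
apply: (@L1_eq (fun x => (f x ^+ 2) * g x ^+ 2)); first by move=> x _; ring.
apply: (L1_bounded_mul (M := M ^+ 2)) => //; first exact: measurable_funX.
move=> x Dx; rewrite normrX lerXn2r ?nnegrE ?(le_trans _ (fM x Dx))//.
Qed.

Lemma ipC f g : ip f g = ip g f.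
Proof. by rewrite !ipE; apply: Rint_ext => x _; rewrite mulrC. Qed.

Lemma ipDr f g h : L2 f -> L2 g -> L2 h ->
  ip f (fun x => g x + h x) = ip f g + ip f h.
Proof.
move=> Lf Lg Lh; rewrite !ipE; under Rint_ext do rewrite mulrDr.
by rewrite RintegralD//; exact: L2_mul.
Qed.

Lemma ipZr a f g : L2 f -> L2 g -> ip f (fun x => a * g x) = a * ip f g.
Proof.
move=> Lf Lg; rewrite !ipE; under Rint_ext do rewrite mulrCA.
by rewrite RintegralZl//; exact: L2_mul.
Qed.

Lemma ip_ge0 f : 0 <= ip f f.
Proof. by rewrite ipE; apply: Rintegral_ge0 => x _; rewrite -expr2 sqr_ge0. Qed.

Lemma sqdist_ge0 f g : 0 <= sqdist f g.
Proof. exact: ip_ge0. Qed.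

Lemma ip_CS f g : L2 f -> L2 g -> ip f g ^+ 2 <= ip f f * ip g g.
Proof.
move=> Lf Lg.
have key t : 0 <= ip f f + 2 * t * ip f g + t ^+ 2 * ip g g.
  have := ip_ge0 (fun x => f x + t * g x).
  have Lt := L2Z t Lg; have Lft := L2D Lf Lt.
  rewrite (ipDr Lft Lf Lt) (ipC _ f) (ipC _ (fun x => t * g x)).
  rewrite (ipDr Lf Lf Lt) (ipDr Lt Lf Lt) (ipC (fun x => t * g x) f).
  rewrite !(ipZr t _ Lg)// (ipC (fun x => t * g x) g) ipZr//.
  by move=> h; rewrite -[leRHS](_ : ip f f + t * ip f g + (t * ip f g + t * (t * ip g g)) = _)//; ring.
have gg := ip_ge0 g; have ff := ip_ge0 f.
have [g0|g0] := eqVneq (ip g g) 0.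
  have [->|n0] := eqVneq (ip f g) 0; first by rewrite expr0n/= mulr_ge0.
  have := key (- (ip f f + 1) / (2 * ip f g)); rewrite g0 mulr0 addr0.
  have -> : 2 * (- (ip f f + 1) / (2 * ip f g)) * ip f g = - (ip f f + 1) by field.
  by move=> h; exfalso; lra.
have gp : 0 < ip g g by rewrite lt0r g0.
have := key (- ip f g / ip g g).
have -> : ip f f + 2 * (- ip f g / ip g g) * ip f g + (- ip f g / ip g g) ^+ 2 * ip g g
  = (ip f f * ip g g - ip f g ^+ 2) / ip g g by field.
by rewrite pmulr_lge0 ?invr_gt0// subr_ge0.
Qed.

Lemma ip_CS_sqrt f g : L2 f -> L2 g ->
  `|ip f g| <= Num.sqrt (ip f f) * Num.sqrt (ip g g).
Proof.
move=> Lf Lg; rewrite -sqrtrM ?ip_ge0// -sqrtr_sqr ler_sqrt ?ip_CS//.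
by rewrite mulr_ge0 ?ip_ge0.
Qed.

Lemma cvg_ip (f_ : nat -> T -> R) f g : (forall n, L2 (f_ n)) -> L2 f -> L2 g ->
  sqdist (f_ n) f @[n --> \oo] --> 0 -> ip (f_ n) g @[n --> \oo] --> ip f g.
Proof.
move=> Lf_ Lf Lg cv.
have : Num.sqrt (sqdist (f_ n) f) * Num.sqrt (ip g g) @[n --> \oo] --> (0 : R).
  rewrite -(mul0r (Num.sqrt (ip g g))); apply: cvgM; last exact: cvg_cst.
  rewrite -[X in _ --> X]sqrtr0.
  by apply: continuous_cvg => //; exact: sqrt_continuous.
move=> cv0; apply/cvgrPdist_le => e e0.
move/cvgrPdist_le : cv0 => /(_ _ e0); apply: filterS => n /=.
rewrite sub0r normrN ger0_norm ?mulr_ge0 ?sqrtr_ge0//; apply: le_trans.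
have Ld := L2B (Lf_ n) Lf.
have -> : ip f g - ip (f_ n) g = - ip (fun x => f_ n x - f x) g.
  rewrite [X in _ = - X](_ : _ = ip (f_ n) g - ip f g) ?opprB//.
  rewrite !ipE -(RintegralB mD (L2_mul (Lf_ n) Lg) (L2_mul Lf Lg)).
  by apply: Rint_ext => x _; ring.
by rewrite normrN /sqdist ip_CS_sqrt.
Qed.

(** The square of the L^2 distance is only a quasi-distance, whence the
    factor two. *)
Lemma sqdist_triangle f g h : L2 f -> L2 g -> L2 h ->
  sqdist f h <= 2 * (sqdist f g + sqdist g h).
Proof.
move=> Lf Lg Lh; rewrite !sqdistE -RintegralD//; last 2 first.
- exact: (L2B Lf Lg).2.
- exact: (L2B Lg Lh).2.
rewrite -RintegralZl//; last by apply: L1D; [exact: (L2B Lf Lg).2|exact: (L2B Lg Lh).2].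
apply: le_Rintegral => //; first exact: (L2B Lf Lh).2.
  by apply: L1Zl; apply: L1D; [exact: (L2B Lf Lg).2|exact: (L2B Lg Lh).2].
move=> x _; have := sqr_ge0 (f x - 2 * g x + h x); nra.
Qed.

Lemma sqdist0_ae f g : L2 f -> L2 g -> sqdist f g = 0 ->
  \forall x \ae mu, D x -> f x = g x.
Proof.
move=> Lf Lg; rewrite sqdistE => /(@Rint_eq0_ae (fun x => (f x - g x) ^+ 2)) h.
apply: filterS (h (L2B Lf Lg).2 (fun x _ => sqr_ge0 _)) => x h0 Dx.
by apply/eqP; rewrite -subr_eq0 -sqrf_eq0; apply/eqP; exact: h0.
Qed.

Lemma inLp2P f : inLp mu 2 D f <-> L2 f.
Proof.
have Lq : measurable_fun D f ->
   (\int[mu]_x (`|(EFin \o f \_ D) x| `^ 2) = \int[mu]_(x in D) ((f x) ^+ 2)%:E)%E.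
  move=> mf; rewrite [RHS]integral_mkcond; apply: eq_integral => x _ /=.
  rewrite !patchE; case: ifPn => _ /=; last by rewrite normr0 powR0// pnatr_eq0.
  by rewrite powR_mulrn// real_normK ?num_real.
split=> [[mf]|[mf If]].
  rewrite /finite_norm => h; split => //; apply/integrableP; split.
    by apply/measurable_EFinP; exact: measurable_funX.
  under eq_integral do rewrite /= ger0_norm ?sqr_ge0//.
  by rewrite -Lq// -poweR_Lnorm ?pnatr_eq0// poweR_lty.
split => //; rewrite /finite_norm unlock Lq// -EFin_Rint//.
by rewrite poweR_EFin ltry.
Qed.

Lemma inLp1P f : inLp mu 1 D f <-> L1 f.
Proof.
have Lq : measurable_fun D f ->
   'N[mu]_1[EFin \o f \_ D]%E = (\int[mu]_(x in D) `|(f x)%:E|)%E.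
  move=> mf; rewrite Lnorm1 [RHS]integral_mkcond; apply: eq_integral => x _ /=.
  by rewrite !patchE; case: ifPn => _ //=; rewrite normr0.
split=> [[mf]|If].
  by rewrite /finite_norm Lq// => h; apply/integrableP; split => //; exact/measurable_EFinP.
split; first exact: L1_meas.
by rewrite /finite_norm Lq//; [case/integrableP: If|exact: L1_meas].
Qed.

Lemma cvgLp2P (f_ : nat -> T -> R) f : (forall n, L2 (f_ n)) -> L2 f ->
  cvgLp mu 2 D f_ f <-> sqdist (f_ n) f @[n --> \oo] --> 0.
Proof.
move=> Lf_ Lf.
have E n : 'N[mu]_2[EFin \o ((f_ n \- f)%R \_ D)]%E = (Num.sqrt (sqdist (f_ n) f))%:E.
  have Ld := L2B (Lf_ n) Lf.
  rewrite unlock -powR12_sqrt ?sqdist_ge0// -poweR_EFin; congr poweR.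
  rewrite sqdistE EFin_Rint; last exact: Ld.2.
  rewrite [RHS]integral_mkcond; apply: eq_integral => x _ /=.
  rewrite !patchE; case: ifPn => _ /=; last by rewrite normr0 powR0// pnatr_eq0.
  by rewrite powR_mulrn// real_normK ?num_real.
rewrite /cvgLp; under eq_fun do rewrite E.
split=> [/fine_cvg /= cv|cv].
  rewrite -(mulr0 (0:R)).
  have -> : (fun n => sqdist (f_ n) f) = (fun n => Num.sqrt (sqdist (f_ n) f) * Num.sqrt (sqdist (f_ n) f)).
    by apply/funext => n; rewrite -expr2 sqr_sqrtr ?sqdist_ge0.
  exact: cvgM.
apply: cvg_EFin; first exact: nearW.
rewrite /= -[X in _ --> X]sqrtr0.
by apply: continuous_cvg => //; exact: sqrt_continuous.
Qed.

End RealIntegral.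

(** * Smooth functions of two variables *)
Section Smooth.
Context {R : realType}.
Local Notation plane := (R * R)%type.
Implicit Types (u v w : plane -> R) (i : 'I_2) (n : nat) (x : plane).
Local Notation ev i := (@basis_vec R i).

Lemma is_derive_lineP v x (e : plane) (d : R) :
  is_derive x e v d <-> is_derive (0 : R) (1 : R) (fun h => v (h *: e + x)) d.
Proof.
have E : (fun h : R => h^-1 *: (((fun h => v (h *: e + x)) \o shift (0 : R)) (h *: (1 : R)) - v (0 *: e + x)))
  = (fun h => h^-1 *: ((v \o shift x) (h *: e) - v x)).
  by apply/funext => h /=; rewrite addr0 scale0r add0r [h *: 1]mulr1.
by split=> -[h1 h2]; split; move: h1 h2; rewrite /derivable /derive /= E.
Qed.

Lemma is_derive_chain (f : R -> R) v x e (df d : R) :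
  is_derive (v x) (1 : R) f df -> is_derive x e v d ->
  is_derive x e (f \o v) (df * d).
Proof.
move=> hf /is_derive_lineP hv; apply/is_derive_lineP.
have hf' : is_derive ((fun h : R => v (h *: e + x)) 0) (1 : R) f df.
  by rewrite scale0r add0r.
exact: (is_derive1_comp hf' hv).
Qed.

Lemma class_C_cont n v : class_C n v -> continuous v.
Proof. by case: n => [|n] []. Qed.

Lemma class_C_is_derive n v i x : class_C n.+1 v ->
  is_derive x (ev i) v (partial i v x).
Proof. by move=> [_ /(_ i)[h _]]; exact/derivableP. Qed.

Lemma class_C_partial n v i : class_C n.+1 v -> class_C n (partial i v).
Proof. by move=> [_ /(_ i)[_ h]]. Qed.

Lemma class_CW n v : class_C n.+1 v -> class_C n v.
Proof.
elim: n v => [|n IH] v [cv h]; split => // i; have [d c] := h i; split => //.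
exact: IH.
Qed.

Lemma partial_is_derive v i (dv : plane -> R) :
  (forall x, is_derive x (ev i) v (dv x)) -> partial i v = dv.
Proof. by move=> h; apply/funext => x; have := h x; case. Qed.

(** The induction step of all closure properties below: a function is C^(n+1)
    as soon as it has partial derivatives that are C^n. *)
Lemma class_CS n v (dv : 'I_2 -> plane -> R) : continuous v ->
  (forall i x, is_derive x (ev i) v (dv i x)) -> (forall i, class_C n (dv i)) ->
  class_C n.+1 v.
Proof.
move=> cv hv hd; split => // i; split; first by move=> x; have := hv i x; case.
by rewrite (partial_is_derive (hv i)).
Qed.

Lemma class_C_cst n (c : R) : class_C n (fun=> c : R).
Proof.
have cc (a : R) : continuous (fun _ : plane => a) by move=> x; exact: cvg_cst.
elim: n c => [|n IH] c; first by split.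
by apply: (class_CS (dv := fun _ _ => 0)) => // i x; exact: is_derive_cst.
Qed.

Lemma class_CD n u v : class_C n u -> class_C n v ->
  class_C n (fun x => u x + v x).
Proof.
elim: n u v => [|n IH] u v Cu Cv.
  by split => // x; apply: cvgD; [exact: (class_C_cont Cu)|exact: (class_C_cont Cv)].
apply: (class_CS (dv := fun i x => partial i u x + partial i v x)).
- by move=> x; apply: cvgD; [exact: (class_C_cont Cu)|exact: (class_C_cont Cv)].
- by move=> i x; apply: is_deriveD; [exact: (class_C_is_derive _ _ Cu)|exact: (class_C_is_derive _ _ Cv)].
- by move=> i; apply: IH; exact: class_C_partial.
Qed.

Lemma class_CM n u v : class_C n u -> class_C n v ->
  class_C n (fun x => u x * v x).
Proof.
elim: n u v => [|n IH] u v Cu Cv.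
  by split => // x; apply: cvgM; [exact: (class_C_cont Cu)|exact: (class_C_cont Cv)].
apply: (class_CS (dv := fun i x => u x * partial i v x + v x * partial i u x)).
- by move=> x; apply: cvgM; [exact: (class_C_cont Cu)|exact: (class_C_cont Cv)].
- by move=> i x; apply: is_deriveM; [exact: (class_C_is_derive _ _ Cu)|exact: (class_C_is_derive _ _ Cv)].
- move=> i; apply: class_CD; apply: IH; try exact: class_C_partial; exact: class_CW.
Qed.

Lemma class_CN n u : class_C n u -> class_C n (fun x => - u x).
Proof.
move=> Cu; have := class_CM (class_C_cst n (-1)) Cu.
by under eq_fun do rewrite mulN1r.
Qed.

Lemma class_CV n u : (forall x, u x != 0) -> class_C n u ->
  class_C n (fun x => (u x)^-1).
Proof.
move=> u0; elim: n => [|n IH] Cu.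
  by split => // x; apply: cvgV => //; exact: (class_C_cont Cu).
have CV := IH (class_CW Cu).
apply: (class_CS (dv := fun i x => - ((u x)^-1 * (u x)^-1) * partial i u x)).
- by move=> x; apply: cvgV => //; exact: (class_C_cont Cu).
- move=> i x; apply: (is_derive_chain (f := fun t : R => t^-1)); last exact: (class_C_is_derive _ _ Cu).
  apply: DeriveDef; first by apply: derivableV => //; exact: derivable_id.
  rewrite deriveV ?derive_id//.
  by rewrite -invfM -expr2 [_ *: _]mulr1 exprnN.
- by move=> i; apply: class_CM; [apply/class_CN/class_CM|exact: class_C_partial].
Qed.

Lemma class_C_sqrt n u : (forall x, 0 < u x) -> class_C n u ->
  class_C n (fun x => Num.sqrt (u x)).
Proof.
move=> u0.
have cs : continuous u -> continuous (fun x => Num.sqrt (u x)).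
  by move=> cu x; apply: continuous_comp; [exact: cu|exact: sqrt_continuous].
have s0 x : 2 * Num.sqrt (u x) != 0.
  by rewrite mulf_neq0 ?pnatr_eq0// gt_eqF// sqrtr_gt0.
elim: n => [|n IH] Cu; first by split => //; exact/cs/(class_C_cont Cu).
have CS := IH (class_CW Cu).
apply: (class_CS (dv := fun i x => (2 * Num.sqrt (u x))^-1 * partial i u x)).
- exact/cs/(class_C_cont Cu).
- move=> i x; apply: (is_derive_chain (f := Num.sqrt)); last exact: (class_C_is_derive _ _ Cu).
  exact: is_derive1_sqrt.
- move=> i; apply: class_CM; last exact: class_C_partial.
  by apply: class_CV => //; apply: class_CM => //; exact: class_C_cst.
Qed.

Lemma is_derive_fst i x : is_derive x (ev i) (fun y : plane => y.1) (ev i).1.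
Proof.
apply/is_derive_lineP => /=.
have -> : (fun h : R => h * (ev i).1 + x.1) = ((fun h => h * (ev i).1) + cst x.1) by [].
rewrite -[X in is_derive _ _ _ X]addr0; apply: is_deriveD.
have -> : (fun h : R => h * (ev i).1) = ((ev i).1 \*: id) by apply/funext => h /=; rewrite [RHS]mulrC.
by apply: is_derive_eq; exact: mulr1.
Qed.

Lemma is_derive_snd i x : is_derive x (ev i) (fun y : plane => y.2) (ev i).2.
Proof.
apply/is_derive_lineP => /=.
have -> : (fun h : R => h * (ev i).2 + x.2) = ((fun h => h * (ev i).2) + cst x.2) by [].
rewrite -[X in is_derive _ _ _ X]addr0; apply: is_deriveD.
have -> : (fun h : R => h * (ev i).2) = ((ev i).2 \*: id) by apply/funext => h /=; rewrite [RHS]mulrC.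
by apply: is_derive_eq; exact: mulr1.
Qed.

Lemma class_C_fst n : class_C n (fun x : plane => x.1).
Proof.
have cf : continuous (fun x : plane => x.1) by move=> x; exact: cvg_fst.
case: n => [|n]; first by split.
apply: (class_CS (dv := fun i _ => (ev i).1)) => // *; first exact: is_derive_fst.
exact: class_C_cst.
Qed.

Lemma class_C_snd n : class_C n (fun x : plane => x.2).
Proof.
have cf : continuous (fun x : plane => x.2) by move=> x; exact: cvg_snd.
case: n => [|n]; first by split.
apply: (class_CS (dv := fun i _ => (ev i).2)) => // *; first exact: is_derive_snd.
exact: class_C_cst.
Qed.

(** The derivatives of exp (- 1 / t), extended by zero, are combinations of
    these functions, so that smoothness is proved for the whole family at
    once. *)
Definition flat (j : nat) (t : R) : R :=
  if 0 < t then t^-1 ^+ j * expR (- t^-1) else 0.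

Lemma flat_le0 j t : t <= 0 -> flat j t = 0.
Proof. by rewrite /flat leNgt => /negbTE ->. Qed.

Lemma flat_ge0 j t : 0 <= flat j t.
Proof.
rewrite /flat; case: ifPn => // t0.
by rewrite mulr_ge0 ?expR_ge0// exprn_ge0// invr_ge0 ltW.
Qed.

Lemma flat0_gt0 t : 0 < t -> 0 < flat 0 t.
Proof. by move=> t0; rewrite /flat t0 mulr_gt0 ?expR_gt0. Qed.

(** The exponential series at 1 / t bounds exp (1 / t) from below by its
    term of order j + 1; this gives the limits at 0. *)
Lemma flat_le j t : flat j t <= (j.+1)`!%:R * `|t|.
Proof.
have f0 : 0 < (j.+1)`!%:R :> R by rewrite ltr0n fact_gt0.
rewrite /flat; case: ifPn => t0; last by rewrite mulr_ge0// ltW.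
rewrite gtr0_norm// expRN.
have i0 : 0 < t^-1 by rewrite invr_gt0.
have E : t^-1 ^+ j.+1 / j.+1`!%:R <= expR t^-1.
  by apply: le_trans (expR_ge1Dxn j (ltW i0)); rewrite lerDr.
have e0 := expR_gt0 t^-1.
rewrite ler_pdivrMr//.
move: E; rewrite ler_pdivrMr// => E.
rewrite -(ler_pM2r i0) -exprSr (le_trans E)//.
by rewrite le_eqVlt; apply/orP; left; apply/eqP; field; rewrite gt_eqF.
Qed.

Lemma is_derive_flat j t :
  is_derive t (1 : R) (flat j) (flat j.+2 t - j%:R * flat j.+1 t).
Proof.
have [t0|t0|->] := ltgtP t 0.
- rewrite !flat_le0 ?ltW// mulr0 subr0.
  apply: (@near_eq_is_derive _ _ _ (cst 0)).
  near=> s; rewrite flat_le0//; apply: ltW; near: s.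
  by apply: lt_nbhsl.
- apply: (@near_eq_is_derive R R R (fun s : R => s^-1 ^+ j * expR (- s^-1)) (flat j) t 1 _ _).
    near=> s; rewrite /flat ifT//; near: s.
    by apply: lt_nbhsr.
  have tn : t != 0 by rewrite gt_eqF.
  have dV : is_derive t (1:R) (fun s : R => s^-1) (- t ^- 2).
    apply: DeriveDef; first by apply: derivableV => //; exact: derivable_id.
    by rewrite deriveV ?derive_id// [_ *: _]mulr1.
  have dE : is_derive t (1:R) (fun s : R => expR (- s^-1)) (expR (- t^-1) * t ^- 2).
    have dN : is_derive t (1:R) (fun s : R => - s^-1) (t ^- 2).
      by rewrite -[t ^- 2]opprK; exact: is_deriveN.
    exact: (@is_derive1_comp R expR (fun s : R => - s^-1) t _ _ (is_derive_expR _) dN).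
  have -> : (fun s : R => s^-1 ^+ j * expR (- s^-1)) =
     (((fun s => s^-1) : R -> R) ^+ j) * (fun s : R => expR (- s^-1)).
    apply/funext => s; congr (_ * _); elim: j => [|j IH]; first by rewrite !expr0.
    by rewrite !exprS IH.
  apply: is_derive_eq.
  rewrite /flat t0.
  have -> : (((fun s => s^-1) : R -> R) ^+ j) t = t^-1 ^+ j.
    by elim: j => [|j IH]; rewrite ?expr0// !exprS -IH.
  rewrite /GRing.scale /=.
  rewrite -exprVn; move: (t^-1) (expR _) => a b.
  by case: j => [|j] /=; rewrite ?exprS; ring.
- rewrite !flat_le0// mulr0 subr0.
  have cv : (fun h : R => h^-1 *: ((flat j \o shift (0:R)) (h *: (1:R)) - flat j 0)) @ 0^' --> (0 : R).
    apply/cvgrPdist_le => e e0; near=> h.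
    have hn : h != 0 by near: h; exact: nbhs_dnbhs_neq.
    rewrite /= addr0 [h *: 1]mulr1 (flat_le0 j (lexx 0)) subr0 sub0r normrN.
    have [h0|h0] := leP h 0; first by rewrite flat_le0// scaler0 normr0 ltW.
    have -> : h^-1 *: flat j h = flat j.+1 h.
      by rewrite /flat h0 exprS -mulrA.
    rewrite ger0_norm ?flat_ge0// (le_trans (flat_le _ _))//.
    rewrite -ler_pdivlMl ?ltr0n ?fact_gt0//.
    near: h; apply: dnbhs0_le.
    by rewrite mulr_gt0// invr_gt0 ltr0n fact_gt0.
  by apply: DeriveDef; [apply/cvg_ex; exists 0|exact: cvg_lim].
Unshelve. all: by end_near. Qed.

Lemma flat_continuous j : continuous (flat j).
Proof.
move=> t; apply: differentiable_continuous; apply/derivable1_diffP.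
by have [] := is_derive_flat j t.
Qed.

Lemma class_C_flat n j u : class_C n u -> class_C n (fun x => flat j (u x)).
Proof.
elim: n j u => [|n IH] j u Cu.
  split => // x; apply: continuous_comp; [exact: (class_C_cont Cu)|exact: flat_continuous].
apply: (class_CS (dv := fun i x => (flat j.+2 (u x) - j%:R * flat j.+1 (u x)) * partial i u x)).
- by move=> x; apply: continuous_comp; [exact: (class_C_cont Cu)|exact: flat_continuous].
- move=> i x; apply: (is_derive_chain (f := flat j)); last exact: (class_C_is_derive _ _ Cu).
  exact: is_derive_flat.
- have Cu' := class_CW Cu; move=> i; apply: class_CM; last exact: class_C_partial.
  apply: class_CD; first exact: IH.
  by apply: class_CN; apply: class_CM; [exact: class_C_cst|exact: IH].
Qed.

Definition step (t : R) : R := flat 0 t / (flat 0 t + flat 0 (1 - t)).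

Lemma step_den t : 0 < flat 0 t + flat 0 (1 - t).
Proof.
have [t0|t0] := ltP 0 t; first by rewrite ltr_wpDr ?flat_ge0// flat0_gt0.
by rewrite ltr_wpDl ?flat_ge0// flat0_gt0//; lra.
Qed.

Lemma step_le0 t : t <= 0 -> step t = 0.
Proof. by move=> t0; rewrite /step flat_le0// mul0r. Qed.

Lemma step_ge1 t : 1 <= t -> step t = 1.
Proof.
move=> t1; rewrite /step (@flat_le0 _ (1 - t)) ?subr_le0// addr0 divff//.
by rewrite gt_eqF// flat0_gt0//; lra.
Qed.

Lemma step_ge0 t : 0 <= step t.
Proof. by rewrite divr_ge0 ?flat_ge0// ltW// step_den. Qed.

Lemma step_le1 t : step t <= 1.
Proof. by rewrite ler_pdivrMr ?step_den// mul1r lerDl flat_ge0. Qed.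

Lemma class_C_step n u : class_C n u -> class_C n (fun x => step (u x)).
Proof.
move=> Cu; apply: class_CM; first exact: class_C_flat.
apply: class_CV => [x|]; first by rewrite gt_eqF// step_den.
apply: class_CD; apply: class_C_flat => //.
by apply: class_CD; [exact: class_C_cst|exact: class_CN].
Qed.

End Smooth.

(** * Test functions and slices of the plane *)
Section Plane.
Context {R : realType}.
Local Notation plane := (R * R)%type.
Local Notation leb1 := (@lebesgue_measure R).
Implicit Types (O K : set plane) (u v w : plane -> R) (i : 'I_2) (n : nat) (x : plane).
Local Notation ev i := (@basis_vec R i).

Lemma I2_cases i : i = ord0 \/ i = ord_max.
Proof. by case: i => [[|[|m]]] // p; [left|right]; exact: val_inj. Qed.

Lemma basis_vec0 : ev ord0 = (1, 0). Proof. by []. Qed.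
Lemma basis_vec1 : ev ord_max = (0, 1). Proof. by []. Qed.

Lemma open_plane_measurable (U : set plane) : open U ->
  measurable (U : set (measurableTypeR R * measurableTypeR R)).
Proof.
move=> oU.
pose bx (q : rat * rat * rat * rat) : set plane :=
  `]ratr q.1.1.1, ratr q.1.1.2[%classic `*` `]ratr q.1.2, ratr q.2[%classic.
pose F n : set plane := if unpickle n is Some q then
   if `[< bx q `<=` U >] then bx q else set0 else set0.
have -> : U = \bigcup_n F n.
  apply/seteqP; split => [x Ux|x [n _]]; last first.
    by rewrite /F; case: unpickle => // q; case: asboolP => // h /h.
  have : nbhs x U by exact: open_nbhs_nbhs.
  case=> -[/= A B] [] /nbhs_ballP[e1 /= e10 s1] /nbhs_ballP[e2 /= e20 s2] AB.
  have [a1 /= +] := @rat_in_itvoo R (x.1 - e1) x.1 ltac:(by rewrite ltrBlDr ltrDl).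
  rewrite in_itv/= => /andP[a1l a1r].
  have [b1 /= +] := @rat_in_itvoo R x.1 (x.1 + e1) ltac:(by rewrite ltrDl).
  rewrite in_itv/= => /andP[b1l b1r].
  have [a2 /= +] := @rat_in_itvoo R (x.2 - e2) x.2 ltac:(by rewrite ltrBlDr ltrDl).
  rewrite in_itv/= => /andP[a2l a2r].
  have [b2 /= +] := @rat_in_itvoo R x.2 (x.2 + e2) ltac:(by rewrite ltrDl).
  rewrite in_itv/= => /andP[b2l b2r].
  have [q [bq bx_]] : exists q, bx q `<=` U /\ bx q x.
    exists (a1, b1, a2, b2); split; last by split; rewrite /= in_itv/=; apply/andP; split.
    move=> y []; rewrite /= !in_itv/= => /andP[y1 y2] /andP[y3 y4].
    rewrite (surjective_pairing y); apply: (AB (y.1, y.2)); split => /=.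
      by apply: s1; rewrite /ball/= ltr_norml; apply/andP; split; lra.
    by apply: s2; rewrite /ball/= ltr_norml; apply/andP; split; lra.
  exists (pickle q); first exact: I.
  by rewrite /F pickleK ifT//; exact/asboolP.
apply: bigcup_measurable => n _; rewrite /F; case: unpickle => // q.
case: ifP => // _; apply: measurableX; exact: measurable_itv.
Qed.

Lemma plane_continuous_measurable (D : set (measurableTypeR R * measurableTypeR R)) v :
  measurable D -> continuous v -> measurable_fun D v.
Proof.
move=> mD cv; apply: (measurable_funS measurableT) => //.
apply: (measurability _ (RGenOpens.measurableE R)).
move=> _ [_ [a [b -> ] <-]]; rewrite setTI; apply: open_plane_measurable.
by apply: open_comp => [x _|]; [exact: cv|exact: interval_open].
Qed.

Lemma compact_cont_bounded v K : continuous v -> compact K ->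
  exists2 M, 0 < M & forall x, K x -> `|v x| <= M.
Proof.
move=> cv cK.
have cvK : compact (v @` K) by apply: continuous_compact => //; exact: continuous_subspaceT.
have [M [_ hM]] := compact_bounded cvK.
exists (`|M| + 1); first by rewrite ltr_wpDl.
by move=> x Kx; apply: hM; [rewrite (le_lt_trans (ler_norm M))// ltrDl|exists x].
Qed.

Lemma smooth_cont v : smooth v -> continuous v.
Proof. by move=> /(_ 0%N) []. Qed.

Lemma smooth_partial v i : smooth v -> smooth (partial i v).
Proof. by move=> sv n; exact: class_C_partial (sv n.+1). Qed.

Lemma smooth_is_derive v i x : smooth v -> is_derive x (ev i) v (partial i v x).
Proof. by move=> sv; exact: class_C_is_derive (sv 1%N). Qed.

Lemma smoothM u v : smooth u -> smooth v -> smooth (fun x => u x * v x).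
Proof. by move=> su sv n; exact: class_CM. Qed.

Lemma smoothD u v : smooth u -> smooth v -> smooth (fun x => u x + v x).
Proof. by move=> su sv n; exact: class_CD. Qed.

Lemma smoothN u : smooth u -> smooth (fun x => - u x).
Proof. by move=> su n; exact: class_CN. Qed.

Lemma smooth_cst (c : R) : smooth (fun _ : plane => c).
Proof. by move=> n; exact: class_C_cst. Qed.

Lemma smooth_fst : smooth (fun x : plane => x.1).
Proof. by move=> n; exact: class_C_fst. Qed.

Lemma smooth_snd : smooth (fun x : plane => x.2).
Proof. by move=> n; exact: class_C_snd. Qed.

Lemma smooth_step u : smooth u -> smooth (fun x => step (u x)).
Proof. by move=> su n; exact: class_C_step. Qed.

Lemma partialM u v i x : smooth u -> smooth v ->
  partial i (fun x => u x * v x) x = u x * partial i v x + v x * partial i u x.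
Proof.
move=> su sv.
by have [] := is_deriveM (smooth_is_derive i x su) (smooth_is_derive i x sv).
Qed.

Lemma partialD u v i x : smooth u -> smooth v ->
  partial i (fun x => u x + v x) x = partial i u x + partial i v x.
Proof.
move=> su sv.
by have [] := is_deriveD (smooth_is_derive i x su) (smooth_is_derive i x sv).
Qed.

Lemma partial_fst i x : partial i (fun y : plane => y.1) x = (ev i).1.
Proof. by have [] := is_derive_fst i x. Qed.

Lemma partial_snd i x : partial i (fun y : plane => y.2) x = (ev i).2.
Proof. by have [] := is_derive_snd i x. Qed.

Lemma partial_cst i (c : R) x : partial i (fun _ : plane => c) x = 0.
Proof. by have [] := @is_derive_cst _ _ _ c x (ev i). Qed.

Lemma plane_compact_closed K : compact K -> closed K.
Proof. by apply: compact_closed; exact: norm_hausdorff. Qed.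

Lemma test_intro O K v : smooth v -> compact K -> K `<=` O ->
  (forall x, ~ K x -> v x = 0) -> test_function O v.
Proof.
move=> sv cK KO v0.
have sK : closure [set x | v x != 0] `<=` K.
  have /closure_id -> := plane_compact_closed cK.
  by apply: closureS => x /= vx; apply: contrapT => /v0 v00; rewrite v00 eqxx in vx.
split => //; last exact: subset_trans KO.
by apply: subclosed_compact sK => //; exact: closed_closure.
Qed.

(** The support enters the arguments below only through some compact
    subset of O off which the function vanishes. *)
Lemma test_suppP O v : test_function O v -> exists K,
  [/\ compact K, K `<=` O & forall x, ~ K x -> v x = 0].
Proof.
move=> [sv cK KO]; exists (closure [set x | v x != 0]); split => // x nK.
apply/eqP; apply: contrapT => /negP vx; apply: nK; exact: subset_closure.
Qed.

Lemma test_smooth O v : test_function O v -> smooth v. Proof. by case. Qed.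

Lemma test_out O v x : test_function O v -> ~ O x -> v x = 0.
Proof. by move=> /test_suppP[K [_ KO v0]] nO; apply: v0 => /KO. Qed.

Lemma test_sub O O' v : O `<=` O' -> test_function O v -> test_function O' v.
Proof. by move=> OO [sv cK KO]; split => //; exact: subset_trans OO. Qed.

Lemma testM O u v : test_function O u -> smooth v ->
  test_function O (fun x => u x * v x).
Proof.
move=> tu sv; have [K [cK KO u0]] := test_suppP tu.
by apply: (test_intro (smoothM (test_smooth tu) sv) cK KO) => x /u0 ->; rewrite mul0r.
Qed.

Lemma testMl O u v : smooth v -> test_function O u ->
  test_function O (fun x => v x * u x).
Proof. by move=> sv tu; under eq_fun do rewrite mulrC; exact: testM. Qed.

Lemma testD O u v : test_function O u -> test_function O v ->
  test_function O (fun x => u x + v x).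
Proof.
move=> tu tv; have [K [cK KO u0]] := test_suppP tu; have [K' [cK' KO' v0]] := test_suppP tv.
apply: (test_intro (smoothD (test_smooth tu) (test_smooth tv)) (compactU cK cK')).
  by move=> x [/KO|/KO'].
by move=> x /not_orP[/u0 -> /v0 ->]; rewrite addr0.
Qed.

Lemma test0 O : test_function O (fun=> 0 : R).
Proof.
by apply: (test_intro (smooth_cst 0) (@compact0 _)) => //.
Qed.

Lemma test_partial O i v : test_function O v -> test_function O (partial i v).
Proof.
move=> tv; have [K [cK KO v0]] := test_suppP tv.
apply: (test_intro (smooth_partial i (test_smooth tv)) cK KO) => x nK.
have oK : open (~` K) by rewrite openC; exact: plane_compact_closed.
have : is_derive x (ev i) v 0.
  apply: (@near_eq_is_derive _ _ _ (cst 0)).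
  have : nbhs x (~` K) by exact: open_nbhs_nbhs.
  by apply: filterS => y nKy; rewrite v0.
by case.
Qed.

Lemma test_bounded O v : test_function O v ->
  exists2 M, 0 < M & forall x, `|v x| <= M.
Proof.
move=> tv; have [K [cK KO v0]] := test_suppP tv.
have [M M0 hM] := compact_cont_bounded (smooth_cont (test_smooth tv)) cK.
exists M => // x; have [Kx|/v0 ->] := pselect (K x); first exact: hM.
by rewrite normr0 ltW.
Qed.

(** These smooth functions converge to the indicator of the open interval
    between a and b when n grows. *)
Definition bump (a b : R) (n : nat) (t : R) : R :=
  step (n.+1%:R * (t - a)) * step (n.+1%:R * (b - t)).

Lemma bump_out a b n t : ~~ (a < t < b) -> bump a b n t = 0.
Proof.
rewrite negb_and -!leNgt /bump => /orP[ta|bt].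
  by rewrite step_le0 ?mul0r// pmulr_rle0// subr_le0.
by rewrite mulrC step_le0 ?mul0r// pmulr_rle0// subr_le0.
Qed.

Lemma bump_ge0 a b n t : 0 <= bump a b n t.
Proof. by rewrite mulr_ge0 ?step_ge0. Qed.

Lemma bump_le1 a b n t : bump a b n t <= 1.
Proof. by rewrite mulr_ile1 ?step_ge0 ?step_le1. Qed.

Lemma bump_norm_le1 a b n t : `|bump a b n t| <= 1.
Proof. by rewrite ger0_norm ?bump_ge0 ?bump_le1. Qed.

Lemma bump_eq1 a b n t : n.+1%:R^-1 <= t - a -> n.+1%:R^-1 <= b - t -> bump a b n t = 1.
Proof.
move=> h1 h2; rewrite /bump !step_ge1 ?mul1r// -ler_pdivrMl//; by rewrite mulr1.
Qed.

Lemma bump_cvg a b t : bump a b n t @[n --> \oo] --> (\1_(`]a, b[%classic) t : R).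
Proof.
have [tab|tab] := boolP (a < t < b); last first.
  have -> : \1_`]a, b[%classic t = 0 :> R.
    by rewrite indicE memNset//= in_itv/=; exact/negP.
  by under eq_fun do rewrite bump_out//; exact: cvg_cst.
rewrite indicE mem_set /=; last by rewrite in_itv.
case/andP: tab => at_ tb.
have h (d : R) : 0 < d -> \forall n \near \oo, n.+1%:R^-1 <= d.
  move=> d0; near=> n; rewrite invf_ple ?posrE// (le_trans _ (_ : n%:R <= _)) ?ler_nat//.
  by near: n; exact: nbhs_infty_ger.
apply: cvg_near_cst; near=> n; apply: bump_eq1; near: n; apply: h; lra.
Unshelve. all: by end_near. Qed.

Lemma smooth_bump1 a b n : smooth (fun x : plane => bump a b n x.1).
Proof.
apply: smoothM; apply: smooth_step; apply: smoothM; try exact: smooth_cst.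
  by apply: smoothD; [exact: smooth_fst|exact: smooth_cst].
by apply: smoothD; [exact: smooth_cst|exact/smoothN/smooth_fst].
Qed.

Lemma smooth_bump2 a b n : smooth (fun x : plane => bump a b n x.2).
Proof.
apply: smoothM; apply: smooth_step; apply: smoothM; try exact: smooth_cst.
  by apply: smoothD; [exact: smooth_snd|exact: smooth_cst].
by apply: smoothD; [exact: smooth_cst|exact/smoothN/smooth_snd].
Qed.

Lemma compact_rect (a b c d : R) : compact (`[a, b]%classic `*` `[c, d]%classic : set plane).
Proof. by apply: compact_setX; exact: segment_compact. Qed.

Lemma test_bump O a b c d n m :
  `[a, b]%classic `*` `[c, d]%classic `<=` O ->
  test_function O (fun x => bump a b n x.1 * bump c d m x.2).
Proof.
move=> sO; apply: (test_intro _ (@compact_rect a b c d) sO).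
  by apply: smoothM; [exact: smooth_bump1|exact: smooth_bump2].
move=> x; rewrite /= !in_itv/= => /not_andP[]/negP h.
  by rewrite bump_out ?mul0r//; apply: contra h => /andP[/ltW -> /ltW ->].
by rewrite mulrC bump_out ?mul0r//; apply: contra h => /andP[/ltW -> /ltW ->].
Qed.

Lemma is_derive_slice1 v (s y : R) : smooth v ->
  is_derive s (1 : R) (fun s => v (s, y)) (partial ord0 v (s, y)).
Proof.
move=> sv; have [h1 h2] := smooth_is_derive ord0 (s, y) sv.
have E : (fun h : R => h^-1 *: ((v \o shift (s, y)) (h *: ev ord0) - v (s, y))) =
  (fun h : R => h^-1 *: (((fun s => v (s, y)) \o shift s) (h *: (1 : R)) - v (s, y))).
  apply/funext => h; congr (_ *: (v _ - _)); rewrite /= basis_vec0.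
  by congr (_, _) => /=; rewrite [h *: 0]mulr0 add0r.
by split; move: h1 h2; rewrite /derivable /derive E.
Qed.

Lemma is_derive_slice2 v (s y : R) : smooth v ->
  is_derive y (1 : R) (fun y => v (s, y)) (partial ord_max v (s, y)).
Proof.
move=> sv; have [h1 h2] := smooth_is_derive ord_max (s, y) sv.
have E : (fun h : R => h^-1 *: ((v \o shift (s, y)) (h *: ev ord_max) - v (s, y))) =
  (fun h : R => h^-1 *: (((fun y => v (s, y)) \o shift y) (h *: (1 : R)) - v (s, y))).
  apply/funext => h; congr (_ *: (v _ - _)); rewrite /= basis_vec1.
  by congr (_, _) => /=; rewrite [h *: 0]mulr0 add0r.
by split; move: h1 h2; rewrite /derivable /derive E.
Qed.

Lemma slice1_cont v (y : R) : continuous v -> continuous (fun s : R => v (s, y)).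
Proof.
move=> cv s; apply: (continuous_comp (f := fun s : R => (s, y))); last exact: cv.
by apply: (@cvg_pair _ _ _ (nbhs s) (nbhs s) (nbhs y) _ _ _ id (cst y)); [exact: cvg_id|exact: cvg_cst].
Qed.

Lemma slice2_cont v (s : R) : continuous v -> continuous (fun y : R => v (s, y)).
Proof.
move=> cv y; apply: (continuous_comp (f := fun y : R => (s, y))); last exact: cv.
by apply: (@cvg_pair _ _ _ (nbhs y) (nbhs s) (nbhs y) _ _ _ (cst s) id); [exact: cvg_cst|exact: cvg_id].
Qed.

Lemma cont_L1 (f : R -> R) (a b : R) : continuous f -> L1 leb1 `]a, b[%classic f.
Proof.
move=> cf; suff h : leb1.-integrable `[a, b] (EFin \o f).
  by apply: integrableS h => //; exact: subset_itv_oo_cc.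
apply: continuous_compact_integrable; first exact: segment_compact.
exact: continuous_subspaceT.
Qed.

Lemma FTC_oo (F f : R -> R) (a b : R) : a <= b ->
  (forall t : R, is_derive t (1 : R) F (f t)) -> continuous f ->
  \int[leb1]_(x in `]a, b[%classic) f x = F b - F a.
Proof.
move=> ab hF cf.
move: ab; rewrite le_eqVlt => /predU1P[->|ab].
  by rewrite set_itv_ge ?bnd_simp ?ltxx// Rintegral_set0 subrr.
have cF : continuous F.
  move=> x; apply: differentiable_continuous; apply/derivable1_diffP.
  by have [] := hF x.
have i1 : leb1.-integrable `[a, b] (EFin \o f).
  apply: continuous_compact_integrable; first exact: segment_compact.
  exact: continuous_subspaceT.
have i2 : leb1.-integrable `]a, b] (EFin \o f).
  by apply: integrableS i1 => //; exact: subset_itv_oc_cc.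
rewrite Rintegral_itv_bndo_bndc; last by apply: integrableS i1 => //; exact: subset_itv_oo_cc.
rewrite Rintegral_itv_obnd_cbnd//.
rewrite /Rintegral (@continuous_FTC2 _ f F)//.
- exact: continuous_subspaceT.
- split; first by move=> x _; have [] := hF x.
    by apply: cvg_at_right_filter; exact: cF.
  by apply: cvg_at_left_filter; exact: cF.
- by move=> x _; rewrite derive1E; have [] := hF x.
Qed.

End Plane.

(** * Fubini on rectangles and the du Bois-Reymond lemma *)
Section Fubini.
Context d1 d2 (T1 : measurableType d1) (T2 : measurableType d2) (R : realType).
Variable m1 : {sigma_finite_measure set T1 -> \bar R}.
Variable m2 : {sigma_finite_measure set T2 -> \bar R}.
Context (A : set T1) (B : set T2) (mA : measurable A) (mB : measurable B).
Implicit Type f : T1 * T2 -> R.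
Local Notation m12 := (m1 \x m2)%E.

Let mAB : measurable (A `*` B). Proof. exact: measurableX. Qed.

Let restr f : T1 * T2 -> \bar R := EFin \o (f \_ (A `*` B)).

Let restr_int f : L1 m12 (A `*` B) f -> m12.-integrable setT (restr f).
Proof.
move=> If; rewrite /restr -restrict_EFin; apply/integrable_restrict => //.
by rewrite setTI.
Qed.

Let restr1 f s : (fun y => restr f (s, y)) = (if s \in A then EFin \o (fun y => f (s, y)) \_ B else cst 0%E).
Proof.
apply/funext => y; rewrite /restr /= patchE in_setX/=.
by case: (s \in A) => //=; rewrite patchE.
Qed.

Let restr2 f y : (fun s => restr f (s, y)) = (if y \in B then EFin \o (fun s => f (s, y)) \_ A else cst 0%E).
Proof.
apply/funext => s; rewrite /restr /= patchE in_setX/= andbC.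
by case: (y \in B) => //=; rewrite patchE.
Qed.

Lemma fub_slice1 f : L1 m12 (A `*` B) f ->
  \forall s \ae m1, A s -> L1 m2 B (fun y => f (s, y)).
Proof.
move=> /restr_int /ae_integrable1; apply: filterS => s + As.
rewrite restr1 mem_set// -restrict_EFin => /integrable_restrict.
by rewrite setTI; apply.
Qed.

Lemma fub_slice2 f : L1 m12 (A `*` B) f ->
  \forall y \ae m2, B y -> L1 m1 A (fun s => f (s, y)).
Proof.
move=> /restr_int /ae_integrable2; apply: filterS => y + By.
rewrite restr2 mem_set// -restrict_EFin => /integrable_restrict.
by rewrite setTI; apply.
Qed.

Let int1 f s : A s -> (\int[m2]_y restr f (s, y) = \int[m2]_(y in B) (f (s, y))%:E)%E.
Proof.
by move=> As; rewrite restr1 mem_set// -restrict_EFin -integral_mkcond.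
Qed.

Let int2 f y : B y -> (\int[m1]_s restr f (s, y) = \int[m1]_(s in A) (f (s, y))%:E)%E.
Proof.
by move=> By; rewrite restr2 mem_set// -restrict_EFin -integral_mkcond.
Qed.

Let finer (d : measure_display) (T : measurableType d) (m : {measure set T -> \bar R})
    (D : set T) (F : T -> \bar R) (g : T -> R) : measurable D -> m.-integrable setT F ->
  (forall s, D s -> g s = fine (F s)) -> (forall s, ~ D s -> F s = 0%E) ->
  L1 m D g /\ (\int[m]_s F s = (\int[m]_(s in D) g s)%:E)%E.
Proof.
move=> mD iF gF F0.
have iFD : m.-integrable D F by apply: integrableS iF.
have fF : \forall s \ae m, D s -> F s \is a fin_num by exact: integrable_ae.
have mg : measurable_fun D g.
  apply: (@eq_measurable_fun _ _ _ _ D (fine \o F)).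
    by move=> s; rewrite inE => Ds /=; rewrite gF.
  by apply: measurableT_comp => //; exact: measurable_int iFD.
have E : ae_eq m D F (EFin \o g).
  by apply: filterS fF => s h Ds /=; rewrite gF// fineK// h.
have Lg : L1 m D g.
  apply/integrableP; split; first exact/measurable_EFinP.
  case/integrableP: (iFD) => mF; apply: le_lt_trans.
  rewrite le_eqVlt; apply/orP; left; apply/eqP; apply: ae_eq_integral => //.
  - by apply: measurableT_comp => //; exact/measurable_EFinP.
  - exact: measurableT_comp.
  - by apply: filterS E => s + Ds /= => ->.
split => //; rewrite EFin_Rint//.
rewrite [LHS](_ : _ = (\int[m]_(s in D) F s)%E); last first.
  rewrite [RHS]integral_mkcond; apply: eq_integral => s _; rewrite patchE.
  by case: ifPn => //; rewrite notin_setE => /F0.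
apply: ae_eq_integral => //; first exact: measurable_int iFD.
exact/measurable_EFinP.
Qed.

Lemma fub1 f : L1 m12 (A `*` B) f ->
  L1 m1 A (fun s => \int[m2]_(y in B) f (s, y)) /\
  \int[m12]_(x in A `*` B) f x = \int[m1]_(s in A) \int[m2]_(y in B) f (s, y).
Proof.
move=> If; have iF := restr_int If.
have [L E] := finer (g := fun s => \int[m2]_(y in B) f (s, y)) mA
  (integrable_fubini_F iF)
  ltac:(by move=> s As; rewrite /fubini_F int1)
  ltac:(by move=> s nA; rewrite /fubini_F restr1 memNset// integral0).
split => //; apply: EFin_inj; rewrite -E integral12_prod_meas1//.
by rewrite EFin_Rint// /restr -restrict_EFin -integral_mkcond.
Qed.

Lemma fub2 f : L1 m12 (A `*` B) f ->
  L1 m2 B (fun y => \int[m1]_(s in A) f (s, y)) /\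
  \int[m12]_(x in A `*` B) f x = \int[m2]_(y in B) \int[m1]_(s in A) f (s, y).
Proof.
move=> If; have iF := restr_int If.
have iG : m2.-integrable setT (fubini_G m1 (restr f)).
  have mr : measurable_fun setT (restr f) by exact: measurable_int iF.
  apply/integrableP; split; first exact: (measurable_fubini_G iF).
  apply: le_lt_trans ((integrable21ltyP m1 m2 mr).1 iF).
  apply: ge0_le_integral => //.
  - by apply: measurableT_comp => //; exact: (measurable_fubini_G iF).
  - by apply: (measurable_fun_fubini_tonelli_G (m1 := m1) (fun x => `|restr f x|%E)) => //; exact: measurableT_comp.
  - by move=> y _; apply: le_abse_integral => //; exact: measurableT_comp.
have [L E] := finer (g := fun y => \int[m1]_(s in A) f (s, y)) mB iG
  ltac:(by move=> y By; rewrite /fubini_G int2)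
  ltac:(by move=> y nB; rewrite /fubini_G restr2 memNset// integral0).
split => //; apply: EFin_inj; rewrite -E integral21_prod_meas1//.
by rewrite EFin_Rint// /restr -restrict_EFin -integral_mkcond.
Qed.

Lemma measurable_fun_fstX (a : T1 -> R) : measurable_fun A a ->
  measurable_fun (A `*` B) (fun x : T1 * T2 => a x.1).
Proof.
move=> ma; apply: (@measurable_comp _ _ _ _ _ _ A) => //.
- by move=> _ [x [Ax _] <-].
- exact: measurable_funTS measurable_fst.
Qed.

Lemma measurable_fun_sndX (b : T2 -> R) : measurable_fun B b ->
  measurable_fun (A `*` B) (fun x : T1 * T2 => b x.2).
Proof.
move=> mb; apply: (@measurable_comp _ _ _ _ _ _ B) => //.
- by move=> _ [x [_ Bx] <-].
- exact: measurable_funTS measurable_snd.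
Qed.

Lemma L1_tensor (a : T1 -> R) (b : T2 -> R) : L1 m1 A a -> L1 m2 B b ->
  L1 m12 (A `*` B) (fun x => a x.1 * b x.2).
Proof.
move=> Ia Ib.
have mf : measurable_fun (A `*` B) (fun x : T1 * T2 => a x.1 * b x.2).
  by apply: measurable_funM; [exact: measurable_fun_fstX (L1_meas Ia)|exact: measurable_fun_sndX (L1_meas Ib)].
suff : m12.-integrable setT (restr (fun x => a x.1 * b x.2)).
  rewrite /restr -restrict_EFin => /integrable_restrict.
  by rewrite setTI; apply.
apply/integrable12ltyP.
  by apply/measurable_EFinP; apply/(measurable_restrictT _ mAB).
rewrite (_ : (fun s => _) = (fun s => (`|(a \_ A) s| * \int[m2]_(y in B) `|b y|)%:E)); last first.
  apply/funext => s.
  rewrite -[LHS]/(\int[m2]_y (abse \o (fun y => restr (fun x => (a x.1 * b x.2)%R) (s, y))) y)%E.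
  rewrite restr1 patchE; case: ifPn => As.
    rewrite EFinM EFin_Rint//; last exact: L1_abs.
    have <- : (\int[m2]_(y in B) (`|a s|%:E * `|b y|%:E) = `|a s|%:E * \int[m2]_(y in B) `|b y|%:E)%E.
      apply: ge0_integralZl => //; try exact: mB.
      by apply/measurable_EFinP; apply: measurableT_comp => //; exact: L1_meas Ib.
    rewrite [RHS]integral_mkcond; apply: eq_integral => y _ /=.
    by rewrite !patchE; case: ifP; rewrite ?normr0// normrM.
  by rewrite -[point]/(0 : R) normr0 mul0r; apply: integral0_eq => y _ /=; rewrite normr0.
rewrite (_ : (fun s => _) = (fun s => (((fun s => `|a s| * \int[m2]_(y in B) `|b y|) \_ A) s)%:E)); last first.
  by apply/funext => s; rewrite !patchE; case: ifP => // _; rewrite -[point]/(0 : R) normr0 mul0r.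
rewrite -[X in (\int[_]_x X x < _)%E]/(EFin \o _) -restrict_EFin -integral_mkcond.
by apply: integrable_lty => //; apply: L1Zr => //; exact: L1_abs.
Qed.

End Fubini.

Section DuBoisReymond.
Context {R : realType}.
Local Notation plane := (R * R)%type.
Local Notation leb1 := (@lebesgue_measure R).

Lemma L1_oo_sub (f : R -> R) (a b c d : R) : a <= c -> d <= b ->
  L1 leb1 `]a, b[%classic f -> L1 leb1 `]c, d[%classic f.
Proof.
move=> ac db If; apply: integrableS If => //.
by move=> x /=; rewrite !in_itv/= => /andP[cx xd]; rewrite (le_lt_trans ac cx) (lt_le_trans xd db).
Qed.

Lemma lebesgue_points (f : R -> R) (a b : R) : L1 leb1 `]a, b[%classic f ->
  \forall x \ae leb1, a < x < b -> forall e, 0 < e -> exists2 r0, 0 < r0 &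
    forall r, 0 < r < r0 -> [/\ a < x - r, x + r < b &
      \int[leb1]_(y in `]x - r, x + r[%classic) `|f y - f x| <= e * r].
Proof.
move=> If; pose D : set R := `]a, b[%classic; pose F := f \_ D.
have mD : measurable D by exact: measurable_itv.
have IF : leb1.-integrable setT (EFin \o F).
  by rewrite -restrict_EFin; apply/integrable_restrict => //; rewrite setTI.
have := lebesgue_differentiation (open_integrable_locally openT IF).
apply: aeS => x; rewrite /lebesgue_pt => cv /andP[ax xb] e e0.
have e20 : (0%:E < (e / 2)%:E)%E by rewrite lte_fin divr_gt0.
have h : \forall r \near (0:R)^'+, (davg F x r < (e / 2)%:E)%E.
  have : nbhs (0%:E) [set y | (y < (e / 2)%:E)%E] by exact: open_ereal_lt'.
  by move/cv.
have [r1 /= r10 hr1] := h.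
exists (Num.min r1 (Num.min (x - a) (b - x))).
  by rewrite !lt_min r10/= !subr_gt0 ax xb.
move=> r /andP[r0]; rewrite !lt_min => /and3P[rr1 ra rb].
have xa : a < x - r by lra.
have xb' : x + r < b by lra.
split => //.
have := hr1 r; rewrite /ball/= sub0r normrN gtr0_norm// => /(_ rr1 r0).
rewrite /davg /iavg (lebesgue_measure_ball x (ltW r0)).
rewrite [ball _ _](ball_itv x r).
have sub : `]x - r, x + r[%classic `<=` D.
  by move=> y /=; rewrite /D/= !in_itv/= => /andP[y1 y2]; apply/andP; split; lra.
have Id : L1 leb1 `]x - r, x + r[%classic (fun y => `|f y - f x|).
  apply: L1_abs => //; apply: L1B => //; first by apply: integrableS If.
  exact: (cont_L1 _ _ (fun y => cvg_cst (f x) (F := nbhs y))).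
rewrite [X in (_ * X)%E](_ : _ = (\int[leb1]_(y in `]x - r, x + r[%classic) `|f y - f x|)%:E); last first.
  rewrite EFin_Rint//; apply: eq_integral => y; rewrite inE => yr /=.
  have Dx : D x by rewrite /D/= in_itv/= ax xb.
  by rewrite /F !patchE !mem_set//; exact: sub.
rewrite inver mulrn_eq0/= gt_eqF// -EFinM lte_fin mulrC ltr_pdivrMr; last by rewrite pmulrn_lgt0.
by move=> /ltW /le_trans; apply; rewrite mulr2n (_ : e / 2 * (r + r) = e * r)//; field.
Qed.

Lemma Rint_cst_oo (c x y : R) : x <= y ->
  \int[leb1]_(_ in `]x, y[%classic) c = c * (y - x).
Proof.
move=> xy; rewrite Rintegral_cst//= lebesgue_measure_itv/= lte_fin.
by case: ltP => xy'; rewrite ?mulr0//= (_ : x = y) ?subrr ?mulr0//; apply/le_anti/andP.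
Qed.

Lemma cst_L1 (c a b : R) : L1 leb1 `]a, b[%classic (fun=> c).
Proof. exact: (cont_L1 _ _ (fun y => cvg_cst c (F := nbhs y))). Qed.

(** The value of f at a Lebesgue point x is the limit of its averages over
    rational intervals around x whose length is comparable to the distance
    of their ends to x. *)
Lemma itv_integral0_ae (f : R -> R) (a b : R) : L1 leb1 `]a, b[%classic f ->
  (forall p q : rat, a < ratr p -> ratr p < ratr q :> R -> ratr q < b ->
    \int[leb1]_(x in `]ratr p, ratr q[%classic) f x = 0) ->
  \forall x \ae leb1, a < x < b -> f x = 0.
Proof.
move=> If f0; apply: aeS (lebesgue_points If) => x h /[dup] axb /h {}h.
apply/eqP; rewrite -normr_le0; apply/ler_addgt0Pr => e e0; rewrite add0r.
have [r0 r00 /(_ (r0 / 2))] := h _ e0.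
set r := r0 / 2; have rp : 0 < r by rewrite divr_gt0.
have rr0 : r < r0 by rewrite /r; lra.
rewrite rp rr0 => /(_ isT)[xa xb hle].
(* The interval between p and q contains x and its length is at least r,
   so the deviation of f from f x integrated over it is at least `|f x| * r. *)
have [p /=] := @rat_in_itvoo R (x - r) (x - r / 2) ltac:(lra).
rewrite in_itv/= => /andP[p1 p2].
have [q /=] := @rat_in_itvoo R (x + r / 2) (x + r) ltac:(lra).
rewrite in_itv/= => /andP[q1 q2].
have pq : ratr p < ratr q :> R by lra.
have Ipq : L1 leb1 `]ratr p, ratr q[%classic f.
  by apply: (L1_oo_sub _ _ If); lra.
have Ir : L1 leb1 `]x - r, x + r[%classic f.
  by apply: (L1_oo_sub _ _ If); lra.
have mpq : measurable (`]ratr p, ratr q[%classic : set (measurableTypeR R)) by exact: measurable_itv.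
have : `|\int[leb1]_(y in `]ratr p, ratr q[%classic) (f y - f x)| <= e * r.
  apply: le_trans hle; apply: le_trans.
    by apply: le_normr_Rintegral => //; apply: L1B => //; exact: cst_L1.
  rewrite [leLHS]Rintegral_mkcond [leRHS]Rintegral_mkcond.
  have IB : L1 leb1 `]x - r, x + r[%classic (fun y => `|f y - f x|).
    by apply: L1_abs => //; apply: L1B => //; exact: cst_L1.
  have IB' : L1 leb1 `]ratr p, ratr q[%classic (fun y => `|f y - f x|).
    by apply: L1_abs => //; apply: L1B => //; exact: cst_L1.
  apply: le_Rintegral => //.
  - by rewrite -restrict_EFin; apply/integrable_restrict => //; rewrite setTI.
  - by rewrite -restrict_EFin; apply/integrable_restrict => //; rewrite setTI.
  - move=> y _; rewrite !patchE; have [|_] := boolP (y \in `]ratr p, ratr q[%classic).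
      rewrite inE/= in_itv/= => /andP[y1 y2].
      by rewrite mem_set//= in_itv/=; apply/andP; split; lra.
    by case: ifP => // _; exact: normr_ge0.
rewrite RintegralB//; last exact: cst_L1.
rewrite f0//; try lra.
rewrite (Rint_cst_oo _ (ltW pq)) sub0r normrN normrM (ger0_norm (_ : 0 <= ratr q - ratr p)); last by rewrite subr_ge0 ltW.
move=> hh; rewrite -(ler_pM2r rp); apply: le_trans hh.
by rewrite ler_wpM2l//; lra.
Qed.

Lemma bump_measurable (a b : R) n (D : set (measurableTypeR R)) : measurable D -> measurable_fun D (bump a b n).
Proof.
move=> mD; apply: measurable_funTS; apply: continuous_measurable_fun.
have cb : continuous (fun x : plane => bump a b n x.1) by exact/smooth_cont/smooth_bump1.
by move=> x; exact: (slice1_cont (y := 0) cb).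
Qed.

(** Only the countable family of bumps between rational points is tested:
    in the dimension two version this allows one null set of slices to be
    discarded for all tests together. *)
Lemma du_bois_reymond1 (f : R -> R) (a b : R) : L1 leb1 `]a, b[%classic f ->
  (forall (p q : rat) n, a < ratr p -> ratr p < ratr q :> R -> ratr q < b ->
    \int[leb1]_(x in `]a, b[%classic) (f x * bump (ratr p) (ratr q) n x) = 0) ->
  \forall x \ae leb1, a < x < b -> f x = 0.
Proof.
move=> If h; apply: (itv_integral0_ae If) => p q ap pq qb.
have mD : measurable (`]a, b[%classic : set (measurableTypeR R)) by exact: measurable_itv.
have mf := L1_meas If.
have [] := @Rdominated _ _ _ leb1 _ mD (fun n x => f x * bump (ratr p) (ratr q) n x)
  (fun x => f x * \1_`]ratr p, ratr q[%classic x) (fun x => `|f x|).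
- by move=> n; apply: measurable_funM => //; exact: bump_measurable.
- apply: measurable_funM => //; exact: measurable_indic.
- exact: L1_abs.
- by apply: aeT => x _; apply: cvgM; [exact: cvg_cst|exact: bump_cvg].
- by apply: aeT => x n _; rewrite normrM ler_piMr// bump_norm_le1.
move=> _ cv.
have -> : \int[leb1]_(x in `]ratr p, ratr q[%classic) f x =
  \int[leb1]_(x in `]a, b[%classic) (f x * \1_`]ratr p, ratr q[%classic x).
  have sub : `]ratr p, ratr q[%classic `<=` (`]a, b[%classic : set R).
    by move=> y /=; rewrite !in_itv/= => /andP[y1 y2]; apply/andP; split; lra.
  rewrite -[in LHS](setIidr sub) Rintegral_mkcondr; apply: Rint_ext => // x _.
  by rewrite patchE indicE; case: (x \in _); rewrite ?mulr1 ?mulr0.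
apply/esym; apply: (cvg_unique _ _ cv) => //.
rewrite /= (_ : (fun n => _) = cst 0); first exact: cvg_cst.
by apply/funext => n; exact: h.
Qed.

Definition lebs : {sigma_finite_measure set (measurableTypeR R) -> \bar R} := leb1.

(** For almost every s the slice at s is orthogonal to all rational bumps:
    apply the one-dimensional lemma first in s for each bump in y, then in
    y for each good s. *)
Lemma du_bois_reymond2 (w : plane -> R) (a b c d : R) :
  L1 leb2 (`]a, b[%classic `*` `]c, d[%classic) w ->
  (forall (p q p' q' : rat) n m, a < ratr p -> ratr p < ratr q :> R -> ratr q < b ->
    c < ratr p' -> ratr p' < ratr q' :> R -> ratr q' < d ->
    \int[leb2]_(x in `]a, b[%classic `*` `]c, d[%classic)
      (w x * (bump (ratr p) (ratr q) n x.1 * bump (ratr p') (ratr q') m x.2)) = 0) ->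
  \forall x \ae leb2, (`]a, b[%classic `*` `]c, d[%classic) x -> w x = 0.
Proof.
set A := `]a, b[%classic; set B := `]c, d[%classic => Iw h.
have mA : measurable (A : set (measurableTypeR R)) by exact: measurable_itv.
have mB : measurable (B : set (measurableTypeR R)) by exact: measurable_itv.
have mAB : measurable (A `*` B : set (measurableTypeR R * measurableTypeR R)) by exact: measurableX.
have mb1 p q n : measurable_fun (A `*` B) (fun x : measurableTypeR R * measurableTypeR R => bump p q n x.1).
  by apply: measurable_fun_fstX => //; exact: bump_measurable.
have mb2 p q n : measurable_fun (A `*` B) (fun x : measurableTypeR R * measurableTypeR R => bump p q n x.2).
  by apply: measurable_fun_sndX => //; exact: bump_measurable.
have Iw2 p q n : L1 (lebs \x lebs)%E (A `*` B) (fun x => w x * bump p q n x.2).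
  under eq_fun do rewrite mulrC.
  by apply: (@L1_bounded_mul _ _ _ _ _ mAB (fun x => bump p q n x.2) w 1); [exact: mb2|move=> x _; exact: bump_norm_le1|exact: Iw].
have slice0 : \forall s \ae leb1, A s -> forall t : rat * rat * nat,
   c < ratr t.1.1 -> ratr t.1.1 < ratr t.1.2 :> R -> ratr t.1.2 < d ->
   \int[leb1]_(y in B) (w (s, y) * bump (ratr t.1.1) (ratr t.1.2) t.2 y) = 0.
  suff : \forall s \ae leb1, forall t : rat * rat * nat, A s ->
   c < ratr t.1.1 -> ratr t.1.1 < ratr t.1.2 :> R -> ratr t.1.2 < d ->
   \int[leb1]_(y in B) (w (s, y) * bump (ratr t.1.1) (ratr t.1.2) t.2 y) = 0.
    by apply: aeS => s hs As t; exact: hs.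
  apply: ae_all => -[[p' q'] m] /=.
  have [cp|] := boolP (c < ratr p'); last by move=> ?; apply: aeT.
  have [pq'|] := boolP (ratr p' < ratr q' :> R); last by move=> ?; apply: aeT.
  have [qd|] := boolP (ratr q' < d); last by move=> ?; apply: aeT.
  have [Im _] := fub1 mA mB (Iw2 (ratr p') (ratr q') m).
  apply: aeS (du_bois_reymond1 Im _) => [s hs As _ _ _|p q n ap pq qb].
    by apply: hs; move: As; rewrite /A /= in_itv.
  have I3 : L1 (lebs \x lebs)%E (A `*` B) (fun x => w x * (bump (ratr p) (ratr q) n x.1 * bump (ratr p') (ratr q') m x.2)).
    under eq_fun do rewrite mulrCA.
    by apply: (@L1_bounded_mul _ _ _ _ _ mAB (fun x => bump (ratr p) (ratr q) n x.1) (fun x => w x * bump (ratr p') (ratr q') m x.2) 1); [exact: mb1|move=> x _; exact: bump_norm_le1|exact: Iw2].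
  have [_ E] := fub1 mA mB I3.
  rewrite -(h p q p' q' n m)// [RHS]E.
  apply: Rint_ae_eq => //.
  - by apply: measurable_funM; [exact: L1_meas Im|exact: bump_measurable].
  - exact: L1_meas (fub1 mA mB I3).1.
  - apply: aeS (fub_slice1 mA mB (Iw2 (ratr p') (ratr q') m)) => s hs As.
    rewrite -RintegralZr//; last exact: hs.
    by apply: Rint_ext => y _; rewrite /=; ring.
have slice1 : \forall s \ae leb1, A s -> \forall y \ae leb1, c < y < d -> w (s, y) = 0.
  apply: aeS (aeI slice0 (fub_slice1 mA mB Iw)) => s [h1 h2] As.
  apply: (du_bois_reymond1 (h2 As)) => p q n cp pq qd.
  exact: (h1 As (p, q, n)).
have Iabs : L1 (lebs \x lebs)%E (A `*` B) (fun x => `|w x|) by exact: L1_abs.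
have [I1 E] := fub1 mA mB Iabs.
have I0 : \int[leb2]_(x in A `*` B) `|w x| = 0.
  rewrite [LHS]E; apply: Rint_ae0 => //; first exact: L1_meas I1.
  apply: aeS (aeI slice1 (fub_slice1 mA mB Iw)) => s [h1 h2] As.
  have h3 : L1 leb1 B (fun y => `|w (s, y)|) by apply: L1_abs => //; exact: h2.
  apply: Rint_ae0 => //; first exact: (L1_meas h3).
  apply: aeS (h1 As) => y hy; rewrite /B/= in_itv/= => cyd.
  by rewrite hy// normr0.
apply: aeS (Rint_eq0_ae mAB Iabs (fun x _ => normr_ge0 _) I0) => x hx ABx.
by apply/eqP; rewrite -normr_eq0; apply/eqP; exact: hx.
Qed.

End DuBoisReymond.

(** * Weak derivatives on rectangles *)
Section WeakDerivatives.
Context {R : realType}.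
Local Notation plane := (R * R)%type.
Local Notation leb1 := (@lebesgue_measure R).
Local Notation mplane := (measurableTypeR R * measurableTypeR R)%type.
Implicit Types (O K : set plane) (u v w : plane -> R) (i : 'I_2) (x : plane).

Lemma measurable_oo (a b : R) : measurable (`]a, b[%classic : set (measurableTypeR R)).
Proof. exact: measurable_itv. Qed.
Hint Resolve measurable_oo : core.

Definition rect (a b c d : R) : set plane := `]a, b[%classic `*` `]c, d[%classic.

Lemma rectP a b c d x : rect a b c d x <-> (a < x.1 < b) /\ (c < x.2 < d).
Proof. by rewrite /rect /=; split => -[]; rewrite !in_itv. Qed.

Lemma measurable_rect a b c d : measurable (rect a b c d : set mplane).
Proof. exact: measurableX. Qed.
Hint Resolve measurable_rect : core.

Lemma compact_plane_measurable K : compact K -> measurable (K : set mplane).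
Proof.
move=> /plane_compact_closed cK; rewrite -[K]setCK; apply: measurableC.
by apply: open_plane_measurable; rewrite openC.
Qed.

Lemma bounded_L1_rect a b c d (f : plane -> R) (M : R) :
  measurable_fun (rect a b c d : set mplane) f ->
  (forall x, rect a b c d x -> `|f x| <= M) -> L1 leb2 (rect a b c d) f.
Proof.
move=> mf fM; apply: (@L1_le _ _ _ _ _ (measurable_rect a b c d) _ (fun=> M)) => //.
have := @L1_tensor _ _ _ _ _ (@lebs R) (@lebs R) _ _ (measurable_oo a b) (measurable_oo c d)
  (fun=> M) (fun=> 1) (cst_L1 _ _ _) (cst_L1 _ _ _).
by rewrite mulr1.
Qed.

Lemma bounded_L2_rect a b c d (f : plane -> R) (M : R) :
  measurable_fun (rect a b c d : set mplane) f ->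
  (forall x, rect a b c d x -> `|f x| <= M) -> L2 leb2 (rect a b c d) f.
Proof.
move=> mf fM; split => //; apply: (bounded_L1_rect (M := M ^+ 2)).
  exact: measurable_funX.
move=> x rx; rewrite normrX lerXn2r ?nnegrE ?(le_trans _ (fM x rx))//.
Qed.

Lemma cont_L2_rect a b c d v : continuous v -> L2 leb2 (rect a b c d) v.
Proof.
move=> cv; have [M _ hM] := compact_cont_bounded cv (@compact_rect R a b c d).
apply: (bounded_L2_rect (M := M)); first exact: plane_continuous_measurable.
by move=> x [x1 x2]; apply: hM; split; exact: subset_itv_oo_cc.
Qed.

Lemma L2_L1_rect a b c d v : L2 leb2 (rect a b c d) v -> L1 leb2 (rect a b c d) v.
Proof.
move=> Lv; have h1 := cont_L2_rect a b c d (smooth_cont (smooth_cst 1)).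
by have := L2_mul (measurable_rect a b c d) Lv h1; under eq_fun do rewrite mulr1.
Qed.

Lemma cont_L1_rect a b c d v : continuous v -> L1 leb2 (rect a b c d) v.
Proof. by move=> /cont_L2_rect cv; exact/L2_L1_rect/cv. Qed.

Lemma test_L2 a b c d O v : test_function O v -> L2 leb2 (rect a b c d) v.
Proof. by move=> tv; exact/cont_L2_rect/smooth_cont/(test_smooth tv). Qed.

Lemma L1_loc O v : measurable (O : set mplane) -> L1 leb2 O v -> loc_integrable O v.
Proof.
move=> mO Iv K KO cK; apply: integrableS Iv => //; exact: compact_plane_measurable.
Qed.

Lemma loc_test_L1 O w phi : measurable (O : set mplane) -> loc_integrable O w ->
  test_function O phi -> L1 leb2 O (fun x => w x * phi x).
Proof.
move=> mO lw tphi; have [K [cK KO p0]] := test_suppP tphi.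
have mK := compact_plane_measurable cK.
have [M M0 hM] := test_bounded tphi.
have IK : L1 leb2 K (fun x => w x * phi x).
  under eq_fun do rewrite mulrC.
  apply: (@L1_bounded_mul _ _ _ _ _ mK phi w M).
  - exact: plane_continuous_measurable (smooth_cont (test_smooth tphi)).
  - by move=> x _; exact: hM.
  - exact: lw.
have : leb2.-integrable O ((EFin \o (fun x => w x * phi x)) \_ K).
  by apply/integrable_restrict => //; rewrite (setIidr KO).
apply: eq_integrable => // x _; rewrite patchE; case: ifPn => // /negP nK.
by rewrite /= p0 ?mulr0// => Kx; apply: nK; rewrite inE.
Qed.

Lemma Rint_sub_supp (O O' : set plane) (f : plane -> R) : O' `<=` O ->
  (forall x, O x -> ~ O' x -> f x = 0) ->
  \int[leb2]_(x in O) f x = \int[leb2]_(x in O') f x.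
Proof.
move=> OO f0; rewrite -[in RHS](setIidr OO) Rintegral_mkcondr.
apply: Rint_ext => x Ox; rewrite patchE; case: ifPn => // /negP nO.
by rewrite f0// => O'x; apply: nO; rewrite inE.
Qed.

Lemma weak_partial_sub O O' i v w : measurable (O : set mplane) ->
  O' `<=` O -> weak_partial O i v w -> weak_partial O' i v w.
Proof.
move=> mO OO [lv lw h]; split.
- by move=> K KO; apply: lv; exact: subset_trans OO.
- by move=> K KO; apply: lw; exact: subset_trans OO.
- move=> phi tphi; have := h phi (test_sub OO tphi).
  rewrite (Rint_sub_supp OO); last first.
    by move=> x _ nx; rewrite (test_out (test_partial i tphi) nx) mulr0.
  rewrite (Rint_sub_supp (O := O) OO)// => x _ nx.
  by rewrite (test_out tphi nx) mulr0.
Qed.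

Lemma subrect a b c d a' b' c' d' : a < a' -> b' < b -> c < c' -> d' < d ->
  `[a', b']%classic `*` `[c', d']%classic `<=` rect a b c d.
Proof.
move=> h1 h2 h3 h4 x [/=]; rewrite !in_itv/= => /andP[y1 y2] /andP[y3 y4].
by apply/rectP; split; apply/andP; split; lra.
Qed.

(** Local integrability suffices: apply the lemma on each rectangle of a
    countable exhaustion. *)
Lemma du_bois_reymond a b c d w : loc_integrable (rect a b c d) w ->
  (forall phi, test_function (rect a b c d) phi ->
     \int[leb2]_(x in rect a b c d) (w x * phi x) = 0) ->
  \forall x \ae leb2, rect a b c d x -> w x = 0.
Proof.
move=> lw h.
pose e n : R := n.+1%:R^-1.
have e0 n : 0 < e n by rewrite invr_gt0.
pose Q n := rect (a + e n) (b - e n) (c + e n) (d - e n).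
have hQ n : \forall x \ae leb2, Q n x -> w x = 0.
  have sQ : `[a + e n, b - e n]%classic `*` `[c + e n, d - e n]%classic `<=` rect a b c d.
    by apply: subrect; have := e0 n; lra.
  have IQ : L1 leb2 (Q n) w.
    have := lw _ sQ (@compact_rect _ _ _ _ _).
    apply: integrableS; [by apply: compact_plane_measurable; exact: compact_rect|exact: measurable_rect|].
    by move=> x [x1 x2]; split; exact: subset_itv_oo_cc.
  apply: (du_bois_reymond2 IQ) => p q p' q' j m h1 h2 h3 h4 h5 h6.
  rewrite -(h (fun x => bump (ratr p) (ratr q) j x.1 * bump (ratr p') (ratr q') m x.2)).
    apply/esym; apply: Rint_sub_supp.
      by move=> x [x1 x2]; apply: sQ; split; exact: subset_itv_oo_cc.
    move=> x _ nQ; suff -> : bump (ratr p) (ratr q) j x.1 * bump (ratr p') (ratr q') m x.2 = 0 by rewrite mulr0.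
    move/not_andP: nQ; rewrite /= !in_itv/= => -[/negP|/negP] nQ.
      by rewrite bump_out ?mul0r//; apply: contra nQ => /andP[n1 n2]; apply/andP; split; lra.
    by rewrite mulrC bump_out ?mul0r//; apply: contra nQ => /andP[n1 n2]; apply/andP; split; lra.
  apply: test_bump; apply: subset_trans sQ => x [/=].
  rewrite !in_itv/= => /andP[y1 y2] /andP[y3 y4].
  by split; apply/andP; split; lra.
apply: aeS (ae_all hQ) => x hx /rectP[/andP[x1 x2] /andP[x3 x4]].
have [n hn] : exists n, e n < Num.min (Num.min (x.1 - a) (b - x.1)) (Num.min (x.2 - c) (d - x.2)).
  set m := Num.min _ _; have m0 : 0 < m by rewrite !lt_min !subr_gt0 x1 x2 x3 x4.
  have [n _ /(_ n (leqnn n))] : \forall n \near \oo, e n < m.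
    exact: (near_infty_natSinv_lt (PosNum m0)).
  by exists n.
apply: (hx n); move: hn; rewrite !lt_min => /andP[/andP[n1 n2] /andP[n3 n4]].
by apply/rectP; split; apply/andP; split; lra.
Qed.

Lemma loc_integrableB O v w : measurable (O : set mplane) -> loc_integrable O v -> loc_integrable O w ->
  loc_integrable O (fun x => v x - w x).
Proof.
move=> mO lv lw K KO cK; have mK := compact_plane_measurable cK.
by apply: (L1B mK); [exact: lv|exact: lw].
Qed.

Lemma weak_partial_unique a b c d i v w w' :
  weak_partial (rect a b c d) i v w -> weak_partial (rect a b c d) i v w' ->
  \forall x \ae leb2, rect a b c d x -> w x = w' x.
Proof.
move=> [lv lw h] [_ lw' h'].
have := @du_bois_reymond a b c d _ (loc_integrableB (measurable_rect a b c d) lw lw').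
have H phi : test_function (rect a b c d) phi ->
    \int[leb2]_(x in rect a b c d) ((w x - w' x) * phi x) = 0.
  move=> tp; under Rint_ext do rewrite mulrBl.
  rewrite RintegralB//; try exact: loc_test_L1.
  by apply/eqP; rewrite -oppr_eq0 opprB subr_eq0 -eqr_opp -h// -h'// eqxx.
move=> /(_ H); apply: aeS => x hx rx.
by apply/eqP; rewrite -subr_eq0; apply/eqP; exact: hx.
Qed.

Lemma loc_integrable_meas a b c d w : loc_integrable (rect a b c d) w ->
  measurable_fun (rect a b c d : set mplane) w.
Proof.
move=> lw.
pose e n : R := n.+1%:R^-1.
have e0 n : 0 < e n by rewrite invr_gt0.
pose Q n : set plane := `[a + e n, b - e n]%classic `*` `[c + e n, d - e n]%classic.
have -> : rect a b c d = \bigcup_n Q n.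
  apply/seteqP; split => [x /rectP[/andP[x1 x2] /andP[x3 x4]]|x [n _]]; last first.
    by apply: subrect; have := e0 n; lra.
  have [n hn] : exists n, e n < Num.min (Num.min (x.1 - a) (b - x.1)) (Num.min (x.2 - c) (d - x.2)).
    set m := Num.min _ _; have m0 : 0 < m by rewrite !lt_min !subr_gt0 x1 x2 x3 x4.
    have [n _ /(_ n (leqnn n))] : \forall n \near \oo, e n < m.
      exact: (near_infty_natSinv_lt (PosNum m0)).
    by exists n.
  exists n => //; move: hn; rewrite !lt_min => /andP[/andP[n1 n2] /andP[n3 n4]].
  by split; rewrite /= in_itv/=; apply/andP; split; lra.
have mQ n : measurable (Q n : set mplane) by apply: compact_plane_measurable; exact: compact_rect.
apply/measurable_fun_bigcup => // n.
apply: L1_meas; apply: lw; last exact: compact_rect.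
by apply: subrect; have := e0 n; lra.
Qed.

Lemma int_partial_test0 a b c d i chi : a <= b -> c <= d -> test_function (rect a b c d) chi ->
  \int[leb2]_(x in rect a b c d) partial i chi x = 0.
Proof.
move=> ab cd tchi; have sp := smooth_partial i (test_smooth tchi).
have Ip := cont_L1_rect a b c d (smooth_cont sp).
have [->|->] := I2_cases i.
  rewrite [LHS](fub2 (measurable_oo a b) (measurable_oo c d) (cont_L1_rect a b c d (smooth_cont (smooth_partial ord0 (test_smooth tchi))))).2.
  rewrite (_ : (fun y => _) = cst 0); first by rewrite Rintegral_cst ?mul0r.
  apply/funext => y.
  rewrite [LHS](FTC_oo ab (fun t => is_derive_slice1 t y (test_smooth tchi))
    (slice1_cont (smooth_cont (smooth_partial ord0 (test_smooth tchi))))).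
  by rewrite !(test_out tchi) ?subrr// => /rectP[]/=; rewrite ltxx ?andbF.
rewrite [LHS](fub1 (measurable_oo a b) (measurable_oo c d) (cont_L1_rect a b c d (smooth_cont (smooth_partial ord_max (test_smooth tchi))))).2.
rewrite (_ : (fun y => _) = cst 0); first by rewrite Rintegral_cst ?mul0r.
apply/funext => s.
rewrite [LHS](FTC_oo cd (fun t => is_derive_slice2 s t (test_smooth tchi))
  (slice2_cont (smooth_cont (smooth_partial ord_max (test_smooth tchi))))).
by rewrite !(test_out tchi) ?subrr// => /rectP[]/= _; rewrite ltxx ?andbF.
Qed.

Lemma ibp_test a b c d i psi phi : a <= b -> c <= d -> smooth psi ->
  test_function (rect a b c d) phi ->
  \int[leb2]_(x in rect a b c d) (psi x * partial i phi x) =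
  - \int[leb2]_(x in rect a b c d) (partial i psi x * phi x).
Proof.
move=> ab cd spsi tphi; have sphi := test_smooth tphi.
have := int_partial_test0 i ab cd (testMl spsi tphi).
under Rint_ext do rewrite partialM//.
have c1 : smooth (fun x => psi x * partial i phi x) by apply: smoothM => //; exact: smooth_partial.
have c2 : smooth (fun x => phi x * partial i psi x) by apply: smoothM => //; exact: smooth_partial.
rewrite RintegralD//; [|exact: cont_L1_rect (smooth_cont c1)|exact: cont_L1_rect (smooth_cont c2)].
move/eqP; rewrite addr_eq0 => /eqP ->; congr (- _).
by apply: Rint_ext => x _; rewrite mulrC.
Qed.

End WeakDerivatives.

(** * The space H^1_0 and the Dirichlet form *)
#[global] Hint Resolve measurable_rect measurable_oo : core.

Section Sobolev0.
Context {R : realType}.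
Local Notation plane := (R * R)%type.
Local Notation leb1 := (@lebesgue_measure R).
Local Notation mplane := (measurableTypeR R * measurableTypeR R)%type.
Local Notation Om := (@Omega R).
Implicit Types (O : set plane) (u v : plane -> R) (w : 'I_2 -> plane -> R) (i : 'I_2).

Lemma OmegaE : Om = rect 0 1 0 1.
Proof.
by apply/seteqP; split => x; rewrite /Omega /rect /= !in_itv.
Qed.

Lemma measurable_Omega : measurable (Om : set mplane).
Proof. by rewrite OmegaE. Qed.
Hint Resolve measurable_Omega : core.

Lemma test_Omega_L2 O v : test_function O v -> L2 leb2 Om v.
Proof. by rewrite OmegaE; exact: test_L2. Qed.

Lemma smooth_Omega_L2 v : smooth v -> L2 leb2 Om v.
Proof. by move=> sv; rewrite OmegaE; exact/cont_L2_rect/smooth_cont. Qed.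

Lemma L2_Omega_L1 v : L2 leb2 Om v -> L1 leb2 Om v.
Proof. by rewrite OmegaE; exact: L2_L1_rect. Qed.

(** The sequence psi of test functions on O converges to v in H^1, with w in
    the role of the gradient; this packs the closure that defines H^1_0
    without any reference to the chosen weak derivatives. *)
Definition h1_approx O v w (psi : nat -> plane -> R) : Prop :=
  [/\ forall n, test_function O (psi n), L2 leb2 Om v, forall i, L2 leb2 Om (w i),
     sqdist leb2 Om (psi n) v @[n --> \oo] --> 0 &
     forall i, sqdist leb2 Om (partial i (psi n)) (w i) @[n --> \oo] --> 0].

(** The weak gradient on the square, sealed: it hides a choice that must not
    be unfolded. *)
Fact gD_seal : {F : 'I_2 -> (plane -> R) -> plane -> R | F = fun i v => wD Om i v}.
Proof. by eexists. Qed.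

Definition gD := sval gD_seal.

Lemma gDE : gD = fun i v => wD Om i v.
Proof. by rewrite /gD; case: gD_seal => F /= ->. Qed.

Lemma approx_weak O v w psi i : O `<=` Om -> h1_approx O v w psi ->
  weak_partial Om i v (w i).
Proof.
move=> OO [tp Lv Lw cv cw]; split; try exact/L1_loc/L2_Omega_L1.
move=> phi tphi.
have Lphi := test_Omega_L2 tphi; have Ldphi := test_Omega_L2 (test_partial i tphi).
have c1 := cvg_ip measurable_Omega (fun n => test_Omega_L2 (tp n)) Lv Ldphi cv.
have c2 := cvg_ip measurable_Omega (fun n => test_Omega_L2 (test_partial i (tp n))) (Lw i) Lphi (cw i).
have c3 : ip leb2 Om (psi n) (partial i phi) @[n --> \oo] --> - ip leb2 Om (w i) phi.
  rewrite (_ : (fun n => _) = (fun n => - ip leb2 Om (partial i (psi n)) phi)); first exact: cvgN.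
  apply/funext => n; rewrite !ipE; rewrite OmegaE in tphi *.
  exact: (ibp_test i ler01 ler01 (test_smooth (tp n)) tphi).
have c4 : ip leb2 Om v (partial i phi) = - ip leb2 Om (w i) phi by exact: (cvg_unique _ c1 c3).
by rewrite !ipE in c4.
Qed.

Lemma wD_weak v i (w0 : plane -> R) : weak_partial Om i v w0 -> weak_partial Om i v (gD i v).
Proof. by rewrite gDE => h; apply: (@getPex _ (weak_partial Om i v)); exists w0. Qed.

Lemma weak_uniq i v (w1 w2 : plane -> R) : weak_partial Om i v w1 -> weak_partial Om i v w2 ->
  \forall x \ae leb2, Om x -> w1 x = w2 x.
Proof. by rewrite OmegaE; exact: weak_partial_unique. Qed.

Lemma weak_meas i v (w1 : plane -> R) : weak_partial Om i v w1 -> measurable_fun (Om : set mplane) w1.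
Proof. by rewrite OmegaE => -[_ + _]; exact: loc_integrable_meas. Qed.

Lemma L2_ae_eq u v : measurable_fun (Om : set mplane) v ->
  (\forall x \ae leb2, Om x -> u x = v x) -> L2 leb2 Om u -> L2 leb2 Om v.
Proof.
move=> mv uv [mu Iu]; split => //; apply: (L1_ae_eq measurable_Omega _ _ Iu).
  exact: measurable_funX.
by apply: aeS uv => x h Ox; rewrite h.
Qed.

Lemma sqdist_ae u v v' : L2 leb2 Om u -> L2 leb2 Om v -> L2 leb2 Om v' ->
  (\forall x \ae leb2, Om x -> v x = v' x) -> sqdist leb2 Om u v = sqdist leb2 Om u v'.
Proof.
move=> Lu Lv Lv' vv; rewrite !sqdistE; apply: Rint_ae_eq => //.
- exact: (L1_meas (L2B measurable_Omega Lu Lv).2).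
- exact: (L1_meas (L2B measurable_Omega Lu Lv').2).
- by apply: aeS vv => x h Ox; rewrite h.
Qed.

Lemma approx_wD O v w psi : O `<=` Om -> h1_approx O v w psi ->
  forall i, L2 leb2 Om (gD i v) /\ \forall x \ae leb2, Om x -> gD i v x = w i x.
Proof.
move=> OO h i; have hw := approx_weak i OO h; have hD := wD_weak hw.
have E := weak_uniq hD hw; split => //.
have [_ _ Lw _ _] := h.
apply: L2_ae_eq (Lw i); first exact: weak_meas hD.
by apply: aeS E => x e Ox; rewrite e.
Qed.

Lemma approx_H10 O v w psi : O `<=` Om -> h1_approx O v w psi -> H10 O v.
Proof.
move=> OO h; have [tp Lv Lw cv cw] := h; have := approx_wD OO h; rewrite gDE => hD.
split.
  split; first by apply/inLp2P.
  move=> i; have hw := approx_weak i OO h.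
  split; first by exists (w i).
  by split => //; apply/inLp2P => //; have [] := hD i.
exists psi => //; split.
  by apply/cvgLp2P => // n; exact: test_Omega_L2 (tp n).
move=> i; have [L E] := hD i; apply/cvgLp2P => // [n|].
  exact: test_Omega_L2 (test_partial i (tp n)).
rewrite (_ : (fun n => _) = (fun n => sqdist leb2 Om (partial i (psi n)) (w i))); first exact: cw.
apply/funext => n; apply: sqdist_ae => //.
exact: test_Omega_L2 (test_partial i (tp n)).
Qed.

Lemma H10_approx O v : H10 O v ->
  exists psi, h1_approx O v (fun i => gD i v) psi.
Proof.
rewrite gDE => -[[iv hw] [psi tp [cv cw]]].
have Lv : L2 leb2 Om v by apply/inLp2P.
have Lw i : L2 leb2 Om (wD Om i v) by apply/inLp2P => //; have [_ []] := hw i.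
exists psi; split => //.
  by apply/(cvgLp2P measurable_Omega) => // n; exact: test_Omega_L2 (tp n).
move=> i; apply/(cvgLp2P measurable_Omega) => // n.
exact: test_Omega_L2 (test_partial i (tp n)).
Qed.

Lemma H10_L2 O v : H10 O v -> L2 leb2 Om v.
Proof. by move=> /H10_approx[psi []]. Qed.

Lemma H10_wD_L2 O v i : H10 O v -> L2 leb2 Om (gD i v).
Proof. by move=> /H10_approx[psi []]. Qed.

Lemma H10_weak O v i : O `<=` Om -> H10 O v -> weak_partial Om i v (gD i v).
Proof. by move=> OO /H10_approx[psi /(approx_weak i OO)]. Qed.

Lemma H10_sub O O' v : O `<=` O' -> H10 O v -> H10 O' v.
Proof.
move=> OO [h [psi tp c]]; split => //; exists psi => // n.
exact: test_sub OO (tp n).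
Qed.

Lemma sqdist_cst O f : sqdist leb2 O f f = 0 :> R.
Proof. by rewrite sqdistE; under eq_Rintegral do rewrite subrr expr0n/=; rewrite /Rintegral integral0. Qed.

Lemma approx_test O v : test_function O v ->
  h1_approx O v (fun i => partial i v) (fun=> v).
Proof.
move=> tv; split => //; first exact: test_Omega_L2 tv.
- by move=> i; exact: test_Omega_L2 (test_partial i tv).
- by under eq_fun do rewrite sqdist_cst; exact: cvg_cst.
- by move=> i; under eq_fun do rewrite sqdist_cst; exact: cvg_cst.
Qed.

Lemma sqdist_comb (a : R) u u' v v' : L2 leb2 Om u -> L2 leb2 Om u' ->
  L2 leb2 Om v -> L2 leb2 Om v' ->
  sqdist leb2 Om (fun x => a * u x + v x) (fun x => a * u' x + v' x) <=
  2 * (a ^+ 2 * sqdist leb2 Om u u' + sqdist leb2 Om v v').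
Proof.
move=> Lu Lu' Lv Lv'; have mO := measurable_Omega.
have I1 := (L2B mO Lu Lu').2; have I2 := (L2B mO Lv Lv').2.
rewrite !sqdistE -RintegralZl// -RintegralD//; last exact: L1Zl.
rewrite -RintegralZl//; last by apply: L1D => //; exact: L1Zl.
apply: le_Rintegral => //.
- exact: (L2B mO (L2D mO (L2Z mO a Lu) Lv) (L2D mO (L2Z mO a Lu') Lv')).2.
- by apply: L1Zl => //; apply: L1D => //; exact: L1Zl.
- move=> x _; have := sqr_ge0 (a * (u x - u' x) - (v x - v' x)); nra.
Qed.

Lemma approx_comb O (a : R) v w psi v' w' psi' :
  h1_approx O v w psi -> h1_approx O v' w' psi' ->
  h1_approx O (fun x => a * v x + v' x) (fun i x => a * w i x + w' i x)
    (fun n x => a * psi n x + psi' n x).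
Proof.
move=> [tp Lv Lw cv cw] [tp' Lv' Lw' cv' cw'].
have sp n := test_smooth (tp n); have sp' n := test_smooth (tp' n).
have mO := measurable_Omega.
have L2p n := test_Omega_L2 (tp n); have L2p' n := test_Omega_L2 (tp' n).
have L2dp n i := test_Omega_L2 (test_partial i (tp n)).
have L2dp' n i := test_Omega_L2 (test_partial i (tp' n)).
have cv0 (s s' : nat -> R) : s n @[n --> \oo] --> 0 -> s' n @[n --> \oo] --> 0 ->
    2 * (a ^+ 2 * s n + s' n) @[n --> \oo] --> 0.
  move=> c c'; rewrite -(mulr0 (2 : R)) -[X in _ * X](addr0 (0 : R)) -[X in X + _](mulr0 (a ^+ 2)).
  by apply: cvgMr; apply: cvgD => //; exact: cvgMr.
split.
- by move=> n; apply: testD => //; exact: testMl (smooth_cst a) (tp n).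
- by apply: L2D => //; exact: L2Z.
- by move=> i; apply: L2D => //; exact: L2Z.
- apply: (squeeze_cvgr _ (cvg_cst 0) (cv0 _ _ cv cv')); near=> n.
  by rewrite sqdist_ge0//= sqdist_comb.
- move=> i; apply: (squeeze_cvgr _ (cvg_cst 0) (cv0 _ _ (cw i) (cw' i))); near=> n.
  have -> : partial i (fun x => a * psi n x + psi' n x) = (fun x => a * partial i (psi n) x + partial i (psi' n) x).
    apply/funext => x; rewrite partialD//; last by apply: smoothM => //; exact: smooth_cst.
    by rewrite partialM ?partial_cst ?mulr0 ?addr0//; exact: smooth_cst.
  by rewrite sqdist_ge0//= sqdist_comb.
Unshelve. all: by end_near. Qed.

(** The chosen weak gradient is additive up to a null set only, by
    uniqueness of weak derivatives. *)
Lemma H10_comb O (a : R) u v : O `<=` Om -> H10 O u -> H10 O v ->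
  H10 O (fun x => a * u x + v x) /\
  forall i, \forall x \ae leb2, Om x ->
    gD i (fun x => a * u x + v x) x = a * gD i u x + gD i v x.
Proof.
move=> OO /H10_approx[p hp] /H10_approx[p' hp'].
have h := approx_comb a hp hp'; split; first exact: approx_H10 h.
by move=> i; have [] := approx_wD OO h i.
Qed.

Lemma H10_B O u v : O `<=` Om -> H10 O u -> H10 O v ->
  H10 O (fun x => u x - v x) /\
  forall i, \forall x \ae leb2, Om x ->
    gD i (fun x => u x - v x) x = gD i u x - gD i v x.
Proof.
move=> OO hu hv; have [h1 h2] := H10_comb (-1) OO hv hu.
have E : (fun x => -1 * v x + u x) = (fun x => u x - v x).
  by apply/funext => x; rewrite mulN1r addrC.
rewrite E in h1 h2; split => // i; apply: aeS (h2 i) => x h Ox.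
by rewrite h// mulN1r addrC.
Qed.

Lemma H10_test O v : O `<=` Om -> test_function O v -> H10 O v /\
  forall i, \forall x \ae leb2, Om x -> gD i v x = partial i v x.
Proof.
move=> OO /approx_test h; split; first exact: approx_H10 h.
by move=> i; have [] := approx_wD OO h i.
Qed.

Lemma sum_I2 (F : 'I_2 -> R) : \sum_(i < 2) F i = F ord0 + F ord_max.
Proof. by rewrite big_ord_recl big_ord1; congr (_ + F _); exact: val_inj. Qed.

Lemma grad_dotE O u v : H10 O u -> H10 O v -> grad_dot Om u v =
  ip leb2 Om (gD ord0 u) (gD ord0 v) + ip leb2 Om (gD ord_max u) (gD ord_max v).
Proof.
move=> hu hv; rewrite !ipE -RintegralD//; last 2 first.
- by apply: L2_mul => //; [exact: H10_wD_L2 hu|exact: H10_wD_L2 hv].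
- by apply: L2_mul => //; [exact: H10_wD_L2 hu|exact: H10_wD_L2 hv].
by rewrite gDE; apply: Rint_ext => x _; exact: sum_I2.
Qed.

Lemma grad_dotC O u v : H10 O u -> H10 O v -> grad_dot Om u v = grad_dot Om v u.
Proof.
move=> hu hv; rewrite (grad_dotE hu hv) (grad_dotE hv hu).
by rewrite (ipC leb2 Om (gD ord0 u)) (ipC leb2 Om (gD ord_max u)).
Qed.

Lemma ip_ae f f' g : L2 leb2 Om f -> L2 leb2 Om f' -> L2 leb2 Om g ->
  (\forall x \ae leb2, Om x -> f x = f' x) -> ip leb2 Om f g = ip leb2 Om f' g.
Proof.
move=> Lf Lf' Lg ff; rewrite !ipE; apply: Rint_ae_eq => //.
- by apply: measurable_funM; [exact: (L2_meas Lf)|exact: (L2_meas Lg)].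
- by apply: measurable_funM; [exact: (L2_meas Lf')|exact: (L2_meas Lg)].
- by apply: aeS ff => x h Ox; rewrite h.
Qed.

Lemma grad_dot_comb O (a : R) u v z : O `<=` Om -> H10 O u -> H10 O v -> H10 O z ->
  grad_dot Om (fun x => a * u x + v x) z = a * grad_dot Om u z + grad_dot Om v z.
Proof.
move=> OO hu hv hz; have [hc hD] := H10_comb a OO hu hv.
have mO := measurable_Omega.
have E i : ip leb2 Om (gD i (fun x => a * u x + v x)) (gD i z) =
   a * ip leb2 Om (gD i u) (gD i z) + ip leb2 Om (gD i v) (gD i z).
  have Lu := H10_wD_L2 i hu; have Lv := H10_wD_L2 i hv; have Lz := H10_wD_L2 i hz.
  have La := L2Z mO a Lu.
  rewrite (ip_ae (H10_wD_L2 i hc) (L2D mO La Lv) Lz (hD i)).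
  rewrite [LHS]ipC (ipDr mO Lz La Lv) (ipZr mO a Lz Lu).
  by rewrite (ipC leb2 Om (gD i z) (gD i u)) (ipC leb2 Om (gD i z) (gD i v)).
rewrite (grad_dotE hc hz) (grad_dotE hu hz) (grad_dotE hv hz) !E.
by rewrite mulrDr addrACA.
Qed.

Lemma grad_dot_ge0 O u : H10 O u -> 0 <= grad_dot Om u u.
Proof. by move=> hu; rewrite (grad_dotE hu hu) addr_ge0 ?ip_ge0. Qed.

Lemma grad_norm_sqr O u : H10 O u -> grad_norm u ^+ 2 = grad_dot Om u u.
Proof. by move=> hu; rewrite sqr_sqrtr// (grad_dot_ge0 hu). Qed.

Lemma CS_sum (a b c d p q : R) : 0 <= a -> 0 <= b -> 0 <= c -> 0 <= d ->
  p ^+ 2 <= b * a -> q ^+ 2 <= d * c -> (q + p) ^+ 2 <= (d + b) * (c + a).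
Proof.
move=> a0 b0 c0 d0 h1 h2.
have x0 : 0 <= d * a by rewrite mulr_ge0.
have y0 : 0 <= b * c by rewrite mulr_ge0.
have h : (q * p) ^+ 2 <= (d * a) * (b * c).
  rewrite exprMn; have -> : d * a * (b * c) = (d * c) * (b * a) by ring.
  by apply: ler_pM => //; exact: sqr_ge0.
have : 2 * (q * p) <= d * a + b * c.
  move: (q * p) (d * a) (b * c) x0 y0 h => z x y x0 y0 h.
  have h3 : (2 * z) ^+ 2 <= (x + y) ^+ 2 by have := sqr_ge0 (x - y); nra.
  apply: le_trans (ler_norm _) _.
  by rewrite -[leRHS]ger0_norm ?addr_ge0// -(@ler_pXn2r _ 2)// ?nnegrE// !real_normK ?num_real.
by move=> h3; nra.
Qed.

Lemma grad_CS O u v : H10 O u -> H10 O v ->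
  `|grad_dot Om u v| <= grad_norm u * grad_norm v.
Proof.
move=> hu hv; have mO := measurable_Omega.
have uu := grad_dot_ge0 hu; have vv := grad_dot_ge0 hv.
have uuvv : 0 <= grad_dot Om u u * grad_dot Om v v by exact: (mulr_ge0 uu vv).
rewrite /grad_norm -(sqrtrM _ uu) -sqrtr_sqr (ler_sqrt _ uuvv).
rewrite (grad_dotE hu hu) (grad_dotE hu hv) (grad_dotE hv hv).
have Lu i := H10_wD_L2 i hu; have Lv i := H10_wD_L2 i hv.
have C i := ip_CS mO (Lu i) (Lv i).
have := C ord0; have := C ord_max.
have := ip_ge0 leb2 Om (gD ord0 u); have := ip_ge0 leb2 Om (gD ord0 v).
have := ip_ge0 leb2 Om (gD ord_max u); have := ip_ge0 leb2 Om (gD ord_max v).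
move=> a0 b0 c0 d0 h1 h2; exact: CS_sum.
Qed.

Definition h1_err (chi v : plane -> R) w : R :=
  sqdist leb2 Om chi v + (sqdist leb2 Om (partial ord0 chi) (w ord0) +
    sqdist leb2 Om (partial ord_max chi) (w ord_max)).

Lemma approx_exists O v w : L2 leb2 Om v -> (forall i, L2 leb2 Om (w i)) ->
  (forall e, 0 < e -> exists2 chi, test_function O chi & h1_err chi v w < e) ->
  exists psi, h1_approx O v w psi.
Proof.
move=> Lv Lw h.
have h' (n : nat) : exists chi, test_function O chi /\ h1_err chi v w < n.+1%:R^-1.
  by have [|chi ? ?] := h n.+1%:R^-1; [rewrite invr_gt0|exists chi].
have [psi hpsi] := choice h'.
have e0 n : 0 <= sqdist leb2 Om (psi n) v by rewrite sqdist_ge0.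
have e1 n i : 0 <= sqdist leb2 Om (partial i (psi n)) (w i) by rewrite sqdist_ge0.
have c0 : (fun n => n.+1%:R^-1 : R) n @[n --> \oo] --> 0 by exact: cvg_harmonic.
exists psi; split => //; first by move=> n; have [] := hpsi n.
- apply: (squeeze_cvgr _ (cvg_cst 0) c0); near=> n.
  rewrite e0//= ltW//; have [_] := hpsi n; apply: le_lt_trans.
  by rewrite /h1_err lerDl addr_ge0.
- move=> i; apply: (squeeze_cvgr _ (cvg_cst 0) c0); near=> n.
  rewrite e1//= ltW//; have [_] := hpsi n; apply: le_lt_trans.
  rewrite /h1_err; have := e0 n; have := e1 n ord0; have := e1 n ord_max.
  by have [->|->] := I2_cases i; lra.
Unshelve. all: by end_near. Qed.

Lemma approx_near O v w psi (e : R) : h1_approx O v w psi -> 0 < e ->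
  exists2 chi, test_function O chi & h1_err chi v w < e.
Proof.
move=> [tp Lv Lw cv cw] e0.
have : h1_err (psi n) v w @[n --> \oo] --> 0 + (0 + 0).
  by apply: cvgD => //; apply: cvgD; exact: cw.
rewrite !addr0 => c.
have [n _ /(_ n (leqnn n))] : \forall n \near \oo, h1_err (psi n) v w < e.
  exact: (cvgr_lt _ c).
by exists (psi n).
Qed.

(** H^1_0 (O) is closed, also when the gradients of the approximations are
    given only as limits of gradients of test functions. *)
Lemma approx_closed O v w (vm : nat -> plane -> R) wm :
  (forall m, exists psi, h1_approx O (vm m) (wm m) psi) ->
  L2 leb2 Om v -> (forall i, L2 leb2 Om (w i)) ->
  sqdist leb2 Om (vm m) v @[m --> \oo] --> 0 ->
  (forall i, sqdist leb2 Om (wm m i) (w i) @[m --> \oo] --> 0) ->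
  exists psi, h1_approx O v w psi.
Proof.
move=> hm Lv Lw cv cw; apply: approx_exists => // e e0; have mO := measurable_Omega.
have : sqdist leb2 Om (vm m) v + (sqdist leb2 Om (wm m ord0) (w ord0) + sqdist leb2 Om (wm m ord_max) (w ord_max))
   @[m --> \oo] --> 0 + (0 + 0).
  by apply: cvgD => //; apply: cvgD; exact: cw.
rewrite !addr0 => c.
have e4 : 0 < e / 4 by rewrite divr_gt0.
have [m _ /(_ m (leqnn m))] := cvgr_lt _ c _ e4.
have [psi hp] := hm m; have [chi tchi hchi] := approx_near hp e4.
have [_ Lvm Lwm _ _] := hp.
move=> hh; exists chi => //.
have T1 := sqdist_triangle mO (test_Omega_L2 tchi) Lvm Lv.
have T2 := sqdist_triangle mO (test_Omega_L2 (test_partial ord0 tchi)) (Lwm ord0) (Lw ord0).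
have T3 := sqdist_triangle mO (test_Omega_L2 (test_partial ord_max tchi)) (Lwm ord_max) (Lw ord_max).
move: hchi hh T1 T2 T3; rewrite /h1_err; lra.
Qed.

End Sobolev0.

(** * Primitives and the injectivity of the gradient *)
#[global] Hint Resolve measurable_Omega : core.

Section Primitives.
Context {R : realType}.
Local Notation plane := (R * R)%type.
Local Notation leb1 := (@lebesgue_measure R).
Local Notation mR := (measurableTypeR R).
Local Notation mplane := (measurableTypeR R * measurableTypeR R)%type.
Local Notation Om := (@Omega R).
Local Notation G := (`]0, 1[%classic : set R).
Implicit Types (O : set plane) (u v : plane -> R) (i : 'I_2).

Definition bdm (a : R -> R) : Prop :=
  measurable_fun (G : set mR) a /\ exists M, forall t, G t -> `|a t| <= M.

(** The kernel of the primitive that vanishes at 0: the integral of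
    f s * before s t over s is that of f up to t. A kernel in place of a
    variable interval makes the exchange of integrals a plain Fubini. *)
Definition before (s t : R) : R := (s < t)%R%:R.

Lemma L1_mul_bounded d (T : measurableType d) (mu : {measure set T -> \bar R})
    (D : set T) (mD : measurable D) (f g : T -> R) M :
  L1 mu D f -> measurable_fun D g -> (forall x, D x -> `|g x| <= M) ->
  L1 mu D (fun x => f x * g x).
Proof.
move=> If mg gM; have := L1_bounded_mul mD mg gM If.
by apply: L1_eq => // x _; rewrite mulrC.
Qed.

Lemma before_le1 s t : `|before s t| <= 1.
Proof. by rewrite /before; case: (s < t); rewrite ?normr1 ?normr0. Qed.

Lemma measurable_before : measurable_fun [set: mplane] (fun x : mplane => before x.2 x.1).
Proof.
have -> : (fun x : mplane => before x.2 x.1) = \1_[set x : plane | x.2 < x.1].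
  by apply/funext => x; rewrite indicE /before; congr (nat_of_bool _)%:R; apply/idP/idP; rewrite inE.
apply: measurable_indic; apply: open_plane_measurable.
have -> : [set x : plane | x.2 < x.1] = (fun x : plane => x.1 - x.2) @^-1` `]0, +oo[%classic.
  by apply/seteqP; split => x /=; rewrite in_itv/= andbT subr_gt0.
apply: open_comp; last exact: interval_open.
move=> x _; apply: cvgB; [exact: cvg_fst|exact: cvg_snd].
Qed.

Lemma bdm_L1 a : bdm a -> L1 leb1 G a.
Proof.
move=> [ma [M hM]]; apply: (L1_le (measurable_oo 0 1) ma (cst_L1 M 0 1)).
exact: hM.
Qed.

Lemma before_L1 (f a : R -> R) : L1 leb1 G f -> bdm a ->
  L1 leb2 (G `*` G) (fun x => a x.1 * (f x.2 * before x.2 x.1)).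
Proof.
move=> If ba; have [ma _] := ba.
have := L1_tensor (m1 := @lebs R) (m2 := @lebs R) (measurable_oo 0 1) (measurable_oo 0 1) (bdm_L1 ba) If.
move=> h; apply: (@L1_le _ _ _ _ _ (measurableX (measurable_oo 0 1) (measurable_oo 0 1)) _ (fun x : mplane => `|a x.1 * f x.2|)).
- apply: measurable_funM; first exact: measurable_fun_fstX.
  apply: measurable_funM; first by apply: measurable_fun_sndX => //; exact: (L1_meas If).
  exact: measurable_funTS measurable_before.
- by apply: L1_abs => //; exact: measurableX.
- by move=> x _; rewrite !normrM mulrA ler_piMr// ?mulr_ge0// before_le1.
Qed.

(** The dual operation, the integral of a from s to 1. *)
Definition prim (a : R -> R) (s : R) : R := \int[leb1]_(t in G) (a t * before s t).

Lemma prim_bdm a : bdm a -> bdm (prim a).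
Proof.
move=> ba; have [ma [M hM]] := ba.
have h := before_L1 (cst_L1 1 0 1) ba.
have [L _] := fub2 (m1 := @lebs R) (m2 := @lebs R) (measurable_oo 0 1) (measurable_oo 0 1) h.
split.
  by apply: eq_measurable_fun (L1_meas L) => s _; apply: Rint_ext => t _ /=; rewrite mul1r.
exists `|M| => s _; rewrite /prim.
have Il : L1 leb1 G (fun t => a t * before s t).
  apply: (L1_mul_bounded (M := 1) (measurable_oo 0 1)); first exact: bdm_L1.
    have -> : before s = \1_(`]s, +oo[%classic).
      by apply/funext => t; rewrite indicE /before; congr (nat_of_bool _)%:R; apply/idP/idP; rewrite inE/= in_itv/= andbT.
    by apply: measurable_indic; exact: measurable_itv.
  by move=> t _; exact: before_le1.
apply: le_trans (le_normr_Rintegral (measurable_oo 0 1) Il) _.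
apply: (@le_trans _ _ (\int[leb1]_(t in G) `|M|)).
  apply: le_Rintegral => //; [by apply: L1_abs|exact: cst_L1|].
  move=> t Gt /=; rewrite normrM.
  apply: (le_trans (ler_pM _ _ (hM t Gt) (before_le1 s t))) => //.
  by rewrite mulr1 ler_norm.
by rewrite Rint_cst_oo// subr0 mulr1.
Qed.

Lemma swap_before (f a : R -> R) : L1 leb1 G f -> bdm a ->
  \int[leb1]_(t in G) (a t * \int[leb1]_(s in G) (f s * before s t)) =
  \int[leb1]_(s in G) (f s * prim a s).
Proof.
move=> If ba; have h := before_L1 If ba; have mG := measurable_oo (0 : R) 1.
have [_ E1] := fub1 (m1 := @lebs R) (m2 := @lebs R) mG mG h.
have [_ E2] := fub2 (m1 := @lebs R) (m2 := @lebs R) mG mG h.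
have sl : forall t, measurable_fun (G : set mR) (fun s => before s t).
  move=> t; have -> : before^~ t = \1_(`]-oo, t[%classic).
    by apply/funext => s; rewrite indicE /before; congr (nat_of_bool _)%:R; apply/idP/idP; rewrite inE/= in_itv/=.
  by apply: measurable_indic; exact: measurable_itv.
have sr : forall s, measurable_fun (G : set mR) (before s).
  move=> s; have -> : before s = \1_(`]s, +oo[%classic).
    by apply/funext => t; rewrite indicE /before; congr (nat_of_bool _)%:R; apply/idP/idP; rewrite inE/= in_itv/= andbT.
  by apply: measurable_indic; exact: measurable_itv.
transitivity (\int[leb1]_(t in G) \int[leb1]_(s in G) (a t * (f s * before s t))).
  apply: Rint_ext => t _; rewrite RintegralZl//.
  by apply: (L1_mul_bounded (M := 1) mG) => // s _; exact: before_le1.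
transitivity (\int[leb1]_(s in G) \int[leb1]_(t in G) (a t * (f s * before s t))).
  by rewrite -[RHS]E2 -[LHS]E1.
apply: Rint_ext => s _; rewrite /prim -RintegralZl//.
  by apply: Rint_ext => t _; ring.
apply: (L1_mul_bounded (M := 1) mG) => //; first exact: bdm_L1.
by move=> t _; exact: before_le1.
Qed.

Lemma tensor_L2 (a b : R -> R) : bdm a -> bdm b -> L2 leb2 Om (fun x => a x.1 * b x.2).
Proof.
move=> [ma [M hM]] [mb [N hN]]; rewrite OmegaE; apply: (bounded_L2_rect (M := M * N)).
  apply: measurable_funM; first exact: measurable_fun_fstX.
  exact: measurable_fun_sndX.
by move=> x [x1 x2]; rewrite normrM; apply: ler_pM => //; [exact: hM|exact: hN].
Qed.

Lemma OmGG : Om = G `*` G. Proof. exact: OmegaE. Qed.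

Lemma before_itv (f : R -> R) (t : R) : G t ->
  \int[leb1]_(s in G) (f s * before s t) = \int[leb1]_(s in `]0, t[%classic) f s.
Proof.
rewrite /= in_itv/= => /andP[t0 t1].
have sub : `]0, t[%classic `<=` G by move=> s /=; rewrite !in_itv/= => /andP[-> /lt_trans ->].
rewrite -[in RHS](setIidr sub) Rintegral_mkcondr.
apply: Rint_ext => s; rewrite /= in_itv/= => /andP[s0 s1].
rewrite patchE /before; case: ifPn.
  by rewrite inE/= in_itv/= s0/= => ->; rewrite mulr1.
by rewrite notin_setE/= in_itv/= s0/= => /negP/negbTE ->; rewrite mulr0.
Qed.

Lemma slice_L1 v y : continuous v -> L1 leb1 G (fun s => v (s, y)).
Proof. by move=> cv; apply: cont_L1; exact: slice1_cont. Qed.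

Lemma prim_test1 phi a b : test_function Om phi -> bdm a -> bdm b ->
  ip leb2 Om phi (fun x => a x.1 * b x.2) =
  ip leb2 Om (partial ord0 phi) (fun x => prim a x.1 * b x.2).
Proof.
move=> tp ba bb; have sp := test_smooth tp; have mG := measurable_oo (0 : R) 1.
have sdp := smooth_partial ord0 sp.
have L1a := L2_mul measurable_Omega (test_Omega_L2 tp) (tensor_L2 ba bb).
have L1b := L2_mul measurable_Omega (test_Omega_L2 (test_partial ord0 tp)) (tensor_L2 (prim_bdm ba) bb).
rewrite !ipE OmGG.
rewrite OmGG in L1a L1b.
rewrite [LHS](fub2 (m1 := @lebs R) (m2 := @lebs R) mG mG L1a).2.
rewrite [RHS](fub2 (m1 := @lebs R) (m2 := @lebs R) mG mG L1b).2.
apply: Rint_ext => y Gy.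
have If : L1 leb1 G (fun s => partial ord0 phi (s, y)) by exact: slice_L1 (smooth_cont sdp).
transitivity (b y * \int[leb1]_(s in G) (a s * phi (s, y))).
  rewrite -RintegralZl//.
    by apply: Rint_ext => s _ /=; ring.
  have [ma [M hM]] := ba; apply: (L1_bounded_mul mG ma hM).
  exact: slice_L1 (smooth_cont sp).
transitivity (b y * \int[leb1]_(s in G) (partial ord0 phi (s, y) * prim a s)); last first.
  rewrite -RintegralZl//.
    by apply: Rint_ext => s _ /=; ring.
  have [ma [M hM]] := prim_bdm ba.
  exact: (L1_mul_bounded mG If ma hM).
congr (_ * _); rewrite -(swap_before If ba); apply: Rint_ext => t Gt; congr (_ * _).
rewrite before_itv//; move: Gt; rewrite /= in_itv/= => /andP[t0 t1].
rewrite (FTC_oo (ltW t0) (fun s => is_derive_slice1 s y sp) (slice1_cont (smooth_cont sdp))).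
by rewrite (test_out (x := (0, y)) tp) ?subr0// OmegaE => /rectP[/=]; rewrite ltxx.
Qed.

Lemma prim_test2 phi a b : test_function Om phi -> bdm a -> bdm b ->
  ip leb2 Om phi (fun x => a x.1 * b x.2) =
  ip leb2 Om (partial ord_max phi) (fun x => a x.1 * prim b x.2).
Proof.
move=> tp ba bb; have sp := test_smooth tp; have mG := measurable_oo (0 : R) 1.
have sdp := smooth_partial ord_max sp.
have L1a := L2_mul measurable_Omega (test_Omega_L2 tp) (tensor_L2 ba bb).
have L1b := L2_mul measurable_Omega (test_Omega_L2 (test_partial ord_max tp)) (tensor_L2 ba (prim_bdm bb)).
rewrite !ipE OmGG.
rewrite OmGG in L1a L1b.
rewrite [LHS](fub1 (m1 := @lebs R) (m2 := @lebs R) mG mG L1a).2.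
rewrite [RHS](fub1 (m1 := @lebs R) (m2 := @lebs R) mG mG L1b).2.
apply: Rint_ext => x Gx.
have If : L1 leb1 G (fun s => partial ord_max phi (x, s)).
  by apply: cont_L1; exact/slice2_cont/smooth_cont.
transitivity (a x * \int[leb1]_(s in G) (b s * phi (x, s))).
  rewrite -RintegralZl//.
    by apply: Rint_ext => s _ /=; ring.
  have [mb [M hM]] := bb; apply: (L1_bounded_mul mG mb hM).
  by apply: cont_L1; exact/slice2_cont/smooth_cont.
transitivity (a x * \int[leb1]_(s in G) (partial ord_max phi (x, s) * prim b s)); last first.
  rewrite -RintegralZl//.
    by apply: Rint_ext => s _ /=; ring.
  have [mb [M hM]] := prim_bdm bb.
  exact: (L1_mul_bounded mG If mb hM).
congr (_ * _); rewrite -(swap_before If bb); apply: Rint_ext => t Gt; congr (_ * _).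
rewrite before_itv//; move: Gt; rewrite /= in_itv/= => /andP[t0 t1].
rewrite (FTC_oo (ltW t0) (fun s => is_derive_slice2 x s sp) (slice2_cont (smooth_cont sdp))).
by rewrite (test_out (x := (x, 0)) tp) ?subr0// OmegaE => /rectP[/= _]; rewrite ltxx.
Qed.

(** Test functions vanish at the left side of the square, hence are the
    primitives in x.1 of their first partial derivative; the pairing of this
    identity with a tensor product passes to the limit in H^1. *)
Lemma H10_prim1 O v a b : O `<=` Om -> H10 O v -> bdm a -> bdm b ->
  ip leb2 Om v (fun x => a x.1 * b x.2) = ip leb2 Om (gD ord0 v) (fun x => prim a x.1 * b x.2).
Proof.
move=> OO /H10_approx[psi [tp Lv Lw cv cw]] ba bb.
have c1 := cvg_ip measurable_Omega (fun n => test_Omega_L2 (tp n)) Lv (tensor_L2 ba bb) cv.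
have c2 := cvg_ip measurable_Omega (fun n => test_Omega_L2 (test_partial ord0 (tp n))) (Lw ord0) (tensor_L2 (prim_bdm ba) bb) (cw ord0).
apply: (cvg_unique _ c1) => //=.
by under eq_fun do rewrite (prim_test1 (test_sub OO (tp _)) ba bb).
Qed.

Lemma H10_prim2 O v a b : O `<=` Om -> H10 O v -> bdm a -> bdm b ->
  ip leb2 Om v (fun x => a x.1 * b x.2) = ip leb2 Om (gD ord_max v) (fun x => a x.1 * prim b x.2).
Proof.
move=> OO /H10_approx[psi [tp Lv Lw cv cw]] ba bb.
have c1 := cvg_ip measurable_Omega (fun n => test_Omega_L2 (tp n)) Lv (tensor_L2 ba bb) cv.
have c2 := cvg_ip measurable_Omega (fun n => test_Omega_L2 (test_partial ord_max (tp n))) (Lw ord_max) (tensor_L2 ba (prim_bdm bb)) (cw ord_max).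
apply: (cvg_unique _ c1) => //=.
by under eq_fun do rewrite (prim_test2 (test_sub OO (tp _)) ba bb).
Qed.

Lemma bump_bdm p q n : bdm (bump p q n).
Proof. by split; [exact: bump_measurable|exists 1 => t _; exact: bump_norm_le1]. Qed.

(** The weak form of the Poincare inequality: if the first weak derivative
    vanishes, so do all pairings of v with tensor products, by the
    representation of v as a primitive. *)
Lemma grad0_ae0 O v : O `<=` Om -> H10 O v -> grad_dot Om v v = 0 ->
  \forall x \ae leb2, Om x -> v x = 0.
Proof.
move=> OO hv v0; have mO := @measurable_Omega R.
have Lg i := H10_wD_L2 i hv.
have g0 : ip leb2 Om (gD ord0 v) (gD ord0 v) = 0.
  apply/eqP; rewrite eq_le ip_ge0 andbT -v0 (grad_dotE hv hv) lerDl.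
  exact: ip_ge0.
rewrite OmegaE; apply: du_bois_reymond2.
  by have := L2_Omega_L1 (H10_L2 hv); rewrite OmegaE.
move=> p q p' q' n m _ _ _ _ _ _.
have := H10_prim1 OO hv (bump_bdm (ratr p) (ratr q) n) (bump_bdm (ratr p') (ratr q') m).
rewrite ipE OmegaE => ->; rewrite -OmegaE.
have LT := tensor_L2 (prim_bdm (bump_bdm (ratr p) (ratr q) n)) (bump_bdm (ratr p') (ratr q') m).
have := ip_CS mO (Lg ord0) LT; rewrite g0 mul0r => h.
by apply/eqP; rewrite -sqrf_eq0 eq_le h sqr_ge0.
Qed.

End Primitives.

(** * Traces on the contact line *)
Section AEIntegral.
Context d (T : measurableType d) (R : realType) (mu : {measure set T -> \bar R}).
Context (D : set T) (mD : measurable D).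
Implicit Types f g : T -> R.

Lemma L1_le_ae f g : measurable_fun D f -> L1 mu D g ->
  (\forall x \ae mu, D x -> `|f x| <= g x) -> L1 mu D f.
Proof.
move=> mf Ig fg.
pose h (x : T) : R := Num.max (- `|g x|) (Num.min (f x) `|g x|).
have mg := L1_meas Ig.
have mng : measurable_fun D (fun x => `|g x|) by apply: measurableT_comp.
have mh : measurable_fun D h.
  apply: measurable_maxr; last exact: measurable_minr.
  exact: measurableT_comp.
have Lh : L1 mu D h.
  apply: (L1_le mD mh (L1_abs Ig)) => x Dx; rewrite /h ler_norml.
  by rewrite le_max lexx/= ge_max ge_min lexx orbT andbT (le_trans _ (normr_ge0 _))// oppr_le0.
apply: (L1_ae_eq mD mf _ Lh); apply: aeS fg => x hx Dx.
have {}hx := le_trans (hx Dx) (ler_norm _).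
move: hx; rewrite ler_norml => /andP[h1 h2].
by rewrite /h (min_idPl h2); apply/max_idPr.
Qed.

Lemma le_Rint_ae f g : L1 mu D f -> L1 mu D g ->
  (\forall x \ae mu, D x -> f x <= g x) ->
  \int[mu]_(x in D) f x <= \int[mu]_(x in D) g x.
Proof.
move=> If Ig fg; rewrite -subr_ge0 -RintegralB//.
have Igf := L1B mD Ig If.
have mm : measurable_fun D (fun x => Num.max (g x - f x) 0).
  by apply: measurable_maxr => //; exact: L1_meas Igf.
rewrite (@Rint_ae_eq _ _ _ mu D mD _ (fun x => Num.max (g x - f x) 0))//.
- by apply: Rintegral_ge0 => x _; rewrite le_max lexx orbT.
- exact: L1_meas Igf.
- by apply: aeS fg => x h Dx; rewrite (max_idPl _)// subr_ge0 h.
Qed.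

End AEIntegral.

Section Traces.
Context {R : realType}.
Local Notation plane := (R * R)%type.
Local Notation leb1 := (@lebesgue_measure R).
Local Notation mR := (measurableTypeR R).
Local Notation mplane := (measurableTypeR R * measurableTypeR R)%type.
Local Notation Om := (@Omega R).
Local Notation G := (`]0, 1[%classic : set R).
Local Notation mO := (@measurable_Omega R).
Local Notation mG := (measurable_oo (0 : R) 1).
Implicit Types (O : set plane) (u v : plane -> R) (i : 'I_2).

Lemma half_sub c : c <= 1 -> `]0, c[%classic `*` G `<=` Om.
Proof.
move=> c1 x [/=]; rewrite !in_itv/= => /andP[x1 x2] x3.
by rewrite /Omega/= x1 x3 (lt_le_trans x2 c1).
Qed.

Lemma le_Rint_Omega (f : plane -> R) (D : set mplane) : measurable D -> D `<=` Om ->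
  L1 leb2 Om f -> (forall x, Om x -> 0 <= f x) ->
  \int[leb2]_(x in D) f x <= \int[leb2]_(x in Om) f x.
Proof.
move=> mD DO If f0; rewrite -[in leLHS](setIidr DO) Rintegral_mkcondr.
apply: le_Rintegral => //.
  rewrite -restrict_EFin; apply: (integrable_restrict leb2 mD mO (EFin \o f)).1.
  by rewrite setIC (setIidl DO); exact: (integrableS mO mD DO If).
by move=> x Ox; rewrite patchE; case: ifP => // _; exact: f0.
Qed.

(** Cauchy-Schwarz on each horizontal segment, of length c at most 1. *)
Lemma slice_sq (f : plane -> R) c : 0 <= c -> c <= 1 -> L2 leb2 Om f ->
  L2 leb1 G (fun y => \int[leb1]_(s in `]0, c[%classic) f (s, y)) /\
  \int[leb1]_(y in G) (\int[leb1]_(s in `]0, c[%classic) f (s, y)) ^+ 2 <=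
  \int[leb2]_(x in Om) (f x ^+ 2).
Proof.
move=> c0 c1 Lf; have [mf If2] := Lf.
set C := `]0, c[%classic; have mC : measurable (C : set mR) by exact: measurable_oo.
have mCG : measurable (C `*` G : set mplane) by exact: measurableX.
have sub := half_sub c1.
have I1 : L1 leb2 (C `*` G) f by apply: integrableS (L2_Omega_L1 Lf).
have I2 : L1 leb2 (C `*` G) (fun x => f x ^+ 2) by apply: integrableS If2.
have [Lt _] := fub2 (m1 := @lebs R) (m2 := @lebs R) mC mG I1.
have [LT ET] := fub2 (m1 := @lebs R) (m2 := @lebs R) mC mG I2.
have key : \forall y \ae leb1, G y ->
    (\int[leb1]_(s in C) f (s, y)) ^+ 2 <= \int[leb1]_(s in C) (f (s, y) ^+ 2).
  apply: aeS (aeI (fub_slice2 (m1 := @lebs R) (m2 := @lebs R) mC mG I1)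
    (fub_slice2 (m1 := @lebs R) (m2 := @lebs R) mC mG I2)) => y [h1 h2] Gy.
  have L2f : L2 leb1 C (fun s => f (s, y)) by split; [exact: (L1_meas (h1 Gy))|exact: h2].
  have L21 : L2 leb1 C (fun=> 1).
    by split => //; under eq_fun do rewrite expr1n; exact: cst_L1.
  have := ip_CS mC L2f L21; rewrite !ipE.
  under eq_Rintegral do rewrite mulr1.
  under [X in _ * X]eq_Rintegral do rewrite mulr1.
  rewrite Rint_cst_oo// subr0 mul1r => /le_trans; apply.
  under eq_Rintegral do rewrite -expr2.
  by rewrite ler_piMr//; apply: Rintegral_ge0 => s _; exact: sqr_ge0.
have Lt2 : L1 leb1 G (fun y => (\int[leb1]_(s in C) f (s, y)) ^+ 2).
  apply: (L1_le_ae mG _ LT); first exact: measurable_funX (L1_meas Lt).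
  by apply: aeS key => y h Gy; rewrite ger0_norm ?sqr_ge0// h.
split; first by split => //; exact: L1_meas Lt.
apply: le_trans (le_Rint_ae mG Lt2 LT key) _.
rewrite -[leLHS]ET; apply: le_Rint_Omega => // x _; exact: sqr_ge0.
Qed.

Definition half : R := 2^-1.
Lemma half_gt0 : 0 < half. Proof. by rewrite invr_gt0. Qed.
Lemma half_lt1 : half < 1. Proof. by rewrite invf_lt1// ltr1n. Qed.

(** The trace of v on the line x.1 = 1 / 2, as the integral of the first
    derivative from the side of the square where v vanishes. *)
Definition trace_fun v (y : R) : R := \int[leb1]_(s in `]0, half[%classic) gD ord0 v (s, y).

Lemma test_slice phi y c : test_function Om phi -> 0 <= c ->
  \int[leb1]_(s in `]0, c[%classic) partial ord0 phi (s, y) = phi (c, y).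
Proof.
move=> tp c0; have sp := test_smooth tp.
rewrite (FTC_oo c0 (fun s => is_derive_slice1 s y sp) (slice1_cont (smooth_cont (smooth_partial ord0 sp)))).
by rewrite (test_out (x := (0, y)) tp) ?subr0// OmegaE => /rectP[/=]; rewrite ltxx.
Qed.

Lemma half_slice (f : plane -> R) : L2 leb2 Om f ->
  \forall y \ae leb1, G y -> L1 leb1 `]0, half[%classic (fun s => f (s, y)).
Proof.
move=> Lf; apply: (fub_slice2 (m1 := @lebs R) (m2 := @lebs R) (measurable_oo _ _) mG).
apply: integrableS (L2_Omega_L1 Lf) => //; first exact: measurableX.
exact/half_sub/ltW/half_lt1.
Qed.

Lemma trace_fun_L2 O v : H10 O v -> L2 leb1 G (trace_fun v).
Proof.
move=> hv.
by have [] := slice_sq (ltW half_gt0) (ltW half_lt1) (H10_wD_L2 ord0 hv).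
Qed.

Lemma psi_trace_cvg O v w psi : O `<=` Om -> h1_approx O v w psi -> H10 O v ->
  sqdist leb1 G (fun y => psi n (half, y)) (trace_fun v) @[n --> \oo] --> 0.
Proof.
move=> OO hp hv; have [tp Lv Lw cv cw] := hp.
have [LD E] := approx_wD OO hp ord0.
apply: (squeeze_cvgr _ (cvg_cst 0) (cw ord0)); near=> n.
rewrite sqdist_ge0/=.
have Lp := test_Omega_L2 (test_partial ord0 (tp n)).
have Lf := L2B mO Lp LD.
have [Lt le] := slice_sq (ltW half_gt0) (ltW half_lt1) Lf.
rewrite -(sqdist_ae Lp LD (Lw ord0) E) [leRHS]sqdistE; apply: le_trans le.
rewrite le_eqVlt; apply/orP; left; apply/eqP; rewrite sqdistE.
have Lpt : L2 leb1 G (fun y => psi n (half, y)).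
  have := slice_sq (ltW half_gt0) (ltW half_lt1) Lp.
  move=> [+ _]; apply: (L2_eq mG) => y _.
  by rewrite (test_slice _ (test_sub OO (tp n)))// ltW// half_gt0.
apply: Rint_ae_eq => //.
- exact: L1_meas (L2B mG Lpt (trace_fun_L2 hv)).2.
- exact: L1_meas Lt.2.
- apply: aeS (half_slice LD) => y h Gy; congr (_ ^+ 2).
  rewrite RintegralB//.
  + by rewrite (test_slice _ (test_sub OO (tp n)))// ltW// half_gt0.
  + by apply: cont_L1; apply: slice1_cont; exact: smooth_cont (smooth_partial ord0 (test_smooth (tp n))).
  + exact: h.
Unshelve. all: by end_near. Qed.

Lemma test_trace_L2 chi : smooth chi -> L2 leb1 G (fun y => chi (half, y)).
Proof.
move=> sc; have cc := slice2_cont (s := half) (smooth_cont sc).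
split; first by apply: measurable_funTS; exact: continuous_measurable_fun.
have : L1 leb1 G (fun y => chi (half, y) * chi (half, y)).
  by apply: cont_L1 => y; apply: cvgM; exact: cc.
  by apply: L1_eq => // y _; rewrite expr2.
Qed.

(** The trace of a smooth function that does not vanish on the boundary is
    controlled by its H^1 norm: apply the previous bound to x.1 * chi, which
    vanishes at x.1 = 0 and whose trace is chi / 2. *)
Lemma smooth_trace_le chi : smooth chi ->
  \int[leb1]_(y in G) (chi (half, y) ^+ 2) <=
  8 * (\int[leb2]_(x in Om) (chi x ^+ 2) + \int[leb2]_(x in Om) (partial ord0 chi x ^+ 2)).
Proof.
move=> sc; have sd := smooth_partial ord0 sc.
have sm : smooth (fun x : plane => x.1 * chi x) by apply: smoothM => //; exact: smooth_fst.
have E x : partial ord0 (fun x : plane => x.1 * chi x) x = x.1 * partial ord0 chi x + chi x.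
  by rewrite partialM ?partial_fst ?basis_vec0/= ?mulr1//; exact: smooth_fst.
have Lf : L2 leb2 Om (partial ord0 (fun x : plane => x.1 * chi x)).
  exact: smooth_Omega_L2 (smooth_partial ord0 sm).
have [_ le] := slice_sq (ltW half_gt0) (ltW half_lt1) Lf.
have Lc := smooth_Omega_L2 sc; have Ld := smooth_Omega_L2 sd.
have le2 : \int[leb2]_(x in Om) (partial ord0 (fun x : plane => x.1 * chi x) x ^+ 2) <=
  2 * (\int[leb2]_(x in Om) (chi x ^+ 2) + \int[leb2]_(x in Om) (partial ord0 chi x ^+ 2)).
  rewrite -RintegralD//; [|exact: Lc.2|exact: Ld.2].
  rewrite -RintegralZl//; last by apply: L1D => //; [exact: Lc.2|exact: Ld.2].
  apply: le_Rintegral => //; first exact: Lf.2.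
    by apply: L1Zl => //; apply: L1D => //; [exact: Lc.2|exact: Ld.2].
  move=> x [/andP[x0 x1] _]; rewrite E.
  have h1 : (x.1 * partial ord0 chi x) ^+ 2 <= partial ord0 chi x ^+ 2.
    by rewrite exprMn ler_piMl ?sqr_ge0// expr_le1// ltW.
  have := sqr_ge0 (x.1 * partial ord0 chi x - chi x); nra.
have Et : \int[leb1]_(y in G) (chi (half, y) ^+ 2) = 4 * \int[leb1]_(y in G)
   (\int[leb1]_(s in `]0, half[%classic) partial ord0 (fun x : plane => x.1 * chi x) (s, y)) ^+ 2.
  rewrite -RintegralZl//; last first.
    by have [[_]] := slice_sq (ltW half_gt0) (ltW half_lt1) Lf.
  apply: Rint_ext => y _.
  rewrite (FTC_oo (ltW half_gt0) (fun s => is_derive_slice1 s y sm) (slice1_cont (smooth_cont (smooth_partial ord0 sm)))).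
  by rewrite /= mul0r subr0 /half; field.
rewrite Et; have := le_trans le le2.
by set a := (X in X <= _); set b := (X in _ <= 2 * X) => h; rewrite (_ : 8 * b = 4 * (2 * b)); [rewrite ler_pM2l|ring].
Qed.

Lemma trace_is O v : O `<=` Om -> H10 O v -> is_trace 2 Om v (trace_fun v).
Proof.
move=> OO hv; have Lt := trace_fun_L2 hv.
have [psi hp] := H10_approx hv; have [tp Lv Lw cv cw] := hp.
split; first by apply/inLp2P.
exists psi; split.
- by move=> n; exact: test_smooth (tp n).
- split; first by apply/cvgLp2P => // n; exact: test_Omega_L2 (tp n).
  move=> i; have := cw i; have := Lw i; rewrite gDE => Lwi cwi.
  by apply/cvgLp2P => // n; exact: test_Omega_L2 (test_partial i (tp n)).
- apply/cvgLp2P => //; first by move=> n; exact: test_trace_L2 (test_smooth (tp n)).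
  exact: psi_trace_cvg OO hp hv.
Qed.

(** Two approximating sequences have nearby traces by the trace inequality
    applied to their difference, which need not vanish on the boundary. *)
Lemma trace_unique O v t : O `<=` Om -> H10 O v -> is_trace 2 Om v t ->
  \forall y \ae leb1, G y -> t y = trace_fun v y.
Proof.
move=> OO hv [/inLp2P Lt' [chi [schi [cv' cw'] ct']]].
have Lt : L2 leb1 G t by exact: Lt'.
have LT := trace_fun_L2 hv.
have [psi hp] := H10_approx hv; have [tp Lv Lw cv cw] := hp.
have {}cv' : sqdist leb2 Om (chi n) v @[n --> \oo] --> 0.
  by apply/(cvgLp2P mO) => // n; exact: smooth_Omega_L2.
have {}cw' : sqdist leb2 Om (partial ord0 (chi n)) (gD ord0 v) @[n --> \oo] --> 0.
  have := cw' ord0; have := Lw ord0; rewrite gDE => Lw0 c.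
  by apply/(cvgLp2P mO) => // n; exact/smooth_Omega_L2/smooth_partial.
have {}ct' : sqdist leb1 G (fun y => chi n (half, y)) t @[n --> \oo] --> 0.
  by apply/(cvgLp2P mG) => // n; exact: test_trace_L2.
have ct := psi_trace_cvg OO hp hv.
apply: (sqdist0_ae mG Lt LT).
pose S n := 2 * (sqdist leb1 G (fun y => chi n (half, y)) t +
  2 * (16 * (sqdist leb2 Om (chi n) v + sqdist leb2 Om (psi n) v +
    (sqdist leb2 Om (partial ord0 (chi n)) (gD ord0 v) +
     sqdist leb2 Om (partial ord0 (psi n)) (gD ord0 v))) +
   sqdist leb1 G (fun y => psi n (half, y)) (trace_fun v))).
have cS : S n @[n --> \oo] --> (2 * (0 + 2 * (16 * (0 + 0 + (0 + 0)) + 0)) : R).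
  apply: cvgMr; apply: cvgD => //; apply: cvgMr; apply: cvgD => //; apply: cvgMr.
  apply: cvgD; apply: cvgD => //; exact: cw.
have hS n : sqdist leb1 G t (trace_fun v) <= S n.
  have sp := test_smooth (tp n); have sc := schi n.
  have Lc := test_trace_L2 sc; have Lp := test_trace_L2 sp.
  have sym f g : sqdist leb1 G f g = sqdist leb1 G g f.
    by rewrite !sqdistE; apply: Rint_ext => y _; ring.
  have sym2 f g : sqdist leb2 Om f g = sqdist leb2 Om g f.
    by rewrite !sqdistE; apply: Rint_ext => y _; ring.
  have T1 := sqdist_triangle mG Lt Lc LT.
  have T2 := sqdist_triangle mG Lc Lp LT.
  have sd : smooth (fun x => chi n x + - psi n x) by apply: smoothD => //; exact: smoothN.
  have B := smooth_trace_le sd.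
  have E1 : \int[leb1]_(y in G) ((chi n (half, y) + - psi n (half, y)) ^+ 2) =
    sqdist leb1 G (fun y => chi n (half, y)) (fun y => psi n (half, y)) by rewrite sqdistE.
  have E2 : \int[leb2]_(x in Om) ((chi n x + - psi n x) ^+ 2) = sqdist leb2 Om (chi n) (psi n) by rewrite sqdistE.
  have E3 : \int[leb2]_(x in Om) (partial ord0 (fun x => chi n x + - psi n x) x ^+ 2) =
     sqdist leb2 Om (partial ord0 (chi n)) (partial ord0 (psi n)).
    rewrite sqdistE; apply: Rint_ext => x _; congr (_ ^+ 2).
    rewrite partialD//; last exact: smoothN.
    congr (_ + _); rewrite -mulN1r -[RHS]addr0 -[X in _ = _ + X](mulr0 (psi n x)) -(partial_cst ord0 (-1) x).
    rewrite -partialM//; last exact: smooth_cst.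
    by congr (partial _ _ _); apply/funext => z; rewrite mulN1r.
  rewrite E1 E2 E3 in B.
  have Lcn := smooth_Omega_L2 sc; have Lpn := smooth_Omega_L2 sp.
  have Ldc := smooth_Omega_L2 (smooth_partial ord0 sc); have Ldp := smooth_Omega_L2 (smooth_partial ord0 sp).
  have T3 := sqdist_triangle mO Lcn Lv Lpn.
  have T4 := sqdist_triangle mO Ldc (Lw ord0) Ldp.
  rewrite (sym2 v) in T3; rewrite (sym2 (gD ord0 v)) in T4.
  rewrite (sym t (fun y => chi n (half, y))) in T1.
  move: T1 T2 T3 T4 B; rewrite /S.
  set a1 := sqdist _ _ _ _; set a2 := sqdist _ _ _ _; set a3 := sqdist _ _ _ _.
  by do 8! (let x := fresh "z" in set x := sqdist _ _ _ _); lra.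
apply/eqP; rewrite eq_le sqdist_ge0 andbT.
rewrite (_ : 2 * _ = 0) in cS; last by ring.
by apply: (cvgr_to_ge cS); near=> n; exact: hS.
Unshelve. all: by end_near. Qed.

Lemma trG_is O v : O `<=` Om -> H10 O v -> is_trace 2 Om v (trG v).
Proof.
by move=> OO hv; apply: (@getPex _ (is_trace 2 Om v)); exists (trace_fun v); exact: trace_is OO hv.
Qed.

Lemma trG_ae O v : O `<=` Om -> H10 O v ->
  \forall y \ae leb1, G y -> trG v y = trace_fun v y.
Proof. by move=> OO hv; apply: trace_unique OO hv (trG_is OO hv). Qed.

Lemma trG_comb O (a : R) u v : O `<=` Om -> H10 O u -> H10 O v ->
  \forall y \ae leb1, G y -> trG (fun x => a * u x + v x) y = a * trG u y + trG v y.
Proof.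
move=> OO hu hv; have [hc hD] := H10_comb a OO hu hv.
have Lc := H10_wD_L2 ord0 hc; have Lu := H10_wD_L2 ord0 hu; have Lv := H10_wD_L2 ord0 hv.
have key : \forall y \ae leb1, G y ->
   trace_fun (fun x => a * u x + v x) y = a * trace_fun u y + trace_fun v y.
  have mH : measurable (`]0, half[%classic `*` G : set mplane) by exact: measurableX.
  have subH := half_sub (ltW half_lt1).
  pose F x := `|gD ord0 (fun x => a * u x + v x) x - (a * gD ord0 u x + gD ord0 v x)|.
  have LF0 : L2 leb2 Om (fun x => a * gD ord0 u x + gD ord0 v x) by apply: L2D => //; exact: L2Z.
  have LF : L1 leb2 (`]0, half[%classic `*` G) F.
    by apply: L1_abs => //; apply: integrableS (L2_Omega_L1 (L2B mO Lc LF0)).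
  have [L2' E2] := fub2 (m1 := @lebs R) (m2 := @lebs R) (measurable_oo _ _) mG LF.
  have F0 : \int[leb2]_(x in `]0, half[%classic `*` G) F x = 0.
    apply: Rint_ae0 => //; first exact: L1_meas LF.
    apply: aeS (hD ord0) => x h /subH Ox; rewrite /F h//.
    by apply/normr0P; rewrite subrr.
  have := Rint_eq0_ae mG L2' (fun y _ => Rintegral_ge0 _ (fun s _ => normr_ge0 _)).
  rewrite -[X in X = 0 -> _]E2 => /(_ F0) ae0.
  apply: aeS (aeI ae0 (aeI (half_slice Lc) (aeI (half_slice Lu) (half_slice Lv)))) => y [h0 [hc' [hu' hv']]] Gy.
  have mh := measurable_oo (0 : R) half.
  rewrite /trace_fun -RintegralZl//; last exact: hu'.
  rewrite -RintegralD//; [|by apply: L1Zl => //; exact: hu'|exact: hv'].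
  have I1 : L1 leb1 `]0, half[%classic (fun s => a * gD ord0 u (s, y) + gD ord0 v (s, y)).
    by apply: L1D => //; [apply: L1Zl => //; exact: hu'|exact: hv'].
  apply/eqP; rewrite -subr_eq0 -RintegralB//; last exact: hc'.
  rewrite -normr_le0; apply: le_trans (le_normr_Rintegral mh _) _.
    by apply: L1B => //; exact: hc'.
  by rewrite le_eqVlt; apply/orP; left; apply/eqP; exact: h0.
apply: aeS (aeI key (aeI (trG_ae OO hc) (aeI (trG_ae OO hu) (trG_ae OO hv)))) => y [k [h1 [h2 h3]]] Gy.
by rewrite h1// h2// h3// k.
Qed.

Lemma trG_B O u v : O `<=` Om -> H10 O u -> H10 O v ->
  \forall y \ae leb1, G y -> trG (fun x => u x - v x) y = trG u y - trG v y.
Proof.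
move=> OO hu hv; have := trG_comb (-1) OO hv hu.
have -> : (fun x => -1 * v x + u x) = (fun x => u x - v x).
  by apply/funext => x; rewrite mulN1r addrC.
by apply: aeS => y h Gy; rewrite h// mulN1r addrC.
Qed.

Lemma trG_test O phi : O `<=` Om -> test_function O phi ->
  \forall y \ae leb1, G y -> trG phi y = phi (half, y).
Proof.
move=> OO tp; have [hp _] := H10_test OO tp.
have ct := psi_trace_cvg OO (approx_test tp) hp.
have c0 : sqdist leb1 G (fun y => phi (half, y)) (trace_fun phi) = 0.
  by apply: (cvg_unique _ _ ct) => //; exact: cvg_cst.
have := sqdist0_ae mG (test_trace_L2 (test_smooth tp)) (trace_fun_L2 hp) c0.
move=> h; apply: aeS (aeI h (trG_ae OO hp)) => y [h1 h2] Gy.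
by rewrite h2// h1.
Qed.

Lemma trG_L2 O v : O `<=` Om -> H10 O v -> L2 leb1 G (trG v).
Proof. by move=> OO hv; have [/inLp2P h _] := trG_is OO hv; exact: h. Qed.

End Traces.

(** * Functions with an integrable mixed derivative are continuous *)
Section ParameterContinuity.
Context {R : realType}.

(** Filters on a metric space are replaced by sequences, for which dominated
    convergence holds. *)
Lemma seq_cvg (T : pseudoMetricType R) (f : T -> R) (x : T) :
  (forall u : nat -> T, u n @[n --> \oo] --> x -> f (u n) @[n --> \oo] --> f x) ->
  f y @[y --> x] --> f x.
Proof.
move=> h; apply/cvgrPdist_lt => e e0; apply: contrapT => nn.
have ex n : exists y, ball x n.+1%:R^-1 y /\ ~ (`|f x - f y| < e).
  apply: contrapT => ne; apply: nn; apply/nbhs_ballP; exists n.+1%:R^-1.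
    by rewrite /= invr_gt0.
  by move=> y hy; apply: contrapT => ny; apply: ne; exists y.
have [u hu] := choice ex.
have cu : u n @[n --> \oo] --> x.
  apply/cvg_ballP => r r0; near=> n; apply: (le_ball _ (hu n).1).
  by apply/ltW; near: n; exact: (near_infty_natSinv_lt (PosNum r0)).
have /cvgrPdist_lt/(_ e e0) [N _ /(_ N (leqnn N))] := h u cu.
exact: (hu N).2.
Unshelve. all: by end_near. Qed.

Lemma param_cont (P : pseudoMetricType R) d (T : measurableType d)
    (mu : {measure set T -> \bar R}) (D : set T) (g : T -> R) (b : P -> T -> R) (p0 : P) :
  measurable D -> L1 mu D g -> (forall p, measurable_fun D (b p)) ->
  (forall p z, `|b p z| <= 1) ->
  (\forall z \ae mu, b q z @[q --> p0] --> b p0 z) ->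
  (\int[mu]_(z in D) (g z * b q z)) @[q --> p0] --> \int[mu]_(z in D) (g z * b p0 z).
Proof.
move=> mD Ig mb b1 cb.
apply: (@seq_cvg P (fun q => \int[mu]_(z in D) (g z * b q z)) p0) => u cu.
have mg := L1_meas Ig.
apply: (@Rdominated _ _ _ mu D mD _ _ (fun z => `|g z|) _ _ _ _ _).2.
- by move=> n; exact: measurable_funM.
- exact: measurable_funM.
- exact: L1_abs.
- apply: aeS cb => z cz Dz; apply: cvgMr.
  exact: (cvg_comp _ _ cu cz).
- by apply: aeT => z n Dz; rewrite normrM ler_piMr.
Qed.

Lemma before_cvg (z p0 : R) : z <> p0 -> before z q @[q --> p0] --> before z p0.
Proof.
move=> /eqP zp; apply: cvg_near_cst; rewrite /before.
have [zp1|zp1|/eqP] := ltgtP z p0; last by rewrite (negbTE zp).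
- have h : \forall q \near p0, z < q by exact: lt_nbhsr.
  by apply: filterS h => q ->.
- have h : \forall q \near p0, q < z by exact: lt_nbhsl.
  by apply: filterS h => q hq; rewrite ltNge (ltW hq).
Qed.

Lemma ae_neq (c : R) : \forall z \ae (@lebesgue_measure R), z <> c.
Proof.
exists [set c]; split => //; first exact: lebesgue_measure_set1.
by move=> z /= /contrapT ->.
Qed.

Lemma null_fst (c : R) : \forall z \ae leb2, z.1 <> c.
Proof.
exists ([set c] `*` setT); split; first exact: measurableX.
  rewrite [LHS](product_measure1E (@lebs R) (@lebs R))//.
  have h : @lebs R [set c] = 0%E := lebesgue_measure_set1 c.
  by transitivity (@lebs R [set c] * @lebs R setT)%E => //; rewrite h mul0e.
by move=> z /= /contrapT.
Qed.

Lemma null_snd (c : R) : \forall z \ae leb2, z.2 <> c.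
Proof.
exists (setT `*` [set c]); split; first exact: measurableX.
  rewrite [LHS](product_measure1E (@lebs R) (@lebs R))//.
  have h : @lebs R [set c] = 0%E := lebesgue_measure_set1 c.
  by transitivity (@lebs R setT * @lebs R [set c])%E => //; rewrite h mule0.
by move=> z /= /contrapT.
Qed.

Lemma ae_itv_ex (P : R -> Prop) (a b : R) : a < b ->
  (\forall y \ae (@lebesgue_measure R), a < y < b -> P y) -> exists2 y, a < y < b & P y.
Proof.
move=> ab [N [mN N0 sub]]; apply: contrapT => ne.
have subN : `]a, b[%classic `<=` N.
  move=> y; rewrite /= in_itv/= => yab; apply: sub => /= h; apply: ne.
  by exists y => //; exact: h.
have : (@lebesgue_measure R `]a, b[%classic <= @lebesgue_measure R N)%E.
  by apply: le_measure => //; rewrite inE//; exact: measurable_oo.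
by rewrite N0 lebesgue_measure_itv/= lte_fin ab -EFinD lee_fin subr_le0 leNgt ab.
Qed.

Lemma cont_ae_eq (f : R -> R) (c x0 r : R) : f y @[y --> x0] --> f x0 -> 0 < r ->
  (\forall y \ae (@lebesgue_measure R), x0 - r < y < x0 + r -> f y = c) -> f x0 = c.
Proof.
move=> /cvgrPdist_lt cf r0 ae; apply: contrapT => /eqP ne.
have e0 : 0 < `|f x0 - c| by rewrite normr_gt0 subr_eq0.
have /nbhs_ballP[/= s s0 hs] := cf _ e0.
have m0 : 0 < Num.min r s by rewrite lt_min r0.
have lt : x0 - Num.min r s < x0 + Num.min r s by rewrite ltr_pwDr// gerBl ltW.
have ae' : \forall y \ae (@lebesgue_measure R), x0 - Num.min r s < y < x0 + Num.min r s -> f y = c.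
  apply: aeS ae => y h /andP[h1 h2]; apply: h.
  have mr : Num.min r s <= r by rewrite ge_min lexx.
  by rewrite (le_lt_trans _ h1) ?(lt_le_trans h2)// ?lerD2l ?lerN2.
have [y /andP[y1 y2] fy] := ae_itv_ex lt ae'.
have /hs/= : ball x0 s y.
  have ms : Num.min r s <= s by rewrite ge_min lexx orbT.
  rewrite /ball/= ltr_distlC (le_lt_trans _ y1) ?(lt_le_trans y2)// ?lerD2l ?lerN2//.
by rewrite fy ltxx.
Qed.

End ParameterContinuity.

Section MixedDerivative.
Context {R : realType}.
Local Notation plane := (R * R)%type.
Local Notation leb1 := (@lebesgue_measure R).
Local Notation mR := (measurableTypeR R).
Local Notation mplane := (measurableTypeR R * measurableTypeR R)%type.
Local Notation Om := (@Omega R).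
Local Notation G := (`]0, 1[%classic : set R).
Local Notation mO := (@measurable_Omega R).
Local Notation mG := (measurable_oo (0 : R) 1).
Implicit Types (O : set plane) (u v g : plane -> R) (i : 'I_2).

Definition quadrant (x z : plane) : R := before z.1 x.1 * before z.2 x.2.

Lemma quadrant_le1 x z : `|quadrant x z| <= 1.
Proof. by rewrite normrM mulr_ile1// before_le1. Qed.

Lemma measurable_quadrant2 :
  measurable_fun [set: mplane * mplane] (fun p : mplane * mplane => quadrant p.1 p.2).
Proof.
apply: measurable_funM.
- apply: (@measurableT_comp _ _ _ _ _ _ (fun x : mplane => before x.2 x.1) _ (fun p : mplane * mplane => (p.1.1, p.2.1) : mplane) measurable_before).
  apply: measurable_fun_pair; apply: measurableT_comp => //; exact: measurable_fst.
- apply: (@measurableT_comp _ _ _ _ _ _ (fun x : mplane => before x.2 x.1) _ (fun p : mplane * mplane => (p.1.2, p.2.2) : mplane) measurable_before).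
  apply: measurable_fun_pair; apply: measurableT_comp => //; exact: measurable_snd.
Qed.

Lemma measurable_quadrant x D : measurable D -> measurable_fun (D : set mplane) (quadrant x).
Proof.
move=> mD; apply: measurable_funTS.
exact: (measurableT_comp measurable_quadrant2 (pair1_measurable (x : mplane))).
Qed.

(** The integral of g over the rectangle between the origin and x; when g is
    the mixed derivative of v and v vanishes on two sides of the square, it
    is a continuous version of v. *)
Definition cumul g (x : plane) : R := \int[leb2]_(z in Om) (g z * quadrant x z).

(** The quadrants of nearby points differ by thin strips around two lines,
    and lines are null sets. *)
Lemma cumul_cont g : L1 leb2 Om g -> continuous (cumul g).
Proof.
move=> Ig x; apply: (@param_cont R _ _ _ leb2 Om g quadrant x) => //.
- by move=> p; exact: measurable_quadrant.
- exact: quadrant_le1.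
- apply: aeS (aeI (null_fst x.1) (null_snd x.2)) => z [z1 z2].
  apply: cvgM.
  + apply: (cvg_comp _ _ _ (before_cvg z1)); exact: cvg_fst.
  + apply: (cvg_comp _ _ _ (before_cvg z2)); exact: cvg_snd.
Qed.

Lemma leb2_sigma_finite : sigma_finite [set: mplane] leb2.
Proof.
have /sigma_finiteP[F [TF ndF Foo]] := sigma_finiteT (@lebs R).
exists (fun n => F n `*` F n).
  apply/seteqP; split => // -[x y] _; have [n _ Fx] : (\bigcup_i F i) x by rewrite -TF.
  have [m _ Fy] : (\bigcup_i F i) y by rewrite -TF.
  exists (maxn n m) => //; split => /=.
    by move: x Fx; exact/subsetPset/ndF/leq_maxl.
  by move: y Fy; exact/subsetPset/ndF/leq_maxr.
move=> k; have [mF fF] := Foo k; split; first exact: measurableX.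
rewrite [X in (X < _)%E](product_measure1E (@lebs R) (@lebs R))//.
by rewrite lte_mul_pinfty// ge0_fin_numE.
Qed.
(** Fubini on the square of the plane needs the product measure of the plane
    as a sigma-finite measure. *)
Definition lebs2 : {sigma_finite_measure set mplane -> \bar R} :=
  HB.pack_for {sigma_finite_measure set mplane -> \bar R} (leb2 : set mplane -> \bar R)
    (Measure.class leb2) (Measure_isSigmaFinite.Build _ mplane R leb2 leb2_sigma_finite).

Lemma prim2 a b z : bdm a -> bdm b ->
  \int[leb2]_(x in Om) (a x.1 * b x.2 * quadrant x z) = prim a z.1 * prim b z.2.
Proof.
move=> ba bb; rewrite OmGG.
have L : L1 leb2 (G `*` G) (fun x => a x.1 * b x.2 * quadrant x z).
  apply: (@L1_mul_bounded _ _ _ _ _ (measurableX mG mG) _ _ 1) => //.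
  - by have := L2_Omega_L1 (tensor_L2 ba bb); rewrite OmGG.
  - apply: measurable_funTS.
    exact: (measurableT_comp measurable_quadrant2 (pair2_measurable (z : mplane))).
  - by move=> x _; exact: quadrant_le1.
rewrite (fub1 (m1 := @lebs R) (m2 := @lebs R) mG mG L).2 /=.
have mb (c : R -> R) y : bdm c -> L1 leb1 G (fun t => c t * before y t).
  move=> bc; apply: (@L1_mul_bounded _ _ _ _ _ mG _ _ 1) => //; first exact: bdm_L1.
  - apply: measurable_funTS.
    exact: (measurableT_comp measurable_before (pair2_measurable (y : mR))).
  - by move=> t _; exact: before_le1.
rewrite /prim -RintegralZr//; last exact: mb.
apply: Rint_ext => s _; rewrite -RintegralZl//; last exact: mb.
by apply: Rint_ext => y _; rewrite /quadrant/=; ring.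
Qed.

Lemma cumul_pair g a b : L1 leb2 Om g -> bdm a -> bdm b ->
  \int[leb2]_(x in Om) (cumul g x * (a x.1 * b x.2)) =
  \int[leb2]_(z in Om) (g z * (prim a z.1 * prim b z.2)).
Proof.
move=> Ig ba bb.
pose F (p : mplane * mplane) := (a p.1.1 * b p.1.2) * g p.2 * quadrant p.1 p.2.
have Iab := L2_Omega_L1 (tensor_L2 ba bb).
have LF : L1 (lebs2 \x lebs2)%E (Om `*` Om) F.
  apply: (@L1_mul_bounded _ _ _ _ _ (measurableX mO mO) _ _ 1) => //.
  - exact: (@L1_tensor _ _ _ _ _ lebs2 lebs2 _ _ mO mO (fun x => a x.1 * b x.2)).
  - exact: measurable_funTS measurable_quadrant2.
  - by move=> x _; exact: quadrant_le1.
have qL x : L1 leb2 Om (fun z => g z * quadrant x z).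
  apply: (@L1_mul_bounded _ _ _ _ _ mO _ _ 1) => //; first exact: measurable_quadrant.
  by move=> z _; exact: quadrant_le1.
have [_ E1] := fub1 (m1 := lebs2) (m2 := lebs2) mO mO LF.
have [_ E2] := fub2 (m1 := lebs2) (m2 := lebs2) mO mO LF.
have := etrans (esym E1) E2; rewrite /F/= => E.
transitivity (\int[lebs2]_(x in Om) \int[lebs2]_(z in Om) (a x.1 * b x.2 * g z * quadrant x z)).
  apply: Rint_ext => x _; rewrite /cumul mulrC -(RintegralZl _ mO (qL x)).
  by apply: Rint_ext => z _; ring.
rewrite E; apply: Rint_ext => z _.
have Lz : L1 leb2 Om (fun x => a x.1 * b x.2 * quadrant x z).
  have mz : measurable_fun (Om : set mplane) (fun x => quadrant x z).
    apply: measurable_funTS.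
    exact: (measurableT_comp measurable_quadrant2 (pair2_measurable (z : mplane))).
  exact: (@L1_mul_bounded _ _ _ _ _ mO _ _ 1 Iab mz (fun x _ => quadrant_le1 x z)).
rewrite -(prim2 z ba bb) -(RintegralZl _ mO Lz).
by apply: Rint_ext => x _; ring.
Qed.

End MixedDerivative.

Section FubiniPull.
Context d1 d2 (T1 : measurableType d1) (T2 : measurableType d2) (R : realType).
Variable m1 : {sigma_finite_measure set T1 -> \bar R}.
Variable m2 : {sigma_finite_measure set T2 -> \bar R}.
Local Notation m12 := (m1 \x m2)%E.
Context (A : set T1) (B : set T2) (mA : measurable A) (mB : measurable B).

Lemma fub_pull1 (H : T1 * T2 -> R) (a : T1 -> R) M : L1 m12 (A `*` B) H ->
  measurable_fun A a -> (forall s, A s -> `|a s| <= M) ->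
  \int[m1]_(s in A) ((\int[m2]_(y in B) H (s, y)) * a s) =
  \int[m12]_(x in A `*` B) (H x * a x.1).
Proof.
move=> LH ma aM.
have LHa : L1 m12 (A `*` B) (fun x => H x * a x.1).
  apply: (@L1_mul_bounded _ _ _ _ _ (measurableX mA mB) _ _ M) => //.
    exact: measurable_fun_fstX.
  by move=> x [/aM].
have [L1f _] := fub1 mA mB LH; have [L1fa ->] := fub1 mA mB LHa.
apply: Rint_ae_eq => //; [|exact: L1_meas L1fa|].
  by apply: measurable_funM => //; exact: L1_meas L1f.
apply: aeS (fub_slice1 mA mB LH) => s h As.
by rewrite -(RintegralZr _ mB (h As)).
Qed.

Lemma fub_pull2 (H : T1 * T2 -> R) (b : T2 -> R) M : L1 m12 (A `*` B) H ->
  measurable_fun B b -> (forall y, B y -> `|b y| <= M) ->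
  \int[m2]_(y in B) ((\int[m1]_(s in A) H (s, y)) * b y) =
  \int[m12]_(x in A `*` B) (H x * b x.2).
Proof.
move=> LH mb bM.
have LHa : L1 m12 (A `*` B) (fun x => H x * b x.2).
  apply: (@L1_mul_bounded _ _ _ _ _ (measurableX mA mB) _ _ M) => //.
    exact: measurable_fun_sndX.
  by move=> x [_ /bM].
have [L1f _] := fub2 mA mB LH; have [L1fa ->] := fub2 mA mB LHa.
apply: Rint_ae_eq => //; [|exact: L1_meas L1fa|].
  by apply: measurable_funM => //; exact: L1_meas L1f.
apply: aeS (fub_slice2 mA mB LH) => y h By.
by rewrite -(RintegralZr _ mA (h By)).
Qed.

End FubiniPull.

Section MixedRepresentation.
Context {R : realType}.
Local Notation plane := (R * R)%type.
Local Notation leb1 := (@lebesgue_measure R).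
Local Notation mR := (measurableTypeR R).
Local Notation mplane := (measurableTypeR R * measurableTypeR R)%type.
Local Notation Om := (@Omega R).
Local Notation G := (`]0, 1[%classic : set R).
Local Notation mO := (@measurable_Omega R).
Local Notation mG := (measurable_oo (0 : R) 1).
Implicit Types (O : set plane) (u v g w : plane -> R) (i : 'I_2).

Definition dbump p q m (y : R) : R := partial ord_max (fun x : plane => bump p q m x.2) (0, y).

Lemma dbump_partial p q m (x : plane) :
  partial ord_max (fun x : plane => bump p q m x.2) x = dbump p q m x.2.
Proof.
case: x => s y /=.
have h1 := is_derive_slice2 s y (smooth_bump2 p q m).
have h2 := is_derive_slice2 0 y (smooth_bump2 p q m).
by rewrite /dbump -(@derive_val _ _ _ _ _ _ _ h1) -(@derive_val _ _ _ _ _ _ _ h2).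
Qed.

Lemma dbump_bdm p q m : bdm (dbump p q m).
Proof.
have cd : continuous (partial ord_max (fun x : plane => bump p q m x.2)).
  exact: smooth_cont (smooth_partial ord_max (smooth_bump2 p q m)).
split.
  apply: measurable_funTS; apply: continuous_measurable_fun.
  exact: (slice2_cont (s := 0) cd).
have [M _ hM] := compact_cont_bounded cd (compact_rect (a := 0) (b := 1) (c := 0) (d := 1)).
exists M => t; rewrite /= in_itv/= => /andP[t0 t1]; apply: hM.
by split; rewrite /= in_itv/= ?lexx ?ler01// !ltW.
Qed.

Lemma partial2_bump1 p q n (x : plane) : partial ord_max (fun x : plane => bump p q n x.1) x = 0.
Proof.
case: x => s y.
have h1 := is_derive_slice2 s y (smooth_bump1 p q n).
by rewrite -(@derive_val _ _ _ _ _ _ _ h1) /= derive_cst.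
Qed.

Lemma partial2_tensor p q n p' q' m (x : plane) :
  partial ord_max (fun x : plane => bump p q n x.1 * bump p' q' m x.2) x =
  bump p q n x.1 * dbump p' q' m x.2.
Proof.
rewrite partialM ?partial2_bump1 ?dbump_partial ?mulr0 ?addr0//.
- exact: smooth_bump1.
- exact: smooth_bump2.
Qed.

Lemma bdm_mul2 a b w f : bdm f -> `]a, b[%classic `<=` G -> L1 leb2 (rect a b 0 1) w ->
  L1 leb2 (rect a b 0 1) (fun x => w x * f x.2).
Proof.
move=> [mf [M hM]] sub Lw.
apply: (@L1_mul_bounded _ _ _ _ _ (measurable_rect a b 0 1) _ _ M) => //.
  by apply: measurable_fun_sndX => //; exact: measurable_oo.
by move=> x [_ h]; exact: hM.
Qed.

(** The weak derivative in y, tested with tensor products of bumps, holds on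
    almost every vertical line for all rational bumps in y. *)
Lemma mixed_slices a b w g (p q : rat) m : 0 <= a -> b <= 1 ->
  (0 : R) < ratr p -> ratr p < ratr q :> R -> ratr q < (1 : R) ->
  L1 leb2 (rect a b 0 1) w -> L1 leb2 (rect a b 0 1) g ->
  weak_partial (rect a b 0 1) ord_max w g ->
  \forall s \ae leb1, a < s < b ->
    \int[leb1]_(y in G) (w (s, y) * dbump (ratr p) (ratr q) m y +
       g (s, y) * bump (ratr p) (ratr q) m y) = 0.
Proof.
move=> a0 b1 p0 pq q1 Lw Lg [_ _ hw].
have sub : `]a, b[%classic `<=` G.
  by move=> t; rewrite /= !in_itv/= => /andP[h1 h2]; rewrite (le_lt_trans a0 h1) (lt_le_trans h2 b1).
pose H (x : mplane) := w x * dbump (ratr p) (ratr q) m x.2 + g x * bump (ratr p) (ratr q) m x.2.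
have mr : measurable (rect a b 0 1 : set mplane) := measurable_rect a b 0 1.
have LH : L1 leb2 (rect a b 0 1) H.
  apply: L1D => //; first by apply: bdm_mul2 => //; exact: dbump_bdm.
  by apply: bdm_mul2 => //; exact: bump_bdm.
have mab := measurable_oo a b.
apply: (@du_bois_reymond1 R (fun s => \int[leb1]_(y in G) H (s, y)) a b).
  exact: (fub1 (m1 := @lebs R) (m2 := @lebs R) mab mG LH).1.
move=> p1 q1' n ap pq1 qb.
rewrite [LHS](fub_pull1 (m1 := @lebs R) (m2 := @lebs R) (M := 1) mab mG LH); last first.
- by move=> s _; exact: bump_norm_le1.
- exact: bump_measurable.
pose phi (x : plane) := bump (ratr p1) (ratr q1') n x.1 * bump (ratr p) (ratr q) m x.2.
have tp : test_function (rect a b 0 1) phi by apply: test_bump; exact: subrect.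
have lphi := smooth_cont (test_smooth tp).
have := hw _ tp; move/eqP; rewrite -subr_eq0 opprK => /eqP E; apply: etrans E.
rewrite -RintegralD//; last 2 first.
- apply: loc_test_L1 => //; [exact: L1_loc|exact: test_partial].
- by apply: loc_test_L1 tp => //; exact: L1_loc.
by apply: Rint_ext => x _; rewrite partial2_tensor /H /phi; ring.
Qed.

Section Representation.
Variables (O : set plane) (v g : plane -> R).
Hypotheses (OO : O `<=` Om) (hv : H10 O v) (Lg : L1 leb2 Om g).
(** The mixed derivative is integrable on each half of the square only, and
    test functions do not cross the line x.1 = 1 / 2. The weak equation on
    almost every vertical line forgets that line, which is a null set, and
    holds on the whole square. *)
Hypothesis Hg : forall (p q : rat) m, (0 : R) < ratr p -> ratr p < ratr q :> R -> ratr q < (1 : R) ->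
  \forall s \ae leb1, G s ->
    \int[leb1]_(y in G) (gD ord0 v (s, y) * dbump (ratr p) (ratr q) m y +
       g (s, y) * bump (ratr p) (ratr q) m y) = 0.

Let LD i : L1 leb2 Om (gD i v). Proof. exact: L2_Omega_L1 (H10_wD_L2 i hv). Qed.

Let Lmul w a b : L1 leb2 Om w -> bdm a -> bdm b -> L1 leb2 Om (fun x => w x * (a x.1 * b x.2)).
Proof.
move=> Lw [ma [M hM]] [mb [N hN]].
have aG x : Om x -> `|a x.1 * b x.2| <= M * N.
  by rewrite OmGG => -[h1 h2]; rewrite normrM ler_pM//; [exact: hM|exact: hN].
apply: (@L1_mul_bounded _ _ _ _ _ mO _ _ (M * N)) => //.
rewrite OmGG; apply: measurable_funM; first exact: measurable_fun_fstX.
exact: measurable_fun_sndX.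
Qed.

Let bdm1 : bdm (fun=> 1 : R).
Proof. by split => //; exists 1 => t _; rewrite normr1. Qed.

(** Write v as the primitive in x.1 of its first derivative, and then use the
    equation for that derivative on almost every vertical line. *)
Lemma mixed_bump (p q p' q' : rat) n m : (0 : R) < ratr p -> ratr p < ratr q :> R -> ratr q < (1 : R) ->
  (0 : R) < ratr p' -> ratr p' < ratr q' :> R -> ratr q' < (1 : R) ->
  \int[leb2]_(x in Om) (gD ord_max v x * (bump (ratr p) (ratr q) n x.1 * bump (ratr p') (ratr q') m x.2)) =
  \int[leb2]_(x in Om) (g x * (prim (bump (ratr p) (ratr q) n) x.1 * bump (ratr p') (ratr q') m x.2)).
Proof.
move=> p0 pq q1 p0' pq' q1'.
pose phi (x : plane) := bump (ratr p) (ratr q) n x.1 * bump (ratr p') (ratr q') m x.2.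
have tp : test_function Om phi by rewrite OmegaE; apply: test_bump; exact: subrect.
have ba := bump_bdm (ratr p : R) (ratr q) n; have bb := bump_bdm (ratr p' : R) (ratr q') m.
have bdb := dbump_bdm (ratr p' : R) (ratr q') m; have bp := prim_bdm ba.
have [_ _ /(_ _ tp)] := H10_weak ord_max OO hv.
have -> : \int[leb2]_(x in Om) (v x * partial ord_max phi x) =
  ip leb2 Om v (fun x => bump (ratr p) (ratr q) n x.1 * dbump (ratr p') (ratr q') m x.2).
  by rewrite ipE; apply: Rint_ext => x _; rewrite partial2_tensor.
rewrite (H10_prim1 OO hv ba bdb) ipE => E.
apply/eqP; rewrite -subr_eq0 -[X in X - _]opprK -E -opprD oppr_eq0; apply/eqP.
rewrite -RintegralD//; [|exact: Lmul|exact: Lmul].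
pose H (x : mplane) := gD ord0 v x * dbump (ratr p') (ratr q') m x.2 + g x * bump (ratr p') (ratr q') m x.2.
have LH : L1 leb2 (G `*` G) H.
  rewrite -OmGG; apply: L1D => //.
    by apply: L1_eq (Lmul (LD ord0) bdm1 bdb) => // x _; rewrite mul1r.
  by apply: L1_eq (Lmul Lg bdm1 bb) => // x _; rewrite mul1r.
have [mp [M hM]] := bp.
have := fub_pull1 (m1 := @lebs R) (m2 := @lebs R) mG mG LH mp hM.
rewrite -OmGG => e; transitivity (\int[leb2]_(x in Om) (H x * prim (bump (ratr p) (ratr q) n) x.1)).
  by apply: Rint_ext => x _; rewrite /H; ring.
rewrite -[LHS]e; apply: Rint_ae0 => //.
  apply: measurable_funM => //.
  exact: L1_meas (fub1 (m1 := @lebs R) (m2 := @lebs R) mG mG LH).1.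
by apply: aeS (Hg m p0' pq' q1') => s h Gs; rewrite /H/= h// mul0r.
Qed.

(** Both sides are integrals in y of an L^1 function against b, and these
    agree when b is a bump. *)
Lemma mixed_prim (p q : rat) n b : (0 : R) < ratr p -> ratr p < ratr q :> R -> ratr q < (1 : R) ->
  bdm b ->
  \int[leb2]_(x in Om) (gD ord_max v x * (bump (ratr p) (ratr q) n x.1 * b x.2)) =
  \int[leb2]_(x in Om) (g x * (prim (bump (ratr p) (ratr q) n) x.1 * b x.2)).
Proof.
move=> p0 pq q1 bb.
have ba := bump_bdm (ratr p : R) (ratr q) n; have bp := prim_bdm ba.
pose H (x : mplane) := gD ord_max v x * bump (ratr p) (ratr q) n x.1 - g x * prim (bump (ratr p) (ratr q) n) x.1.
have LH : L1 leb2 (G `*` G) H.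
  rewrite -OmGG; apply: L1B => //.
    by apply: L1_eq (Lmul (LD ord_max) ba bdm1) => // x _; rewrite mulr1.
  by apply: L1_eq (Lmul Lg bp bdm1) => // x _; rewrite mulr1.
have pull f : bdm f -> \int[leb1]_(y in G) ((\int[leb1]_(s in G) H (s, y)) * f y) =
  \int[leb2]_(x in Om) (gD ord_max v x * (bump (ratr p) (ratr q) n x.1 * f x.2)) -
  \int[leb2]_(x in Om) (g x * (prim (bump (ratr p) (ratr q) n) x.1 * f x.2)).
  move=> bf; have [mf [M hM]] := bf.
  rewrite [LHS](fub_pull2 (m1 := @lebs R) (m2 := @lebs R) mG mG LH mf hM) -OmGG.
  rewrite -RintegralB//; [|exact: Lmul|exact: Lmul].
  by apply: Rint_ext => x _; rewrite /H; ring.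
have Lk := (fub2 (m1 := @lebs R) (m2 := @lebs R) mG mG LH).1.
have k0 : \forall y \ae leb1, 0 < y < 1 -> \int[leb1]_(s in G) H (s, y) = 0.
  apply: du_bois_reymond1 => // p' q' m p0' pq' q1'.
  by rewrite pull; [rewrite mixed_bump// subrr|exact: bump_bdm].
apply/eqP; rewrite -subr_eq0 -pull//; apply/eqP; apply: Rint_ae0 => //.
  by apply: measurable_funM; [exact: L1_meas Lk|exact: bb.1].
by apply: aeS k0 => y h; rewrite /= in_itv/= => Gy; rewrite h// mul0r.
Qed.

Lemma cumul_L1 : L1 leb2 Om (cumul g).
Proof. by rewrite OmegaE; apply: cont_L1_rect; exact: cumul_cont. Qed.

(** In the pairing with a tensor product, v is first the primitive in x.2 of
    its second derivative, which is then the primitive in x.1 of g. *)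
Lemma repr_ae : \forall x \ae leb2, Om x -> v x = cumul g x.
Proof.
have Lv := L2_Omega_L1 (H10_L2 hv).
suff : \forall x \ae leb2, Om x -> v x - cumul g x = 0.
  by apply: aeS => x h Ox; apply/eqP; rewrite -subr_eq0 h.
rewrite OmegaE; apply: du_bois_reymond2.
  by have := L1B mO Lv cumul_L1; rewrite {1}OmegaE.
move=> p q p' q' n m p0 pq q1 p0' pq' q1'.
have ba := bump_bdm (ratr p : R) (ratr q) n; have bb := bump_bdm (ratr p' : R) (ratr q') m.
have := mixed_prim n p0 pq q1 (prim_bdm bb).
have := H10_prim2 OO hv ba bb; rewrite !ipE => E1 E2.
have := etrans E1 E2; rewrite -cumul_pair// => /eqP; rewrite -subr_eq0 -RintegralB//.
- by move=> /eqP E; rewrite OmegaE in E; apply: etrans E; apply: Rint_ext => x _; ring.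
- exact: Lmul.
- by apply: Lmul => //; exact: cumul_L1.
Qed.

(** The derivative of the trace along the line, so that the trace is
    absolutely continuous. *)
Definition flux (y : R) : R := \int[leb1]_(s in `]0, half[%classic) g (s, y).

Let mh : measurable (`]0, half[%classic : set mR). Proof. exact: measurable_oo. Qed.
Let subh : `]0, half[%classic `*` G `<=` Om := half_sub (ltW (@half_lt1 R)).
Let mhG : measurable (`]0, half[%classic `*` G : set mplane) := measurableX mh mG.
Let Lgh : L1 leb2 (`]0, half[%classic `*` G) g := integrableS mO mhG subh Lg.

Lemma flux_L1 : L1 leb1 G flux.
Proof. exact: (fub2 (m1 := @lebs R) (m2 := @lebs R) mh mG Lgh).1. Qed.

Let mb_y (y : R) : measurable_fun (G : set mR) (fun s => before s y).
Proof.
apply: measurable_funTS.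
exact: (measurableT_comp measurable_before (pair1_measurable (y : mR))).
Qed.

Lemma G_half : G half.
Proof. by rewrite /= in_itv/= half_gt0 half_lt1. Qed.

Lemma cumul_half y : cumul g (half, y) = \int[leb1]_(s in G) (flux s * before s y).
Proof.
pose H (z : mplane) := g z * before z.1 half.
have LH : L1 leb2 (G `*` G) H.
  apply: (@L1_mul_bounded _ _ _ _ _ (measurableX mG mG) _ _ 1).
  - by rewrite -OmGG.
  - have mbh : measurable_fun (G : set mR) (fun s => before s half) by exact: mb_y.

    exact: (measurable_fun_fstX mG mbh).
  - by move=> x _; exact: before_le1.
have := fub_pull2 (m1 := @lebs R) (m2 := @lebs R) mG mG LH (mb_y y) (fun s _ => before_le1 s y).
rewrite -OmGG => E; rewrite /cumul.
transitivity (\int[leb2]_(z in Om) (H z * before z.2 y)).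
  by apply: Rint_ext => z _; rewrite /H /quadrant/= mulrA.
rewrite -[LHS]E; apply: Rint_ext => s _; congr (_ * _).
by rewrite /H/= before_itv//; exact: G_half.
Qed.

(** The continuous version restricted to the line is the trace: this is not
    automatic, as the line is a null set. The pairing of the first
    derivative with a bump b in y agrees for almost every abscissa with the
    pairing of g with the primitive of b, and the integrals up to t of both
    are continuous in t; so they agree at t = 1 / 2. *)
Lemma trace_repr_ae : \forall y \ae leb1, G y -> trG v y = cumul g (half, y).
Proof.
have Lt : L1 leb1 G (trace_fun v).
  exact: (fub2 (m1 := @lebs R) (m2 := @lebs R) mh mG (integrableS mO mhG subh (LD ord0))).1.
have LC : L1 leb1 G (fun y => cumul g (half, y)).
  by apply: cont_L1; apply: slice2_cont; exact: cumul_cont.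
suff : \forall y \ae leb1, 0 < y < 1 -> trace_fun v y - cumul g (half, y) = 0.
  move=> h; apply: aeS (aeI h (trG_ae OO hv)) => y [e1 e2] Gy; rewrite e2//.
  by apply/eqP; rewrite -subr_eq0 e1.
apply: du_bois_reymond1; first exact: L1B.
move=> p q m p0 pq q1.
pose b := bump (ratr p : R) (ratr q) m.
have bb : bdm b by exact: bump_bdm.
have bp := prim_bdm bb.
pose H (x : mplane) := gD ord0 v x * b x.2 - g x * prim b x.2.
have LHO : L1 leb2 Om H.
  apply: L1B => //.
    by apply: L1_eq (Lmul (LD ord0) bdm1 bb) => // x _; rewrite mul1r.
  by apply: L1_eq (Lmul Lg bdm1 bp) => // x _; rewrite mul1r.
have LH : L1 leb2 (G `*` G) H by rewrite -OmGG.
pose f s := \int[leb1]_(y in G) H (s, y).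
have Lf : L1 leb1 G f := (fub1 (m1 := @lebs R) (m2 := @lebs R) mG mG LH).1.
pose W t := \int[leb1]_(s in G) (f s * before s t).
have Wc t : W x @[x --> t] --> W t.
  apply: (param_cont mG Lf mb_y (fun t s => before_le1 s t)).
  by apply: aeS (ae_neq t) => z; exact: before_cvg.
have W0 : \forall t \ae leb1, 0 < t < 1 -> W t = 0.
  apply: du_bois_reymond1.
    apply: (@cont_L1 R W 0 1) => t; exact: Wc.
  move=> p' q' n p0' pq' q1'.
  pose a := bump (ratr p' : R) (ratr q') n.
  have ba : bdm a by exact: bump_bdm.
  have := swap_before Lf ba; rewrite -/W => e.
  transitivity (\int[leb1]_(t in G) (a t * W t)); first by apply: Rint_ext => t _; rewrite mulrC.
  rewrite [LHS]e; have [mp [M hM]] := prim_bdm ba.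
  rewrite [LHS](fub_pull1 (m1 := @lebs R) (m2 := @lebs R) mG mG LH mp hM) -OmGG.
  have := H10_prim1 OO hv ba bb; have := H10_prim2 OO hv ba bb; rewrite !ipE => E2 E1.
  have E3 := mixed_prim n p0' pq' q1' bp.
  have := etrans (esym E1) (etrans E2 E3) => /eqP.
  rewrite -subr_eq0 -(RintegralB mO (Lmul (LD ord0) (prim_bdm ba) bb) (Lmul Lg (prim_bdm ba) bp)).
  by move/eqP => E4; apply: etrans E4; apply: Rint_ext => x _; rewrite /H; ring.
have Wh : W half = 0.
  apply: (cont_ae_eq (Wc half) (@half_gt0 R)); apply: aeS W0 => t h.
  by rewrite subrr (_ : half + half = 1); [exact: h|rewrite /half; field].
have {}Wh : \int[leb1]_(s in `]0, half[%classic) f s = 0 by rewrite -(before_itv f G_half).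
have LHh : L1 leb2 (`]0, half[%classic `*` G) H := integrableS mO mhG subh LHO.
have [_ E1] := fub1 (m1 := @lebs R) (m2 := @lebs R) mh mG LHh.
have E := etrans E1 Wh.
have Lth : L1 leb2 (`]0, half[%classic `*` G) (gD ord0 v) := integrableS mO mhG subh (LD ord0).
have [mb [M hM]] := bb; have [mbp [N hN]] := bp.
have P1 := fub_pull2 (m1 := @lebs R) (m2 := @lebs R) mh mG Lth mb hM.
have P2 := fub_pull2 (m1 := @lebs R) (m2 := @lebs R) mh mG Lgh mbp hN.
have L1h : L1 leb2 (`]0, half[%classic `*` G) (fun x => gD ord0 v x * b x.2).
  apply: (@L1_mul_bounded _ _ _ _ _ mhG _ _ M) => //; first exact: measurable_fun_sndX.
  by move=> x [_ /hM].
have L2h : L1 leb2 (`]0, half[%classic `*` G) (fun x => g x * prim b x.2).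
  apply: (@L1_mul_bounded _ _ _ _ _ mhG _ _ N) => //; first exact: measurable_fun_sndX.
  by move=> x [_ /hN].
have E4 : \int[leb1]_(y in G) (trace_fun v y * b y) = \int[leb1]_(y in G) (flux y * prim b y).
  apply/eqP; rewrite -subr_eq0; apply/eqP; rewrite [X in X - _]P1 [X in _ - X]P2.
  by rewrite -RintegralB//; exact: E.
have S := swap_before flux_L1 bb.
transitivity (\int[leb1]_(y in G) (trace_fun v y * b y) - \int[leb1]_(y in G) (cumul g (half, y) * b y)).
  have Lb h : L1 leb1 G h -> L1 leb1 G (fun y => h y * b y).
    by move=> Lh; exact: (@L1_mul_bounded _ _ _ _ _ mG _ _ M Lh mb hM).
  rewrite -(RintegralB mG (Lb _ Lt) (Lb _ LC)).
  by apply: Rint_ext => y _; rewrite mulrBl.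
rewrite E4 -S; apply/eqP; rewrite subr_eq0; apply/eqP; apply: Rint_ext => y _.
by rewrite cumul_half mulrC.
Qed.

End Representation.
End MixedRepresentation.

Section MixedExists.
Context {R : realType}.
Local Notation plane := (R * R)%type.
Local Notation leb1 := (@lebesgue_measure R).
Local Notation mR := (measurableTypeR R).
Local Notation mplane := (measurableTypeR R * measurableTypeR R)%type.
Local Notation Om := (@Omega R).
Local Notation G := (`]0, 1[%classic : set R).
Local Notation mO := (@measurable_Omega R).
Local Notation mG := (measurable_oo (0 : R) 1).
Implicit Types (O : set plane) (u v g w : plane -> R) (i : 'I_2).

Lemma OmegaLE : @OmegaL R = rect 0 half 0 1.
Proof.
apply/seteqP; split => x.
  by move=> [[/andP[x1 _] x2] /= h]; apply/rectP; rewrite x1.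
move=> /rectP[/andP[h1 h2] h3]; split => //; split => //.
by rewrite h1 (lt_trans h2 half_lt1).
Qed.

Lemma OmegaRE : @OmegaR R = rect half 1 0 1.
Proof.
apply/seteqP; split => x.
  by move=> [[/andP[_ x1] x2] /= h]; apply/rectP; rewrite x1 andbT.
move=> /rectP[/andP[h1 h2] h3]; split => //; split => //.
by rewrite h2 (lt_trans half_gt0 h1).
Qed.

Lemma weak_partial_ae (O : set plane) i v v' w : measurable (O : set mplane) -> L1 leb2 O v' ->
  (\forall x \ae leb2, O x -> v x = v' x) -> weak_partial O i v w -> weak_partial O i v' w.
Proof.
move=> mo Lv' E [lv lw h]; split => //; first exact: L1_loc.
move=> phi tp; rewrite -h//; have tp' := test_partial i tp.
apply: Rint_ae_eq => //.
- exact: L1_meas (loc_test_L1 mo (L1_loc mo Lv') tp').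
- exact: L1_meas (loc_test_L1 mo lv tp').
- by apply: aeS E => x e Ox; rewrite e.
Qed.

Lemma wD_spec (O : set plane) i v : has_weak_partial O i v -> weak_partial O i v (wD O i v).
Proof. by case=> w h; exact: (getI h). Qed.

Lemma mixed_half a b O v : O `<=` Om -> H10 O v -> 0 <= a -> b <= 1 ->
  inWkp 2 1 (rect a b 0 1) v ->
  exists2 g, L1 leb2 (rect a b 0 1) g & weak_partial (rect a b 0 1) ord_max (gD ord0 v) g.
Proof.
move=> OO hv a0 b1 [_ /(_ ord0)[hw [_ /(_ ord_max)[hg [Lg _]]]]].
have mr : measurable (rect a b 0 1 : set mplane) := measurable_rect a b 0 1.
have sub : rect a b 0 1 `<=` Om.
  by move=> x /rectP[/andP[x1 x2] x3]; rewrite OmegaE; apply/rectP; rewrite (le_lt_trans a0 x1) (lt_le_trans x2 b1).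
exists (wD (rect a b 0 1) ord_max (wD (rect a b 0 1) ord0 v)).
  by apply/inLp1P.
apply: (weak_partial_ae mr (v := wD (rect a b 0 1) ord0 v)).
- exact: integrableS mO mr sub (L2_Omega_L1 (H10_wD_L2 ord0 hv)).
- apply: (weak_partial_unique (i := ord0) (v := v)).
    exact: wD_spec.
  exact: (weak_partial_sub mO sub (H10_weak ord0 OO hv)).
- exact: wD_spec.
Qed.

(** The two halves glue: no jump term appears, since only almost every
    vertical line is considered. *)
Lemma mixed_derivative O v : O `<=` Om -> H10 O v ->
  inWkp 2 1 (@OmegaL R) v -> inWkp 2 1 (@OmegaR R) v ->
  exists2 g, L1 leb2 Om g &
    forall (p q : rat) m, (0 : R) < ratr p -> ratr p < ratr q :> R -> ratr q < (1 : R) ->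
      \forall s \ae leb1, G s ->
      \int[leb1]_(y in G) (gD ord0 v (s, y) * dbump (ratr p) (ratr q) m y +
       g (s, y) * bump (ratr p) (ratr q) m y) = 0.
Proof.
move=> OO hv; rewrite OmegaLE OmegaRE => WL WR.
have [gL LL hL] := mixed_half OO hv (lexx 0) (ltW half_lt1) WL.
have [gR LR hR] := mixed_half OO hv (ltW half_gt0) (lexx 1) WR.
have ml : measurable (rect 0 half 0 1 : set mplane) := measurable_rect 0 half 0 1.
have mr : measurable (rect half 1 0 1 : set mplane) := measurable_rect half 1 0 1.
have subL : rect 0 half 0 1 `<=` Om.
  by move=> x /rectP[/andP[x1 x2] x3]; rewrite OmegaE; apply/rectP; rewrite x1 (lt_trans x2 half_lt1).
have subR : rect half 1 0 1 `<=` Om.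
  by move=> x /rectP[/andP[x1 x2] x3]; rewrite OmegaE; apply/rectP; rewrite x2 (lt_trans half_gt0 x1).
have ext (f : plane -> R) (D : set mplane) : measurable D -> D `<=` Om -> L1 leb2 D f -> L1 leb2 Om (f \_ D).
  move=> mD DO Lf; rewrite /L1 -restrict_EFin; apply: (integrable_restrict leb2 mD mO (EFin \o f)).1.
  by rewrite setIC (setIidl DO).
exists (fun x => (gL \_ (rect 0 half 0 1)) x + (gR \_ (rect half 1 0 1)) x).
  by apply: L1D => //; exact: ext.
move=> p q m p0 pq q1.
have LDr (D : set mplane) : measurable D -> D `<=` Om -> L1 leb2 D (gD ord0 v).
  by move=> mD DO; exact: integrableS mO mD DO (L2_Omega_L1 (H10_wD_L2 ord0 hv)).
have SL := mixed_slices m (lexx 0) (ltW half_lt1) p0 pq q1 (LDr _ ml subL) LL hL.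
have SR := mixed_slices m (ltW half_gt0) (lexx 1) p0 pq q1 (LDr _ mr subR) LR hR.
apply: aeS (aeI (ae_neq half) (aeI SL SR)) => s [sh [h1 h2]].
rewrite /= in_itv/= => /andP[s0 s1].
have in_r c d y : G y -> ((s, y) \in rect c d 0 1) = (c < s < d).
  rewrite /= in_itv/= => Gy; apply/idP/idP; first by rewrite inE => /rectP[].
  by move=> h; rewrite inE; apply/rectP.
have [lt|gt|/sh//] := ltgtP s half.
- rewrite -[RHS]h1 ?s0//; apply: Rint_ext => y Gy.
  by rewrite !patchE !in_r// s0 lt (ltNge half) (ltW lt)/= addr0.
- rewrite -[RHS]h2 ?gt//; apply: Rint_ext => y Gy.
  by rewrite !patchE !in_r// s0 s1 gt (ltNge s) (ltW gt)/= add0r.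
Qed.

End MixedExists.

(** * Functions of H^1_0 that vanish on a set *)
Section LipschitzComposition.
Context d (T : measurableType d) (R : realType) (mu : {measure set T -> \bar R}).
Context (D : set T) (mD : measurable D).
Implicit Types (a b : T -> R) (f : R -> R).

Lemma sqdist_bmul (h : T -> R) (M : R) a b : measurable_fun D h -> (forall x, D x -> `|h x| <= M) ->
  L2 mu D a -> L2 mu D b ->
  sqdist mu D (fun x => h x * a x) (fun x => h x * b x) <= M ^+ 2 * sqdist mu D a b.
Proof.
move=> mh hM La Lb; have Lab := L2B mD La Lb.
rewrite !sqdistE -(RintegralZl _ mD Lab.2).
apply: le_Rintegral => //.
- have [_] := L2_bounded_mul mD mh hM Lab.
  by apply: L1_eq => // x _; congr (_ ^+ 2); rewrite mulrBr.
- exact: L1Zl Lab.2.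
- move=> x Dx; rewrite -mulrBr exprMn ler_wpM2r ?sqr_ge0//.
  by rewrite -[leLHS]real_normK ?num_real// lerXn2r ?nnegrE ?hM// (le_trans _ (hM x Dx)).
Qed.

(** The square of b is integrable, so its integral over the set where b
    exceeds N is small for N large. *)
Lemma L2_tail b (e : R) : L2 mu D b -> 0 < e -> exists2 N : R, 0 < N &
  forall h : T -> R, measurable_fun D h -> (forall x, D x -> `|h x| <= (N < `|b x|)%R%:R) ->
  L2 mu D (fun x => h x * b x) /\ \int[mu]_(x in D) ((h x * b x) ^+ 2) < e.
Proof.
move=> [mb Lb] e0.
pose g n (x : T) := ((n.+1%:R < `|b x|)%R%:R * b x) ^+ 2.
have mg n : measurable_fun D (g n).
  apply: measurable_funX; apply: measurable_funM => //.
  apply: (measurableT_comp (f := fun t : bool => t%:R : R)) => //.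
  by apply: measurable_fun_ltr => //; exact: measurableT_comp.
have ind1 (c : bool) : c%:R ^+ 2 <= 1 :> R by case: c; rewrite ?expr1n// expr0n.
have [_ cg] : L1 mu D (fun=> 0 : R) /\ \int[mu]_(x in D) g n x @[n --> \oo] --> \int[mu]_(x in D) (0 : R).
  apply: (Rdominated mD mg _ Lb); first exact: measurable_cst.
  - apply: aeT => x _; apply: cvg_near_cst.
    have hn := ltW (archi_boundP (normr_ge0 (b x))); set n := Num.bound _ in hn.
    near=> m; rewrite /g ltNge (_ : `|b x| <= _)//= ?mul0r ?expr0n//.
    rewrite (le_trans hn)// ler_nat; apply: leqW; near: m; exact: nbhs_infty_ge.
  - by apply: aeT => x n _; rewrite /g ger0_norm ?sqr_ge0// exprMn ler_piMl ?sqr_ge0.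
rewrite Rintegral_cst ?mul0r// in cg.
have [n _ /(_ n (leqnn n)) hn] := cvgr_lt _ cg _ e0.
exists n.+1%:R => // h mh hb.
have le x : D x -> (h x * b x) ^+ 2 <= g n x.
  move=> Dx; rewrite /g !exprMn ler_wpM2r ?sqr_ge0//.
  by rewrite -[leLHS]real_normK ?num_real// lerXn2r ?nnegrE ?hb.
have Lh : L2 mu D (fun x => h x * b x).
  split; first exact: measurable_funM.
  apply: (L1_le mD _ Lb); first by apply: measurable_funX; exact: measurable_funM.
  move=> x Dx; rewrite ger0_norm ?sqr_ge0// (le_trans (le x Dx))// /g exprMn.
  by rewrite ler_piMl ?sqr_ge0.
split=> //; apply: le_lt_trans hn; apply: le_Rintegral => //; first exact: Lh.2.
apply: (L1_le mD _ Lb) => // x _.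
by rewrite /g ger0_norm ?sqr_ge0// exprMn ler_piMl ?sqr_ge0.
Unshelve. all: by end_near. Qed.

(** A product with a bounded Lipschitz function of a convergent sequence
    converges in L^2 although the second factor is unbounded: where the limit
    b is large, the tail of b is used and f is only bounded; elsewhere the
    Lipschitz bound is used. *)
Lemma lip_mul_cvg f (L M : R) (a_ b_ : nat -> T -> R) a b :
  continuous f -> (forall s, `|f s| <= M) -> (forall s t, `|f s - f t| <= L * `|s - t|) ->
  (forall n, L2 mu D (a_ n)) -> L2 mu D a -> (forall n, L2 mu D (b_ n)) -> L2 mu D b ->
  sqdist mu D (a_ n) a @[n --> \oo] --> 0 -> sqdist mu D (b_ n) b @[n --> \oo] --> 0 ->
  sqdist mu D (fun x => f (a_ n x) * b_ n x) (fun x => f (a x) * b x) @[n --> \oo] --> 0.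
Proof.
move=> cf fM fL La_ La Lb_ Lb ca cb.
have mf a' : L2 mu D a' -> measurable_fun D (fun x => f (a' x)).
  by move=> [ma _]; apply: measurableT_comp ma; exact: continuous_measurable_fun.
have M0 : 0 <= M := le_trans (normr_ge0 _) (fM 0).
have L0 : 0 <= L.
  by have := le_trans (normr_ge0 _) (fL 1 0); rewrite subr0 normr1 mulr1.
have Lfb a' b' : L2 mu D a' -> L2 mu D b' -> L2 mu D (fun x => f (a' x) * b' x).
  by move=> h h'; apply: (L2_bounded_mul (M := M) mD (mf _ h)).
apply/cvgrPdist_lt => e e0.
have e'0 : 0 < e / 8 / (4 * M ^+ 2 + 1).
  by rewrite !divr_gt0// ltr_pwDr// mulr_ge0// sqr_ge0.
have [N N0 tail] := L2_tail Lb e'0.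
have ca' : \forall n \near \oo, L ^+ 2 * N ^+ 2 * sqdist mu D (a_ n) a < e / 8.
  apply: (cvgr_lt (L ^+ 2 * N ^+ 2 * 0)); last by rewrite mulr0 divr_gt0.
  exact: cvgMr.
have cb' : \forall n \near \oo, M ^+ 2 * sqdist mu D (b_ n) b < e / 8.
  apply: (cvgr_lt (M ^+ 2 * 0)); last by rewrite mulr0 divr_gt0.
  exact: cvgMr.
near=> n; rewrite sub0r normrN ger0_norm ?sqdist_ge0//.
have T1 := sqdist_triangle mD (Lfb _ _ (La_ n) (Lb_ n)) (Lfb _ _ (La_ n) Lb) (Lfb _ _ La Lb).
have T2 := sqdist_bmul (mf _ (La_ n)) (fun x _ => fM (a_ n x)) (Lb_ n) Lb.
pose I x : R := (N < `|b x|)%R%:R.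
have mI : measurable_fun D I.
  apply: (measurableT_comp (f := fun t : bool => t%:R : R)) => //.
  by apply: measurable_fun_ltr => //; apply: measurableT_comp => //; exact: Lb.1.
have [LI hI] := tail I mI (fun x _ => ltac:(by rewrite /I ger0_norm)).
have Laa := L2B mD (La_ n) La.
have T3 : sqdist mu D (fun x => f (a_ n x) * b x) (fun x => f (a x) * b x) <=
  L ^+ 2 * N ^+ 2 * sqdist mu D (a_ n) a + 4 * M ^+ 2 * \int[mu]_(x in D) ((I x * b x) ^+ 2).
  rewrite !sqdistE -(RintegralZl _ mD Laa.2) -(RintegralZl _ mD LI.2) -RintegralD//;
    [|exact: L1Zl Laa.2|exact: L1Zl LI.2].
  apply: le_Rintegral => //.
  - exact: (L2B mD (Lfb _ _ (La_ n) Lb) (Lfb _ _ La Lb)).2.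
  - exact: (L1D mD (L1Zl mD _ Laa.2) (L1Zl mD _ LI.2)).
  move=> x _; rewrite -mulrBl exprMn /I.
  have [bN|bN] := ltP N `|b x|.
    rewrite mul1r -[leLHS]add0r lerD//.
      by apply: mulr_ge0; [apply: mulr_ge0|]; exact: sqr_ge0.
    rewrite ler_wpM2r ?sqr_ge0// -[leLHS]real_normK ?num_real//.
    have -> : 4 * M ^+ 2 = (M + M) ^+ 2 by ring.
    rewrite lerXn2r ?nnegrE ?addr_ge0//.
    by rewrite (le_trans (ler_normB _ _))// lerD.
  rewrite mul0r expr0n/= mulr0 addr0 [leRHS]mulrAC; apply: ler_pM; rewrite ?sqr_ge0//.
    rewrite -exprMn -[leLHS]real_normK ?num_real// -[leRHS]real_normK ?num_real//.
    by rewrite lerXn2r ?nnegrE// [leRHS]normrM (ger0_norm L0).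
  by rewrite -[leLHS]real_normK ?num_real// lerXn2r ?nnegrE// ltW.
have h1 : L ^+ 2 * N ^+ 2 * sqdist mu D (a_ n) a < e / 8 by near: n.
have h2 : M ^+ 2 * sqdist mu D (b_ n) b < e / 8 by near: n.
have h3 : 4 * M ^+ 2 * \int[mu]_(x in D) ((I x * b x) ^+ 2) <= e / 8.
  have p : 0 < 4 * M ^+ 2 + 1 by rewrite ltr_pwDr// mulr_ge0// sqr_ge0.
  have i0 : 0 <= \int[mu]_(x in D) ((I x * b x) ^+ 2) by apply: Rintegral_ge0 => x _; exact: sqr_ge0.
  move: hI; rewrite ltr_pdivlMr//; move: i0; set J := Rintegral _ _ _ => i0 hI.
  by apply: le_trans (ltW hI); rewrite mulrC ler_wpM2l// lerDl.
move: T1 T2 T3 h1 h2 h3; set a1 := sqdist _ _ _ _; set a2 := sqdist _ _ _ _; set a3 := sqdist _ _ _ _.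
set a4 := _ * sqdist _ _ _ _; set a5 := L ^+ 2 * _ * _; set a6 := 4 * _ * _.
move=> *; lra.
Unshelve. all: by end_near. Qed.

End LipschitzComposition.

Section Cutoffs.
Context {R : realType}.
Local Notation plane := (R * R)%type.
Local Notation leb1 := (@lebesgue_measure R).
Local Notation mplane := (measurableTypeR R * measurableTypeR R)%type.
Local Notation Om := (@Omega R).
Local Notation mO := (@measurable_Omega R).
Implicit Types (O : set plane) (u v : plane -> R) (i : 'I_2).

Lemma partial_near_eq i u v x : (\near x, u x = v x) -> partial i u x = partial i v x.
Proof. exact: near_eq_derive. Qed.

Lemma partial_near_cst i v x (c : R) : (\near x, v x = c) -> partial i v x = 0.
Proof. by move=> h; rewrite (partial_near_eq i (v := fun=> c)) ?partial_cst. Qed.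

Lemma lip_of_smooth (w : plane -> R) : smooth w -> (forall s, 2 < `|s| -> w (s, 0) = 1) ->
  exists L M : R, (forall s, `|w (s, 0)| <= M) /\
    forall s t, `|w (s, 0) - w (t, 0)| <= L * `|s - t|.
Proof.
move=> sw w1; have cw := smooth_cont sw.
have cp := smooth_cont (smooth_partial ord0 sw).
have K := @compact_rect R (-3) 3 0 0.
have [M M0 hM] := compact_cont_bounded cw K; have [L L0 hL] := compact_cont_bounded cp K.
pose c (s : R) : R := Num.max (-3) (Num.min s 3).
have c3 s : -3 <= c s <= 3.
  rewrite /c le_max lexx/= ge_max ge_min lexx orbT andbT; lra.
have wc s : w (s, 0) = w (c s, 0).
  rewrite /c; have [s3|s3] := leP s 3; last first.
    rewrite max_r; last by lra.
    by rewrite !w1// ger0_norm; lra.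
  have [s4|s4] := leP (-3) s; first by [].
  by rewrite !w1// ltr0_norm; lra.
have cc s t : `|c s - c t| <= `|s - t|.
  rewrite /c; have h1 := ler_norm (s - t); have h2 := ler_norm (- (s - t)); rewrite normrN in h2.
  have cE (x : R) : [\/ Num.max (-3) (Num.min x 3) = -3 /\ x <= -3, Num.max (-3) (Num.min x 3) = 3 /\ 3 <= x |
      Num.max (-3) (Num.min x 3) = x /\ (-3 <= x /\ x <= 3)].
    have [x3|x3] := leP x 3; last by constructor 2; split; [apply: max_r; lra|exact: ltW].
    have [x4|x4] := leP (-3) x; first by constructor 3.
    by constructor 1; split => //; exact: ltW.
  by rewrite ler_norml; case: (cE s) => [[-> ?]|[-> ?]|[-> [? ?]]]; case: (cE t) => [[-> ?]|[-> ?]|[-> [? ?]]]; apply/andP; split; lra.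
have inK (s : R) : -3 <= s <= 3 -> (`[-3, 3]%classic `*` `[0, 0]%classic : set plane) (s, 0).
  by move=> h; split; rewrite /= in_itv/= ?lexx.
exists L, M; split; first by move=> s; rewrite wc; apply: hM; exact: inK.
have key (s t : R) : -3 <= s -> s <= t -> t <= 3 -> `|w (t, 0) - w (s, 0)| <= L * (t - s).
  move=> s3 st t3; have cpd := slice1_cont (y := 0) cp.
  rewrite -(FTC_oo st (fun s => is_derive_slice1 s 0 sw) cpd).
  apply: le_trans (le_normr_Rintegral (measurable_oo s t) _) _; first exact: cont_L1.
  rewrite -Rint_cst_oo//; apply: le_Rintegral => //.
  - by apply: L1_abs; exact: cont_L1.
  - exact: cst_L1.
  move=> x; rewrite /= in_itv/= => /andP[x1 x2]; apply: hL; apply: inK; lra.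
move=> s t; rewrite (wc s) (wc t); have /andP[s1 s2] := c3 s; have /andP[t1 t2] := c3 t.
apply: (@le_trans _ _ (L * `|c s - c t|)); last by rewrite ler_wpM2l ?cc// ltW.
have [st|st] := leP (c s) (c t).
  by rewrite distrC [X in L * X]distrC (ger0_norm (x := c t - c s)) ?subr_ge0//; exact: key.
have st' := ltW st; rewrite [X in L * X]ger0_norm ?subr_ge0//; exact: key.
Qed.

(** A smooth truncation: the function s * soft (c * s) vanishes for
    `|c * s| at most 1 and is the identity for `|c * s| above 2. *)
Definition soft (s : R) : R := step (s * s - 1).

Lemma soft_far s : 2 < `|s| -> soft s = 1.
Proof.
move=> s2; apply: step_ge1; rewrite lerBrDr -expr2 -real_normK ?num_real//.
have -> : (1 + 1 : R) = 2 by []. nra.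
Qed.

Lemma soft_near s : `|s| <= 1 -> soft s = 0.
Proof.
by move=> s1; apply: step_le0; rewrite subr_le0 -expr2 -real_normK ?num_real// expr_le1.
Qed.

Lemma smooth_soft u : smooth u -> smooth (fun x => soft (u x)).
Proof. by move=> su; apply: smooth_step; apply: smoothD; [exact: smoothM|exact: smooth_cst]. Qed.

Definition dsoft (s : R) : R := partial ord0 (fun x : plane => soft x.1) (s, 0).

Lemma is_derive_soft s : is_derive s (1 : R) soft (dsoft s).
Proof. exact: (is_derive_slice1 s 0 (smooth_soft smooth_fst)). Qed.

Lemma partial_soft i u x : smooth u -> partial i (fun x => soft (u x)) x = dsoft (u x) * partial i u x.
Proof.
move=> su; have h1 := smooth_is_derive i x (smooth_soft su).
have h2 := is_derive_chain (is_derive_soft (u x)) (smooth_is_derive i x su).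
by rewrite -(@derive_val _ _ _ _ _ _ _ h1) -(@derive_val _ _ _ _ _ _ _ h2).
Qed.

Lemma dsoft_far s : 2 < `|s| -> dsoft s = 0.
Proof.
move=> s2; apply: (@partial_near_cst _ _ _ 1).
have h : \forall x \near ((s, 0) : plane), 2 < `|x.1|.
  have c : `|x.1| @[x --> ((s, 0) : plane)] --> `|s| by apply: cvg_norm; exact: cvg_fst.
  exact: (cvgr_gt _ c).
by apply: filterS h => x; exact: soft_far.
Qed.

Lemma dsoft_near s : `|s| < 1 -> dsoft s = 0.
Proof.
move=> s1; apply: (@partial_near_cst _ _ _ 0).
have h : \forall x \near ((s, 0) : plane), `|x.1| < 1.
  have c : `|x.1| @[x --> ((s, 0) : plane)] --> `|s| by apply: cvg_norm; exact: cvg_fst.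
  exact: (cvgr_lt _ c).
by apply: filterS h => x hx; apply: soft_near; exact: ltW.
Qed.

(** The derivative of s * soft s. *)
Definition slope (s : R) : R := soft s + s * dsoft s.

Lemma slope_far s : 2 < `|s| -> slope s = 1.
Proof. by move=> s2; rewrite /slope soft_far// dsoft_far// mulr0 addr0. Qed.

Lemma slope_near s : `|s| < 1 -> slope s = 0.
Proof. by move=> s1; rewrite /slope soft_near ?ltW// dsoft_near// mulr0 addr0. Qed.

Lemma soft_lip : exists L M : R, (forall s, `|soft s| <= M) /\
    forall s t, `|soft s - soft t| <= L * `|s - t|.
Proof. by apply: (lip_of_smooth (smooth_soft smooth_fst)) => s /=; exact: soft_far. Qed.

Lemma slope_lip : exists L M : R, (forall s, `|slope s| <= M) /\
    forall s t, `|slope s - slope t| <= L * `|s - t|.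
Proof.
have sw : smooth (fun x : plane => soft x.1 + x.1 * partial ord0 (fun x : plane => soft x.1) x).
  apply: smoothD; first exact: smooth_soft smooth_fst.
  apply: smoothM; first exact: smooth_fst.
  exact: smooth_partial (smooth_soft smooth_fst).
by apply: (lip_of_smooth sw) => s /=; exact: slope_far.
Qed.

Lemma lip_cont (f : R -> R) L : (forall s t, `|f s - f t| <= L * `|s - t|) -> continuous f.
Proof.
move=> h s; apply/cvgrPdist_lt => e e0; have L1 : 0 < `|L| + 1 by rewrite ltr_pwDr.
near=> t; apply: le_lt_trans (h s t) _.
apply: (@le_lt_trans _ _ ((`|L| + 1) * `|s - t|)).
  by rewrite ler_wpM2r// (le_trans (ler_norm L))// lerDl.
rewrite mulrC -ltr_pdivlMr//; near: t; apply: (@cvgr_dist_lt _ _ _ (nbhs s) _ id s); first exact: cvg_id.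
by rewrite divr_gt0.
Unshelve. all: by end_near. Qed.

(** Compactness as an induction principle: a hereditary property that is
    closed under unions and holds locally holds for the compact set. *)
Lemma compact_induction (T : topologicalType) (K : set T) (P : set T -> Prop) : compact K ->
  P set0 -> (forall A B, A `<=` B -> P B -> P A) -> (forall A B, P A -> P B -> P (A `|` B)) ->
  (forall x, K x -> exists2 U, nbhs x U & P U) -> P K.
Proof.
move=> cK P0 PS PU loc; apply: contrapT => nPK.
pose F : set_system T := [set B | P (K `&` ~` B)].
have FF : ProperFilter F.
  split; first by rewrite /F/= setC0 setIT.
  split.
  - by rewrite /F/= setCT setI0.
  - move=> A B PA PB; rewrite /F/= setCI setIUr; exact: PU.
  - by move=> A B AB; rewrite /F/=; apply: PS; apply: setIS; exact: subsetC.
have FK : F K by rewrite /F/= setICr.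
have [x [Kx clx]] := cK F FF FK.
have [U nU PUU] := loc x Kx.
have FU : F (~` U) by rewrite /F/= setCK; apply: PS PUU; exact: subIsetr.
by have [y []] := clx _ _ FU nU.
Qed.

Lemma near_bump (a r y z : R) n : z = n.+1%:R^-1 -> z < r / 4 -> `|a - y| < r / 4 ->
  bump (a - r / 2) (a + r / 2) n y = 1.
Proof. by move=> ez h; rewrite ltr_distl => /andP[h1 h2]; apply: bump_eq1; rewrite -ez; lra. Qed.

Lemma near_seg (a r y : R) : 0 < r -> a - r / 2 <= y <= a + r / 2 -> `|a - y| < r.
Proof. by move=> r0 /andP[h1 h2]; rewrite ltr_distl; apply/andP; split; lra. Qed.

(** The closed set C keeps the support of chi away from S, whether or not S
    is closed. *)
Definition cutoff_for (S Z : set plane) (chi : plane -> R) : Prop :=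
  [/\ smooth chi, forall x, Z x -> chi x = 1 &
    exists C, [/\ closed C, (forall x, C x -> ~ S x) & forall x, ~ C x -> chi x = 0]].

(** Products of bumps do the job locally, and two cutoffs c1 and c2 are
    combined by 1 - (1 - c1) * (1 - c2). *)
Lemma cutoff_exists (S Z : set plane) : compact Z ->
  (forall x, Z x -> exists2 U, nbhs x U & forall y, U y -> ~ S y) -> exists chi, cutoff_for S Z chi.
Proof.
move=> cZ loc; apply: (compact_induction (P := fun Z => exists chi, cutoff_for S Z chi) cZ).
- exists (fun=> 0); split => //; first exact: smooth_cst.
  by exists set0; split => //; exact: closed0.
- move=> A B AB [chi [s1 h1 hC]]; exists chi; split => // x /AB; exact: h1.
- move=> A B [c1 [s1 h1 [C1 [k1 d1 z1]]]] [c2 [s2 h2 [C2 [k2 d2 z2]]]].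
  exists (fun x => c1 x + c2 x + - (c1 x * c2 x)); split.
  + by apply: smoothD; [exact: smoothD|apply: smoothN; exact: smoothM].
  + by move=> x [/h1|/h2] ->; ring.
  + exists (C1 `|` C2); split; [exact: closedU|by move=> x [/d1|/d2]|].
    move=> x nC; have nC1 : ~ C1 x by move=> h; apply: nC; left.
    have nC2 : ~ C2 x by move=> h; apply: nC; right.
    by rewrite z1// z2//; ring.
- move=> [x1 x2] /loc[U nU US].
  have [a ea] : exists a : R, x1 = a by exists x1.
  have [b eb] : exists b : R, x2 = b by exists x2.
  rewrite {}ea {}eb {x1 x2} in nU *.
  have [r r0 hr] : exists2 r : R, 0 < r & forall y : plane, `|a - y.1| < r -> `|b - y.2| < r -> U y.
    move: nU => /nbhs_ballP[r /= r0 sub]; exists r => // y h1 h2; apply: sub.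
    by split.
  have [n hn] : exists n, n.+1%:R^-1 < r / 4 :> R.
    have r4 : 0 < r / 4 by rewrite divr_gt0.
    by have [n _ /(_ n (leqnn n)) h] := near_infty_natSinv_lt (PosNum r4); exists n.
  exists [set y : plane | `|a - y.1| < r / 4 /\ `|b - y.2| < r / 4].
    apply/nbhs_ballP; exists (r / 4); first by rewrite /= divr_gt0.
    by move=> y [].
  exists (fun y => bump (a - r / 2) (a + r / 2) n y.1 * bump (b - r / 2) (b + r / 2) n y.2); split.
  + by apply: smoothM; [exact: smooth_bump1|exact: smooth_bump2].
  + by move=> y [h1 h2]; rewrite (near_bump erefl hn h1) (near_bump erefl hn h2) mulr1.
  + exists (`[a - r / 2, a + r / 2]%classic `*` `[b - r / 2, b + r / 2]%classic); split.
    * by apply: plane_compact_closed; exact: compact_rect.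
    * move=> y [] /=; rewrite !in_itv/= => h1 h2; apply: US; apply: hr; exact: near_seg.
    * move=> y nC; have [h1|h1] := boolP (a - r / 2 < y.1 < a + r / 2); last by rewrite bump_out// mul0r.
      have [h2|h2] := boolP (b - r / 2 < y.2 < b + r / 2); last by rewrite [X in _ * X]bump_out// mulr0.
      exfalso; apply: nC; move: h1 h2 => /andP[h1 h2] /andP[h3 h4].
      by split; rewrite /= in_itv/= !ltW.
Qed.

End Cutoffs.

Section Truncation.
Context {R : realType}.
Local Notation plane := (R * R)%type.
Local Notation leb1 := (@lebesgue_measure R).
Local Notation mplane := (measurableTypeR R * measurableTypeR R)%type.
Local Notation Om := (@Omega R).
Local Notation mO := (@measurable_Omega R).
Implicit Types (O : set plane) (u v : plane -> R) (i : 'I_2).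

Lemma Om_closed_sub : Om `<=` `[0, 1]%classic `*` `[0, 1]%classic.
Proof. by move=> x [/andP[? ?] /andP[? ?]]; split; rewrite /= in_itv/= !ltW. Qed.

Lemma open_Om : open Om.
Proof.
have -> : Om = ((fun x : plane => x.1) @^-1` `]0, 1[%classic) `&` ((fun x : plane => x.2) @^-1` `]0, 1[%classic).
  by apply/seteqP; split => x; rewrite /= !in_itv.
apply: openI; apply: open_comp => //; try exact: interval_open.
  by move=> x _; exact: cvg_fst.
by move=> x _; exact: cvg_snd.
Qed.

(** The continuous version V of d vanishes on S, so the set where
    `|c * V| is at least 1 is compact and away from S. A cutoff chi equal to
    1 there leaves the truncation of d unchanged and makes the truncations
    of the approximating test functions vanish near S. *)
Lemma truncation_step (S : set plane) (d V : plane -> R) (c : R) :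
  H10 Om d -> continuous V -> (\forall x \ae leb2, Om x -> d x = V x) ->
  (forall x, Om x -> S x -> V x = 0) -> 0 < c ->
  exists psi, h1_approx (Om `\` S) (fun x => soft (c * d x) * d x)
     (fun i x => slope (c * d x) * gD i d x) psi.
Proof.
move=> hd cV dV SV c0.
have [phi [tp Ld LD cd cD]] := H10_approx hd.
have c0' : 0 <= c := ltW c0.
pose Z := (`[0, 1]%classic `*` `[0, 1]%classic : set plane) `&` [set x | 1 <= `|c * V x|].
have cZV : continuous (fun x => `|c * V x|) by move=> x; apply: cvg_norm; apply: cvgMr; exact: cV.
have cZ : compact Z.
  apply: compact_closedI; first exact: compact_rect.
  apply: (@preimage_closed _ _ (fun x : plane => `|c * V x|) _ _ (@closed_ge R 1)).
  by move=> x _; exact: cZV.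
have locZ x : Z x -> exists2 U, nbhs x U & forall y, U y -> ~ (Om `&` S) y.
  move=> [_ hx]; exists [set y | 0 < `|c * V y|].
    by apply: (cvgr_gt _ (cZV x)); apply: lt_le_trans hx.
  by move=> y /= h [Oy Sy]; move: h; rewrite (SV y)// mulr0 normr0 ltxx.
have [chi [schi chi1 [C [clC CS C0]]]] := cutoff_exists cZ locZ.
have [B B0 hB] := compact_cont_bounded (smooth_cont schi) (compact_rect (a := 0) (b := 1) (c := 0) (d := 1)).
have hBD i : exists2 B', 0 < B' & forall x, Om x -> `|partial i chi x| <= B'.
  have [B' B0' h] := compact_cont_bounded (smooth_cont (smooth_partial i schi)) (compact_rect (a := 0) (b := 1) (c := 0) (d := 1)).
  by exists B' => // x /Om_closed_sub; exact: h.
have {}hB x : Om x -> `|chi x| <= B by move=> /Om_closed_sub; exact: hB.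
have mchi : measurable_fun (Om : set mplane) chi.
  by apply: plane_continuous_measurable => //; exact: smooth_cont.
have mchiD i : measurable_fun (Om : set mplane) (partial i chi).
  by apply: plane_continuous_measurable => //; apply: smooth_cont; exact: smooth_partial.
have [L [M [soM soL]]] := @soft_lip R; have [L' [M' [slM slL]]] := @slope_lip R.
pose so s := soft (c * s); pose sl s := slope (c * s).
have cst s t : c * `|s - t| = `|c * s - c * t| by rewrite -mulrBr normrM (ger0_norm c0').
have soL' s t : `|so s - so t| <= (L * c) * `|s - t|.
  by rewrite -mulrA cst; exact: soL.
have slL' s t : `|sl s - sl t| <= (L' * c) * `|s - t|.
  by rewrite -mulrA cst; exact: slL.
have soM' s : `|so s| <= M by exact: soM.
have slM' s : `|sl s| <= M' by exact: slM.
have cso := lip_cont soL'; have csl := lip_cont slL'.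
have mso v : L2 leb2 Om v -> measurable_fun (Om : set mplane) (fun x => so (v x)).
  by move=> [mv _]; apply: measurableT_comp mv; exact: continuous_measurable_fun.
have msl v : L2 leb2 Om v -> measurable_fun (Om : set mplane) (fun x => sl (v x)).
  by move=> [mv _]; apply: measurableT_comp mv; exact: continuous_measurable_fun.
have Lso v w : L2 leb2 Om v -> L2 leb2 Om w -> L2 leb2 Om (fun x => so (v x) * w x).
  by move=> h h'; exact: (L2_bounded_mul mO (mso _ h) (fun x _ => soM' (v x)) h').
have Lsl v w : L2 leb2 Om v -> L2 leb2 Om w -> L2 leb2 Om (fun x => sl (v x) * w x).
  by move=> h h'; exact: (L2_bounded_mul mO (msl _ h) (fun x _ => slM' (v x)) h').
have Lphi n := test_Omega_L2 (tp n).
have LphiD n i := test_Omega_L2 (test_partial i (tp n)).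
have c1 : sqdist leb2 Om (fun x => so (phi n x) * phi n x) (fun x => so (d x) * d x) @[n --> \oo] --> 0.
  exact: (lip_mul_cvg mO cso soM' soL' Lphi Ld Lphi Ld cd cd).
have c2 i : sqdist leb2 Om (fun x => sl (phi n x) * partial i (phi n) x) (fun x => sl (d x) * gD i d x) @[n --> \oo] --> 0.
  exact: (lip_mul_cvg mO csl slM' slL' Lphi Ld (fun n => LphiD n i) (LD i) cd (cD i)).
pose psi n x := chi x * (so (phi n x) * phi n x).
have sso n : smooth (fun x => so (phi n x)).
  apply: smooth_soft; apply: smoothM; [exact: smooth_cst|exact: test_smooth (tp n)].
have sph n : smooth (fun x => so (phi n x) * phi n x).
  by apply: smoothM; [exact: sso|exact: test_smooth (tp n)].
have tpsi n : test_function (Om `\` S) (psi n).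
  have [K [cK KO K0]] := test_suppP (tp n).
  apply: (test_intro (K := K `&` C)).
  - by apply: smoothM.
  - exact: compact_closedI.
  - by move=> x [Kx Cx]; split; [exact: KO|move=> Sx; apply: (CS x Cx); split => //; exact: KO].
  - move=> x nKC; rewrite /psi; have [Kx|nKx] := pselect (K x).
      by rewrite C0 ?mul0r// => Cx; apply: nKC.
    by rewrite (K0 x)// !mulr0.
have partial_psi n i x : partial i (psi n) x =
  chi x * (sl (phi n x) * partial i (phi n) x) + partial i chi x * (so (phi n x) * phi n x).
  rewrite /psi partialM// [X in chi x * X]partialM//; last exact: test_smooth (tp n).
  rewrite (@partial_soft _ i (fun x => c * phi n x)); last first.
    by apply: smoothM; [exact: smooth_cst|exact: test_smooth (tp n)].
  rewrite partialM; [|exact: smooth_cst|exact: test_smooth (tp n)].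
  by rewrite partial_cst mulr0 addr0 /sl /slope /so; ring.
have chi_far x : Om x -> 1 < `|c * V x| -> chi x = 1 /\ forall i, partial i chi x = 0.
  move=> Ox h; split; first by apply: chi1; split; [exact: Om_closed_sub|exact: ltW].
  move=> i; apply: (@partial_near_cst _ _ _ _ 1).
  have n1 : \forall y \near x, 1 < `|c * V y| by exact: (cvgr_gt _ (cZV x)).
  have n2 : \forall y \near x, Om y by apply: open_nbhs_nbhs; split => //; exact: open_Om.
  apply: filterS2 n1 n2 => y h1 h2; apply: chi1; split; [exact: Om_closed_sub|exact: ltW].
exists psi; split => //; [exact: Lso|by move=> i; exact: Lsl| |].
- have E : \forall x \ae leb2, Om x -> chi x * (so (d x) * d x) = so (d x) * d x.
    apply: aeS dV => x h Ox; have [le1|gt1] := leP (`|c * V x|) 1.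
      by rewrite /so soft_near ?mul0r ?mulr0// h.
    by rewrite (chi_far x Ox gt1).1 mul1r.
  have Lc := L2_bounded_mul mO mchi hB (Lso _ _ Ld Ld).
  apply: (squeeze_cvgr (f := fun=> 0) (h := fun n => B ^+ 2 * sqdist leb2 Om (fun x => so (phi n x) * phi n x) (fun x => so (d x) * d x))).
  + near=> n; rewrite sqdist_ge0/= -(sqdist_ae _ Lc (Lso _ _ Ld Ld) E); last exact: test_Omega_L2 (tpsi n).
    by apply: (sqdist_bmul mO mchi hB); [exact: Lso|exact: Lso].
  + exact: cvg_cst.
  + by rewrite -(mulr0 (B ^+ 2)); exact: cvgMr.
- move=> i.
  have [B' B0' hB'] := hBD i.
  pose w x := chi x * (sl (d x) * gD i d x) + partial i chi x * (so (d x) * d x).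
  have E : \forall x \ae leb2, Om x -> w x = sl (d x) * gD i d x.
    apply: aeS dV => x h Ox; rewrite /w; have [lt1|ge1] := ltP (`|c * V x|) 1.
      by rewrite /sl /so slope_near ?h// soft_near ?ltW// !mul0r !mulr0 addr0.
    (* The level set where c * V has modulus 1 is handled apart: the cutoff
       need not be flat there, but the truncation vanishes. *)
    move: ge1; rewrite le_eqVlt => /predU1P[e1|gt1].
      rewrite /so soft_near ?h -?e1// mul0r mulr0 addr0 chi1 ?mul1r//.
      by split; [exact: Om_closed_sub|rewrite /= -e1].
    by rewrite (chi_far x Ox gt1).1 (chi_far x Ox gt1).2 mul1r mul0r addr0.
  have Lw1 := L2_bounded_mul mO mchi hB (Lsl _ _ Ld (LD i)).
  have Lw2 := L2_bounded_mul mO (mchiD i) hB' (Lso _ _ Ld Ld).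
  have Lw : L2 leb2 Om w := L2D mO Lw1 Lw2.
  have Lp1 n := L2_bounded_mul mO mchi hB (Lsl _ _ (Lphi n) (LphiD n i)).
  have Lp2 n := L2_bounded_mul mO (mchiD i) hB' (Lso _ _ (Lphi n) (Lphi n)).
  apply: (squeeze_cvgr (f := fun=> 0) (h := fun n => 2 * (1 ^+ 2 *
     (B ^+ 2 * sqdist leb2 Om (fun x => sl (phi n x) * partial i (phi n) x) (fun x => sl (d x) * gD i d x)) +
      B' ^+ 2 * sqdist leb2 Om (fun x => so (phi n x) * phi n x) (fun x => so (d x) * d x)))).
  + near=> n; rewrite sqdist_ge0/= -(sqdist_ae _ Lw (Lsl _ _ Ld (LD i)) E); last exact: test_Omega_L2 (test_partial i (tpsi n)).
    have T := sqdist_comb 1 (Lp1 n) Lw1 (Lp2 n) Lw2.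
    have T1 := sqdist_bmul mO mchi hB (Lsl _ _ (Lphi n) (LphiD n i)) (Lsl _ _ Ld (LD i)).
    have T2 := sqdist_bmul mO (mchiD i) hB' (Lso _ _ (Lphi n) (Lphi n)) (Lso _ _ Ld Ld).
    have -> : sqdist leb2 Om (partial i (psi n)) w = sqdist leb2 Om
      (fun x => 1 * (chi x * (sl (phi n x) * partial i (phi n) x)) + partial i chi x * (so (phi n x) * phi n x))
      (fun x => 1 * (chi x * (sl (d x) * gD i d x)) + partial i chi x * (so (d x) * d x)).
      by rewrite !sqdistE; apply: Rint_ext => x _; rewrite partial_psi /w !mul1r.
    apply: (le_trans T); rewrite ler_pM2l// lerD// expr1n !mul1r//.
  + exact: cvg_cst.
  + have -> : (0 : R) = 2 * (1 ^+ 2 * (B ^+ 2 * 0) + B' ^+ 2 * 0) by ring.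
    by apply: cvgMr; apply: cvgD; [apply: cvgMr; apply: cvgMr; exact: c2|apply: cvgMr; exact: c1].
Unshelve. all: by end_near. Qed.

(** Let the truncation level 1 / c tend to 0 and use that H^1_0 is closed.
    The gradients of the truncations converge to the gradient of d cut to
    zero on the zero set of d, and closedness identifies this limit with the
    gradient of d. *)
Lemma truncation (S : set plane) (d V : plane -> R) :
  H10 Om d -> continuous V -> (\forall x \ae leb2, Om x -> d x = V x) ->
  (forall x, Om x -> S x -> V x = 0) -> H10 (Om `\` S) d.
Proof.
move=> hd cV dV SV.
have Ld := H10_L2 hd; have LD i := H10_wD_L2 i hd.
have [L [M [soM soL]]] := @soft_lip R; have [L' [M' [slM slL]]] := @slope_lip R.
have cso := lip_cont soL; have csl := lip_cont slL.
pose so m s := soft (m.+1%:R * s); pose sl m s := slope (m.+1%:R * s).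
pose nz (s : R) : R := (s != 0)%R%:R.
have far (s : R) : s != 0 -> \forall m \near \oo, 2 < `|m.+1%:R * s|.
  move=> s0; have s0' : 0 < `|s| by rewrite normr_gt0.
  have hn := archi_boundP (ltW (divr_gt0 (@ltr0n R 2) s0')); set n := Num.bound _ in hn.
  near=> m; rewrite normrM normr_nat -ltr_pdivrMr// (lt_le_trans hn)// ler_nat.
  by apply: leqW; near: m; exact: nbhs_infty_ge.
have mc (f : R -> R) m : continuous f -> measurable_fun (Om : set mplane) (fun x => f (m.+1%:R * d x)).
  move=> cf; apply: (measurableT_comp (f := f)); first exact: continuous_measurable_fun.
  by apply: measurable_funM => //; exact: Ld.1.
have gen (f : R -> R) (N : R) (b : plane -> R) : continuous f -> (forall s, `|f s| <= N) ->
    (forall s, 2 < `|s| -> f s = 1) -> L2 leb2 Om b ->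
    (f 0 = 0 ) ->
    L2 leb2 Om (fun x => nz (d x) * b x) /\
    sqdist leb2 Om (fun x => f (m.+1%:R * d x) * b x) (fun x => nz (d x) * b x) @[m --> \oo] --> 0.
  move=> cf fN f1 Lb f0.
  have mnz : measurable_fun (Om : set mplane) (fun x => nz (d x)).
    apply: (measurableT_comp (f := fun t : bool => t%:R : R)) => //.
    apply: measurable_neg; apply: measurable_fun_eqr => //; exact: Ld.1.
  have nz1 s : `|nz s| <= 1 by rewrite /nz; case: (s != 0); rewrite ?normr1 ?normr0.
  have Lnz : L2 leb2 Om (fun x => nz (d x) * b x) := L2_bounded_mul mO mnz (fun x _ => nz1 (d x)) Lb.
  have N0 : 0 <= N := le_trans (normr_ge0 _) (fN 0).
  have Lf m : L2 leb2 Om (fun x => f (m.+1%:R * d x) * b x).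
    exact: (L2_bounded_mul mO (mc f m cf) (fun x _ => fN _) Lb).
  split => //.
  have [_] : L1 leb2 Om (fun=> 0 : R) /\
    \int[leb2]_(x in Om) ((f (m.+1%:R * d x) * b x - nz (d x) * b x) ^+ 2) @[m --> \oo] --> \int[leb2]_(x in Om) (0 : R).
    apply: (@Rdominated _ _ _ leb2 Om mO _ _ (fun x => (N + 1) ^+ 2 * b x ^+ 2)).
    - by move=> m; exact: L1_meas (L2B mO (Lf m) Lnz).2.
    - exact: measurable_cst.
    - exact: (L1Zl mO _ Lb.2).
    - apply: aeT => x _; apply: cvg_near_cst.
      have [d0|d0] := eqVneq (d x) 0.
        by apply: nearW => m; rewrite d0 mulr0 f0 /nz eqxx mul0r subrr expr0n.
      apply: filterS (far _ d0) => m h; by rewrite f1// /nz d0 subrr expr0n.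
    - apply: aeT => x m _; rewrite -mulrBl exprMn normrM [X in _ * X]ger0_norm ?sqr_ge0//.
      rewrite ler_wpM2r ?sqr_ge0// normrX lerXn2r ?nnegrE ?addr_ge0//.
      by rewrite (le_trans (ler_normB _ _))// lerD.
  rewrite Rintegral_cst ?mul0r// => h.
  have -> : (fun m => sqdist leb2 Om (fun x => f (m.+1%:R * d x) * b x) (fun x => nz (d x) * b x)) =
     (fun m => \int[leb2]_(x in Om) ((f (m.+1%:R * d x) * b x - nz (d x) * b x) ^+ 2)).
    by apply/funext => m; rewrite sqdistE.
  exact: h.
have [Lnd cnd] := gen soft M d cso soM (@soft_far R) Ld (soft_near (s := 0) ltac:(by rewrite normr0 ler01)).
have [Lng cng] := gen soft M d cso soM (@soft_far R) Ld (soft_near (s := 0) ltac:(by rewrite normr0 ler01)).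
have gw i := gen slope M' (gD i d) csl slM (@slope_far R) (LD i) (slope_near (s := 0) ltac:(by rewrite normr0 ltr01)).
have [psi hp] : exists psi, h1_approx (Om `\` S) (fun x => nz (d x) * d x) (fun i x => nz (d x) * gD i d x) psi.
  apply: (approx_closed (vm := fun m x => soft (m.+1%:R * d x) * d x) (wm := fun m i x => slope (m.+1%:R * d x) * gD i d x)) => //.
  - by move=> m; apply: truncation_step dV SV _.
  - by move=> i; have [] := gw i.
  - by move=> i; have [] := gw i.
have e : (fun x => nz (d x) * d x) = d.
  by apply/funext => x; rewrite /nz; case: eqVneq => [->|_]; rewrite ?mulr0 ?mul1r.
rewrite e in hp; apply: approx_H10 hp => x; exact: (@proj1 _ _).
Unshelve. all: by end_near. Qed.

End Truncation.

(** * Inactive sets and the multiplier off the contact set *)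
Section InactiveSets.
Context {R : realType}.
Local Notation plane := (R * R)%type.
Local Notation leb1 := (@lebesgue_measure R).
Local Notation mplane := (measurableTypeR R * measurableTypeR R)%type.
Local Notation Om := (@Omega R).
Local Notation G := (`]0, 1[%classic : set R).
Local Notation mO := (@measurable_Omega R).
Local Notation mG := (measurable_oo (0 : R) 1).
Implicit Types (O : set plane) (u v : plane -> R) (i : 'I_2) (A B : set R).

(** The set A is null near y; the complement in the unit interval is the
    essential support of A. *)
Definition gap A (y : R) : Prop := exists2 r : R, 0 < r &
  \forall z \ae leb1, G z -> y - r < z < y + r -> ~ A z.

Definition contact A : set plane := [set x | x.1 = half /\ ~ gap A x.2].

Lemma plane_nbhs (x : plane) (U : set plane) : nbhs x U -> exists2 r : R, 0 < r &
  forall y : plane, `|x.1 - y.1| < r -> `|x.2 - y.2| < r -> U y.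
Proof.
by move=> /nbhs_ballP[r /= r0 sub]; exists r => // y h1 h2; apply: sub; split.
Qed.

Lemma plane_nbhsI (x : plane) (U : set plane) (r : R) : 0 < r ->
  (forall y : plane, `|x.1 - y.1| < r -> `|x.2 - y.2| < r -> U y) -> nbhs x U.
Proof.
by move=> r0 h; apply/nbhs_ballP; exists r => // y [h1 h2]; exact: h.
Qed.

(** The union over all representatives is attained by removing from A its
    part in the gaps, which is a null set. *)
Lemma inactiveE A : inactive A = Om `\` contact A.
Proof.
apply/seteqP; split => x.
  move=> [A' [AA' A'A /plane_nbhs[r r0 hr]]].
  have [Ox _] : (Om `\` on_Gamma A') x by apply: hr; rewrite subrr normr0.
  split => // -[x1 ng]; apply: ng; exists r => //.
  apply: aeS AA' => z h Gz /andP[z1 z2] Az.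
  have [_] : (Om `\` on_Gamma A') (x.1, z).
    by apply: hr; rewrite /= ?subrr ?normr0// ltr_distl; apply/andP; split; lra.
  by apply; split => //=; exact: h.
move=> [Ox nc].
have [r0 r0p hr0] := plane_nbhs (open_nbhs_nbhs (conj (@open_Om R) Ox)).
have [x1|x1] := eqVneq x.1 half.
  have [r rp hr] : gap A x.2 by apply: contrapT => ng; apply: nc.
  exists [set z | A z /\ ~ (x.2 - r < z < x.2 + r)]; split.
  - by apply: aeS hr => z h Gz Az; split => // hz; exact: h Gz hz Az.
  - by apply: aeT => z _ [].
  - apply: (plane_nbhsI (r := Num.min r r0)); first by rewrite lt_min rp.
    move=> y h1 h2; rewrite !lt_min in h1 h2; move/andP: h1 => [h1 h3]; move/andP: h2 => [h2 h4].
    split; first exact: hr0.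
    move=> [_ [_]]; apply; move: h2; rewrite ltr_distl => /andP[? ?]; apply/andP; split; lra.
exists A; split; [by apply: aeT|by apply: aeT|].
have d0 : 0 < `|x.1 - half| by rewrite normr_gt0 subr_eq0.
apply: (plane_nbhsI (r := Num.min `|x.1 - half| r0)); first by rewrite lt_min d0.
move=> y h1 h2; rewrite !lt_min in h1 h2; move/andP: h1 => [h1 h3]; move/andP: h2 => [h2 h4].
split; first exact: hr0.
by move=> [y1 _]; move: h1; rewrite y1 ltxx.
Qed.

Lemma inactive_sub A : inactive A `<=` Om.
Proof. by rewrite inactiveE => x []. Qed.

Lemma gap_subset A B : ae_subset A B -> forall y, gap B y -> gap A y.
Proof.
move=> AB y [r r0 h]; exists r => //.
by apply: aeS (aeI AB h) => z [ab hz] Gz zr /(ab Gz); exact: hz.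
Qed.

Lemma inactive_mono A B : ae_subset A B -> inactive B `<=` inactive A.
Proof.
move=> AB; rewrite !inactiveE => x [Ox nc]; split => // -[x1 ng]; apply: nc; split => // gB.
by apply: ng; exact: gap_subset gB.
Qed.

Lemma ratr_between (a b : R) : a < b -> exists q : rat, a < ratr q < b.
Proof. by move=> ab; have [q] := rat_in_itvoo ab; rewrite in_itv/= => h; exists q. Qed.

(** The gaps are covered by countably many rational intervals that meet A
    in a null set. *)
Lemma ae_not_gap A : \forall y \ae leb1, G y -> A y -> ~ gap A y.
Proof.
pose N (pq : rat * rat) := \forall z \ae leb1, G z -> ratr pq.1 < z < ratr pq.2 -> ~ A z.
have h (pq : rat * rat) : \forall z \ae leb1, N pq -> G z -> ratr pq.1 < z < ratr pq.2 -> ~ A z.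
  have [n|n] := pselect (N pq); first by apply: aeS n => z hz _.
  by apply: aeT => z /n.
apply: aeS (ae_all h) => y hy Gy Ay [r r0 hr].
have [p /andP[p1 p2]] := @ratr_between (y - r) y ltac:(by rewrite gtrBl).
have [q /andP[q1 q2]] := @ratr_between y (y + r) ltac:(by rewrite ltrDl).
apply: (hy (p, q) _ Gy _ Ay); last by rewrite /= p2 q1.
apply: aeS hr => z hz Gz /= /andP[z1 z2]; apply: hz => //.
by rewrite (lt_trans p1 z1) (lt_trans z2 q2).
Qed.

(** Every neighbourhood of a point of the essential support meets A in a
    set of positive measure, where f equals c. *)
Lemma contact_value A (f : R -> R) c y : f z @[z --> y] --> f y ->
  (\forall z \ae leb1, G z -> A z -> f z = c) -> ~ gap A y -> f y = c.
Proof.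
move=> /cvgrPdist_lt cf ae ng; apply: contrapT => /eqP ne; apply: ng.
have e0 : 0 < `|f y - c| by rewrite normr_gt0 subr_eq0.
have /nbhs_ballP[/= s s0 hs] := cf _ e0; exists s => //.
apply: aeS ae => z h Gz /andP[z1 z2] Az.
have := hs z; rewrite (h Gz Az) ltxx => hf.
suff : false by []. apply: hf.
by rewrite /ball/= ltr_distl; apply/andP; split; lra.
Qed.

Lemma Rint_sub_supp1 (D D' : set R) (f : R -> R) : D' `<=` D ->
  (forall x, D x -> ~ D' x -> f x = 0) ->
  \int[leb1]_(x in D) f x = \int[leb1]_(x in D') f x.
Proof.
move=> sub h0; rewrite Rintegral_mkcond [RHS]Rintegral_mkcond.
apply: Rint_ext => x _; rewrite !patchE.
case: ifPn => [/set_mem Dx|/negP nD]; case: ifPn => [/set_mem D'x|/negP nD'] //.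
  by rewrite h0//; move=> /mem_set.
by exfalso; apply: nD; apply/mem_set/sub.
Qed.

(** Bumps supported near a gap, times a cutoff across the line, are test
    functions on the inactive set. *)
Lemma multiplier_zero A (L : (plane -> R) -> R) (l : R -> R) :
  represented_by L l -> L1 leb1 G l ->
  (forall v, H10 (inactive A) v -> L v = 0) ->
  \forall y \ae leb1, G y -> gap A y -> l y = 0.
Proof.
move=> [ml hL] Ll L0.
have key (p q : rat) : (0 : R) < ratr p -> ratr q < (1 : R) ->
    (forall y, ratr p < y < ratr q -> gap A y) ->
    \forall y \ae leb1, ratr p < y < ratr q -> l y = 0.
  move=> p0 q1 hg.
  have Gpq : `]ratr p, ratr q[%classic `<=` G.
    by move=> y; rewrite /= !in_itv/= => /andP[h1 h2]; rewrite (lt_trans p0 h1) (lt_trans h2 q1).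
  apply: du_bois_reymond1.
    by apply: (L1_oo_sub _ _ Ll); exact: ltW.
  move=> p' q' n pp' pq' qq'.
  pose phi (x : plane) := bump (4^-1) (3 / 4) 3 x.1 * bump (ratr p' : R) (ratr q') n x.2.
  have tp : test_function (inactive A) phi.
    apply: test_bump => x [/=]; rewrite !in_itv/= => /andP[x1 x2] /andP[x3 x4].
    rewrite inactiveE; split.
      by rewrite OmegaE; apply/rectP; split; apply/andP; split; lra.
    by move=> [_]; apply; apply: hg; apply/andP; split; lra.
  have [hp _] := H10_test (@inactive_sub A) tp.
  have hpO : H10 Om phi by apply: H10_sub hp; exact: inactive_sub.
  have [Lp] := hL _ hpO; rewrite (L0 _ hp) => /esym E.
  have phih y : phi (half, y) = bump (ratr p') (ratr q') n y.
    rewrite /phi/= bump_eq1 ?mul1r//; rewrite /half; lra.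
  rewrite -[RHS]E.
  transitivity (\int[leb1]_(y in G) (l y * bump (ratr p') (ratr q') n y)).
    apply/esym/Rint_sub_supp1 => // y _.
    rewrite /= in_itv/= => npq; rewrite bump_out ?mulr0//; apply/negP => /andP[h1 h2]; apply: npq.
    by rewrite (lt_trans pp' h1) (lt_trans h2 qq').
  apply: Rint_ae_eq => //.
  - by apply: measurable_funM => //; exact: bump_measurable.
  - exact: L1_meas Lp.
  - apply: aeS (trG_test (@inactive_sub A) tp) => y h Gy; by rewrite h// phih.
pose N (pq : rat * rat) := [/\ (0 : R) < ratr pq.1, ratr pq.2 < (1 : R) &
   forall y, ratr pq.1 < y < ratr pq.2 -> gap A y].
have h (pq : rat * rat) : \forall z \ae leb1, N pq -> ratr pq.1 < z < ratr pq.2 -> l z = 0.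
  have [[n1 n2 n3]|n] := pselect (N pq); last by apply: aeT => z /n.
  by apply: aeS (key _ _ n1 n2 n3) => z hz _.
apply: aeS (ae_all h) => y hy; rewrite /= in_itv/= => /andP[y0 y1] [r r0 hr].
have [p /andP[p1 p2]] := @ratr_between (Num.max 0 (y - r)) y ltac:(by rewrite gt_max y0 gtrBl).
have [q /andP[q1 q2]] := @ratr_between y (Num.min 1 (y + r)) ltac:(by rewrite lt_min y1 ltrDl).
move: p1 q2; rewrite gt_max lt_min => /andP[p0 pr] /andP[q1' qr].
apply: (hy (p, q)); last by rewrite /= p2 q1.
split => // z /= /andP[z1 z2].
exists (Num.min (z - ratr p) (ratr q - z)); first by rewrite lt_min !subr_gt0 z1.
apply: aeS hr => w hw Gw /andP[w1 w2]; apply: hw => //.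
have m1 : Num.min (z - ratr p) (ratr q - z) <= z - ratr p by rewrite ge_min lexx.
have m2 : Num.min (z - ratr p) (ratr q - z) <= ratr q - z by rewrite ge_min lexx orbT.
move: w1 w2 m1 m2; set m := Num.min _ _ => *; apply/andP; split; lra.
Qed.

End InactiveSets.

(** * The equation tested with a kinked Poisson kernel *)
Section KernelCalculus.
Context {R : realType}.
Local Notation plane := (R * R)%type.
Implicit Types (u v m q : plane -> R) (i : 'I_2) (s y : R).

Lemma smoothV u : (forall x, u x != 0) -> smooth u -> smooth (fun x => (u x)^-1).
Proof. by move=> u0 su n; exact: class_CV. Qed.

Lemma smooth_sqrt u : (forall x, 0 < u x) -> smooth u -> smooth (fun x => Num.sqrt (u x)).
Proof. by move=> u0 su n; exact: class_C_sqrt. Qed.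

Lemma partialN i u x : smooth u -> partial i (fun x => - u x) x = - partial i u x.
Proof.
move=> su; have -> : (fun x => - u x) = (fun x => -1 * u x) by apply/funext => z; rewrite mulN1r.
by rewrite partialM ?partial_cst; [rewrite mulr0 addr0 mulN1r|exact: smooth_cst|].
Qed.

Lemma partialV i u x : (forall x, u x != 0) -> smooth u ->
  partial i (fun x => (u x)^-1) x = - ((u x)^-1 * (u x)^-1) * partial i u x.
Proof.
move=> u0 su; have sV := smoothV u0 su.
have := partialM i x su sV.
have -> : (fun x => u x * (u x)^-1) = fun=> 1 by apply/funext => z; rewrite divff.
rewrite partial_cst => /esym/eqP; rewrite addr_eq0 => /eqP E.
apply: (mulfI (u0 x)); rewrite E; field; exact: u0.
Qed.

Lemma partial_sqrt i u x : (forall x, 0 < u x) -> smooth u ->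
  partial i (fun x => Num.sqrt (u x)) x = (2 * Num.sqrt (u x))^-1 * partial i u x.
Proof.
move=> u0 su; have sS := smooth_sqrt u0 su.
have n0 : Num.sqrt (u x) != 0 by rewrite gt_eqF// sqrtr_gt0.
have := partialM i x sS sS.
have -> : (fun x => Num.sqrt (u x) * Num.sqrt (u x)) = u.
  by apply/funext => z; rewrite -expr2 sqr_sqrtr// ltW.
by move=> ->; field.
Qed.

(** The Poisson kernel of the half plane up to a factor pi, the real part of
    the reciprocal of s + i * y. It is harmonic, and the suffixes name its
    partial derivatives. *)
Definition pk s y : R := s / (s * s + y * y).
Definition pk_s s y : R := (y * y - s * s) / ((s * s + y * y) * (s * s + y * y)).
Definition pk_y s y : R := - (2 * s * y) / ((s * s + y * y) * (s * s + y * y)).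
Definition pk_ss s y : R := 2 * s * (s * s - 3 * (y * y)) / (s * s + y * y) ^+ 3.
Definition pk_sy s y : R := 2 * y * (3 * (s * s) - y * y) / (s * s + y * y) ^+ 3.

Lemma den_gt0 s y : 0 < s -> 0 < s * s + y * y.
Proof. by move=> s0; rewrite ltr_pwDl ?mulr_gt0// -expr2 sqr_ge0. Qed.

Section Compose.
Variables (m q : plane -> R).
Hypotheses (sm : smooth m) (sq : smooth q) (m0 : forall x, 0 < m x).

Let D x := m x * m x + q x * q x.
Let D0 x : D x != 0. Proof. by rewrite gt_eqF// den_gt0. Qed.
Let sD : smooth D. Proof. by apply: smoothD; exact: smoothM. Qed.
Let sI : smooth (fun x => (D x)^-1). Proof. exact: smoothV. Qed.
Let pD i x : partial i D x = 2 * m x * partial i m x + 2 * q x * partial i q x.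
Proof. by rewrite partialD ?partialM//; [ring|exact: smoothM|exact: smoothM]. Qed.
Let pI i x : partial i (fun x => (D x)^-1) x =
  - ((D x)^-1 * (D x)^-1) * (2 * m x * partial i m x + 2 * q x * partial i q x).
Proof. by rewrite partialV// pD. Qed.
Let D0' x : m x * m x + q x * q x != 0 := D0 x.

Lemma smooth_pk : smooth (fun x => pk (m x) (q x)).
Proof. exact: smoothM. Qed.

Lemma partial_pk i x : partial i (fun x => pk (m x) (q x)) x =
  pk_s (m x) (q x) * partial i m x + pk_y (m x) (q x) * partial i q x.
Proof. by rewrite [LHS]partialM// pI /pk_s /pk_y /D; field; exact: D0'. Qed.

Let pk_sE : (fun x => pk_s (m x) (q x)) =
  fun x => (q x * q x + - (m x * m x)) * ((D x)^-1 * (D x)^-1).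
Proof. by apply/funext => x; rewrite /pk_s -invfM. Qed.

Let pk_yE : (fun x => pk_y (m x) (q x)) =
  fun x => (- 2 * (m x * q x)) * ((D x)^-1 * (D x)^-1).
Proof. by apply/funext => x; rewrite /pk_y -invfM; congr (_ * _); ring. Qed.

Let sI2 : smooth (fun x => (D x)^-1 * (D x)^-1). Proof. exact: smoothM. Qed.
Let sn : smooth (fun x => q x * q x + - (m x * m x)).
Proof. by apply: smoothD; [exact: smoothM|apply: smoothN; exact: smoothM]. Qed.
Let sn' : smooth (fun x => - 2 * (m x * q x)).
Proof. by apply: smoothM; [exact: smooth_cst|exact: smoothM]. Qed.

Lemma smooth_pk_s : smooth (fun x => pk_s (m x) (q x)).
Proof. by rewrite pk_sE; exact: smoothM. Qed.

Lemma smooth_pk_y : smooth (fun x => pk_y (m x) (q x)).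
Proof. by rewrite pk_yE; exact: smoothM. Qed.

Lemma partial_pk_s i x : partial i (fun x => pk_s (m x) (q x)) x =
  pk_ss (m x) (q x) * partial i m x + pk_sy (m x) (q x) * partial i q x.
Proof.
rewrite pk_sE partialM// (partialM _ _ sI sI) !pI partialD; [|exact: smoothM|by apply: smoothN; exact: smoothM].
rewrite partialN ?partialM//; last exact: smoothM.
by rewrite /pk_ss /pk_sy /D; field; exact: D0'.
Qed.

Lemma partial_pk_y i x : partial i (fun x => pk_y (m x) (q x)) x =
  pk_sy (m x) (q x) * partial i m x - pk_ss (m x) (q x) * partial i q x.
Proof.
rewrite pk_yE partialM// (partialM _ _ sI sI) !pI partialM; [|exact: smooth_cst|exact: smoothM].
rewrite partial_cst mulr0 addr0 partialM//.
by rewrite /pk_ss /pk_sy /D; field; exact: D0'.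
Qed.

End Compose.

Lemma pk_bound s y (r : R) : 0 < r -> 0 < s -> r * r <= s * s + y * y -> `|pk s y| <= r^-1.
Proof.
move=> r0 s0 h; have d0 := den_gt0 y s0.
rewrite /pk ger0_norm; last by apply: divr_ge0; exact: ltW.
rewrite ler_pdivrMr// ler_pdivlMl//.
have yy : 0 <= y * y by rewrite -expr2 sqr_ge0.
have rs : 0 <= r * s by rewrite mulr_ge0// ltW.
rewrite -ler_sqr ?nnegrE ?(ltW d0)//.
have -> : (r * s) ^+ 2 = (r * r) * (s * s) by ring.
rewrite [leRHS]expr2; apply: ler_pM => //; rewrite ?mulr_ge0//; try exact: ltW; lra.
Qed.

Lemma pk_s_bound s y (r : R) : 0 < r -> 0 < s -> r * r <= s * s + y * y -> `|pk_s s y| <= (r * r)^-1.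
Proof.
move=> r0 s0 h; have d0 := den_gt0 y s0.
have yy : 0 <= y * y by rewrite -expr2 sqr_ge0.
have ss : 0 < s * s by rewrite mulr_gt0.
have rr : 0 < r * r by rewrite mulr_gt0.
rewrite /pk_s normrM normfV (gtr0_norm (mulr_gt0 d0 d0)) ler_pdivrMr ?mulr_gt0//.
rewrite ler_pdivlMl//.
have h1 : `|y * y - s * s| <= s * s + y * y by rewrite ler_norml; apply/andP; split; lra.
by apply: ler_pM => //; exact: ltW.
Qed.

Lemma pk_y_bound s y (r : R) : 0 < r -> 0 < s -> r * r <= s * s + y * y -> `|pk_y s y| <= (r * r)^-1.
Proof.
move=> r0 s0 h; have d0 := den_gt0 y s0.
have rr : 0 < r * r by rewrite mulr_gt0.
rewrite /pk_y normrM normfV (gtr0_norm (mulr_gt0 d0 d0)) ler_pdivrMr ?mulr_gt0//.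
rewrite ler_pdivlMl//.
have h1 : `|- (2 * s * y)| <= s * s + y * y.
  by rewrite ler_norml; apply/andP; split; [have := sqr_ge0 (s - y)|have := sqr_ge0 (s + y)]; nra.
by apply: ler_pM => //; exact: ltW.
Qed.

Lemma pk_cont (F : set_system nat) {FF : Filter F} (a_ : nat -> R) (a y : R) : 0 < a -> a_ n @[n --> F] --> a ->
  [/\ pk (a_ n) y @[n --> F] --> pk a y, pk_s (a_ n) y @[n --> F] --> pk_s a y &
      pk_y (a_ n) y @[n --> F] --> pk_y a y].
Proof.
move=> a0 ca; have d0 : a * a + y * y != 0 by rewrite gt_eqF// den_gt0.
have cd : (a_ n * a_ n + y * y)%R @[n --> F] --> a * a + y * y.
  by apply: cvgD; [exact: cvgM|exact: cvg_cst].
have cd2 : ((a_ n * a_ n + y * y) * (a_ n * a_ n + y * y))%R @[n --> F] --> (a * a + y * y) * (a * a + y * y).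
  exact: cvgM.
split.
- by apply: cvgM => //; exact: cvgV.
- apply: cvgM; last by apply: cvgV => //; rewrite mulf_neq0.
  by apply: cvgB; [exact: cvg_cst|exact: cvgM].
- apply: cvgM; last by apply: cvgV => //; rewrite mulf_neq0.
  by apply: cvgN; apply: cvgMl; exact: cvgMr.
Qed.

End KernelCalculus.

Section HalfGreen.
Context {R : realType}.
Local Notation plane := (R * R)%type.
Local Notation leb1 := (@lebesgue_measure R).
Local Notation mR := (measurableTypeR R).
Local Notation mplane := (measurableTypeR R * measurableTypeR R)%type.
Local Notation Om := (@Omega R).
Local Notation G := (`]0, 1[%classic : set R).
Local Notation mO := (@measurable_Omega R).
Local Notation mG := (measurable_oo (0 : R) 1).
Implicit Types (O : set plane) (u v w : plane -> R) (i : 'I_2).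

Lemma natcvgD (f g : nat -> R) (a b : R) : f n @[n --> \oo] --> a -> g n @[n --> \oo] --> b ->
  (f n + g n) @[n --> \oo] --> a + b.
Proof. exact: cvgD. Qed.

Lemma natcvg_eq (f g : nat -> R) (a b : R) : (forall n, f n = g n) ->
  f n @[n --> \oo] --> a -> g n @[n --> \oo] --> b -> a = b.
Proof. by move=> /funext -> ca cb; exact: (cvg_unique _ ca cb). Qed.

Lemma rect_sub_Om a b : 0 <= a -> b <= 1 -> rect a b 0 1 `<=` Om.
Proof.
by move=> a0 b1 x /rectP[/andP[x1 x2] x3]; rewrite OmegaE; apply/rectP; rewrite (le_lt_trans a0 x1) (lt_le_trans x2 b1).
Qed.

Lemma smooth_L2_rect a b w : smooth w -> L2 leb2 (rect a b 0 1) w.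
Proof. by move=> sw; apply: cont_L2_rect; exact: smooth_cont. Qed.

Lemma green_smooth1 a b u w : a <= b -> smooth u -> smooth w ->
  ip leb2 (rect a b 0 1) (partial ord0 u) w + ip leb2 (rect a b 0 1) u (partial ord0 w) =
  \int[leb1]_(y in G) (u (b, y) * w (b, y) - u (a, y) * w (a, y)).
Proof.
move=> ab su sw; have sp := smoothM su sw.
have mr : measurable (rect a b 0 1 : set mplane) := measurable_rect a b 0 1.
rewrite !ipE -RintegralD//; last 2 first.
- by apply: L2_mul => //; [exact: smooth_L2_rect (smooth_partial ord0 su)|exact: smooth_L2_rect].
- by apply: L2_mul => //; [exact: smooth_L2_rect|exact: smooth_L2_rect (smooth_partial ord0 sw)].
transitivity (\int[leb2]_(x in rect a b 0 1) partial ord0 (fun x => u x * w x) x).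
  by apply: Rint_ext => x _; rewrite partialM//; ring.
rewrite (fub2 (m1 := @lebs R) (m2 := @lebs R) (measurable_oo a b) mG _).2; last first.
  by apply: (@cont_L1_rect R a b 0 1); exact: smooth_cont (smooth_partial ord0 sp).
apply: Rint_ext => y _.
exact: (FTC_oo ab (fun s => is_derive_slice1 s y sp) (slice1_cont (smooth_cont (smooth_partial ord0 sp)))).
Qed.

Lemma green_smooth2 a b u w : smooth u -> smooth w ->
  ip leb2 (rect a b 0 1) (partial ord_max u) w + ip leb2 (rect a b 0 1) u (partial ord_max w) =
  \int[leb1]_(s in `]a, b[%classic) (u (s, 1) * w (s, 1) - u (s, 0) * w (s, 0)).
Proof.
move=> su sw; have sp := smoothM su sw.
have mr : measurable (rect a b 0 1 : set mplane) := measurable_rect a b 0 1.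
rewrite !ipE -RintegralD//; last 2 first.
- by apply: L2_mul => //; [exact: smooth_L2_rect (smooth_partial ord_max su)|exact: smooth_L2_rect].
- by apply: L2_mul => //; [exact: smooth_L2_rect|exact: smooth_L2_rect (smooth_partial ord_max sw)].
transitivity (\int[leb2]_(x in rect a b 0 1) partial ord_max (fun x => u x * w x) x).
  by apply: Rint_ext => x _; rewrite partialM//; ring.
rewrite (fub1 (m1 := @lebs R) (m2 := @lebs R) (measurable_oo a b) mG _).2; last first.
  by apply: (@cont_L1_rect R a b 0 1); exact: smooth_cont (smooth_partial ord_max sp).
apply: Rint_ext => s _.
exact: (FTC_oo ler01 (fun y => is_derive_slice2 s y sp) (slice2_cont (smooth_cont (smooth_partial ord_max sp)))).
Qed.

Lemma L2_sub (D D' : set mplane) (f : plane -> R) : measurable D -> measurable D' -> D' `<=` D ->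
  L2 leb2 D f -> L2 leb2 D' f.
Proof.
move=> mD mD' sub [mf If]; split; first exact: measurable_funS mf.
exact: integrableS If.
Qed.

Lemma sqdist_sub (D D' : set mplane) (f g : plane -> R) : measurable D -> measurable D' -> D' `<=` D ->
  L2 leb2 D f -> L2 leb2 D g -> sqdist leb2 D' f g <= sqdist leb2 D f g.
Proof.
move=> mD mD' sub Lf Lg; rewrite !sqdistE.
have [mfg Ifg] := L2B mD Lf Lg.
rewrite -[in leLHS](setIidr sub) Rintegral_mkcondr.
apply: le_Rintegral => //.
  rewrite -restrict_EFin; apply: (integrable_restrict leb2 mD' mD (EFin \o (fun x => (f x - g x) ^+ 2))).1.
  by rewrite setIC (setIidl sub); exact: (integrableS mD mD' sub Ifg).
by move=> x Ox; rewrite patchE; case: ifP => // _; exact: sqr_ge0.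
Qed.

Section Limit.
Variables (O : set plane) (u : plane -> R).
Hypotheses (OO : O `<=` Om) (hu : H10 O u).

Lemma cvg_ip_sub a b (f_ : nat -> plane -> R) f w : 0 <= a -> b <= 1 -> smooth w ->
  (forall n, L2 leb2 Om (f_ n)) -> L2 leb2 Om f -> sqdist leb2 Om (f_ n) f @[n --> \oo] --> 0 ->
  ip leb2 (rect a b 0 1) (f_ n) w @[n --> \oo] --> ip leb2 (rect a b 0 1) f w.
Proof.
move=> a0 b1 sw Lf_ Lf cf.
have mr : measurable (rect a b 0 1 : set mplane) := measurable_rect a b 0 1.
have sub := rect_sub_Om a0 b1.
have S g : L2 leb2 Om g -> L2 leb2 (rect a b 0 1) g by exact: L2_sub.
apply: (cvg_ip mr (fun n => S _ (Lf_ n)) (S _ Lf) (smooth_L2_rect _ _ sw)).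
apply: (squeeze_cvgr _ (cvg_cst 0) cf); near=> n.
by rewrite sqdist_ge0/=; exact: sqdist_sub.
Unshelve. all: by end_near. Qed.

Lemma green_H10_y a b w : 0 <= a -> b <= 1 -> smooth w ->
  ip leb2 (rect a b 0 1) (gD ord_max u) w = - ip leb2 (rect a b 0 1) u (partial ord_max w).
Proof.
move=> a0 b1 sw; have [phi [tp Lu Lw cu cw]] := H10_approx hu.
have c1 := cvg_ip_sub a0 b1 sw (fun n => test_Omega_L2 (test_partial ord_max (tp n))) (Lw ord_max) (cw ord_max).
have c2 := cvg_ip_sub a0 b1 (smooth_partial ord_max sw) (fun n => test_Omega_L2 (tp n)) Lu cu.
apply/eqP; rewrite -addr_eq0; apply/eqP.
apply: natcvg_eq (natcvgD c1 c2) (cvg_cst 0) => n.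
  rewrite green_smooth2//; last exact: test_smooth (tp n).
  have h s y : ~ (0 < y < 1) -> phi n (s, y) = 0.
    by move=> hy; apply: (test_out (test_sub OO (tp n))) => -[_]; exact: hy.
  transitivity (\int[leb1]_(s in `]a, b[%classic) (0 : R)).
    by apply: Rint_ext => s _; rewrite !h ?mul0r ?subrr// ltxx ?andbF.
  by rewrite Rintegral_cst ?mul0r//; exact: measurable_oo.
Qed.

(** Green's formula on the two halves of the square, by density of test
    functions; their traces on the common side have opposite signs. *)
Lemma green_H10_half w : smooth w ->
  ip leb2 (rect 0 half 0 1) (gD ord0 u) w + ip leb2 (rect 0 half 0 1) u (partial ord0 w) =
    \int[leb1]_(y in G) (trace_fun u y * w (half, y)) /\
  ip leb2 (rect half 1 0 1) (gD ord0 u) w + ip leb2 (rect half 1 0 1) u (partial ord0 w) =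
    - \int[leb1]_(y in G) (trace_fun u y * w (half, y)).
Proof.
move=> sw; have [phi hp] := H10_approx hu; have [tp Lu Lw cu cw] := hp.
have h0 := ltW (@half_gt0 R); have h1 := ltW (@half_lt1 R).
have out n y : phi n (0, y) = 0 /\ phi n (1, y) = 0.
  by split; apply: (test_out (test_sub OO (tp n))) => -[/=]; rewrite ltxx ?andbF.
have ct : ip leb1 G (fun y => phi n (half, y)) (fun y => w (half, y)) @[n --> \oo] -->
    ip leb1 G (trace_fun u) (fun y => w (half, y)).
  apply: (cvg_ip mG) => //.
  - by move=> n; exact: test_trace_L2 (test_smooth (tp n)).
  - exact: trace_fun_L2 hu.
  - exact: test_trace_L2.
  - exact: psi_trace_cvg OO hp hu.
split.
  have c1 := cvg_ip_sub (lexx 0) h1 sw (fun n => test_Omega_L2 (test_partial ord0 (tp n))) (Lw ord0) (cw ord0).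
  have c2 := cvg_ip_sub (lexx 0) h1 (smooth_partial ord0 sw) (fun n => test_Omega_L2 (tp n)) Lu cu.
  rewrite -ipE; apply: natcvg_eq (natcvgD c1 c2) ct => n.
  rewrite green_smooth1//; last exact: test_smooth (tp n).
  by rewrite ipE; apply: Rint_ext => y _; rewrite (out n y).1 mul0r subr0.
have c1 := cvg_ip_sub h0 (lexx 1) sw (fun n => test_Omega_L2 (test_partial ord0 (tp n))) (Lw ord0) (cw ord0).
have c2 := cvg_ip_sub h0 (lexx 1) (smooth_partial ord0 sw) (fun n => test_Omega_L2 (tp n)) Lu cu.
rewrite -ipE; apply: natcvg_eq (natcvgD c1 c2) (cvgN ct) => n.
rewrite green_smooth1//; last exact: test_smooth (tp n).
have Lc := L2_mul mG (test_trace_L2 (test_smooth (tp n))) (test_trace_L2 sw).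
rewrite /= ipE -(RintN mG Lc).
by apply: Rint_ext => y _; rewrite (out n y).2 mul0r sub0r.
Qed.

End Limit.
End HalfGreen.

Section KinkedTest.
Context {R : realType}.
Local Notation plane := (R * R)%type.
Local Notation leb1 := (@lebesgue_measure R).
Local Notation mR := (measurableTypeR R).
Local Notation mplane := (measurableTypeR R * measurableTypeR R)%type.
Local Notation Om := (@Omega R).
Local Notation G := (`]0, 1[%classic : set R).
Local Notation mO := (@measurable_Omega R).
Local Notation mG := (measurable_oo (0 : R) 1).
Implicit Types (O : set plane) (v w : plane -> R) (i : 'I_2).

Lemma Rdominated_pt d (T : measurableType d) (mu : {measure set T -> \bar R}) (D : set T)
  (mD : measurable D) (f_ : nat -> T -> R) (f g : T -> R) :
  (forall n, measurable_fun D (f_ n)) -> L1 mu D g ->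
  (forall x, D x -> f_ n x @[n --> \oo] --> f x) -> (forall n x, D x -> `|f_ n x| <= g x) ->
  L1 mu D f /\ \int[mu]_(x in D) f_ n x @[n --> \oo] --> \int[mu]_(x in D) f x.
Proof.
move=> mf Lg cf fg; apply: (Rdominated mD mf _ Lg).
- exact: measurable_fun_cvg mf cf.
- exact: aeT.
- by apply: aeT => x n; exact: fg.
Qed.

Lemma bound_combination (a p z k w A B C : R) : `|a| <= 1 -> `|p| <= A -> `|z| <= B -> `|k| <= C ->
  `|w| <= B -> `|a * p * z + k * w| <= A * B + C * B.
Proof.
move=> ha hp hz hk hw; apply: (le_trans (ler_normD _ _)); apply: lerD; rewrite !normrM; apply: ler_pM => //.
by rewrite -[leRHS]mul1r; exact: ler_pM.
Qed.

Section Equation.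
Variables (u V : plane -> R) (l : R -> R).
Hypotheses (hu : H10 Om u) (Ll : L1 leb1 G l).
Hypothesis heq : forall v, H10 Om v ->
  grad_dot Om u v + \int[leb1]_(y in G) (l y * trG v y) = load_pair v.

Lemma test_equation psi : test_function Om psi ->
  \int[leb2]_(x in Om) (gD ord0 u x * partial ord0 psi x) +
  \int[leb2]_(x in Om) (gD ord_max u x * partial ord_max psi x) +
  \int[leb1]_(y in G) (l y * psi (half, y)) = \int[leb2]_(x in Om) (20 * psi x).
Proof.
move=> tp; have sO : Om `<=` Om by [].
have [hp hD] := H10_test sO tp; have := heq hp.
rewrite (grad_dotE hu hp) /load_pair /load => <-.
have E i : ip leb2 Om (gD i u) (gD i psi) = \int[leb2]_(x in Om) (gD i u x * partial i psi x).
  by rewrite ipC (ip_ae (H10_wD_L2 i hp) (test_Omega_L2 (test_partial i tp)) (H10_wD_L2 i hu) (hD i)) ipC ipE.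
rewrite !E; congr (_ + _); apply: Rint_ae_eq => //.
- apply: measurable_funM; first exact: L1_meas Ll.
  exact: (test_trace_L2 (test_smooth tp)).1.
- by apply: measurable_funM; [exact: L1_meas Ll|exact: (trG_L2 sO hp).1].
- by apply: aeS (trG_test sO tp) => y h Gy; rewrite h.
Qed.

Variables (zeta : plane -> R) (eps y1 : R).
Hypotheses (tz : test_function Om zeta) (eps0 : 0 < eps).

Let off (x : plane) : R := x.2 - y1.
Let soff : smooth off. Proof. by apply: smoothD; [exact: smooth_snd|exact: smooth_cst]. Qed.
Let sz := test_smooth tz.

(** The kernel with pole at distance eps behind the line, reflected to both
    sides: as a function of the distance `|x.1 - half| + eps it is harmonic
    off the line and has a kink on it. *)
Definition dist_eps (x : plane) : R := `|x.1 - half| + eps.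
(** The partial derivatives, off the line, of the kinked kernel times
    zeta. *)
Definition kink_s (x : plane) : R :=
  Num.sg (x.1 - half) * pk_s (dist_eps x) (x.2 - y1) * zeta x + pk (dist_eps x) (x.2 - y1) * partial ord0 zeta x.
Definition kink_y (x : plane) : R :=
  pk_y (dist_eps x) (x.2 - y1) * zeta x + pk (dist_eps x) (x.2 - y1) * partial ord_max zeta x.

(* The distance to the line, smoothed: the square root of rad n tends to
   it from above when n grows. *)
Let rad n (x : plane) : R := (x.1 - half) * (x.1 - half) + n.+1%:R^-1 * n.+1%:R^-1.
Let rad0 n x : 0 < rad n x.
Proof. by rewrite /rad ltr_wpDl ?mulr_gt0 ?invr_gt0// -expr2 sqr_ge0. Qed.
Let ss : smooth (fun x : plane => x.1 - half).
Proof. by apply: smoothD; [exact: smooth_fst|exact: smooth_cst]. Qed.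
Let srad n : smooth (rad n).
Proof. by apply: smoothD; [exact: smoothM|exact: smooth_cst]. Qed.
Let mn n (x : plane) : R := Num.sqrt (rad n x) + eps.
Let smn n : smooth (mn n).
Proof. by apply: smoothD; [exact: smooth_sqrt|exact: smooth_cst]. Qed.
Let mn0 n x : 0 < mn n x.
Proof. by rewrite /mn ltr_wpDl// sqrtr_ge0. Qed.
Let mn_ge n x : eps <= mn n x.
Proof. by rewrite /mn lerDr sqrtr_ge0. Qed.

Let partial_ss i x : partial i (fun x : plane => x.1 - half) x = (basis_vec i).1.
Proof. by rewrite partialD ?partial_cst ?addr0 ?partial_fst//; [exact: smooth_fst|exact: smooth_cst]. Qed.

Let partial_off i x : partial i off x = (basis_vec i).2.
Proof. by rewrite partialD ?partial_cst ?addr0 ?partial_snd//; [exact: smooth_snd|exact: smooth_cst]. Qed.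

Let pmn n i x : partial i (mn n) x = (x.1 - half) / Num.sqrt (rad n x) * (basis_vec i).1.
Proof.
rewrite partialD ?partial_cst ?addr0; [|exact: smooth_sqrt|exact: smooth_cst].
rewrite partial_sqrt// partialD ?partial_cst ?addr0; [|exact: smoothM|exact: smooth_cst].
have n0 : Num.sqrt (rad n x) != 0 by rewrite gt_eqF// sqrtr_gt0.
by rewrite partialM// partial_ss; field.
Qed.

Let inv0 : (n.+1%:R^-1 : R) @[n --> \oo] --> 0.
Proof.
apply/cvgrPdist_lt => e e0; near=> n; rewrite sub0r normrN ger0_norm ?invr_ge0//.
by near: n; exact: (near_infty_natSinv_lt (PosNum e0)).
Unshelve. all: by end_near. Qed.

Let crad x : rad n x @[n --> \oo] --> (x.1 - half) ^+ 2.
Proof.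
rewrite -[X in _ --> X]addr0 expr2; apply: cvgD; first exact: cvg_cst.
by rewrite -(mulr0 0); exact: cvgM.
Qed.

Let csq x : Num.sqrt (rad n x) @[n --> \oo] --> `|x.1 - half|.
Proof. by rewrite -sqrtr_sqr; apply: (@continuous_cvg _ _ _ _ _ _ Num.sqrt); [exact: sqrt_continuous|exact: crad]. Qed.

Let cmn x : mn n x @[n --> \oo] --> dist_eps x.
Proof. by apply: cvgD; [exact: csq|exact: cvg_cst]. Qed.

Let cdm x : (x.1 - half) / Num.sqrt (rad n x) @[n --> \oo] --> Num.sg (x.1 - half).
Proof.
have [->|n0] := eqVneq (x.1 - half) 0.
  by rewrite sgr0; under eq_fun do rewrite mul0r; exact: cvg_cst.
have -> : Num.sg (x.1 - half) = (x.1 - half) / `|x.1 - half|.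
  by apply/(canRL (mulfK _)); rewrite ?normr_eq0// -numEsg.
by apply: cvgMr; apply: cvgV; [rewrite normr_eq0|exact: csq].
Qed.

Let pz n x := pk (mn n x) (off x) * zeta x.
Let tpz n : test_function Om (pz n).
Proof. by apply: testMl => //; exact: smooth_pk. Qed.

Let ppz n i x : partial i (pz n) x = ((x.1 - half) / Num.sqrt (rad n x) * (basis_vec i).1 * pk_s (mn n x) (off x) +
  pk_y (mn n x) (off x) * (basis_vec i).2) * zeta x + pk (mn n x) (off x) * partial i zeta x.
Proof.
rewrite partialM//; last exact: smooth_pk.
by rewrite partial_pk// pmn partial_off; ring.
Qed.

Let bz : exists2 B, 0 < B & forall x, `|zeta x| <= B /\ forall i, `|partial i zeta x| <= B.
Proof.
have [B B0 hB] := test_bounded tz.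
have [B1 B10 hB1] := test_bounded (test_partial ord0 tz).
have [B2 B20 hB2] := test_bounded (test_partial ord_max tz).
exists (B + (B1 + B2)); first by rewrite !addr_gt0.
move=> x; split; first by apply: (le_trans (hB x)); rewrite lerDl ltW// addr_gt0.
move=> i; have [->|->] := I2_cases i.
  apply: (le_trans (hB1 x)); lra.
apply: (le_trans (hB2 x)); lra.
Qed.

Let bnd n x : [/\ `|pk (mn n x) (off x)| <= eps^-1, `|pk_s (mn n x) (off x)| <= (eps * eps)^-1 &
  `|pk_y (mn n x) (off x)| <= (eps * eps)^-1].
Proof.
have h : eps * eps <= mn n x * mn n x + off x * off x.
  rewrite -[leLHS]addr0; apply: lerD; last by rewrite -expr2 sqr_ge0.
  by apply: ler_pM; rewrite ?mn_ge// ltW.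
by split; [exact: pk_bound|exact: pk_s_bound|exact: pk_y_bound].
Qed.

Let dm_le1 n x : `|(x.1 - half) / Num.sqrt (rad n x)| <= 1.
Proof.
have r0 : 0 < Num.sqrt (rad n x) by rewrite sqrtr_gt0.
rewrite normrM normfV (gtr0_norm r0) ler_pdivrMr// mul1r -sqrtr_sqr ler_wsqrtr// expr2 lerDl.
by rewrite mulr_ge0.
Qed.

(** The kinked kernel times zeta is not smooth, but the test functions in which
    the distance to the line is smoothed converge to it, with their
    gradients, pointwise and boundedly for fixed eps. *)
Lemma kinked_equation :
  [/\ L1 leb2 Om (fun x => gD ord0 u x * kink_s x), L1 leb2 Om (fun x => gD ord_max u x * kink_y x),
      L1 leb2 Om (fun x => pk (dist_eps x) (x.2 - y1) * zeta x) &
  \int[leb2]_(x in Om) (gD ord0 u x * kink_s x) +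
  \int[leb2]_(x in Om) (gD ord_max u x * kink_y x) +
  \int[leb1]_(y in G) (l y * (pk eps (y - y1) * zeta (half, y))) =
  \int[leb2]_(x in Om) (20 * (pk (dist_eps x) (x.2 - y1) * zeta x))].
Proof.
have [B B0 hB] := bz.
have d0 x : 0 < dist_eps x by rewrite /dist_eps ltr_wpDl.
have Lg i : L1 leb2 Om (gD i u) := L2_Omega_L1 (H10_wD_L2 i hu).
pose K := (eps * eps)^-1 * B + eps^-1 * B.
have ee0 : 0 < (eps * eps)^-1 by rewrite invr_gt0 mulr_gt0.
have e0 : 0 < eps^-1 by rewrite invr_gt0.
have m_sm w v : L1 leb2 Om v -> smooth w -> measurable_fun (Om : set mplane) (fun x => v x * w x).
  move=> Lv sw; apply: measurable_funM; first exact: L1_meas Lv.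
  by apply: plane_continuous_measurable => //; exact: smooth_cont.
have [I0 c0] : L1 leb2 Om (fun x => gD ord0 u x * kink_s x) /\
   \int[leb2]_(x in Om) (gD ord0 u x * partial ord0 (pz n) x) @[n --> \oo] -->
   \int[leb2]_(x in Om) (gD ord0 u x * kink_s x).
  apply: (Rdominated_pt mO (g := fun x => K * `|gD ord0 u x|)).
  - move=> n; apply: m_sm => //; exact: smooth_partial (test_smooth (tpz n)).
  - exact: (L1Zl mO _ (L1_abs (Lg ord0))).
  - move=> x _; apply: cvgMr; rewrite /kink_s.
    have [k1 k2 _] := pk_cont (off x) (d0 x) (@cmn x).
    under eq_fun do rewrite ppz basis_vec0/= mulr1 mulr0 addr0.
    by apply: cvgD; [apply: cvgMl; apply: cvgM => //; exact: cdm|exact: cvgMl].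
  - move=> n x _; rewrite normrM mulrC ler_wpM2r// ppz basis_vec0/= mulr1 mulr0 addr0.
    have [b1 b2 _] := bnd n x; have [z1 /(_ ord0) z2] := hB x.
    by apply: bound_combination => //; exact: dm_le1.
have [I1 c1] : L1 leb2 Om (fun x => gD ord_max u x * kink_y x) /\
   \int[leb2]_(x in Om) (gD ord_max u x * partial ord_max (pz n) x) @[n --> \oo] -->
   \int[leb2]_(x in Om) (gD ord_max u x * kink_y x).
  apply: (Rdominated_pt mO (g := fun x => K * `|gD ord_max u x|)).
  - move=> n; apply: m_sm => //; exact: smooth_partial (test_smooth (tpz n)).
  - exact: (L1Zl mO _ (L1_abs (Lg ord_max))).
  - move=> x _; apply: cvgMr; rewrite /kink_y.
    have [k1 _ k2] := pk_cont (off x) (d0 x) (@cmn x).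
    under eq_fun do rewrite ppz basis_vec1/= mulr1 mulr0 mul0r add0r.
    by apply: cvgD; exact: cvgMl.
  - move=> n x _; rewrite normrM mulrC ler_wpM2r// ppz basis_vec1/= mulr1 mulr0 mul0r add0r.
    have [b1 _ b2] := bnd n x; have [z1 /(_ ord_max) z2] := hB x.
    by rewrite -[pk_y _ _]mul1r; apply: bound_combination => //; rewrite normr1.
have [I2 c2] : L1 leb1 G (fun y => l y * (pk (dist_eps (half, y)) (y - y1) * zeta (half, y))) /\
   \int[leb1]_(y in G) (l y * pz n (half, y)) @[n --> \oo] -->
   \int[leb1]_(y in G) (l y * (pk (dist_eps (half, y)) (y - y1) * zeta (half, y))).
  apply: (Rdominated_pt mG (g := fun y => (eps^-1 * B) * `|l y|)).
  - move=> n; apply: measurable_funM; first exact: L1_meas Ll.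
    exact: (test_trace_L2 (test_smooth (tpz n))).1.
  - exact: (L1Zl mG _ (L1_abs Ll)).
  - move=> y _; apply: cvgMr; apply: cvgMl.
    by have [] := pk_cont (off (half, y)) (d0 (half, y)) (@cmn (half, y)).
  - move=> n y _; rewrite normrM mulrC ler_wpM2r// normrM.
    have [b1 _ _] := bnd n (half, y); have [z1 _] := hB (half, y).
    by apply: ler_pM.
have [I3 c3] : L1 leb2 Om (fun x => 20 * (pk (dist_eps x) (x.2 - y1) * zeta x)) /\
   \int[leb2]_(x in Om) (20 * pz n x) @[n --> \oo] -->
   \int[leb2]_(x in Om) (20 * (pk (dist_eps x) (x.2 - y1) * zeta x)).
  apply: (Rdominated_pt mO (g := fun x => 20 * (eps^-1 * B))).
  - move=> n; apply: measurable_funM => //.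
    by apply: plane_continuous_measurable => //; exact: smooth_cont (test_smooth (tpz n)).
  - by rewrite OmegaE; apply: (@cont_L1_rect R 0 1 0 1 (fun=> 20 * (eps^-1 * B))) => x; exact: cvg_cst.
  - move=> x _; apply: cvgMr; apply: cvgMl.
    by have [] := pk_cont (off x) (d0 x) (@cmn x).
  - move=> n x _; rewrite normrM (ger0_norm (x := 20))// ler_wpM2l// normrM.
    have [b1 _ _] := bnd n x; have [z1 _] := hB x.
    by apply: ler_pM.
split => //.
  by have := L1Zl mO 20^-1 I3; apply: L1_eq => // x _; field.
have -> : \int[leb1]_(y in G) (l y * (pk eps (y - y1) * zeta (half, y))) =
  \int[leb1]_(y in G) (l y * (pk (dist_eps (half, y)) (y - y1) * zeta (half, y))).
  by apply: Rint_ext => y _; rewrite /dist_eps/= subrr normr0 add0r.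
apply: natcvg_eq (natcvgD (natcvgD c0 c1) c2) c3 => n.
exact: test_equation (tpz n).
Qed.

End Equation.
End KinkedTest.

(** * Poisson averages of the multiplier *)
Section HalfFormula.
Context {R : realType}.
Local Notation plane := (R * R)%type.
Local Notation leb1 := (@lebesgue_measure R).
Local Notation mR := (measurableTypeR R).
Local Notation mplane := (measurableTypeR R * measurableTypeR R)%type.
Local Notation Om := (@Omega R).
Local Notation L := (rect 0 half 0 1 : set plane).
Local Notation Rr := (rect half 1 0 1 : set plane).
Local Notation G := (`]0, 1[%classic : set R).
Local Notation mO := (@measurable_Omega R).
Local Notation mG := (measurable_oo (0 : R) 1).
Implicit Types (O : set plane) (v w : plane -> R) (i : 'I_2).

Lemma partial2_fst (f : R -> R) (x : plane) : smooth (fun x : plane => f x.1) ->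
  partial ord_max (fun x : plane => f x.1) x = 0.
Proof.
move=> sf; case: x => s y; have h1 := is_derive_slice2 s y sf.
by rewrite -(@derive_val _ _ _ _ _ _ _ h1) /= derive_cst.
Qed.

Lemma Rint_Omega_split f : L1 leb2 Om f ->
  \int[leb2]_(x in Om) f x = \int[leb2]_(x in L) f x + \int[leb2]_(x in Rr) f x.
Proof.
move=> Lf.
have ml : measurable (L : set mplane) := measurable_rect 0 half 0 1.
have mr : measurable (Rr : set mplane) := measurable_rect half 1 0 1.
have subL : L `<=` Om := rect_sub_Om (lexx 0) (ltW half_lt1).
have subR : Rr `<=` Om := rect_sub_Om (ltW half_gt0) (lexx 1).
have ext (D : set mplane) : measurable D -> D `<=` Om -> L1 leb2 Om (f \_ D) /\
    \int[leb2]_(x in Om) (f \_ D) x = \int[leb2]_(x in D) f x.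
  move=> mD DO; split.
    rewrite /L1 -restrict_EFin; apply: (integrable_restrict leb2 mD mO (EFin \o f)).1.
    by rewrite setIC (setIidl DO); exact: integrableS mO mD DO Lf.
  rewrite (Rint_sub_supp DO).
    by apply: Rint_ext => x Dx; rewrite patchE mem_set.
  by move=> x _ nD; rewrite patchE memNset.
have [L1' E1] := ext _ ml subL; have [L2' E2] := ext _ mr subR.
rewrite -E1 -E2 -RintegralD//.
apply: Rint_ae_eq => //; [exact: L1_meas Lf|exact: L1_meas (L1D mO L1' L2')|].
apply: aeS (null_fst half) => x xh; rewrite OmegaE => /rectP[/andP[x0 x1] x2].
rewrite !patchE; have [lt|gt|/xh//] := ltgtP x.1 half.
  rewrite mem_set; last by apply/rectP; rewrite x0.
  by rewrite memNset ?addr0// => /rectP[/andP[h _] _]; rewrite ltNge (ltW lt) in h.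
rewrite memNset; last by move=> /rectP[/andP[_ h] _]; rewrite ltNge (ltW gt) in h.
by rewrite mem_set ?add0r//; apply/rectP; rewrite gt.
Qed.

Lemma lap_algebra (b e z0 z a d z00 c z1 z11 : R) :
  b * e * z0 + z * a + (d * z00 + z0 * (b * e)) + (c * z1 + z * - a + (d * z11 + z1 * c)) =
  2 * (e * b * z0 + c * z1) + d * (z00 + z11).
Proof. by ring. Qed.

Lemma parabola_algebra (i j p00 p11 p r : R) : - 20 * i + j = 0 -> p11 = 0 -> j + p00 = r ->
  p = p00 + p11 -> 20 * i + p = r.
Proof. by move=> ? ? ? ?; lra. Qed.

Lemma side_algebra (X0 X1 I U00 U11 PL T S s : R) : X0 + U00 = s * T -> X1 = - U11 ->
  20 * I + PL = s * S -> X0 + X1 - 20 * I = - (U00 + U11 - PL) + s * (T - S).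
Proof. by move=> ? ? ?; lra. Qed.

Lemma sum_algebra (g0L g0R g1L g1R lp IL IR JL JR TL TR K : R) :
  g0L + g0R + (g1L + g1R) + lp = 20 * (IL + IR) ->
  g0L + g1L - 20 * IL = - JL + - -1 * TL -> g0R + g1R - 20 * IR = - JR + -1 * TR ->
  TL - TR = - 2 * K -> lp = JL + JR + 2 * K.
Proof. by move=> ? ? ? ?; lra. Qed.

Section Side.
Variables (eps y1 e : R) (zeta : plane -> R).
Hypotheses (eps0 : 0 < eps) (tz : test_function Om zeta) (e2 : e * e = 1).
Let sz := test_smooth tz.

Let off (x : plane) : R := x.2 - y1.
Let soff : smooth off. Proof. by apply: smoothD; [exact: smooth_snd|exact: smooth_cst]. Qed.
Let partial_off i x : partial i off x = (basis_vec i).2.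
Proof. by rewrite partialD ?partial_cst ?addr0 ?partial_snd//; [exact: smooth_snd|exact: smooth_cst]. Qed.

(** On one side of the line, given by the sign e, the kinked kernel is
    replaced by a smooth function on the whole square that coincides with it
    there. The distance eps + st would become negative on the other side, so
    it is cut off at - st = eps / 2. *)
Let st (t : R) : R := e * (t - half).
Let cut (t : R) : R := step (- (2 / eps) * st t).
Let m1 (t : R) : R := eps + st t * (1 + - cut t).
Let m (x : plane) : R := m1 x.1.

Let s_st : smooth (fun x : plane => st x.1).
Proof.
apply: smoothM; first exact: smooth_cst.
by apply: smoothD; [exact: smooth_fst|exact: smooth_cst].
Qed.
Let s_cut : smooth (fun x : plane => cut x.1).
Proof. by apply: smooth_step; apply: smoothM => //; exact: smooth_cst. Qed.
Let s_1cut : smooth (fun x : plane => 1 + - cut x.1).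
Proof. by apply: smoothD; [exact: smooth_cst|exact: smoothN]. Qed.
Let sm : smooth m.
Proof. by apply: smoothD; [exact: smooth_cst|exact: smoothM]. Qed.

Let cut0 t : 0 <= st t -> cut t = 0.
Proof. by move=> h; apply: step_le0; rewrite mulNr oppr_le0 mulr_ge0// divr_ge0// ltW. Qed.

Let mE x : 0 <= st x.1 -> m x = eps + st x.1.
Proof. by move=> h; rewrite /m /m1 cut0// oppr0 addr0 mulr1. Qed.

Let m0 x : 0 < m x.
Proof.
rewrite /m /m1; set t := st x.1.
have [t0|t0] := leP 0 t; first by rewrite cut0// oppr0 addr0 mulr1 ltr_pwDl.
have c1 := step_le1 (- (2 / eps) * t); have c0 := step_ge0 (- (2 / eps) * t).
have [h|h] := leP 1 (- (2 / eps) * t).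
  by rewrite /cut -/t (step_ge1 h) subrr mulr0 addr0.
have : - t < eps / 2.
  move: h; rewrite mulNr -mulrN mulrAC ltr_pdivrMr// mul1r => h.
  by rewrite ltr_pdivlMr// mulrC.
rewrite /cut -/t; move: c0 c1; set c := step _ => *; nra.
Qed.

Let pst i x : partial i (fun x : plane => st x.1) x = e * (basis_vec i).1.
Proof.
have s1 : smooth (fun x : plane => x.1 + - half) by apply: smoothD; [exact: smooth_fst|exact: smooth_cst].
rewrite partialM// ?partial_cst ?mulr0 ?addr0; [|exact: smooth_cst].
by rewrite partialD ?partial_cst ?addr0 ?partial_fst//; [exact: smooth_fst|exact: smooth_cst].
Qed.

Let near_st (x : plane) : 0 < st x.1 -> \forall z \near x, 0 < st (z : plane).1.
Proof.
move=> h; have c : st z.1 @[z --> x] --> st x.1 by exact: (smooth_cont s_st).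
exact: (cvgr_gt _ c).
Qed.

Let pm i x : 0 <= st x.1 -> partial i m x = e * (basis_vec i).1.
Proof.
move=> h; rewrite partialD; [|exact: smooth_cst|exact: smoothM].
rewrite partial_cst add0r partialM// pst cut0// oppr0 addr0 mul1r.
move: h; rewrite le_eqVlt => /predU1P[<-|h]; first by rewrite mul0r add0r.
rewrite (@partial_near_cst _ _ _ _ 1) ?mulr0 ?add0r//.
by apply: filterS (near_st h) => z hz; rewrite cut0 ?oppr0 ?addr0// ltW.
Qed.

Let ppm i j x : 0 < st x.1 -> partial j (partial i m) x = 0.
Proof.
move=> h; apply: (@partial_near_cst _ _ _ _ (e * (basis_vec i).1)).
by apply: filterS (near_st h) => z hz; apply: pm; exact: ltW.
Qed.

Let pm2 x : partial ord_max m x = 0.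
Proof. exact: (partial2_fst (f := m1)). Qed.

Definition side_test (x : plane) : R := pk (m x) (off x) * zeta x.

Lemma side_test_test : test_function Om side_test.
Proof. by apply: testMl => //; exact: smooth_pk. Qed.

Let ps0 : partial ord0 side_test = fun x => pk_s (m x) (off x) * partial ord0 m x * zeta x + pk (m x) (off x) * partial ord0 zeta x.
Proof.
apply/funext => x; rewrite partialM//; last exact: smooth_pk.
by rewrite partial_pk// partial_off basis_vec0/= mulr0 addr0; ring.
Qed.

Let ps1 : partial ord_max side_test = fun x => pk_y (m x) (off x) * zeta x + pk (m x) (off x) * partial ord_max zeta x.
Proof.
apply/funext => x; rewrite partialM//; last exact: smooth_pk.
by rewrite partial_pk// partial_off pm2 basis_vec1/= mulr0 mulr1 add0r; ring.
Qed.

Let sgE x : 0 < st x.1 -> Num.sg (x.1 - half) = e /\ dist_eps eps x = m x.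
Proof.
move=> h; have hx := mE (ltW h); rewrite hx /dist_eps (addrC eps).
have [e1|e1] : e = 1 \/ e = -1.
  have := e2; rewrite -expr2 => /eqP; rewrite sqrf_eq1 => /orP[/eqP|/eqP]; by [left|right].
  move: h; rewrite /st e1 mul1r => h; by rewrite gtr0_sg// gtr0_norm.
move: h; rewrite /st e1 mulN1r => h.
have h' : x.1 - half < 0 by rewrite -oppr_gt0.
by rewrite ltr0_sg// ltr0_norm.
Qed.

Lemma side_first x : 0 < e * (x.1 - half) ->
  [/\ partial ord0 side_test x = kink_s zeta eps y1 x,
      partial ord_max side_test x = kink_y zeta eps y1 x &
      side_test x = pk (dist_eps eps x) (x.2 - y1) * zeta x].
Proof.
move=> h; have [sg dm] := sgE h; rewrite ps0 ps1 /side_test /kink_s /kink_y dm sg; split => //.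
by rewrite pm ?basis_vec0/= ?mulr1 ?(mulrC e)//; exact: ltW.
Qed.

Lemma side_at_half y : partial ord0 side_test (half, y) =
  e * pk_s eps (y - y1) * zeta (half, y) + pk eps (y - y1) * partial ord0 zeta (half, y).
Proof.
have h : 0 <= st (half, y).1 by rewrite /st/= subrr mulr0.
have mh : m (half, y) = eps by rewrite mE// /st/= subrr mulr0 addr0.
by rewrite ps0 pm// mh basis_vec0/= mulr1 (mulrC e).
Qed.

(** As the kernel is harmonic, the Laplacian of kernel times zeta has only
    terms with derivatives of zeta: near a point of the line around which
    zeta is constant, it vanishes however small eps is. *)
Definition kink_lap (x : plane) : R :=
  2 * (Num.sg (x.1 - half) * pk_s (dist_eps eps x) (x.2 - y1) * partial ord0 zeta x +
       pk_y (dist_eps eps x) (x.2 - y1) * partial ord_max zeta x) +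
  pk (dist_eps eps x) (x.2 - y1) * (partial ord0 (partial ord0 zeta) x + partial ord_max (partial ord_max zeta) x).

Lemma side_second x : 0 < e * (x.1 - half) ->
  partial ord0 (partial ord0 side_test) x + partial ord_max (partial ord_max side_test) x = kink_lap x.
Proof.
move=> h; have [sg dm] := sgE h; rewrite ps0 ps1 /kink_lap dm sg.
have spk := smooth_pk sm soff m0; have spks := smooth_pk_s sm soff m0; have spky := smooth_pk_y sm soff m0.
have sdm i := smooth_partial i sm; have sdz i := smooth_partial i sz.
have S1 := smoothM spks (sdm ord0).
rewrite (partialD _ _ (smoothM S1 sz) (smoothM spk (sdz ord0))).
rewrite (partialM _ _ S1 sz) (partialM _ _ spks (sdm ord0)) (partialM _ _ spk (sdz ord0)).
rewrite (partialD _ _ (smoothM spky sz) (smoothM spk (sdz ord_max))).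
rewrite (partialM _ _ spky sz) (partialM _ _ spk (sdz ord_max)).
rewrite (partial_pk_s sm soff m0) !(partial_pk sm soff m0) (partial_pk_y sm soff m0) !partial_off.
rewrite ppm// pm2 (pm _ (ltW h)) basis_vec0 basis_vec1/= !mulr0 !mulr1 !addr0 !add0r.
set a := pk_ss _ _; set b := pk_s _ _; set c := pk_y _ _; set d := pk _ _.
have ea : e * (a * e) = a by rewrite mulrC -mulrA e2 mulr1.
rewrite ea; exact: lap_algebra.
Qed.

End Side.

Section Assemble.
Variables (u : plane -> R) (l : R -> R).
Hypotheses (hu : H10 Om u) (Ll : L1 leb1 G l).
Hypothesis heq : forall v, H10 Om v ->
  grad_dot Om u v + \int[leb1]_(y in G) (l y * trG v y) = load_pair v.
Variables (zeta : plane -> R) (eps y1 : R).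
Hypotheses (tz : test_function Om zeta) (eps0 : 0 < eps).

(** A particular solution: minus its Laplacian is the load 20, its trace on
    the line is the obstacle 1 and its normal derivative vanishes there. *)
Definition parabola (x : plane) : R := 1 + - (10 * ((x.1 + - half) * (x.1 + - half))).

Let sx : smooth (fun x : plane => x.1 + - half).
Proof. by apply: smoothD; [exact: smooth_fst|exact: smooth_cst]. Qed.
Let sx2 : smooth (fun x : plane => (x.1 + - half) * (x.1 + - half)).
Proof. exact: smoothM. Qed.

Lemma smooth_parabola : smooth parabola.
Proof.
apply: smoothD; first exact: smooth_cst.
by apply: smoothN; apply: smoothM; [exact: smooth_cst|exact: sx2].
Qed.
Let sP := smooth_parabola.

Let psx i x : partial i (fun x : plane => x.1 + - half) x = (basis_vec i).1.
Proof. by rewrite partialD ?partial_cst ?addr0 ?partial_fst//; [exact: smooth_fst|exact: smooth_cst]. Qed.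

Lemma partial_parabola i : partial i parabola = fun x => - 20 * (x.1 + - half) * (basis_vec i).1.
Proof.
apply/funext => x; rewrite partialD; [|exact: smooth_cst|by apply: smoothN; apply: smoothM; [exact: smooth_cst|]].
rewrite partial_cst add0r partialN; last by apply: smoothM; [exact: smooth_cst|].
rewrite partialM//; last exact: smooth_cst.
by rewrite partial_cst mulr0 addr0 partialM// psx; ring.
Qed.

Let c0 (c : R) : smooth (fun _ : plane => c) := smooth_cst c.

Let parab_side a b e : (a = 0 /\ b = half) \/ (a = half /\ b = 1) -> e * e = 1 ->
  let psi := side_test eps y1 e zeta in
  20 * \int[leb2]_(x in rect a b 0 1) psi x +
   ip leb2 (rect a b 0 1) parabola (fun x => partial ord0 (partial ord0 psi) x + partial ord_max (partial ord_max psi) x)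
  = (if a == 0 then 1 else -1) * \int[leb1]_(y in G) partial ord0 psi (half, y).
Proof.
move=> ab e2 psi; have tp : test_function Om psi by exact: side_test_test.
have sp := test_smooth tp; have s0 := smooth_partial ord0 sp; have s1 := smooth_partial ord_max sp.
have t0 := test_partial ord0 tp; have t1 := test_partial ord_max tp.
have lab : a <= b by case: ab => -[-> ->]; rewrite ?ltW// ?half_gt0// half_lt1.
have mr : measurable (rect a b 0 1 : set mplane) := measurable_rect a b 0 1.
have out f x : test_function Om f -> (x.1 = 0 \/ x.1 = 1 \/ x.2 = 0 \/ x.2 = 1) -> f x = 0.
  move=> tf h; apply: (test_out tf); rewrite OmegaE => /rectP[/andP[h1 h2] /andP[h3 h4]].
  by case: h => [h|[h|[h|h]]]; move: h1 h2 h3 h4; rewrite h ltxx.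
have L2s w : smooth w -> L2 leb2 (rect a b 0 1) w by exact: smooth_L2_rect.
have A := green_smooth1 lab sP s0.
have B := green_smooth2 a b sP s1.
have C := green_smooth1 lab (smooth_partial ord0 sP) sp.
have A0 : ip leb2 (rect a b 0 1) parabola (fun x => partial ord0 (partial ord0 psi) x + partial ord_max (partial ord_max psi) x)
   = ip leb2 (rect a b 0 1) parabola (partial ord0 (partial ord0 psi)) + ip leb2 (rect a b 0 1) parabola (partial ord_max (partial ord_max psi)).
  apply: ipDr => //; apply: L2s => //; exact: smooth_partial.
have B0 : ip leb2 (rect a b 0 1) (partial ord_max parabola) (partial ord_max psi) = 0.
  rewrite ipE; apply: Rint_ae0 => //.
    by have := L1_meas (L2_mul mr (L2s _ (smooth_partial ord_max sP)) (L2s _ s1)).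
  by apply: aeT => x _; rewrite partial_parabola basis_vec1/= mulr0 mul0r.
have B1 : \int[leb1]_(s in `]a, b[%classic) (parabola (s, 1) * partial ord_max psi (s, 1) - parabola (s, 0) * partial ord_max psi (s, 0)) = 0.
  transitivity (\int[leb1]_(s in `]a, b[%classic) (0 : R)).
    apply: Rint_ext => s _; rewrite !(out _ (s, _) t1); [by rewrite !mulr0 subrr|by right; right; left|by right; right; right].
  by rewrite Rintegral_cst ?mul0r//; exact: measurable_oo.
have C0 : ip leb2 (rect a b 0 1) (partial ord0 (partial ord0 parabola)) psi = - 20 * \int[leb2]_(x in rect a b 0 1) psi x.
  rewrite ipE -(RintegralZl _ mr); last exact: (L2_L1_rect (L2s _ sp)).
  apply: Rint_ext => x _; congr (_ * _).
  rewrite partial_parabola basis_vec0/=.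
  have -> : (fun x : plane => - 20 * (x.1 + - half) * 1) = (fun x : plane => (- 20 : R) * (x.1 + - half)).
    by apply/funext => z; rewrite mulr1.
  by rewrite partialM// partial_cst psx basis_vec0/=; ring.
have Z0 (f : plane -> R) y : test_function Om f -> f (0, y) = 0 /\ f (1, y) = 0.
  by move=> tf; split; apply: (out _ (_, y) tf); [left|right; left].
have C1 : \int[leb1]_(y in G) (partial ord0 parabola (b, y) * psi (b, y) - partial ord0 parabola (a, y) * psi (a, y)) = 0.
  transitivity (\int[leb1]_(s in G) (0 : R)); last by rewrite Rintegral_cst ?mul0r//; exact: measurable_oo.
  apply: Rint_ext => y _; rewrite partial_parabola; have [z0 z1] := Z0 _ y tp.
  by case: ab => -[-> ->]; rewrite /= ?z0 ?z1 subrr; ring.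
have A1 : \int[leb1]_(y in G) (parabola (b, y) * partial ord0 psi (b, y) - parabola (a, y) * partial ord0 psi (a, y)) =
   (if a == 0 then 1 else -1) * \int[leb1]_(y in G) partial ord0 psi (half, y).
  have P1 y : parabola (half, y) = 1 by rewrite /parabola/= subrr; ring.
  have Lh : L1 leb1 G (fun y => partial ord0 psi (half, y)).
    by apply: cont_L1; apply: slice2_cont; exact: smooth_cont.
  rewrite -(RintegralZl _ mG Lh); apply: Rint_ext => y _; have [z0 z1] := Z0 _ y t0.
  case: ab => -[-> ->]; first by rewrite eqxx P1 z0; ring.
  by rewrite (negbTE (lt0r_neq0 half_gt0)) P1 z1; ring.
rewrite A1 in A; rewrite B0 B1 add0r in B; rewrite C0 C1 in C.
exact: parabola_algebra C B A A0.
Qed.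

Let side_identity a b e : (a = 0 /\ b = half /\ e = -1) \/ (a = half /\ b = 1 /\ e = 1) ->
  let psi := side_test eps y1 e zeta in
  [/\ L1 leb2 (rect a b 0 1) (fun x => (u x - parabola x) * kink_lap eps y1 zeta x),
   measurable_fun (rect a b 0 1 : set mplane) (kink_lap eps y1 zeta) &
  \int[leb2]_(x in rect a b 0 1) (gD ord0 u x * kink_s zeta eps y1 x) +
  \int[leb2]_(x in rect a b 0 1) (gD ord_max u x * kink_y zeta eps y1 x) -
  20 * \int[leb2]_(x in rect a b 0 1) (pk (dist_eps eps x) (x.2 - y1) * zeta x) =
  - (\int[leb2]_(x in rect a b 0 1) ((u x - parabola x) * kink_lap eps y1 zeta x)) +
  (- e) * \int[leb1]_(y in G) ((trace_fun u y - 1) * partial ord0 psi (half, y))].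
Proof.
move=> ab psi; have e2 : e * e = 1 by case: ab => -[_ [_ ->]]; ring.
have tp : test_function Om psi by exact: side_test_test.
have sp := test_smooth tp; have s0 := smooth_partial ord0 sp; have s1 := smooth_partial ord_max sp.
have s00 := smooth_partial ord0 s0; have s11 := smooth_partial ord_max s1.
have sO : Om `<=` Om by [].
have ab0 : 0 <= a by case: ab => -[-> _] //; exact: ltW half_gt0.
have ab1 : b <= 1 by case: ab => -[_ [-> _]] //; exact: ltW half_lt1.
have mr : measurable (rect a b 0 1 : set mplane) := measurable_rect a b 0 1.
have sub : rect a b 0 1 `<=` Om := rect_sub_Om ab0 ab1.
have pos x : rect a b 0 1 x -> 0 < e * (x.1 - half).
  move=> /rectP[/andP[x1 x2] _]; case: ab => -[ea [eb ->]]; first by rewrite mulN1r opprB subr_gt0 -eb.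
  by rewrite mul1r subr_gt0 -ea.
have first_ x (rx : rect a b 0 1 x) := side_first y1 eps0 tz e2 (pos x rx).
have second_ x (rx : rect a b 0 1 x) := side_second y1 eps0 tz e2 (pos x rx).
pose lap x := partial ord0 (partial ord0 psi) x + partial ord_max (partial ord_max psi) x.
have slap : smooth lap by exact: smoothD.
have Lu : L2 leb2 (rect a b 0 1) u := L2_sub mO mr sub (H10_L2 hu).
have L2s w : smooth w -> L2 leb2 (rect a b 0 1) w by exact: smooth_L2_rect.
have LuP := L2B mr Lu (L2s _ sP).
have Ldir := L2_mul mr LuP (L2s _ slap).
have Ec x : rect a b 0 1 x -> (u x - parabola x) * lap x = (u x - parabola x) * kink_lap eps y1 zeta x.
  by move=> rx; rewrite /lap -second_.
split.
- exact: (L1_eq mr Ec Ldir).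
- apply: (eq_measurable_fun lap); last exact: (L2s _ slap).1.
  by move=> x; rewrite inE => rx; exact: second_.
have X0 : \int[leb2]_(x in rect a b 0 1) (gD ord0 u x * kink_s zeta eps y1 x) =
    ip leb2 (rect a b 0 1) (gD ord0 u) (partial ord0 psi).
  by rewrite ipE; apply: Rint_ext => x rx; have [-> _ _] := first_ x rx.
have X1 : \int[leb2]_(x in rect a b 0 1) (gD ord_max u x * kink_y zeta eps y1 x) =
    ip leb2 (rect a b 0 1) (gD ord_max u) (partial ord_max psi).
  by rewrite ipE; apply: Rint_ext => x rx; have [_ -> _] := first_ x rx.
have X2 : \int[leb2]_(x in rect a b 0 1) (pk (dist_eps eps x) (x.2 - y1) * zeta x) =
    \int[leb2]_(x in rect a b 0 1) psi x.
  by apply: Rint_ext => x rx; have [_ _ <-] := first_ x rx.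
have X3 : \int[leb2]_(x in rect a b 0 1) ((u x - parabola x) * kink_lap eps y1 zeta x) =
    ip leb2 (rect a b 0 1) u (partial ord0 (partial ord0 psi)) +
    ip leb2 (rect a b 0 1) u (partial ord_max (partial ord_max psi)) - ip leb2 (rect a b 0 1) parabola lap.
  rewrite -(ipDr mr Lu (L2s _ s00) (L2s _ s11)) !ipE -RintegralB//.
  - by apply: Rint_ext => x rx; rewrite -Ec// mulrBl.
  - exact: (L2_mul mr Lu (L2s _ slap)).
  - exact: (L2_mul mr (L2s _ sP) (L2s _ slap)).
have Lt : L2 leb1 G (trace_fun u) := trace_fun_L2 hu.
have Lh : L2 leb1 G (fun y => partial ord0 psi (half, y)) := test_trace_L2 s0.
have Lh1 : L1 leb1 G (fun y => partial ord0 psi (half, y)).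
  by apply: cont_L1; apply: slice2_cont; exact: smooth_cont.
have X4 : \int[leb1]_(y in G) ((trace_fun u y - 1) * partial ord0 psi (half, y)) =
  \int[leb1]_(y in G) (trace_fun u y * partial ord0 psi (half, y)) - \int[leb1]_(y in G) partial ord0 psi (half, y).
  rewrite -(RintegralB mG (L2_mul mG Lt Lh) Lh1).
  by apply: Rint_ext => y _; rewrite mulrBl mul1r.
have GY := green_H10_y sO hu ab0 ab1 s1.
have [GL GR] := green_H10_half sO hu s0.
rewrite X0 X1 X2 X3 X4; apply: side_algebra GY _.
- case: ab => -[-> [-> ->]]; first by rewrite opprK mul1r.
  by rewrite mulN1r.
- case: ab => -[ea [eb ee]].
    have se : - e = (if a == 0 then 1 else -1) by rewrite ea eqxx ee opprK.
    have P := parab_side (or_introl (conj ea eb)) e2; rewrite -se in P; exact: P.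
  have se : - e = (if a == 0 then 1 else -1) by rewrite ea (negbTE (lt0r_neq0 half_gt0)) ee.
  have P := parab_side (or_intror (conj ea eb)) e2; rewrite -se in P; exact: P.
Qed.

(** Since u - parabola is harmonic off the line, Green's formula on both
    halves moves all derivatives to the kernel. The average of the
    multiplier against the Poisson kernel equals a part that depends
    continuously on the pole up to the line, plus a boundary term that
    contains only the difference u - 1 on the line. *)
Lemma kernel_identity :
  [/\ L1 leb2 L (fun x => (u x - parabola x) * kink_lap eps y1 zeta x),
   L1 leb2 Rr (fun x => (u x - parabola x) * kink_lap eps y1 zeta x),
   measurable_fun (L : set mplane) (kink_lap eps y1 zeta),
   measurable_fun (Rr : set mplane) (kink_lap eps y1 zeta) &
  \int[leb1]_(y in G) (l y * (pk eps (y - y1) * zeta (half, y))) =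
  \int[leb2]_(x in L) ((u x - parabola x) * kink_lap eps y1 zeta x) +
  \int[leb2]_(x in Rr) ((u x - parabola x) * kink_lap eps y1 zeta x) +
  2 * \int[leb1]_(y in G) ((trace_fun u y - 1) * (pk_s eps (y - y1) * zeta (half, y)))].
Proof.
have [A1 m1 A] := @side_identity 0 half (-1) (or_introl (conj erefl (conj erefl erefl))).
have [B1 m2 B] := @side_identity half 1 1 (or_intror (conj erefl (conj erefl erefl))).
split => //; have [I0 I1 I2 E] := kinked_equation hu Ll heq y1 tz eps0.
move: E; rewrite (RintegralZl _ mO I2) (Rint_Omega_split I0) (Rint_Omega_split I1) (Rint_Omega_split I2) => E.
have eL : (-1 : R) * -1 = 1 by ring.
have eR : (1 : R) * 1 = 1 by ring.
have Lt1 : L2 leb1 G (fun y => trace_fun u y - 1).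
  apply: L2B => //; first exact: trace_fun_L2 hu.
  exact: (test_trace_L2 (smooth_cst 1)).
have tpL := smooth_partial ord0 (test_smooth (side_test_test y1 (-1) eps0 tz)).
have tpR := smooth_partial ord0 (test_smooth (side_test_test y1 1 eps0 tz)).
have T : \int[leb1]_(y in G) ((trace_fun u y - 1) * partial ord0 (side_test eps y1 (-1) zeta) (half, y)) -
   \int[leb1]_(y in G) ((trace_fun u y - 1) * partial ord0 (side_test eps y1 1 zeta) (half, y)) =
   - 2 * \int[leb1]_(y in G) ((trace_fun u y - 1) * (pk_s eps (y - y1) * zeta (half, y))).
  have LL := L2_mul mG Lt1 (test_trace_L2 tpL); have LR := L2_mul mG Lt1 (test_trace_L2 tpR).
  have D y : (trace_fun u y - 1) * partial ord0 (side_test eps y1 (-1) zeta) (half, y) -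
     (trace_fun u y - 1) * partial ord0 (side_test eps y1 1 zeta) (half, y) =
     - 2 * ((trace_fun u y - 1) * (pk_s eps (y - y1) * zeta (half, y))).
    by rewrite !side_at_half//; ring.
  rewrite -(RintegralB mG LL LR).
  have Lps : L1 leb1 G (fun y => (trace_fun u y - 1) * (pk_s eps (y - y1) * zeta (half, y))).
    have := L1Zl mG (- 2^-1) (L1B mG LL LR); apply: L1_eq => // y _.
    by rewrite D; field.
  by rewrite -(RintegralZl _ mG Lps); apply: Rint_ext => y _.
refine (sum_algebra E A B T).
Qed.

End Assemble.
End HalfFormula.

(** * The negative part of the multiplier on the contact set *)
Section LebesguePoints.
Context {R : realType}.
Local Notation leb1 := (@lebesgue_measure R).
Local Notation mR := (measurableTypeR R).
Local Notation G := (`]0, 1[%classic : set R).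
Local Notation mG := (measurable_oo (0 : R) 1).
Implicit Types (f g l : R -> R) (y r e eps : R).

Definition win y r : set R := `]y - r, y + r[%classic.

Lemma winP y r z : win y r z <-> `|z - y| < r.
Proof. by rewrite /win /= in_itv/= ltr_distl. Qed.

Let mw y r : measurable (win y r : set mR). Proof. exact: measurable_oo. Qed.

Lemma patch_L1 (D D' : set mR) f : measurable D -> measurable D' -> D' `<=` D -> L1 leb1 D f ->
  L1 leb1 D (f \_ D') /\ \int[leb1]_(x in D) (f \_ D') x = \int[leb1]_(x in D') f x.
Proof.
move=> mD mD' sub Lf; split.
  rewrite /L1 -restrict_EFin; apply: (integrable_restrict leb1 mD' mD (EFin \o f)).1.
  by rewrite setIC (setIidl sub); exact: integrableS mD mD' sub Lf.
rewrite (Rint_sub_supp1 sub).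
  by apply: Rint_ext => x Dx; rewrite patchE mem_set.
by move=> x _ nD; rewrite patchE memNset.
Qed.

Lemma le_Rint_set (D D' : set mR) f : measurable D -> measurable D' -> D' `<=` D -> L1 leb1 D f ->
  (forall x, D x -> 0 <= f x) -> \int[leb1]_(x in D') f x <= \int[leb1]_(x in D) f x.
Proof.
move=> mD mD' sub Lf f0; have [Lp <-] := patch_L1 mD mD' sub Lf.
by apply: le_Rintegral => // x Dx; rewrite patchE; case: ifP => // _; exact: f0.
Qed.

Definition leb_point f y : Prop := forall e, 0 < e -> exists2 r0, 0 < r0 &
    forall r, 0 < r < r0 -> [/\ 0 < y - r, y + r < 1 &
      \int[leb1]_(z in win y r) `|f z - f y| <= e * r].

Lemma ae_leb_point f : L1 leb1 G f -> \forall y \ae leb1, G y -> leb_point f y.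
Proof.
move=> Lf; apply: aeS (lebesgue_points Lf) => y h; rewrite /= in_itv/= => Gy; exact: h.
Qed.

Lemma pk_le_inv (eps y : R) : 0 < eps -> 0 < `|y| -> pk eps y <= eps / (y * y).
Proof.
move=> e0 y0; have e0' := ltW e0; rewrite /pk ler_wpM2l// lef_pV2 ?posrE.
- by rewrite lerDr mulr_ge0.
- exact: den_gt0.
- by rewrite -expr2 -real_normK ?num_real// exprn_gt0.
Qed.

Lemma pk_gt0 (eps y : R) : 0 < eps -> 0 < pk eps y.
Proof. by move=> e0; rewrite divr_gt0// den_gt0. Qed.

Lemma pk_le_eps (eps y : R) : 0 < eps -> pk eps y <= eps^-1.
Proof.
move=> e0; apply: le_trans (ler_norm _) (pk_bound e0 e0 _).
by rewrite lerDl -expr2 sqr_ge0.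
Qed.

Lemma pk_ge (eps y : R) : 0 < eps -> `|y| <= eps -> (2 * eps)^-1 <= pk eps y.
Proof.
move=> e0 ye; have d0 := den_gt0 y e0.
rewrite /pk ler_pdivlMr// mulrC ler_pdivrMr ?mulr_gt0//.
have : y * y <= eps * eps by rewrite -!expr2 -real_normK ?num_real// lerXn2r ?nnegrE// ltW.
nra.
Qed.

Let pk_meas y1 eps (D : set mR) : 0 < eps -> measurable D -> measurable_fun D (fun y => pk eps (y - y1)).
Proof.
move=> e0 mD; apply: measurable_funTS; apply: continuous_measurable_fun => y.
have d0 : eps * eps + (y - y1) * (y - y1) != 0 by rewrite gt_eqF// den_gt0.
have c : z - y1 @[z --> y] --> y - y1 by apply: cvgB; [exact: cvg_id|exact: cvg_cst].
by apply: cvgM; [exact: cvg_cst|apply: cvgV => //; apply: cvgD; [exact: cvg_cst|exact: cvgM]].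
Qed.

Lemma win_sub y r r' : r <= r' -> win y r `<=` win y r'.
Proof. by move=> rr z /winP h; apply/winP; exact: lt_le_trans rr. Qed.

Lemma win_G y r : 0 <= y - r -> y + r <= 1 -> win y r `<=` G.
Proof.
move=> h0 h1 z; rewrite /win /= !in_itv/= => /andP[z1 z2].
by rewrite (le_lt_trans h0 z1) (lt_le_trans z2 h1).
Qed.

(** On the N-th dyadic annulus the kernel is at most eps / (2 ^ N * eps) ^ 2,
    and the deviation integrates to at most e * 2 ^ (N + 1) * eps; the
    geometric series gives the bound. *)
Lemma dyadic_bound f y1 e eps r0 N : L1 leb1 G f -> 0 < eps -> 0 < e ->
  (forall r, 0 < r < r0 -> [/\ 0 < y1 - r, y1 + r < 1 &
      \int[leb1]_(z in win y1 r) `|f z - f y1| <= e * r]) ->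
  2 ^+ N * eps < r0 ->
  \int[leb1]_(y in win y1 (2 ^+ N * eps)) (`|f y - f y1| * pk eps (y - y1)) <= e * (5 - 4 / 2 ^+ N).
Proof.
move=> Lf e0 ee0 hr; elim: N => [|N IH] lt.
  rewrite expr0 mul1r in lt *; have [h0 h1 h] := hr eps ltac:(by rewrite e0).
  have sub := win_G (ltW h0) (ltW h1).
  have La : L1 leb1 (win y1 eps) (fun y => `|f y - f y1|).
    by apply: L1_abs; apply: L1B => //; [exact: integrableS mG _ sub Lf|exact: cst_L1].
  apply: (@le_trans _ _ (\int[leb1]_(y in win y1 eps) (eps^-1 * `|f y - f y1|))).
    apply: le_Rintegral => //.
    - apply: (@L1_mul_bounded _ _ _ _ _ (mw y1 eps) _ _ eps^-1) => //; first exact: pk_meas.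
      by move=> y _; rewrite ger0_norm ?pk_le_eps// ltW// pk_gt0.
    - exact: L1Zl.
    - by move=> y _; rewrite mulrC ler_wpM2r// pk_le_eps.
  rewrite (RintegralZl _ (mw _ _) La) divr1 ler_pdivrMl//.
  apply: (le_trans h); rewrite le_eqVlt; apply/orP; left; apply/eqP; ring.
set rN := 2 ^+ N * eps; have rN0 : 0 < rN by rewrite mulr_gt0// exprn_gt0.
have rS : 2 ^+ N.+1 * eps = 2 * rN by rewrite exprS mulrA.
rewrite rS in lt *.
have [h0 h1 h] := hr (2 * rN) ltac:(by rewrite mulr_gt0).
have ltN : rN < r0 by lra.
have {}IH := IH ltN.
have sub := win_G (ltW h0) (ltW h1).
have La : L1 leb1 (win y1 (2 * rN)) (fun y => `|f y - f y1|).
  by apply: L1_abs; apply: L1B => //; [exact: integrableS mG _ sub Lf|exact: cst_L1].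
have LF : L1 leb1 (win y1 (2 * rN)) (fun y => `|f y - f y1| * pk eps (y - y1)).
  apply: (@L1_mul_bounded _ _ _ _ _ (mw y1 (2 * rN)) _ _ eps^-1) => //; first exact: pk_meas.
  by move=> y _; rewrite ger0_norm ?pk_le_eps// ltW// pk_gt0.
have subN : win y1 rN `<=` win y1 (2 * rN) by apply: win_sub; lra.
have [Lp Ep] := patch_L1 (mw _ _) (mw y1 rN) subN LF.
have c0 : 0 <= eps / (rN * rN) by rewrite divr_ge0 ?mulr_ge0 ?ltW.
apply: (@le_trans _ _ (\int[leb1]_(y in win y1 rN) (`|f y - f y1| * pk eps (y - y1)) +
   eps / (rN * rN) * (e * (2 * rN)))).
  apply: (@le_trans _ _ (\int[leb1]_(y in win y1 rN) (`|f y - f y1| * pk eps (y - y1)) +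
     eps / (rN * rN) * \int[leb1]_(y in win y1 (2 * rN)) `|f y - f y1|)); last first.
    by rewrite lerD2l ler_wpM2l.
  rewrite -Ep -(RintegralZl _ (mw _ _) La) -(RintegralD (mw _ _) Lp (L1Zl (mw _ _) _ La)).
  apply: le_Rintegral => //; first exact: (L1D (mw _ _) Lp (L1Zl (mw _ _) _ La)).
  move=> y _; rewrite patchE; case: ifPn => [_|]; first by rewrite lerDl mulr_ge0.
  move=> /negP nw; rewrite -[point]/(0 : R) add0r mulrC ler_wpM2r//.
  have yr : rN <= `|y - y1| by rewrite leNgt; apply/negP => hlt; apply: nw; rewrite inE; apply/winP.
  apply: (le_trans (pk_le_inv e0 (lt_le_trans rN0 yr))).
  have yy0 : 0 < (y - y1) * (y - y1).
    by rewrite -expr2 -real_normK ?num_real// exprn_gt0// (lt_le_trans rN0).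
  rewrite ler_wpM2l ?(ltW e0)// lef_pV2 ?posrE//; last exact: mulr_gt0.
  by rewrite -!expr2 -(real_normK (num_real (y - y1))) lerXn2r ?nnegrE// ltW.
have -> : eps / (rN * rN) * (e * (2 * rN)) = e * (2 / 2 ^+ N).
  by rewrite /rN; field; rewrite expf_neq0//= gt_eqF.
apply: (le_trans (lerD IH (lexx _))); rewrite -mulrDr ler_wpM2l ?(ltW ee0)// exprS.
have z0 : 0 < 2 ^+ N :> R by rewrite exprn_gt0.
rewrite le_eqVlt; apply/orP; left; apply/eqP; field; exact: lt0r_neq0.
Qed.

Lemma dyadic_exists eps r1 : 0 < eps -> eps <= r1 -> exists N : nat, 2 ^+ N * eps <= r1 < 2 ^+ N.+1 * eps.
Proof.
move=> e0 er.
have ex : exists N : nat, r1 < 2 ^+ N.+1 * eps.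
  have r10 : 0 <= r1 := le_trans (ltW e0) er.
  have hn := archi_boundP (divr_ge0 r10 (ltW e0)); set n := Num.bound _ in hn.
  exists n; rewrite -ltr_pdivrMr// (lt_trans hn)// -natrX ltr_nat.
  by rewrite (ltn_trans (ltnSn n))// ltn_expl.
case: (ex_minnP ex) => N hN mN; exists N; rewrite hN andbT.
case: N hN mN => [|N] hN mN; first by rewrite expr0 mul1r.
by rewrite leNgt; apply/negP => /mN; rewrite ltnn.
Qed.

(** The kernel concentrates at a Lebesgue point. Its mass p
    near the point is only bounded from below, by 1, which suffices because p
    multiplies a quantity of known sign later on. *)
Lemma poisson_limit f y1 (z2 : R -> R) rho eta : L1 leb1 G f -> leb_point f y1 ->
  measurable_fun (G : set mR) z2 -> (forall y, `|z2 y| <= 1) -> 0 < rho ->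
  (forall y, win y1 rho y -> z2 y = 1) -> 0 < eta ->
  exists2 eps0, 0 < eps0 & forall eps, 0 < eps < eps0 -> exists2 p, 1 <= p &
    `|\int[leb1]_(y in G) (f y * (pk eps (y - y1) * z2 y)) - f y1 * p| <= eta.
Proof.
move=> Lf lp mz z1 rho0 zr eta0.
have e0 : 0 < eta / 10 by rewrite divr_gt0.
have [r0 r00 hr] := lp _ e0.
pose r1 := Num.min r0 rho / 2.
have m0 : 0 < Num.min r0 rho by rewrite lt_min r00.
have r10 : 0 < r1 by rewrite divr_gt0.
have r1r0 : r1 < r0.
  by rewrite /r1 ltr_pdivrMr// (@le_lt_trans _ _ r0) ?ge_min ?lexx//; lra.
have r1rho : r1 < rho.
  by rewrite /r1 ltr_pdivrMr// (@le_lt_trans _ _ rho) ?ge_min ?lexx ?orbT//; lra.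
pose A := \int[leb1]_(y in G) `|f y|.
have A0 : 0 <= A by apply: Rintegral_ge0.
pose eps0 := Num.min r1 (eta * (r1 * r1) / (8 * (A + 1))).
have A1 : 0 < 8 * (A + 1) by rewrite mulr_gt0// ltr_wpDl.
exists eps0; first by rewrite lt_min r10 divr_gt0// !mulr_gt0.
move=> eps /andP[eps_gt0]; rewrite lt_min => /andP[er1 eA].
have [N /andP[N1 N2]] := dyadic_exists eps_gt0 (ltW er1).
set rN := 2 ^+ N * eps in N1 N2 *.
have rN0 : 0 < rN by rewrite mulr_gt0// exprn_gt0.
have rNr1 : r1 < 2 * rN by move: N2; rewrite exprS -mulrA.
have [h0 h1 _] := hr rN ltac:(by rewrite rN0 (le_lt_trans N1)).
have sub := win_G (ltW h0) (ltW h1).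
have mI := mw y1 rN.
have LfI : L1 leb1 (win y1 rN) f by exact: integrableS mG _ sub Lf.
pose p := \int[leb1]_(y in win y1 rN) pk eps (y - y1).
have Lpk (D : set mR) f' : measurable D -> L1 leb1 D f' -> L1 leb1 D (fun y => f' y * pk eps (y - y1)).
  move=> mD Lf'; apply: (@L1_mul_bounded _ _ _ _ _ mD _ _ eps^-1) => //; first exact: pk_meas.
  by move=> y _; rewrite ger0_norm ?pk_le_eps// ltW// pk_gt0.
have Lp : L1 leb1 (win y1 rN) (fun y => pk eps (y - y1)).
  have := Lpk _ (fun=> 1) mI (cst_L1 1 _ _); apply: L1_eq => // y _; exact: mul1r.
exists p.
  have se : eps <= rN.
    by rewrite /rN ler_peMl ?(ltW eps_gt0)// exprn_ege1// ler1n.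
  apply: (@le_trans _ _ (\int[leb1]_(y in win y1 eps) pk eps (y - y1))); last first.
    by apply: le_Rint_set => //; [exact: win_sub|move=> y _; exact/ltW/pk_gt0].
  apply: (@le_trans _ _ (\int[leb1]_(y in win y1 eps) (2 * eps)^-1)).
    rewrite Rint_cst_oo; last by lra.
    rewrite le_eqVlt; apply/orP; left; apply/eqP; field; exact: lt0r_neq0.
  apply: le_Rintegral => //; first exact: cst_L1.
    exact: (integrableS mI (mw y1 eps) (win_sub se) Lp).
  by move=> y /winP yw; apply: pk_ge => //; exact: ltW.
have LF : L1 leb1 G (fun y => f y * (pk eps (y - y1) * z2 y)).
  have := @L1_mul_bounded _ _ _ _ _ mG _ z2 1 (Lpk _ _ mG Lf) mz (fun y _ => z1 y).
  by apply: L1_eq => // y _; rewrite mulrA.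
have [LP EP] := patch_L1 mG mI sub LF.
have E1 : \int[leb1]_(y in win y1 rN) (f y * (pk eps (y - y1) * z2 y)) - f y1 * p =
   \int[leb1]_(y in win y1 rN) ((f y - f y1) * pk eps (y - y1)).
  rewrite /p -(RintegralZl _ mI Lp).
  have -> : \int[leb1]_(y in win y1 rN) (f y * (pk eps (y - y1) * z2 y)) =
            \int[leb1]_(y in win y1 rN) (f y * pk eps (y - y1)).
    apply: Rint_ext => y yw; rewrite zr ?mulr1//; apply: win_sub yw.
    exact: ltW (le_lt_trans N1 r1rho).
  rewrite -(RintegralB mI (Lpk _ _ mI LfI) (L1Zl mI _ Lp)).
  by apply: Rint_ext => y _; rewrite mulrBl.
have Lff : L1 leb1 (win y1 rN) (fun y => f y - f y1) by apply: L1B => //; exact: cst_L1.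
have B1 : `|\int[leb1]_(y in win y1 rN) ((f y - f y1) * pk eps (y - y1))| <= eta / 2.
  apply: le_trans (le_normr_Rintegral mI (Lpk _ _ mI Lff)) _.
  have := dyadic_bound Lf eps_gt0 e0 hr (le_lt_trans N1 r1r0).
  rewrite -/rN => hd; apply: le_trans (le_trans hd _).
    rewrite le_eqVlt; apply/orP; left; apply/eqP; apply: Rint_ext => y _.
    by rewrite normrM [X in _ * X = _]ger0_norm// ltW// pk_gt0.
  have z0 : 0 <= 4 / 2 ^+ N :> R by rewrite divr_ge0// exprn_ge0.
  by move: z0; set z := _ / _ => z0; rewrite -[leRHS]mulr1; nra.
have B2 : `|\int[leb1]_(y in G) (f y * (pk eps (y - y1) * z2 y)) - \int[leb1]_(y in win y1 rN) (f y * (pk eps (y - y1) * z2 y))| <= eta / 2.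
  rewrite -EP -(RintegralB mG LF LP).
  apply: le_trans (le_normr_Rintegral mG (L1B mG LF LP)) _.
  apply: (@le_trans _ _ (\int[leb1]_(y in G) (4 * eps / (r1 * r1) * `|f y|))).
    apply: le_Rintegral => //.
    - exact: L1_abs (L1B mG LF LP).
    - exact: (L1Zl mG _ (L1_abs Lf)).
    - move=> y _; rewrite patchE; case: ifPn => [_|/negP nw].
        by rewrite subrr normr0 mulr_ge0// divr_ge0 ?mulr_ge0 ?ltW.
      rewrite -[point]/(0 : R) subr0 normrM mulrC ler_wpM2r// normrM.
      have yr : rN <= `|y - y1| by rewrite leNgt; apply/negP => hlt; apply: nw; rewrite inE; apply/winP.
      rewrite -[leRHS]mulr1; apply: ler_pM => //.
      rewrite ger0_norm ?(ltW (pk_gt0 _ _))//.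
      apply: (le_trans (pk_le_inv eps_gt0 (lt_le_trans rN0 yr))).
      rewrite ler_pdivlMr ?mulr_gt0// mulrAC ler_pdivrMr; last first.
        by rewrite -expr2 -real_normK ?num_real// exprn_gt0// (lt_le_trans rN0).
      have hh : r1 * r1 <= 4 * ((y - y1) * (y - y1)).
        have -> : 4 * ((y - y1) * (y - y1)) = (2 * `|y - y1|) ^+ 2.
          by rewrite exprMn real_normK ?num_real//; ring.
        by rewrite -expr2 lerXn2r ?nnegrE ?mulr_ge0 ?(ltW r10)//; lra.
      rewrite [leRHS](_ : _ = eps * (4 * ((y - y1) * (y - y1)))); last by ring.
      by rewrite ler_wpM2l ?(ltW eps_gt0).
  rewrite (RintegralZl _ mG (L1_abs Lf)) -/A.
  rewrite mulrAC ler_pdivrMr ?mulr_gt0//.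
  move: eA; rewrite ltr_pdivlMr// => eA.
  have rr : 0 < r1 * r1 by rewrite mulr_gt0.
  have ea : 0 <= eps by exact: ltW.
  move: eA rr; set c := r1 * r1 => eA c0; nra.
have -> : \int[leb1]_(y in G) (f y * (pk eps (y - y1) * z2 y)) - f y1 * p =
  (\int[leb1]_(y in G) (f y * (pk eps (y - y1) * z2 y)) - \int[leb1]_(y in win y1 rN) (f y * (pk eps (y - y1) * z2 y))) +
  (\int[leb1]_(y in win y1 rN) (f y * (pk eps (y - y1) * z2 y)) - f y1 * p) by ring.
apply: (le_trans (ler_normD _ _)); rewrite E1.
by apply: (le_trans (lerD B2 B1)); rewrite -splitr.
Qed.

End LebesguePoints.

Section ContactLine.
Context {R : realType}.
Local Notation leb1 := (@lebesgue_measure R).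
Local Notation mR := (measurableTypeR R).
Local Notation G := (`]0, 1[%classic : set R).
Local Notation mG := (measurable_oo (0 : R) 1).
Implicit Types (kap t : R -> R) (y r e eps : R).

Let mw y r : measurable (win y r : set mR). Proof. exact: measurable_oo. Qed.

Lemma Rint_cst_co (c x y : R) : x <= y -> \int[leb1]_(_ in `[x, y[%classic) c = c * (y - x).
Proof.
move=> xy; rewrite Rintegral_cst//= lebesgue_measure_itv/= lte_fin.
by case: ltP => xy'; rewrite ?mulr0//= (_ : x = y) ?subrr ?mulr0//; apply/le_anti/andP.
Qed.

Lemma prim_increment kap a b : L1 leb1 G kap -> 0 < a -> a <= b -> b < 1 ->
  \int[leb1]_(s in G) (kap s * before s b) - \int[leb1]_(s in G) (kap s * before s a) =
  \int[leb1]_(s in `[a, b[%classic) kap s.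
Proof.
move=> Lk a0 ab b1.
have Lb y : L1 leb1 G (fun s => kap s * before s y).
  apply: (@L1_mul_bounded _ _ _ _ _ mG _ _ 1) => //.
    apply: measurable_funTS; exact: (measurableT_comp measurable_before (pair1_measurable (y : mR))).
  by move=> s _; exact: before_le1.
rewrite -(RintegralB mG (Lb b) (Lb a)).
have sub : `[a, b[%classic `<=` G.
  by move=> s; rewrite /= !in_itv/= => /andP[h1 h2]; rewrite (lt_le_trans a0 h1) (lt_trans h2 b1).
have [_ <-] := patch_L1 mG (measurable_itv `[a, b[) sub Lk.
apply: Rint_ext => s _; rewrite -mulrBr patchE /before.
case: ifPn => [|]; first by rewrite inE /= in_itv/= => /andP[h1 h2]; rewrite h2 ltNge h1 subr0 mulr1.
rewrite notin_setE /= in_itv/= => /negP; rewrite negb_and -ltNge -leNgt => /orP[h|h].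
  by rewrite h (lt_le_trans h ab) subrr mulr0.
by rewrite ltNge h/= ltNge (le_trans ab h)/= subrr mulr0.
Qed.

Lemma prim_cont kap y : L1 leb1 G kap ->
  (\int[leb1]_(s in G) (kap s * before s z)) @[z --> y] --> \int[leb1]_(s in G) (kap s * before s y).
Proof.
move=> Lk; apply: (@param_cont R _ _ _ leb1 G kap (fun y s => before s y)) => //.
- move=> p; apply: measurable_funTS; exact: (measurableT_comp measurable_before (pair1_measurable (p : mR))).
- by move=> p s; exact: before_le1.
- by apply: aeS (ae_neq y) => z; exact: before_cvg.
Qed.

(** The trace t has its maximum 1 at y1 and is there differentiable, with
    derivative kap y1, which must vanish. Hence 1 - t is o(`|y - y1|). *)
Lemma contact_window kap t y1 eta : L1 leb1 G kap ->
  (forall y, G y -> t y = \int[leb1]_(s in G) (kap s * before s y)) ->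
  (forall y, G y -> t y <= 1) -> leb_point kap y1 -> t y1 = 1 -> 0 < eta ->
  exists2 eps0, 0 < eps0 & forall eps, 0 < eps < eps0 -> win y1 eps `<=` G /\
    2 / (eps * eps) * \int[leb1]_(y in win y1 eps) (1 - t y) <= eta.
Proof.
move=> Lk tE t1 lp ty1 eta0.
have Gw r : 0 < y1 - r -> y1 + r < 1 -> win y1 r `<=` G by move=> h0 h1; apply: win_G; exact: ltW.
have incr r a b e : 0 < y1 - r -> y1 + r < 1 -> \int[leb1]_(z in win y1 r) `|kap z - kap y1| <= e ->
    y1 - r < a -> a <= b -> b < y1 + r -> `|t b - t a - kap y1 * (b - a)| <= e.
  move=> h0 h1 he ra ab br.
  have Ga : G a by apply: (Gw r) => //; rewrite /win/= in_itv/= ra (le_lt_trans ab br).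
  have Gb : G b by apply: (Gw r) => //; rewrite /win/= in_itv/= br (lt_le_trans ra ab).
  have := Ga; have := Gb; rewrite /= !in_itv/= => /andP[b0 b1] /andP[a0 a1].
  rewrite (tE _ Ga) (tE _ Gb) prim_increment// -Rint_cst_co//.
  have mI : measurable (`[a, b[%classic : set mR) by exact: measurable_itv.
  have sI : `[a, b[%classic `<=` win y1 r.
    move=> z; rewrite /win /= !in_itv/= => /andP[h2 h3].
    by rewrite (lt_le_trans ra h2) (lt_trans h3 br).
  have LW : L1 leb1 (win y1 r) (fun z => kap z - kap y1).
    by apply: L1B => //; [exact: integrableS mG _ (Gw r h0 h1) Lk|exact: cst_L1].
  have LI : L1 leb1 `[a, b[%classic kap := integrableS (mw _ _) mI sI (integrableS mG (mw _ _) (Gw r h0 h1) Lk).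
  have Lc : L1 leb1 `[a, b[%classic (fun=> kap y1) := integrableS (mw _ _) mI sI (cst_L1 _ _ _).
  rewrite -(RintegralB mI LI Lc).
  apply: le_trans (le_normr_Rintegral mI (L1B mI LI Lc)) _.
  apply: le_trans he; apply: le_Rint_set => //.
  exact: L1_abs LW.
have k0 : kap y1 = 0.
  apply/eqP; rewrite -normr_le0; apply/ler_addgt0Pr => e e0; rewrite add0r.
  have e2 : 0 < e / 2 by rewrite divr_gt0.
  have [r0 r00 hr] := lp _ e2.
  pose r := r0 / 2; have rp : 0 < r by rewrite divr_gt0.
  have [h0 h1 h] := hr r ltac:(by rewrite rp /r; lra).
  have i1 := incr r y1 (y1 + r / 2) _ h0 h1 h ltac:(lra) ltac:(lra) ltac:(lra).
  have i2 := incr r (y1 - r / 2) y1 _ h0 h1 h ltac:(lra) ltac:(lra) ltac:(lra).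
  have G1 : G (y1 + r / 2) by apply: (Gw r) => //; rewrite /win/= in_itv/=; apply/andP; split; lra.
  have G2 : G (y1 - r / 2) by apply: (Gw r) => //; rewrite /win/= in_itv/=; apply/andP; split; lra.
  have T1 := t1 _ G1; have T2 := t1 _ G2.
  move: i1 i2 T1 T2; rewrite ty1 !ler_norml.
  have -> : y1 + r / 2 - y1 = r / 2 by ring.
  have -> : y1 - (y1 - r / 2) = r / 2 by ring.
  move=> /andP[i1 i1'] /andP[i2 i2'] T1 T2.
  apply/andP; split.
    rewrite -(ler_pM2r (x := r / 2)) ?divr_gt0//; lra.
  rewrite -(ler_pM2r (x := r / 2)) ?divr_gt0//; lra.
have e8 : 0 < eta / 8 by rewrite divr_gt0.
have [r0 r00 hr] := lp _ e8.
exists (r0 / 2); first by rewrite divr_gt0.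
move=> eps /andP[eps0 er].
have [h0 h1 h] := hr (2 * eps) ltac:(by rewrite mulr_gt0//=; lra).
have sub : win y1 eps `<=` G by apply: Gw; lra.
split => //.
have Lw : L1 leb1 (win y1 eps) (fun y => 1 - t y).
  apply: L1B => //; first exact: cst_L1.
  apply: (L1_eq (mw y1 eps) (f := fun y => \int[leb1]_(s in G) (kap s * before s y))).
    by move=> y /sub Gy; rewrite tE.
  apply: (@cont_L1 R (fun y => \int[leb1]_(s in G) (kap s * before s y)) (y1 - eps) (y1 + eps)) => y; exact: prim_cont.
have bound y : win y1 eps y -> 1 - t y <= eta / 8 * (2 * eps).
  move=> /winP yw; have [yy|yy] := leP y1 y.
    have := incr (2 * eps) y1 y _ h0 h1 h ltac:(lra) yy.
    move: yw; rewrite ltr_norml => /andP[_ yw] /(_ ltac:(lra)).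
    by rewrite k0 mul0r subr0 ty1 ler_norml => /andP[h2 _]; lra.
  have := incr (2 * eps) y y1 _ h0 h1 h.
  move: yw; rewrite ltr_norml => /andP[yw _] /(_ ltac:(lra) (ltW yy) ltac:(lra)).
  by rewrite k0 mul0r subr0 ty1 ler_norml => /andP[_ h2]; lra.
have : \int[leb1]_(y in win y1 eps) (1 - t y) <= \int[leb1]_(y in win y1 eps) (eta / 8 * (2 * eps)).
  by apply: le_Rintegral => //; exact: cst_L1.
rewrite Rint_cst_oo; last by lra.
set I := Rintegral _ _ _ => hI.
rewrite mulrAC ler_pdivrMr ?mulr_gt0//; nra.
Qed.

End ContactLine.

Lemma cvg_dist_ball (R : realType) (h : R -> R) (a c d : R) :
  h e @[e --> a] --> c -> 0 < d ->
  exists2 r, 0 < r & forall e, `|a - e| < r -> `|c - h e| < d.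
Proof.
move=> ch d0; have /nbhs_ballP[r /= r0 hr] : \forall e \near a, `|c - h e| < d.
  by move/cvgrPdist_lt : ch => /(_ _ d0).
by exists r => // e ae; exact: hr.
Qed.

Section UpperSemicontinuity.
Context {R : realType}.
Local Notation plane := (R * R)%type.
Local Notation leb1 := (@lebesgue_measure R).
Local Notation mR := (measurableTypeR R).
Local Notation mplane := (measurableTypeR R * measurableTypeR R)%type.
Local Notation Om := (@Omega R).
Local Notation L := (rect 0 half 0 1 : set plane).
Local Notation Rr := (rect half 1 0 1 : set plane).
Local Notation G := (`]0, 1[%classic : set R).
Local Notation mO := (@measurable_Omega R).
Local Notation mG := (measurable_oo (0 : R) 1).
Implicit Types (O : set plane) (v w : plane -> R) (i : 'I_2) (r eps e : R).

Lemma param_cont_loc (P : pseudoMetricType R) d (T : measurableType d)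
    (mu : {measure set T -> \bar R}) (D : set T) (g : T -> R) (b : P -> T -> R) (p0 : P) (M : R) (U : set P) :
  measurable D -> L1 mu D g -> nbhs p0 U -> (forall p, U p -> measurable_fun D (b p)) ->
  (forall p z, U p -> D z -> `|b p z| <= M) ->
  (forall z, D z -> b q z @[q --> p0] --> b p0 z) ->
  (\int[mu]_(z in D) (g z * b q z)) @[q --> p0] --> \int[mu]_(z in D) (g z * b p0 z).
Proof.
move=> mD Ig nU mb bM cb.
apply: (@seq_cvg R P (fun q => \int[mu]_(z in D) (g z * b q z)) p0) => u cu.
have [N _ hN] : \forall n \near \oo, U (u n) by exact: cu.
have mg := L1_meas Ig.
have hU n : U (u (n + N)%N) by apply: hN; rewrite /= leq_addl.
rewrite -(cvg_shiftn N).
apply: (@Rdominated_pt R _ _ mu D mD (fun n z => g z * b (u (n + N)%N) z) _ (fun z => M * `|g z|) _ _ _ _).2.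
- by move=> n; apply: measurable_funM => //; exact: mb.
- exact: (L1Zl mD _ (L1_abs Ig)).
- move=> z Dz; apply: cvgMr.
  have c : b (u n) z @[n --> \oo] --> b p0 z by exact: (cvg_comp _ _ cu (cb z Dz)).
  by rewrite -(cvg_shiftn N) in c.
- by move=> n z Dz; rewrite normrM mulrC ler_wpM2r// bM.
Qed.

Lemma pk_cvg2 (T : Type) (F : set_system T) (FF : Filter F) (a_ b_ : T -> R) (a b : R) :
  0 < a -> a_ n @[n --> F] --> a -> b_ n @[n --> F] --> b ->
  [/\ pk (a_ n) (b_ n) @[n --> F] --> pk a b, pk_s (a_ n) (b_ n) @[n --> F] --> pk_s a b &
      pk_y (a_ n) (b_ n) @[n --> F] --> pk_y a b].
Proof.
move=> a0 ca cb; have d0 : a * a + b * b != 0 by rewrite gt_eqF// den_gt0.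
have cd : (a_ n * a_ n + b_ n * b_ n)%R @[n --> F] --> a * a + b * b.
  by apply: cvgD; exact: cvgM.
have cd2 : ((a_ n * a_ n + b_ n * b_ n) * (a_ n * a_ n + b_ n * b_ n))%R @[n --> F] --> (a * a + b * b) * (a * a + b * b).
  exact: cvgM.
split.
- by apply: cvgM => //; exact: cvgV.
- apply: cvgM; last by apply: cvgV => //; rewrite mulf_neq0.
  by apply: cvgB; exact: cvgM.
- apply: cvgM; last by apply: cvgV => //; rewrite mulf_neq0.
  by apply: cvgN; apply: cvgM => //; exact: cvgMr.
Qed.

Lemma window_algebra (A A' J0 J1 J2 X W : R) :
  - (- (A' + J0 - J2) / 4) < J0 - J1 -> - (- (A' + J0 - J2) / 4) <= A - X -> 0 <= X ->
  A <= A' + J1 - J2 + W -> W <= - (A' + J0 - J2) / 4 -> A' + J0 - J2 < 0 -> False.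
Proof. by move=> *; lra. Qed.

Section Local.
Variables (u : plane -> R) (l kap t : R -> R) (F : set R).
Hypotheses (hu : H10 Om u) (Ll : L1 leb1 G l) (Lk : L1 leb1 G kap).
Hypothesis heq : forall v, H10 Om v ->
  grad_dot Om u v + \int[leb1]_(y in G) (l y * trG v y) = load_pair v.
Hypothesis tE : forall y, G y -> t y = \int[leb1]_(s in G) (kap s * before s y).
Hypothesis tu : \forall y \ae leb1, G y -> trG u y = t y.
Hypotheses (t1 : forall y, G y -> t y <= 1) (FG : F `<=` G) (tF : forall y, F y -> t y = 1).

Section Window.
Variables (y0 rho : R) (N : nat).
Hypotheses (rho0 : 0 < rho) (w0 : 0 < y0 - 3 * rho) (w1 : y0 + 3 * rho < 1) (hN : N.+1%:R^-1 <= rho).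

Definition cut_y (y : R) : R := bump (y0 - 3 * rho) (y0 + 3 * rho) N y.
(** Equal to 1 on a rectangle around the point (1 / 2, y0) whose height is
    proportional to rho. *)
Definition cutoff (x : plane) : R := bump (4^-1) (3 / 4) 7 x.1 * cut_y x.2.

Lemma cutoff_test : test_function Om cutoff.
Proof. by rewrite OmegaE; apply: test_bump; apply: subrect => //; lra. Qed.
Let tz := cutoff_test.
Let sz := test_smooth tz.

Lemma cut_y_eq1 y1 y : `|y1 - y0| < rho -> `|y - y1| <= rho -> cut_y y = 1.
Proof.
rewrite ltr_norml ler_norml => /andP[h1 h2] /andP[h3 h4].
by apply: bump_eq1; apply: (le_trans hN); lra.
Qed.

Lemma cutoff_half y : cutoff (half, y) = cut_y y.
Proof. by rewrite /cutoff/= bump_eq1 ?mul1r//; rewrite /half; lra. Qed.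

Let r := Num.min (8^-1) rho.
Let r0 : 0 < r. Proof. by rewrite lt_min rho0 invr_gt0 ltr0n. Qed.

Let flat_near y1 (x : plane) : `|y1 - y0| < rho -> `|x.1 - half| < r -> `|x.2 - y1| < r ->
  \forall z \near x, cutoff z = 1.
Proof.
rewrite !lt_min => hy /andP[x1 x1'] /andP[x2 x2'].
have c1 : `|z.1 - half| @[z --> x] --> `|x.1 - half|.
  by apply: cvg_norm; apply: cvgB; [exact: cvg_fst|exact: cvg_cst].
have c2 : `|z.2 - y1| @[z --> x] --> `|x.2 - y1|.
  by apply: cvg_norm; apply: cvgB; [exact: cvg_snd|exact: cvg_cst].
have n1 : \forall z \near x, `|z.1 - half| < 8^-1 by exact: (cvgr_lt _ c1 _ x1).
have n2 : \forall z \near x, `|z.2 - y1| < rho by exact: (cvgr_lt _ c2 _ x2').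
apply: filterS2 n1 n2 => z h1 h2.
rewrite /cutoff (cut_y_eq1 hy (ltW h2)) mulr1.
by move: h1; rewrite ltr_norml /half => /andP[? ?]; apply: bump_eq1; lra.
Qed.

Let d0 := partial ord0 cutoff.
Let d1 := partial ord_max cutoff.
Let d2 (x : plane) := partial ord0 d0 x + partial ord_max d1 x.

Let flat0 y1 (x : plane) : `|y1 - y0| < rho -> `|x.1 - half| < r -> `|x.2 - y1| < r ->
  [/\ d0 x = 0, d1 x = 0 & d2 x = 0].
Proof.
move=> hy h1 h2; have fn := flat_near hy h1 h2.
split; [exact: partial_near_cst fn|exact: partial_near_cst fn|].
have fd i : \forall z \near x, partial i cutoff z = 0.
  have c1 : `|z.1 - half| @[z --> x] --> `|x.1 - half|.
    by apply: cvg_norm; apply: cvgB; [exact: cvg_fst|exact: cvg_cst].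
  have c2 : `|z.2 - y1| @[z --> x] --> `|x.2 - y1|.
    by apply: cvg_norm; apply: cvgB; [exact: cvg_snd|exact: cvg_cst].
  have n1 : \forall z \near x, `|z.1 - half| < r by exact: (cvgr_lt _ c1 _ h1).
  have n2 : \forall z \near x, `|z.2 - y1| < r by exact: (cvgr_lt _ c2 _ h2).
  apply: filterS2 n1 n2 => z k1 k2; exact: partial_near_cst (flat_near hy k1 k2).
by rewrite /d2 (partial_near_cst _ (fd ord0)) (partial_near_cst _ (fd ord_max)) addr0.
Qed.

Let bB : exists2 B, 0 < B & forall x, [/\ `|d0 x| <= B, `|d1 x| <= B & `|d2 x| <= B].
Proof.
have t0 := test_partial ord0 tz; have t1' := test_partial ord_max tz.
have [B0 B00 h0] := test_bounded t0; have [B1 B10 h1] := test_bounded t1'.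
have [B2 B20 h2] := test_bounded (testD (test_partial ord0 t0) (test_partial ord_max t1')).
exists (B0 + (B1 + B2)); first by rewrite !addr_gt0.
move=> x; split.
- by apply: (le_trans (h0 x)); rewrite lerDl ltW// addr_gt0.
- by apply: (le_trans (h1 x)); lra.
- by apply: (le_trans (h2 x)); lra.
Qed.

(** The Laplacian of the kinked kernel times the cutoff. The parameter p.1 is
    the distance of the pole to the line, with absolute value so that p.1
    ranges over a neighbourhood of 0, and p.2 its ordinate. *)
Definition lap_at (p x : plane) : R := kink_lap `|p.1| p.2 cutoff x.

(** Where the kernel is unbounded, near (1 / 2, p.2), the cutoff is constant
    and the Laplacian is zero. *)
Lemma lap_bound : exists M : R, forall p x, `|p.2 - y0| < rho -> x.1 != half -> `|lap_at p x| <= M.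
Proof.
have [B B0 hB] := bB.
exists (2 * ((r * r)^-1 * B + (r * r)^-1 * B) + r^-1 * B) => p x hp xh.
have [b0 b1 b2] := hB x.
rewrite /lap_at /kink_lap -/d0 -/d1 -/(d2 x).
have s0 : 0 < `|x.1 - half| by rewrite normr_gt0 subr_eq0.
set sg := Num.sg _; have sg1 : `|sg| <= 1.
  by rewrite normr_sg; case: (_ != 0).
have [near|far] := boolP ((`|x.1 - half| < r) && (`|x.2 - p.2| < r)).
  move/andP: near => [h1 h2]; have [-> -> ->] := flat0 hp h1 h2.
  rewrite !(mulr0, addr0) normr0.
  have ri : 0 < r^-1 by rewrite invr_gt0.
  have rri : 0 < (r * r)^-1 by rewrite invr_gt0 mulr_gt0.
  by rewrite addr_ge0 ?mulr_ge0 ?addr_ge0 ?mulr_ge0// ltW.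
have D0 : 0 < dist_eps `|p.1| x by rewrite /dist_eps ltr_pwDl.
have hr : r * r <= dist_eps `|p.1| x * dist_eps `|p.1| x + (x.2 - p.2) * (x.2 - p.2).
  move: far; rewrite negb_and -!leNgt => /orP[h|h].
    rewrite -[leLHS]addr0; apply: lerD; last by rewrite -expr2 sqr_ge0.
    by apply: ler_pM; rewrite ?(ltW r0)//; apply: (le_trans h); rewrite lerDl.
  rewrite -[leLHS]add0r; apply: lerD; first by rewrite -expr2 sqr_ge0.
  by rewrite -!expr2 -(real_normK (num_real (x.2 - p.2))) lerXn2r ?nnegrE// ltW.
have k1 := pk_bound r0 D0 hr; have k2 := pk_s_bound r0 D0 hr; have k3 := pk_y_bound r0 D0 hr.
apply: (le_trans (ler_normD _ _)); apply: lerD; last by rewrite normrM; exact: ler_pM.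
rewrite normrM (ger0_norm (x := 2))// ler_wpM2l//.
by apply: bound_combination.
Qed.

Lemma lap_cont p0 x : x.1 != half -> lap_at p x @[p --> p0] --> lap_at p0 x.
Proof.
move=> xh; have s0 : 0 < `|x.1 - half| by rewrite normr_gt0 subr_eq0.
have ca : dist_eps `|p.1| x @[p --> p0] --> dist_eps `|p0.1| x.
  by apply: cvgD; [exact: cvg_cst|apply: cvg_norm; exact: cvg_fst].
have cb : x.2 - p.2 @[p --> p0] --> x.2 - p0.2.
  by apply: cvgB; [exact: cvg_cst|exact: cvg_snd].
have D0 : 0 < dist_eps `|p0.1| x by rewrite /dist_eps ltr_pwDl.
have [k1 k2 k3] := pk_cvg2 _ D0 ca cb.
apply: cvgD; last exact: cvgMl.
apply: cvgMr; apply: cvgD; last exact: cvgMl.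
by apply: cvgMl; exact: cvgMr.
Qed.

Definition smooth_part (p : plane) : R :=
  \int[leb2]_(x in L) ((u x - parabola x) * lap_at p x) +
  \int[leb2]_(x in Rr) ((u x - parabola x) * lap_at p x).

Let ml : measurable (L : set mplane) := measurable_rect 0 half 0 1.
Let mr : measurable (Rr : set mplane) := measurable_rect half 1 0 1.
Let subL : L `<=` Om := rect_sub_Om (lexx 0) (ltW half_lt1).
Let subR : Rr `<=` Om := rect_sub_Om (ltW half_gt0) (lexx 1).
Let Lne x : L x -> x.1 != half. Proof. by move=> /rectP[/andP[_ h] _]; rewrite lt_eqF. Qed.
Let Rne x : Rr x -> x.1 != half. Proof. by move=> /rectP[/andP[h _] _]; rewrite gt_eqF. Qed.

Let lap_meas p : measurable_fun (L : set mplane) (lap_at p) /\ measurable_fun (Rr : set mplane) (lap_at p).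
Proof.
have [p0|p0] := eqVneq p.1 0; last first.
  have e0 : 0 < `|p.1| by rewrite normr_gt0.
  by have [_ _ h1 h2 _] := kernel_identity hu Ll heq p.2 tz e0.
have c x : x.1 != half -> lap_at (n.+1%:R^-1, p.2) x @[n --> \oo] --> lap_at p x.
  move=> xh; have ci : (n.+1%:R^-1 : R) @[n --> \oo] --> 0.
    apply/cvgrPdist_lt => e e0; near=> n; rewrite sub0r normrN ger0_norm ?invr_ge0//.
    by near: n; exact: (near_infty_natSinv_lt (PosNum e0)).
  have cs : ((n.+1%:R^-1, p.2) : plane) @[n --> \oo] --> p.
    rewrite [X in _ --> X]surjective_pairing p0.
    by apply: (@cvg_pair _ _ _ \oo (nbhs (0 : R)) (nbhs p.2) _ _ _ (fun n => n.+1%:R^-1) (cst p.2)) => //; exact: cvg_cst.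
  have cl := lap_cont (p0 := p) xh.
  exact: (@cvg_comp _ _ _ (fun n => (n.+1%:R^-1, p.2) : plane) (fun q : plane => lap_at q x) _ _ (nbhs (lap_at p x)) cs cl).
have h n : measurable_fun (L : set mplane) (lap_at (n.+1%:R^-1, p.2)) /\ measurable_fun (Rr : set mplane) (lap_at (n.+1%:R^-1, p.2)).
  have e0 : 0 < `|(n.+1%:R^-1 : R)| by rewrite normr_gt0 invr_eq0.
  by have [_ _ h1 h2 _] := kernel_identity hu Ll heq p.2 tz e0.
split.
  by apply: (measurable_fun_cvg (h := fun n => lap_at (n.+1%:R^-1, p.2))) => [n|x /Lne]; [exact: (h n).1|exact: c].
by apply: (measurable_fun_cvg (h := fun n => lap_at (n.+1%:R^-1, p.2))) => [n|x /Rne]; [exact: (h n).2|exact: c].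
Unshelve. all: by end_near. Qed.

(** The poles may reach the line: the integrand stays bounded. *)
Lemma smooth_part_cont p0 : `|p0.2 - y0| < rho -> smooth_part p @[p --> p0] --> smooth_part p0.
Proof.
move=> hp; have [M hM] := lap_bound.
have nU : nbhs p0 [set p : plane | `|p.2 - y0| < rho].
  have c : `|p.2 - y0| @[p --> p0] --> `|p0.2 - y0|.
    by apply: cvg_norm; apply: cvgB; [exact: cvg_snd|exact: cvg_cst].
  exact: (cvgr_lt _ c).
have Lq : L1 leb2 Om (fun x => u x - parabola x).
  apply: L2_Omega_L1; apply: L2B => //; [exact: H10_L2 hu|exact: smooth_Omega_L2 smooth_parabola].
apply: cvgD.
- apply: (param_cont_loc (M := M) ml (integrableS mO ml subL Lq) nU).
  + by move=> p _; exact: (lap_meas p).1.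
  + by move=> p z hp' /Lne; exact: hM.
  + by move=> z /Lne; exact: lap_cont.
- apply: (param_cont_loc (M := M) mr (integrableS mO mr subR Lq) nU).
  + by move=> p _; exact: (lap_meas p).2.
  + by move=> p z hp' /Rne; exact: hM.
  + by move=> z /Rne; exact: lap_cont.
Qed.

Definition average (eps y1 : R) : R := \int[leb1]_(y in G) (l y * (pk eps (y - y1) * cut_y y)).

Lemma average_identity eps y1 : 0 < eps -> average eps y1 = smooth_part (eps, y1) +
  2 * \int[leb1]_(y in G) ((trace_fun u y - 1) * (pk_s eps (y - y1) * cut_y y)).
Proof.
move=> e0; have [_ _ _ _ E] := kernel_identity hu Ll heq y1 tz e0.
rewrite /average /smooth_part /lap_at/= gtr0_norm//.
transitivity (\int[leb1]_(y in G) (l y * (pk eps (y - y1) * cutoff (half, y)))).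
  by apply: Rint_ext => y _; rewrite cutoff_half.
rewrite E; congr (_ + 2 * _).
by apply: Rint_ext => y _; rewrite cutoff_half.
Qed.

Lemma average_cont eps y1 : 0 < eps -> average eps z @[z --> y1] --> average eps y1.
Proof.
move=> e0; rewrite /average; apply: (@param_cont_loc R _ _ leb1 G l (fun z y => pk eps (y - z) * cut_y y) y1 eps^-1 setT mG Ll).
- exact: filterT.
- move=> z _; apply: measurable_funM; last by exact: bump_measurable.
  apply: measurable_funTS; apply: continuous_measurable_fun => y.
  have d00 : eps * eps + (y - z) * (y - z) != 0 by rewrite gt_eqF// den_gt0.
  have c : w - z @[w --> y] --> y - z by apply: cvgB; [exact: cvg_id|exact: cvg_cst].
  by apply: cvgM; [exact: cvg_cst|apply: cvgV => //; apply: cvgD; [exact: cvg_cst|exact: cvgM]].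
- move=> z y _ _; rewrite normrM -[leRHS]mulr1; apply: ler_pM => //; last exact: bump_norm_le1.
  by rewrite ger0_norm ?pk_le_eps// ltW// pk_gt0.
- move=> y _; apply: cvgMl.
  have cb : y - z @[z --> y1] --> y - y1 by apply: cvgB; [exact: cvg_cst|exact: cvg_id].
  by have [] := pk_cvg2 _ e0 (cvg_cst eps) cb.
Qed.

(** Off the window of half-width e', moving the pole towards the line
    increases the normal derivative of the kernel. *)
Lemma pk_s_mono e' e y : 0 < e' -> e' < e -> e' <= `|y| -> pk_s e y <= pk_s e' y.
Proof.
move=> e'0 ee ey; have e0 := lt_trans e'0 ee.
have d' := den_gt0 y e'0; have dd := den_gt0 y e0.
have yy : e' * e' <= y * y.
  by rewrite -!expr2 -(real_normK (num_real y)) lerXn2r ?nnegrE// ltW.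
have ab : e' * e' < e * e by rewrite -!expr2 ltrXn2r ?nnegrE ?ltW.
rewrite /pk_s ler_pdivrMr ?mulr_gt0// mulrAC ler_pdivlMr ?mulr_gt0//.
move: yy ab d' dd; set a := e' * e'; set b := e * e; set c := y * y => yy ab d' dd.
have [cb|cb] := leP c b.
  apply: (@le_trans _ _ 0); first by rewrite mulr_le0_ge0 ?subr_le0// mulr_ge0// ltW.
  by rewrite mulr_ge0 ?subr_ge0// mulr_ge0// ltW.
apply: ler_pM; rewrite ?subr_ge0 ?mulr_ge0 ?(ltW d')//; [exact: ltW|lra|].
by apply: ler_pM; rewrite ?(ltW d')//; lra.
Qed.

(** The boundary term of the identity is (u - 1) * pk_s with u at most 1.
    Moving the pole from e to e' decreases it off the window of half-width
    e'; inside the window pk_s is at least - 1 / e' ^ 2 at distance e' and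
    nonpositive at distance e. *)
Lemma average_mono e' e y1 : 0 < e' -> e' < e -> win y1 e' `<=` G ->
  average e' y1 <= average e y1 + smooth_part (e', y1) - smooth_part (e, y1) +
    2 / (e' * e') * \int[leb1]_(y in win y1 e') (1 - t y).
Proof.
move=> e'0 ee sub; have e0 := lt_trans e'0 ee.
rewrite !average_identity//.
have Lt : L2 leb1 G (trace_fun u) := trace_fun_L2 hu.
have Lt1 : L1 leb1 G (fun y => trace_fun u y - 1).
  apply: L1B => //; last exact: cst_L1.
  have := L2_mul mG Lt (test_trace_L2 (smooth_cst 1)); apply: L1_eq => // y _; exact: mulr1.
have Lker eps : 0 < eps -> L1 leb1 G (fun y => (trace_fun u y - 1) * (pk_s eps (y - y1) * cut_y y)).
  move=> h0; apply: (@L1_mul_bounded _ _ _ _ _ mG _ _ (eps * eps)^-1) => //.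
    apply: measurable_funM; last by exact: bump_measurable.
    apply: measurable_funTS; apply: continuous_measurable_fun => y.
    have cb : z - y1 @[z --> y] --> y - y1 by apply: cvgB; [exact: cvg_id|exact: cvg_cst].
    by have [] := pk_cvg2 _ h0 (cvg_cst eps) cb.
  move=> y _; rewrite normrM -[leRHS]mulr1; apply: ler_pM => //; last exact: bump_norm_le1.
  by apply: pk_s_bound => //; rewrite lerDl -expr2 sqr_ge0.
have tT : \forall y \ae leb1, G y -> trace_fun u y = t y.
  have sO : Om `<=` Om by [].
  by apply: aeS (aeI tu (trG_ae sO hu)) => y [h1 h2] Gy; rewrite -h1// h2.
have Lt' : L1 leb1 G (fun y => 1 - t y).
  apply: L1B => //; first exact: cst_L1.
  apply: (L1_eq mG (f := fun y => \int[leb1]_(s in G) (kap s * before s y))).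
    by move=> y Gy; rewrite tE.
  apply: (@cont_L1 R (fun y => \int[leb1]_(s in G) (kap s * before s y)) 0 1) => y; exact: prim_cont.
have mw : measurable (win y1 e' : set mR) by exact: measurable_oo.
have [Lp Ep] := patch_L1 mG mw sub Lt'.
have key : \int[leb1]_(y in G) ((trace_fun u y - 1) * (pk_s e' (y - y1) * cut_y y)) -
   \int[leb1]_(y in G) ((trace_fun u y - 1) * (pk_s e (y - y1) * cut_y y)) <=
   (e' * e')^-1 * \int[leb1]_(y in win y1 e') (1 - t y).
  rewrite -Ep -(RintegralZl _ mG Lp) -(RintegralB mG (Lker _ e'0) (Lker _ e0)).
  apply: le_Rint_ae => //; [exact: (L1B mG (Lker _ e'0) (Lker _ e0))|exact: (L1Zl mG _ Lp)|].
  apply: aeS tT => y h Gy; rewrite h// -mulrBr -mulrBl patchE.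
  have z0 : 0 <= cut_y y by exact: bump_ge0.
  have z1 : cut_y y <= 1 by exact: bump_le1.
  have ty := t1 Gy.
  case: ifPn => [|/negP nw].
    rewrite inE => /winP yw.
    have k1 : `|pk_s e' (y - y1)| <= (e' * e')^-1.
      by apply: pk_s_bound => //; rewrite lerDl -expr2 sqr_ge0.
    have k2 : pk_s e (y - y1) <= 0.
      rewrite /pk_s pmulr_lle0 ?invr_gt0 ?mulr_gt0 ?den_gt0// subr_le0.
      rewrite -!expr2 -(real_normK (num_real (y - y1))) lerXn2r ?nnegrE ?(ltW e0)//.
      exact: ltW (lt_trans yw ee).
    have ei : 0 < (e' * e')^-1 by rewrite invr_gt0 mulr_gt0.
    move: k1; rewrite ler_norml => /andP[k1 _].
    move: ei k1 k2 ty z0 z1; set A := _^-1; set B := pk_s e' _; set C := pk_s e _; set z := cut_y y => ei k1 k2 ty z0 z1.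
    have h1 : - A <= (B - C) * z.
      have [bc|bc] := leP 0 (B - C); first by apply: (@le_trans _ _ 0); [lra|rewrite mulr_ge0].
      apply: (@le_trans _ _ (B - C)); first by lra.
      by rewrite -subr_ge0 (_ : _ - _ = (C - B) * (1 - z)); [rewrite mulr_ge0|ring]; lra.
    have : 0 <= (1 - t y) * (A + (B - C) * z) by rewrite mulr_ge0 ?subr_ge0//; lra.
    rewrite mulrDr; lra.
  rewrite -[point]/(0 : R) mulr0.
  have yr : e' <= `|y - y1| by rewrite leNgt; apply/negP => hlt; apply: nw; rewrite inE; apply/winP.
  have k := pk_s_mono e'0 ee yr.
  by rewrite mulr_le0_ge0 ?subr_le0// mulr_ge0// subr_ge0.
move: key; rewrite -[2 / (e' * e')]/(2 * (e' * e')^-1) -mulrA.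
set A := \int[leb1]_(y in G) _; set B := \int[leb1]_(y in G) _; set C := _ * Rintegral _ _ _.
set D := smooth_part _; set E := smooth_part _ => ?; lra.
Qed.

End Window.

(** On the contact set F the multiplier is upper semicontinuous in the
    measure sense. Let B(y) be the Poisson average at distance eps corrected
    by the smooth parts at distances 0 and eps, a continuous function of y.
    At a Lebesgue point y0 with l y0 < 0 one has B(y0) < 0 for small eps, so
    B is negative near y0. At almost every y1 of F near y0, the averages at
    distances e' below eps are bounded by B(y1) plus terms that vanish with
    e', by monotonicity and by the behaviour of 1 - t at y1; as e' tends
    to 0 they approach a positive multiple of l y1, which is therefore
    negative. *)
Lemma negative_open : \forall y0 \ae leb1, F y0 -> l y0 < 0 -> exists2 r, 0 < r &
  \forall y1 \ae leb1, F y1 -> y0 - r < y1 < y0 + r -> l y1 < 0.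
Proof.
apply: aeS (ae_leb_point Ll) => y0 lp Fy0 l0; have Gy0 := FG Fy0.
have {}lp := lp Gy0; move: (Gy0); rewrite /= in_itv/= => /andP[y00 y01].
pose rho := Num.min y0 (1 - y0) / 4.
have m0 : 0 < Num.min y0 (1 - y0) by rewrite lt_min y00 subr_gt0.
have rho0 : 0 < rho by rewrite divr_gt0.
have ra : Num.min y0 (1 - y0) <= y0 by rewrite ge_min lexx.
have rb : Num.min y0 (1 - y0) <= 1 - y0 by rewrite ge_min lexx orbT.
have w0 : 0 < y0 - 3 * rho by rewrite /rho; lra.
have w1 : y0 + 3 * rho < 1 by rewrite /rho; lra.
have [N _ /(_ N (leqnn N)) /ltW hN] := near_infty_natSinv_lt (PosNum rho0).
rewrite /= in hN.
have cm : measurable_fun (G : set mR) (cut_y y0 rho N) by exact: bump_measurable.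
have cn y : `|cut_y y0 rho N y| <= 1 by exact: bump_norm_le1.
have cw y1 : `|y1 - y0| < rho -> forall y, win y1 rho y -> cut_y y0 rho N y = 1.
  by move=> h y /winP hy; apply: (cut_y_eq1 hN h); exact: ltW.
have y0c : `|y0 - y0| < rho by rewrite subrr normr0.
pose eta := - l y0 / 2.
have eta0 : 0 < eta by rewrite divr_gt0// oppr_gt0.
have [ea ea0 hA] := poisson_limit Ll lp cm cn rho0 (cw _ y0c) eta0.
have cJ : smooth_part y0 rho N (e, y0) @[e --> 0] --> smooth_part y0 rho N (0, y0).
  have c := smooth_part_cont rho0 w0 w1 hN (p0 := (0, y0)) y0c.
  have cs : ((e, y0) : plane) @[e --> (0 : R)] --> ((0, y0) : plane).
    by apply: (@cvg_pair _ _ _ (nbhs (0 : R)) (nbhs (0 : R)) (nbhs y0) _ _ _ id (cst y0)); [exact: cvg_id|exact: cvg_cst].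
  exact: (cvg_comp (fun e => (e, y0) : plane) (smooth_part y0 rho N) cs c).
have eta2 : 0 < eta / 2 by rewrite divr_gt0.
have [eb eb0 hJ] := cvg_dist_ball cJ eta2.
pose eps := Num.min ea eb / 2.
have mab : 0 < Num.min ea eb by rewrite lt_min ea0.
have eps0 : 0 < eps by rewrite divr_gt0.
have epsa : eps < ea.
  by rewrite /eps ltr_pdivrMr// (@le_lt_trans _ _ ea) ?ge_min ?lexx//; lra.
have epsb : eps < eb.
  by rewrite /eps ltr_pdivrMr// (@le_lt_trans _ _ eb) ?ge_min ?lexx ?orbT//; lra.
pose Bf y1 := average y0 rho N eps y1 + smooth_part y0 rho N (0, y1) - smooth_part y0 rho N (eps, y1).
have B0 : Bf y0 < 0.
  have [p p1] := hA eps ltac:(by rewrite eps0).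
  have := hJ eps; rewrite sub0r normrN (gtr0_norm eps0) => /(_ epsb).
  rewrite ltr_norml ler_norml -/(average y0 rho N eps y0) => /andP[j1 j2] /andP[a1 a2].
  have lp1 : l y0 * p <= l y0 by rewrite -[leRHS]mulr1 ler_wnM2l// ltW.
  move: j1 j2 a1 a2 lp1; rewrite /Bf /eta.
  set A := average _ _ _ _ _; set J0 := smooth_part _ _ _ (0, y0); set J1 := smooth_part _ _ _ _; set X := l y0 * p; set Y := l y0.
  by move=> *; lra.
have cB : Bf y1 @[y1 --> y0] --> Bf y0.
  have cp e : smooth_part y0 rho N (e, y1) @[y1 --> y0] --> smooth_part y0 rho N (e, y0).
    have c := smooth_part_cont rho0 w0 w1 hN (p0 := (e, y0)) y0c.
    have cs : ((e, z) : plane) @[z --> y0] --> ((e, y0) : plane).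
      by apply: (@cvg_pair _ _ _ (nbhs y0) (nbhs e) (nbhs y0) _ _ _ (cst e) id); [exact: cvg_cst|exact: cvg_id].
    exact: (cvg_comp (fun z => (e, z) : plane) (smooth_part y0 rho N) cs c).
  apply: cvgB; last exact: cp.
  by apply: cvgD; [exact: average_cont|exact: cp].
have [rB rB0 hB] := cvg_dist_ball cB (d := - Bf y0) ltac:(by rewrite oppr_gt0).
exists (Num.min rho rB); first by rewrite lt_min rho0.
apply: aeS (aeI (ae_leb_point Ll) (ae_leb_point Lk)) => y1 [lpl lpk] Fy1 yr.
have Gy1 := FG Fy1; have {}lpl := lpl Gy1; have {}lpk := lpk Gy1.
have yd : `|y1 - y0| < Num.min rho rB by rewrite ltr_distl.
move: yd; rewrite lt_min => /andP[y1rho y1B].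
have By1 : Bf y1 < 0 by have := hB y1; rewrite distrC => /(_ y1B); rewrite ltr_norml => /andP[]; lra.
rewrite ltNge; apply/negP => l1.
have e3 : 0 < - Bf y1 / 4 by rewrite divr_gt0// oppr_gt0.
have [e1 e10 h1] := poisson_limit Ll lpl cm cn rho0 (cw _ y1rho) e3.
have [e2 e20 h2] := contact_window Lk tE t1 lpk (tF Fy1) e3.
have cJ1 : smooth_part y0 rho N (e, y1) @[e --> 0] --> smooth_part y0 rho N (0, y1).
  have c := smooth_part_cont rho0 w0 w1 hN (p0 := (0, y1)) y1rho.
  have cs : ((e, y1) : plane) @[e --> (0 : R)] --> ((0, y1) : plane).
    by apply: (@cvg_pair _ _ _ (nbhs (0 : R)) (nbhs (0 : R)) (nbhs y1) _ _ _ id (cst y1)); [exact: cvg_id|exact: cvg_cst].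
  exact: (cvg_comp (fun e => (e, y1) : plane) (smooth_part y0 rho N) cs c).
have [e4 e40 h4] := cvg_dist_ball cJ1 e3.
pose e' := Num.min (Num.min e1 e2) (Num.min e4 eps) / 2.
have me : 0 < Num.min (Num.min e1 e2) (Num.min e4 eps) by rewrite !lt_min e10 e20 e40.
have e'0 : 0 < e' by rewrite divr_gt0.
have : e' < Num.min (Num.min e1 e2) (Num.min e4 eps).
  by rewrite /e' ltr_pdivrMr// ltr_pMr// ltr1n.
rewrite !lt_min => /andP[/andP[l1' l2'] /andP[l4' leps]].
have [p p1] := h1 e' ltac:(by rewrite e'0).
have [sub hw] := h2 e' ltac:(by rewrite e'0).
have := h4 e'; rewrite sub0r normrN (gtr0_norm e'0) => /(_ l4').
have mono := average_mono N w0 w1 e'0 leps sub.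
rewrite ltr_norml ler_norml -/(average y0 rho N e' y1) => /andP[j1 j2] /andP[a1 a2].
have lp1 : 0 <= l y1 * p by rewrite mulr_ge0// (le_trans ler01).
exact: window_algebra j1 a1 lp1 mono hw By1.
Qed.

End Local.
End UpperSemicontinuity.

(** * Dual norms *)
Section DualNorm.
Context {R : realType}.
Local Notation plane := (R * R)%type.
Local Notation leb1 := (@lebesgue_measure R).
Local Notation mplane := (measurableTypeR R * measurableTypeR R)%type.
Local Notation Om := (@Omega R).
Local Notation mO := (@measurable_Omega R).
Implicit Types (O : set plane) (u v w : plane -> R) (i : 'I_2).

Lemma grad_dot_B O u v z : O `<=` Om -> H10 O u -> H10 O v -> H10 O z ->
  grad_dot Om (fun x => u x - v x) z = grad_dot Om u z - grad_dot Om v z.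
Proof.
move=> OO hu hv hz.
have -> : (fun x => u x - v x) = (fun x => -1 * v x + u x).
  by apply/funext => x; rewrite mulN1r addrC.
by rewrite (grad_dot_comb _ OO hv hu hz) mulN1r addrC.
Qed.

Lemma sqr_combination (ne nw nd a b c f : R) : ne = a -> nw = b -> nd = c ->
  c = b - f - 0 -> 0 = f - a -> ne - nw + nd = 0.
Proof. by move=> *; lra. Qed.

Lemma pythagoras_B O w e : O `<=` Om -> H10 O w -> H10 O e ->
  grad_dot Om e (fun x => w x - e x) = 0 ->
  grad_norm e ^+ 2 - grad_norm w ^+ 2 + grad_norm (fun x => w x - e x) ^+ 2 = 0.
Proof.
move=> OO hw he orth; have [hd _] := H10_B OO hw he.
have E1 := grad_dot_B OO hw he hd; have E2 := grad_dot_B OO hw he hw.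
have E3 := grad_dot_B OO hw he he.
rewrite orth (grad_dotC hw hd) in E1; rewrite (grad_dotC hd he) in E3.
rewrite orth (grad_dotC hw he) in E3.
apply: sqr_combination (grad_norm_sqr he) (grad_norm_sqr hw) (grad_norm_sqr hd) _ E3.
exact: etrans E1 (congr1 (fun z => z - 0) E2).
Qed.

Lemma grad_norm_ge0 v : 0 <= grad_norm v. Proof. exact: sqrtr_ge0. Qed.

Lemma grad_norm0_ae O v : O `<=` Om -> H10 O v -> grad_norm v = 0 ->
  \forall x \ae leb2, Om x -> v x = 0.
Proof.
move=> OO hv v0; apply: (grad0_ae0 OO hv).
by rewrite -(grad_norm_sqr hv) v0 expr0n.
Qed.

Lemma ae0_grad_norm O v : O `<=` Om -> H10 O v ->
  (\forall x \ae leb2, Om x -> v x = 0) -> grad_norm v = 0.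
Proof.
move=> OO hv v0; have L0 := H10_L2 hv.
have Lz : L2 leb2 Om (fun=> 0 : R) := test_Omega_L2 (test0 Om).
have h : h1_approx Om v (fun=> fun=> 0) (fun=> fun=> 0).
  split => //; first by move=> n; exact: test0.
    rewrite (sqdist_ae Lz L0 Lz v0) sqdist_cst; exact: cvg_cst.
  move=> i; rewrite (_ : partial i _ = fun=> 0); last by apply/funext => x; exact: partial_cst.
  rewrite sqdist_cst; exact: cvg_cst.
have h0 i := approx_wD (@subset_refl _ Om) h i.
have E i : ip leb2 Om (gD i v) (gD i v) = 0.
  have [Lg g0] := h0 i.
  rewrite (ip_ae Lg Lz Lg g0) ipE (@Rint_ext _ _ _ _ _ _ (fun=> 0)); last by move=> x _; rewrite mul0r.
  by rewrite Rintegral_cst// mul0r.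
by rewrite /grad_norm (grad_dotE hv hv) !E addr0 sqrtr0.
Qed.

(** The supremum is attained at the Riesz representative w. If w is zero
    almost everywhere the set is empty or the singleton of 0, and the
    supremum of the empty set is 0 by convention. *)
Lemma Hm1_norm_riesz O (M : (plane -> R) -> R) w : O `<=` Om -> H10 O w ->
  (forall v, H10 O v -> `|M v| = `|grad_dot Om w v|) -> Hm1_norm O M = grad_norm w.
Proof.
move=> OO hw hM; rewrite /Hm1_norm; set S := [set _ | _ in _].
have ub : ubound S (grad_norm w).
  move=> _ [v [hv v0] <-]; rewrite hM//.
  have n0 : 0 < grad_norm v.
    rewrite lt_def grad_norm_ge0 andbT; apply/eqP => n0; apply: v0.
    exact: grad_norm0_ae hv n0.
  by rewrite ler_pdivrMr//; exact: grad_CS hw hv.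
have [w0|w0] := eqVneq (grad_norm w) 0.
  rewrite w0 in ub *.
  have S0 : S `<=` [set 0].
    move=> x Sx; apply/eqP; rewrite eq_le ub//=; case: Sx => v _ <-.
    by rewrite divr_ge0// grad_norm_ge0.
  by have [->|->] := subset_set1 S0; [exact: sup0|exact: sup1].
have Sw : S (grad_norm w).
  exists w; first by split => // h; move/eqP: w0; apply; exact: ae0_grad_norm OO hw h.
  rewrite hM// -(grad_norm_sqr hw) ger0_norm ?sqr_ge0// expr2 mulfK//.
apply/eqP; rewrite eq_le; apply/andP; split.
  by apply: ge_sup => //; exists (grad_norm w).
by apply: ub_le_sup => //; exists (grad_norm w).
Qed.

End DualNorm.

(** * One step of the iteration *)
Section Iterates.
Context {R : realType}.
Local Notation plane := (R * R)%type.
Local Notation leb1 := (@lebesgue_measure R).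
Local Notation mplane := (measurableTypeR R * measurableTypeR R)%type.
Local Notation Om := (@Omega R).
Local Notation G := (`]0, 1[%classic : set R).
Local Notation mO := (@measurable_Omega R).
Local Notation mG := (measurable_oo (0 : R) 1).
Local Notation OO := (@subset_refl _ Om).
Implicit Types (O : set plane) (v w : plane -> R) (i : 'I_2) (A B : set R).

(** The trace along the line is moreover a primitive of an integrable
    function kap. *)
Definition continuous_version v (V : plane -> R) : Prop :=
  [/\ continuous V, \forall x \ae leb2, Om x -> v x = V x,
    \forall y \ae leb1, G y -> trG v y = V (half, y) &
    exists2 kap, L1 leb1 G kap &
      forall y, V (half, y) = \int[leb1]_(s in G) (kap s * before s y)].

Lemma continuous_version_exists v : H10 Om v -> inWkp 2 1 (@OmegaL R) v ->
  inWkp 2 1 (@OmegaR R) v -> exists V, continuous_version v V.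
Proof.
move=> hv WL WR; have [g Lg Hg] := mixed_derivative OO hv WL WR.
exists (cumul g); split.
- exact: cumul_cont.
- exact: repr_ae OO hv Lg Hg.
- exact: trace_repr_ae OO hv Lg Hg.
- by exists (flux g); [exact: flux_L1|move=> y; exact: cumul_half].
Qed.

Lemma cont_half (V : plane -> R) (y : R) : continuous V ->
  V (half, z) @[z --> y] --> V (half, y).
Proof.
move=> cV; have cs : ((half, z) : plane) @[z --> y] --> ((half, y) : plane).
  by apply: (@cvg_pair _ _ _ (nbhs y) (nbhs half) (nbhs y) _ _ _ (cst half) id); [exact: cvg_cst|exact: cvg_id].
exact: (cvg_comp (fun z => (half, z) : plane) V cs (cV _)).
Qed.

Lemma cont_ae_le (f : R -> R) (c y0 : R) : f y @[y --> y0] --> f y0 -> G y0 ->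
  (\forall y \ae leb1, G y -> f y <= c) -> f y0 <= c.
Proof.
move=> cf Gy0 h; rewrite leNgt; apply/negP => cy.
have n1 : \forall y \near y0, c < f y by exact: (cvgr_gt _ cf).
have n2 : \forall y \near y0, G y.
  apply: open_nbhs_nbhs; split => //; exact: interval_open.
have /nbhs_ballP[r /= r0 hr] : nbhs y0 [set y | c < f y /\ G y] by exact: filterI.
have lt : y0 - r < y0 + r by rewrite ltrBlDr -addrA ltrDl addr_gt0.
have [|y yr []] := @ae_itv_ex _ (fun y => ~ (c < f y /\ G y)) _ _ lt.
  by apply: aeS h => y hy _ [c1 /hy]; rewrite leNgt c1.
by apply: hr; rewrite /ball/= ltr_distlC.
Qed.

Lemma gap_open A y : gap A y -> exists2 r : R, 0 < r & forall z, y - r < z < y + r -> gap A z.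
Proof.
case=> r r0 h; exists r => // z /andP[z1 z2].
exists (Num.min (z - (y - r)) (y + r - z)); first by rewrite lt_min !subr_gt0 z1.
apply: aeS h => x hx Gx /andP[x1 x2]; apply: hx => //.
have m1 : Num.min (z - (y - r)) (y + r - z) <= z - (y - r) by rewrite ge_min lexx.
have m2 : Num.min (z - (y - r)) (y + r - z) <= y + r - z by rewrite ge_min lexx orbT.
by apply/andP; split; lra.
Qed.

Lemma Rint_ge0_ae (f : R -> R) : L1 leb1 G f -> (\forall y \ae leb1, G y -> 0 <= f y) ->
  0 <= \int[leb1]_(y in G) f y.
Proof.
move=> Lf h; have L0 : L1 leb1 G (fun=> 0 : R).
  by apply: (L1_eq mG _ (L1Zl mG 0 Lf)) => y _; rewrite mul0r.
apply: le_trans (le_Rint_ae mG L0 Lf h); by rewrite Rintegral_cst// mul0r.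
Qed.

Section Step.
Variables (U : plane -> R) (Ls : (plane -> R) -> R) (ls : R -> R).
Variables (u : nat -> plane -> R) (lam : nat -> (plane -> R) -> R) (k : nat).
Hypotheses (hS : solution_multiplier U Ls ls) (hk : HIK u lam).
Local Notation A0 := (active_it u k).
Local Notation A1 := (active_it u k.+1).
Local Notation l1 := (lam_fun u k.+1).
Local Notation u1 := (u k.+1).
Local Notation u2 := (u k.+2).
Hypothesis sub : ae_subset (active U ls) A1.
Hypothesis obs : below_obstacle u1.

Let hU : H10 Om U. Proof. by have [[]] := hS. Qed.
Let hu j : H10 Om (u j.+1). Proof. exact: HIK_H10 hk j. Qed.
Let hd : H10 Om (fun x => u1 x - u2 x). Proof. by have [] := H10_B OO (hu k) (hu k.+1). Qed.
Let he : H10 Om (fun x => u2 x - U x). Proof. by have [] := H10_B OO (hu k.+1) hU. Qed.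
Let hw j : H10 Om (fun x => u j.+1 x - U x). Proof. by have [] := H10_B OO (hu j) hU. Qed.

Lemma multiplier_L1 j : L1 leb1 G (lam_fun u j).
Proof.
have q1 : 1 <= (1 : R) < 8 / 5 by lra.
by have /inLp1P := HIK_Lq hk j q1.
Qed.

Lemma version_exists j : exists V, continuous_version (u j.+1) V.
Proof.
have p1 : 1 <= (1 : R) < 4 / 3 by lra.
have [WL WR] := HIK_W2p hk j.+1 p1; exact: continuous_version_exists (hu j) WL WR.
Qed.

Lemma version_contact j V y : continuous_version (u j.+1) V -> ~ gap (active_it u j) y ->
  V (half, y) = 1.
Proof.
move=> [cV _ tV _] ng; apply: (contact_value (f := fun z => V (half, z)) _ _ ng); first exact: cont_half.
apply: aeS (aeI tV (HIK_active hk j)) => z [h1 h2] Gz Az; by rewrite -h1// h2.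
Qed.

Lemma version_le1 V y : continuous_version u1 V -> G y -> V (half, y) <= 1.
Proof.
move=> [cV _ tV _] Gy; apply: (@cont_ae_le (fun z => V (half, z)) 1 y) => //; first exact: cont_half.
by apply: aeS (aeI tV obs) => z [h1 h2] Gz; rewrite -h1// h2.
Qed.

Lemma multiplier_gap0 : \forall y \ae leb1, G y -> gap A0 y -> l1 y = 0.
Proof.
exact: (multiplier_zero (HIK_repr hk k.+1) (multiplier_L1 k.+1) (HIK_inactive hk (k := k))).
Qed.

(** In a gap of the previous active set the multiplier vanishes, and the
    iterate does not exceed the obstacle; so no such point is active. *)
Lemma active_contact : \forall y \ae leb1, A1 y -> ~ gap A0 y.
Proof.
apply: aeS (aeI multiplier_gap0 obs) => y [h1 h2] [Gy pos] g; move: pos.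
by rewrite h1// add0r subr_gt0 ltNge h2.
Qed.

(** The contact set, on which the continuous version of the iterate equals
    the obstacle, can only shrink. *)
Lemma contact_persists y : ~ gap A1 y -> ~ gap A0 y.
Proof.
move=> n1 g0; apply: n1; have [r r0 hr] := gap_open g0.
exists r => //; apply: aeS active_contact => z h _ zr /h; apply; exact: hr.
Qed.

Lemma active_trace : \forall y \ae leb1, A1 y -> trG u1 y = 1 /\ trG u2 y = 1.
Proof.
have [V vV] := version_exists k; have [_ _ tV _] := vV.
apply: aeS (aeI tV (aeI active_contact (HIK_active hk k.+1))) => y [h1 [h2 h3]] Ay.
have Gy := Ay.1; split; last by rewrite h3.
by rewrite h1//; apply: version_contact vV (h2 Ay).
Qed.

(** Both iterates equal the obstacle on the new contact set, so the
    continuous version of their difference vanishes on it. *)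
Lemma correction_inactive : H10 (inactive_it u k.+1) (fun x => u1 x - u2 x).
Proof.
have [V vV] := version_exists k; have [W vW] := version_exists k.+1.
have [cV uV _ _] := vV; have [cW uW _ _] := vW.
rewrite /inactive_it inactiveE; apply: (truncation (V := fun x => V x - W x)) => //.
- by move=> x; apply: cvgB; [exact: cV|exact: cW].
- by apply: aeS (aeI uV uW) => x [h1 h2] Ox; rewrite h1// h2.
- move=> [x1 x2] _ [/= -> ng]; rewrite (version_contact vV (contact_persists ng)).
  by rewrite (version_contact vW ng) subrr.
Qed.

Lemma error_eq j v : H10 Om v ->
  grad_dot Om (fun x => u j.+1 x - U x) v = Ls v - lam j.+1 v.
Proof.
move=> hv; rewrite (grad_dot_B OO (hu j) hU hv).
have := HIK_eq hk j hv; have := multiplier_eq hS hv.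
set a := grad_dot _ _ _; set b := grad_dot _ _ _; set c := load_pair v; set p := Ls v; set q := lam _ v.
by move=> e1 e2; lra.
Qed.

Lemma correction_eq v : H10 (inactive_it u k.+1) v ->
  grad_dot Om (fun x => u1 x - u2 x) v = - lam k.+1 v.
Proof.
move=> hvI; have hv := H10_sub (@inactive_sub _ A1) hvI.
rewrite (grad_dot_B OO (hu k) (hu k.+1) hv).
have := HIK_eq hk k hv; have := HIK_eq hk k.+1 hv; have := HIK_inactive hk hvI.
set a := grad_dot _ _ _; set b := grad_dot _ _ _; set c := load_pair v; set p := lam _ v; set q := lam _ v.
by move=> -> e1 e2; lra.
Qed.

(** Where the multiplier of the solution is positive, complementarity puts the
    solution on the obstacle, which makes the point active. *)
Lemma multiplier_active : \forall y \ae leb1, G y -> ls y = 0 \/ A1 y.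
Proof.
apply: aeS (aeI sub (aeI (multiplier_ge0 hS) (multiplier_compl hS))) => y [h1 [h2 h3]] Gy.
have [l0|l0] := eqVneq (ls y) 0; [by left|right].
have := h3 Gy; move/eqP; rewrite mulf_eq0 (negPf l0)/= => /eqP t0.
by apply: h1 => //; split => //; rewrite -addrA t0 addr0 lt_def l0 h2.
Qed.

(** The next multiplier vanishes on the correction, which lives on the
    inactive set; the multiplier of the solution is carried by the active
    set, where the trace of the correction vanishes. *)
Lemma orthogonality : grad_dot Om (fun x => u2 x - U x) (fun x => u1 x - u2 x) = 0.
Proof.
rewrite error_eq// (HIK_inactive hk correction_inactive) subr0.
have [ms hs] := multiplier_repr hS; have [Ld ->] := hs _ hd.
apply: (Rint_ae0 mG); first exact: L1_meas Ld.
apply: aeS (aeI multiplier_active (aeI active_trace (trG_B OO (hu k) (hu k.+1)))) => y [h1 [h2 h3]] Gy.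
have [->|Ay] := h1 Gy; first by rewrite mul0r.
by have [t1 t2] := h2 Ay; rewrite h3// t1 t2 subrr mulr0.
Qed.

Lemma pythagoras : grad_norm (fun x => u2 x - U x) ^+ 2 -
  grad_norm (fun x => u1 x - U x) ^+ 2 + grad_norm (fun x => u1 x - u2 x) ^+ 2 = 0.
Proof.
have dE : (fun x => u1 x - u2 x) = (fun x => (u1 x - U x) - (u2 x - U x)).
  by apply/funext => x; rewrite opprB addrA subrK.
by have := orthogonality; rewrite dE; exact: pythagoras_B OO (hw k) he.
Qed.

(** On the inactive set the correction represents the current multiplier, up to
    sign. *)
Lemma residual_norm : Hm1_norm (inactive_it u k.+1) (lam k.+1) = grad_norm (fun x => u1 x - u2 x).
Proof.
apply: (Hm1_norm_riesz (@inactive_sub _ _) correction_inactive) => v hv.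
by rewrite correction_eq// normrN.
Qed.

Lemma multiplier_error_norm j :
  Hm1_norm Om (lam j.+1 \- Ls) = grad_norm (fun x => u j.+1 x - U x).
Proof.
by apply: (Hm1_norm_riesz OO (hw j)) => v hv; rewrite error_eq// /= distrC.
Qed.

Lemma error_zero j : grad_norm (fun x => u j.+1 x - U x) = 0 ->
  (u j.+1 = U %[ae leb2 in Om]) /\ (forall v, H10 Om v -> lam j.+1 v = Ls v).
Proof.
move=> n0; split.
  by apply: aeS (grad_norm0_ae OO (hw j) n0) => x h Ox; apply/eqP; rewrite -subr_eq0 h.
move=> v hv; have := error_eq j hv; have := grad_CS (hw j) hv; rewrite n0 mul0r normr_le0 => /eqP ->.
by move/eqP; rewrite eq_sym subr_eq0 => /eqP.
Qed.

(** If the correction vanishes, the current and the next multiplier coincide,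
    so the current one is zero in the gaps of the new active set. Its
    negative values on the contact set would occupy a neighbourhood there,
    which would contain no active point: a gap. *)
Lemma multiplier_ge0_of_stationary : grad_norm (fun x => u1 x - u2 x) = 0 ->
  (\forall y \ae leb1, G y -> gap A1 y -> l1 y = 0) /\
  (\forall y \ae leb1, G y -> 0 <= l1 y).
Proof.
move=> d0; have [V vV] := version_exists k; have [cV uV tV [kap Lk kE]] := vV.
have lz : \forall y \ae leb1, G y -> gap A1 y -> l1 y = 0.
  apply: (multiplier_zero (HIK_repr hk k.+1) (multiplier_L1 k.+1)) => v hvI.
  have hv := H10_sub (@inactive_sub _ A1) hvI.
  have := grad_CS hd hv; rewrite d0 mul0r normr_le0 correction_eq// oppr_eq0.
  by move/eqP.
split => //; pose F := [set y | G y /\ ~ gap A1 y].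
have heq v : H10 Om v -> grad_dot Om u1 v + \int[leb1]_(y in G) (l1 y * trG v y) = load_pair v.
  by move=> hv; have [_ h] := HIK_repr hk k.+1; have [_ <-] := h _ hv; exact: HIK_eq hk k v hv.
have tF y : F y -> V (half, y) = 1.
  by move=> [_ ng]; exact: version_contact vV (contact_persists ng).
have FG : F `<=` G by move=> y [].
have neg := negative_open (hu k) (multiplier_L1 k.+1) Lk heq (fun y _ => kE y) tV
   (fun y Gy => version_le1 vV Gy) FG tF.
apply: aeS (aeI lz neg) => y [h1 h2] Gy; rewrite leNgt; apply/negP => l0.
have [g|ng] := pselect (gap A1 y); first by move: l0; rewrite h1// ltxx.
have [r r0 hr] := h2 (conj Gy ng) l0; apply: ng; exists r => //.
apply: aeS (aeI hr (aeI (ae_not_gap A1) tV)) => z [h3 [h4 h5]] Gz zr Az.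
have Fz : F z by split => //; exact: h4.
case: (Az) => _; rewrite h5// tF// -addrA subrr addr0 => lp.
by have := h3 Fz zr; rewrite ltNge (ltW lp).
Qed.

(** Otherwise the iterate satisfies all the conditions that characterise the
    solution: testing the difference of the two equations with the
    difference of the two functions shows that they agree. *)
Lemma correction_neq0 : grad_norm (fun x => u1 x - U x) != 0 ->
  grad_norm (fun x => u1 x - u2 x) != 0.
Proof.
move=> w0; apply/eqP => d0; move/eqP: w0; apply.
have [lz lp] := multiplier_ge0_of_stationary d0.
have [V vV] := version_exists k; have [cV uV tV _] := vV.
have [_ hr] := HIK_repr hk k.+1; have [Ll El] := hr _ (hw k).
have [_ hs] := multiplier_repr hS; have [Lm Em] := hs _ (hw k).
have adm : below_obstacle U by have [[]] := hS.
have tB := trG_B OO (hu k) hU.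
have i1 : 0 <= \int[leb1]_(y in G) (l1 y * trG (fun x => u1 x - U x) y).
  apply: Rint_ge0_ae => //.
  apply: aeS (aeI lz (aeI lp (aeI tV (aeI adm tB)))) => y [h1 [h2 [h3 [h4 h5]]]] Gy.
  have [g|ng] := pselect (gap A1 y); first by rewrite h1// mul0r.
  rewrite mulr_ge0 ?h2// h5// h3// (version_contact vV (contact_persists ng)).
  by rewrite subr_ge0 h4.
have i2 : 0 <= \int[leb1]_(y in G) (- (ls y * trG (fun x => u1 x - U x) y)).
  apply: Rint_ge0_ae; first exact: L1N.
  apply: aeS (aeI (multiplier_ge0 hS) (aeI (multiplier_compl hS) (aeI obs tB))) => y [h1 [h2 [h3 h4]]] Gy.
  have := h2 Gy; have := h1 Gy; have := h3 Gy; rewrite h4// /obstacle.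
  set a := ls y; set b := trG u1 y; set c := trG U y => e1 e2 e3.
  by rewrite (_ : - _ = a * (1 - b) + a * (c - 1)); [rewrite e3 addr0 mulr_ge0// subr_ge0|ring].
have := error_eq k (hw k); rewrite El Em -(grad_norm_sqr (hw k)) => E.
move: i2; rewrite (RintN mG Lm) oppr_ge0 => i2.
have : grad_norm (fun x => u1 x - U x) ^+ 2 <= 0.
  by rewrite E subr_le0; apply: le_trans i2 i1.
by rewrite le_eqVlt ltNge sqr_ge0 orbF sqrf_eq0 => /eqP.
Qed.

End Step.
End Iterates.

Section Rate.
Context {R : realType}.

Lemma rate_identities (e1 e0 r : R) : 0 <= e1 -> 0 <= e0 -> e0 != 0 -> r != 0 ->
  e1 ^+ 2 - e0 ^+ 2 + r ^+ 2 = 0 ->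
  [/\ 0 <= 1 - r ^+ 2 / e0 ^+ 2, e1 / e0 = Num.sqrt (1 - r ^+ 2 / e0 ^+ 2) &
    Num.sqrt (1 - r ^+ 2 / e0 ^+ 2) < 1].
Proof.
move=> p1 p0 n0 nr h.
have h1 : e1 ^+ 2 = e0 ^+ 2 - r ^+ 2 by lra.
have E : 1 - r ^+ 2 / e0 ^+ 2 = (e1 / e0) ^+ 2.
  by rewrite expr_div_n h1 mulrBl divff// sqrf_eq0.
split; first by rewrite E sqr_ge0.
  by rewrite E sqrtr_sqr ger0_norm// divr_ge0.
rewrite -[ltRHS]sqrtr1 ltr_sqrt// ltrBlDr ltrDl divr_gt0//.
  by rewrite lt_def sqrf_eq0 nr sqr_ge0.
by rewrite lt_def sqrf_eq0 n0 sqr_ge0.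
Qed.

End Rate.

Unset Implicit Arguments.
Set Strict Implicit.
Set Printing Implicit Defensive.

Theorem theorem7p7 (R : realType)
    (ustar : R * R -> R) (lamstar : (R * R -> R) -> R) (lamstar_fun : R -> R)
    (u : nat -> R * R -> R) (lam : nat -> (R * R -> R) -> R) (k : nat) :
  solution_multiplier ustar lamstar lamstar_fun ->
  HIK u lam ->
  (1 <= k)%N ->
  ae_subset (active ustar lamstar_fun) (active_it u k) ->
  ~ ((u k = ustar %[ae leb2 in Omega]) /\
     (forall v, H10 Omega v -> lam k v = lamstar v)) ->
  below_obstacle (u k) ->
  let err_u j := grad_norm (u j \- ustar) in
  let err_lam j := Hm1_norm Omega (lam j \- lamstar) in
  let res := Hm1_norm (inactive_it u k) (lam k) in
  let rate := Num.sqrt (1 - res ^+ 2 / err_lam k ^+ 2) in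
  inactive_it u k `<=` inactive (active ustar lamstar_fun) /\
  err_u k.+1 ^+ 2 - err_u k ^+ 2 + res ^+ 2 = 0 /\
  (err_u k != 0 /\ err_lam k != 0 /\ 0 <= 1 - res ^+ 2 / err_lam k ^+ 2) /\
  err_u k.+1 / err_u k = err_lam k.+1 / err_lam k /\
  err_lam k.+1 / err_lam k = rate /\
  rate < 1.
Proof.
move=> hS hk; case: k => [//|k] _ sub nsol obs err_u err_lam res rate.
have pyth := pythagoras hS hk sub obs.
have resE : res = grad_norm (fun x => u k.+1 x - u k.+2 x) := residual_norm hk obs.
have lamE j : err_lam j.+1 = err_u j.+1 := multiplier_error_norm hS hk j.
have w0 : err_u k.+1 != 0.
  by apply/eqP => /(error_zero hS hk); exact: nsol.
have d0 : res != 0 by rewrite resE; exact: correction_neq0 hS hk obs w0.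
rewrite -resE in pyth.
have [r0 rE r1] := rate_identities (grad_norm_ge0 _) (grad_norm_ge0 _) w0 d0 pyth.
split; first exact: inactive_mono sub.
split; first exact: pyth.
by rewrite /rate !lamE.
Qed.
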